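(* Let $(M,P_M^{\mathfrak h},\mu)$ be a quasi-hamiltonian space for the connected quasi-Poisson Lie group $G_D^{\mathfrak h}$. For $m\in M$ let $\mathcal D_m=\operatorname{Im}\,(P_M^{\mathfrak h})^\sharp_m\subset T_mM$, where $\mathfrak h$ is any isotropic complement of $\mathfrak g$ in $\mathfrak d$ admissible at $\mu(m)$. Then $\mathcal D_m$ does not depend on the choice of admissible $\mathfrak h$, and the generalized distribution $\mathcal D$ on $M$ is completely integrable: it defines a generalized foliation of $M$ (in the sense of Stefan and Sussmann). Each leaf of this foliation contains the $G$-orbits of its points and, with the restrictions of the $G$-action and of the bivectors, is a nondegenerate quasi-hamiltonian space.
   Context: Everything is real, finite-dimensional and smooth; ''bivector'' on a manifold means bivector field. $a\wedge b=a\otimes b-b\otimes a$. Manin pair $(\mathfrak d,\mathfrak g)$: a Lie algebra $\mathfrak d$ of dimension $2n$ with an invariant nondegenerate symmetric bilinear form $(\cdot|\cdot)$ of signature $(n,n)$, and a Lie subalgebra $\mathfrak g\subset\mathfrak d$ that is a maximal isotropic subspace. A Manin quasi-triple $(\mathfrak d,\mathfrak g,\mathfrak h)$ is a Manin pair with an isotropic linear complement $\mathfrak h$, $\mathfrak d=\mathfrak g\oplus\mathfrak h$. $p_{\mathfrak g},p_{\mathfrak h}$ are the projections; $j:\mathfrak g^*\to\mathfrak h$ is the isomorphism with $(j(\xi)|x)=\langle\xi,x\rangle$. $F_{\mathfrak h}:\mathfrak g\to\bigwedge^2\mathfrak g$ is given by $F_{\mathfrak h}(x)(\xi,\eta)=\langle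 j^{-1}p_{\mathfrak h}[j\xi,j\eta],x\rangle$ and $\varphi_{\mathfrak h}\in\bigwedge^3\mathfrak g$ by $\varphi_{\mathfrak h}(\xi,\eta,\zeta)=\langle\zeta,p_{\mathfrak g}[j\xi,j\eta]\rangle$. If $\mathfrak h'$ is another isotropic complement with isomorphism $j'$, the twist from $\mathfrak h$ to $\mathfrak h'$ is $t=j'-j:\mathfrak g^*\to\mathfrak g$, regarded as $t\in\bigwedge^2\mathfrak g$ via $t(\xi,\eta)=\langle t(\xi),\eta\rangle$. Group pair $(D,G)$: a connected Lie group $D$ with a bi-invariant scalar product and a connected closed Lie subgroup $G$ whose Lie algebras form a Manin pair $(\mathfrak d,\mathfrak g)$. With a basis $(e_i)$ of $\mathfrak g$ and dual basis $(\varepsilon^i)$ of $\mathfrak g^*$, $r_{\mathfrak d}=\sum_i e_i\otimes j(\varepsilon^i)$. $G_D^{\mathfrak h}$ is $G$ with the bivector obtained by restricting $r_{\mathfrak d}^\lambda-r_{\mathfrak d}^\rho$ (left- minus right-invariant tensors) to $G$ and with $\varphi_{\mathfrak h}$ (a quasi-Poisson Lie group). $S=D/G$; the dressing action is the action of $D$ (and of $G\subset D$) on $S$ induced by left multiplication. For an action on a manifold $M$, $x_M$ is the vector field $(x_Mf)(m)=\frac{d}{dt}f(\exp(-tx)m)|_{t=0}$, extended multiplicatively to tensors; likewise $X_S$ for $X\in\mathfrak d$. $\mathfrak h$ is admissible at $s\in S$ if $\mathfrak h\to T_sS$, $\xi\mapsto\xi_S(s)$, is an isomorphism, and admissible on a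 subset if admissible at each of its points; every $s\in S$ has an admissible $\mathfrak h$. Where $\mathfrak h$ is admissible, for $x\in\mathfrak g$ the $1$-form $\hat x_{\mathfrak h}$ on $S$ is defined by $\langle\hat x_{\mathfrak h},\xi_S\rangle=-(x|\xi)$ for all $\xi\in\mathfrak h$. The action of $G_D^{\mathfrak h}$ on $(M,P_M^{\mathfrak h})$ is quasi-Poisson if $\frac12[P_M^{\mathfrak h},P_M^{\mathfrak h}]=(\varphi_{\mathfrak h})_M$ and $\mathcal L_{x_M}P_M^{\mathfrak h}=-F_{\mathfrak h}(x)_M$ for $x\in\mathfrak g$ (Schouten bracket normalized by $\frac12[P,P](df,dg,dh)=\{f,\{g,h\}\}+$cyclic, $\{f,g\}=P(df,dg)$). When $\mathfrak h$ is replaced by $\mathfrak h'$, $P_M^{\mathfrak h}$ is replaced by $P_M^{\mathfrak h'}=P_M^{\mathfrak h}-t_M$. For a bivector $P$, $P^\sharp$ maps $1$-forms to vector fields by $\langle P^\sharp\alpha,\beta\rangle=P(\beta,\alpha)$. A moment map for a quasi-Poisson action is a map $\mu:M\to S$, equivariant for the $G$-action on $M$ and the dressing action of $G$ on $S$, such that on any open $\Omega\subset M$, $(P_M^{\mathfrak h})^\sharp(\mu^*\hat x_{\mathfrak h})=x_M$ for all $x\in\mathfrak g$ and any $\mathfrak h$ admissible on $\mu(\Omega)$. A quasi-hamiltonian space is a manifold with bivector carrying a quasi-Poisson action that admits a moment map. It is nondegenerate if, at each point $m$, $(P_M^{\mathfrak h})^\sharp_m:T_m^*M\to T_mM$ is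 an isomorphism for $\mathfrak h$ admissible at $\mu(m)$. A generalized foliation in the sense of Stefan and Sussmann integrating $\mathcal D$ is a partition of $M$ into connected immersed submanifolds (leaves, possibly of varying dimension) whose tangent space at each point $m$ is $\mathcal D_m$. *)

(* Defs.v *)
From HB Require Import structures.
From mathcomp Require Import all_boot all_order all_algebra.
From mathcomp Require Import all_classical all_reals all_analysis.

Set Implicit Arguments.
Unset Strict Implicit.
Unset Printing Implicit Defensive.

Import Order.TTheory GRing.Theory Num.Theory.
Import numFieldNormedType.Exports.
Local Open Scope classical_set_scope.
Local Open Scope ring_scope.

(** * Linear algebra *)

(* Linear forms.  Elements of the second and third exterior powers of V are
   represented throughout by bilinear, resp. trilinear, forms on dual V, with
   (a /\ b)(xi, eta) = xi(a) eta(b) - xi(b) eta(a). *)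
Section Dual.
Variables (R : realType) (V : lmodType R).

Definition linear_form : {pred V -> R} :=
  fun a => `[< forall (k : R) (u v : V), a (k *: u + v) = k * a u + a v >].

Record dual := Dual { dual_fun :> V -> R; dual_prop : dual_fun \in linear_form }.

HB.instance Definition _ := [isSub for dual_fun].
HB.instance Definition _ := [Choice of dual by <:].

Fact linear_form_submod : submod_closed linear_form.
Proof.
split.
  by apply/asboolP => k u v; rewrite mulr0 addr0.
move=> c a b /asboolP Ha /asboolP Hb; apply/asboolP => k u v.
rewrite /GRing.add /GRing.scale /= !Ha !Hb /GRing.scale /=.
by rewrite !mulrDr !mulrA (mulrC k c) addrACA.
Qed.

HB.instance Definition _ :=
  GRing.isSubmodClosed.Build R (V -> R) linear_form linear_form_submod.
HB.instance Definition _ := [SubChoice_isSubLmodule of dual by <:].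

(* The linear form with underlying function a; 0 when a is not linear. *)
Definition mkdual (a : V -> R) : dual := insubd (0 : dual) a.

End Dual.

Section Tensors.
Variables (R : realType) (V W : lmodType R).

(* The transpose of a linear map f. *)
Definition pullback (f : V -> W) (a : dual W) : dual V := mkdual (a \o f).

(* The maps induced by a linear map f on second and third exterior powers. *)
Definition push2 (f : V -> W) (t : dual V -> dual V -> R) :
    dual W -> dual W -> R :=
  fun a b => t (pullback f a) (pullback f b).

Definition push3 (f : V -> W) (t : dual V -> dual V -> dual V -> R) :
    dual W -> dual W -> dual W -> R :=
  fun a b c => t (pullback f a) (pullback f b) (pullback f c).

Definition bilinear_form (B : V -> V -> R) : Prop :=
  (forall k u v w, B (k *: u + v) w = k * B u w + B v w) /\
  (forall k u v w, B w (k *: u + v) = k * B w u + B w v).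

Definition symmetric_form (B : V -> V -> R) : Prop :=
  forall u v, B u v = B v u.

Definition nondegenerate_form (B : V -> V -> R) : Prop :=
  forall u, (forall v, B u v = 0) -> u = 0.

(* There is an orthogonal basis with p vectors of square 1 and q of square -1;
   in particular V has dimension p + q. *)
Definition has_signature (p q : nat) (B : V -> V -> R) : Prop :=
  exists (e : 'I_p -> V) (f : 'I_q -> V),
    [/\ forall i j, B (e i) (e j) = (i == j)%:R,
        forall i j, B (f i) (f j) = - (i == j)%:R,
        forall i j, B (e i) (f j) = 0
      & forall v, exists (a : 'I_p -> R) (b : 'I_q -> R),
          v = \sum_i a i *: e i + \sum_i b i *: f i].

Definition subspace (A : set V) : Prop :=
  A 0 /\ (forall k u v, A u -> A v -> A (k *: u + v)).

Definition isotropic (B : V -> V -> R) (A : set V) : Prop :=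
  forall u v, A u -> A v -> B u v = 0.

End Tensors.

(** * Manin pairs and quasi-triples *)

(* The subalgebra is given by an injective linear map i : g -> d. *)
Section Manin.
Variables (R : realType) (d g : lmodType R).
Variables (br : d -> d -> d) (B : d -> d -> R) (i : g -> d).

Record manin_pair (n : nat) : Prop := ManinPair {
  mp_bilinear : bilinear_form B;
  mp_symmetric : symmetric_form B;
  mp_nondegenerate : nondegenerate_form B;
  mp_signature : has_signature n n B;
  mp_invariant : forall x y z, B (br x y) z = B x (br y z);
  mp_linear : forall k x y, i (k *: x + y) = k *: i x + i y;
  mp_injective : injective i;
  mp_subalgebra : forall x y, range i (br (i x) (i y));
  mp_isotropic : isotropic B (range i);
  mp_maximal : forall A : set d,
    subspace A -> isotropic B A -> range i `<=` A -> A `<=` range i }.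

Definition isotropic_complement (h : set d) : Prop :=
  [/\ subspace h, isotropic B h
    & forall z : d, exists! x : g, h (z - i x)].

Section Quasitriple.
Variable h : set d.

Definition proj_g (z : d) : g := xget 0 [set x | h (z - i x)].
Definition proj_h (z : d) : d := z - i (proj_g z).

Definition j_iso (xi : dual g) : d :=
  xget 0 [set y | h y /\ forall x, B y (i x) = xi x].

(* For y in h this is the inverse of j_iso. *)
Definition j_inv (y : d) : dual g := mkdual (fun x => B y (i x)).

Definition F_ (x : g) (xi eta : dual g) : R :=
  j_inv (proj_h (br (j_iso xi) (j_iso eta))) x.

Definition phi_ (xi eta zeta : dual g) : R :=
  zeta (proj_g (br (j_iso xi) (j_iso eta))).

End Quasitriple.

Definition twist_map (h h' : set d) (xi : dual g) : g :=
  xget 0 [set x | i x = j_iso h' xi - j_iso h xi].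

Definition twist (h h' : set d) (xi eta : dual g) : R :=
  eta (twist_map h h' xi).

End Manin.

(** * Smooth manifolds *)

Section Smoothness.
Variables (R : realType) (n : nat).

Definition partial (i : 'I_n) (f : 'rV[R]_n -> R) : 'rV[R]_n -> R :=
  'D_(delta_mx 0 i) f.

(* f is of class C^k on the open set U. *)
Fixpoint Ck (k : nat) (U : set 'rV[R]_n) (f : 'rV[R]_n -> R) : Prop :=
  (forall x, U x -> {for x, continuous f}) /\
  (if k is k'.+1 then
     forall i, (forall x, U x -> derivable f x (delta_mx 0 i)) /\
               Ck k' U (partial i f)
   else True).

Definition Cinf (U : set 'rV[R]_n) (f : 'rV[R]_n -> R) : Prop :=
  forall k, Ck k U f.

End Smoothness.

(* Only the values of the second component on chart_dom, and of the third one
   on its image, are meaningful. *)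
Record chart (R : realType) (n : nat) (T : topologicalType) := Chart {
  chart_dom : set T;
  chart_map : T -> 'rV[R]_n;
  chart_inv : 'rV[R]_n -> T }.

Definition chart_im (R : realType) (n : nat) (T : topologicalType)
    (c : chart R n T) : set 'rV[R]_n := chart_map c @` chart_dom c.

Definition is_chart (R : realType) (n : nat) (T : topologicalType)
    (c : chart R n T) : Prop :=
  [/\ open (chart_dom c), open (chart_im c),
      forall p, chart_dom c p -> chart_inv c (chart_map c p) = p,
      forall p, chart_dom c p -> {for p, continuous (chart_map c)}
    & forall x, chart_im c x -> {for x, continuous (chart_inv c)}].

Record manifold (R : realType) := Manifold {
  mcarrier :> topologicalType;
  mdim : nat;
  atlas : set (chart R mdim mcarrier);
  m_hausdorff : hausdorff_space mcarrier;
  m_countable : @second_countable mcarrier;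
  m_chart : forall c, atlas c -> is_chart c;
  m_cover : forall p, exists2 c, atlas c & chart_dom c p;
  m_compatible : forall c c', atlas c -> atlas c' -> forall i,
    Cinf (chart_map c @` (chart_dom c `&` chart_dom c'))
         (fun x => chart_map c' (chart_inv c x) 0 i) }.

Section SmoothMaps.
Variable R : realType.

(* Smoothness on an open subset of R^n of a map to a manifold. *)
Definition smooth_on (n : nat) (N : manifold R) (U : set 'rV[R]_n)
    (F : 'rV[R]_n -> N) : Prop :=
  (forall x, U x -> {for x, continuous F}) /\
  (forall c : chart R (mdim N) N, atlas c -> forall i,
     Cinf (U `&` F @^-1` chart_dom c) (fun x => chart_map c (F x) 0 i)).

Definition smooth_fun (M : manifold R) (f : M -> R) : Prop :=
  forall c : chart R (mdim M) M, atlas c -> Cinf (chart_im c) (f \o chart_inv c).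

Definition smooth_map (M N : manifold R) (F : M -> N) : Prop :=
  forall c : chart R (mdim M) M, atlas c ->
    smooth_on (chart_im c) (F \o chart_inv c).

(* Smoothness of a map from the product manifold L * M to N. *)
Definition smooth_map2 (L M N : manifold R) (F : L -> M -> N) : Prop :=
  forall (c : chart R (mdim L) L) (c' : chart R (mdim M) M),
    atlas c -> atlas c' ->
    smooth_on [set x : 'rV[R]_(mdim L + mdim M) |
                chart_im c (lsubmx x) /\ chart_im c' (rsubmx x)]
              (fun x => F (chart_inv c (lsubmx x)) (chart_inv c' (rsubmx x))).

Definition smooth_curve (N : manifold R) (gamma : R -> N) : Prop :=
  smooth_on setT (fun x : 'rV[R]_1 => gamma (x 0 0)).

End SmoothMaps.

(** ** Tangent vectors *)

Section Tangent.
Variables (R : realType) (M : manifold R) (p : M).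

(* Tangent vectors at p are the derivations at p of the algebra of smooth
   functions.  A derivation is extended by 0 to the functions that are not
   smooth, so that equality of tangent vectors is equality on smooth
   functions. *)
Definition derivation_at : {pred (M -> R) -> R} :=
  fun v => `[< [/\ forall f, ~ smooth_fun f -> v f = 0,
    forall (k : R) f g, smooth_fun f -> smooth_fun g ->
      v (k *: f + g) = k * v f + v g
  & forall f g, smooth_fun f -> smooth_fun g ->
      v (fun q => f q * g q) = v f * g p + f p * v g] >].

Record tangent := Tangent {
  tangent_fun :> (M -> R) -> R;
  tangent_prop : tangent_fun \in derivation_at }.

HB.instance Definition _ := [isSub for tangent_fun].
HB.instance Definition _ := [Choice of tangent by <:].

Fact derivation_at_submod : submod_closed derivation_at.
Proof.
split.
  by apply/asboolP; split => [f _|k f g _ _|f g _ _] //;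
     rewrite ?mulr0 ?mul0r ?addr0.
move=> a u v /asboolP[u0 ul uM] /asboolP[v0 vl vM]; apply/asboolP.
split => [f nf|k f g sf sg|f g sf sg]; rewrite /GRing.add /GRing.scale /=.
- by rewrite u0// v0// scaler0 addr0.
- rewrite ul// vl// /GRing.scale /= !mulrDr !mulrA (mulrC k a).
  by rewrite addrACA.
- rewrite uM// vM// /GRing.scale /= !mulrDr !mulrDl !mulrA (mulrC (f p) a).
  by rewrite addrACA.
Qed.

HB.instance Definition _ :=
  GRing.isSubmodClosed.Build R ((M -> R) -> R) derivation_at
    derivation_at_submod.
HB.instance Definition _ := [SubChoice_isSubLmodule of tangent by <:].

(* The tangent vector at p given on smooth functions by v; 0 when v is not a
   derivation at p. *)
Definition mktangent (v : (M -> R) -> R) : tangent :=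
  insubd (0 : tangent) (fun f => if `[< smooth_fun f >] then v f else 0).

Definition cotangent := dual tangent.

Definition dfun (f : M -> R) : cotangent := mkdual (fun v : tangent => v f).

End Tangent.

Section TangentMaps.
Variables (R : realType) (M N : manifold R).

(* The differential of F at p; the second version is meant for q = F p, and
   serves when this equality holds only propositionally. *)
Definition dmap (F : M -> N) (p : M) (v : tangent p) : tangent (F p) :=
  mktangent (F p) (fun f => v (f \o F)).

Definition dmap_to (F : M -> N) (p : M) (q : N) (v : tangent p) : tangent q :=
  mktangent q (fun f => v (f \o F)).

Definition immersion (F : M -> N) : Prop :=
  smooth_map F /\ forall p, injective (@dmap F p).

Definition submersion (F : M -> N) : Prop :=
  smooth_map F /\ forall p (w : tangent (F p)), range (@dmap F p) w.

End TangentMaps.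

(** ** Bivector fields *)

Section Bivectors.
Variables (R : realType) (M : manifold R).

Definition bifield := forall m : M, cotangent m -> cotangent m -> R.

Implicit Type P : bifield.

Definition poisson_bracket P (f g : M -> R) : M -> R :=
  fun m => P m (dfun m f) (dfun m g).

Definition is_bivector P : Prop :=
  [/\ forall m, bilinear_form (P m),
      forall m a b, P m a b = - P m b a
    & forall f g, smooth_fun f -> smooth_fun g ->
        smooth_fun (poisson_bracket P f g)].

(* [P, P] / 2 on the differentials of f, g, k. *)
Definition half_schouten P (f g k : M -> R) (m : M) : R :=
  poisson_bracket P f (poisson_bracket P g k) m +
  poisson_bracket P g (poisson_bracket P k f) m +
  poisson_bracket P k (poisson_bracket P f g) m.

Definition lie_derivative (X : forall m : M, tangent m) P (f g : M -> R)
    (m : M) : R :=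
  X m (poisson_bracket P f g)
  - poisson_bracket P (fun q => X q f) g m
  - poisson_bracket P f (fun q => X q g) m.

Definition sharp P (m : M) (a : cotangent m) : tangent m :=
  xget 0 [set v : tangent m | forall b : cotangent m, b v = P m b a].

End Bivectors.

(* The bivector field PL on L is the restriction of P along the immersion F. *)
Definition bivector_restricts (R : realType) (L M : manifold R) (F : L -> M)
    (PL : bifield L) (P : bifield M) : Prop :=
  forall (l : L) (a b : cotangent (F l)),
    push2 (@dmap R L M F l) (PL l) a b = P (F l) a b.

(** * Lie groups and actions *)

Record lieGroup (R : realType) := LieGroup {
  lg_manifold :> manifold R;
  lg_mul : lg_manifold -> lg_manifold -> lg_manifold;
  lg_one : lg_manifold;
  lg_inv : lg_manifold -> lg_manifold;
  lg_mulA : associative lg_mul;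
  lg_mul1 : left_id lg_one lg_mul;
  lg_mulV : left_inverse lg_one lg_inv lg_mul;
  lg_mul_smooth : smooth_map2 lg_mul;
  lg_inv_smooth : smooth_map lg_inv }.

Section LieGroups.
Variables (R : realType) (G : lieGroup R).

Definition lie : lmodType R := tangent (lg_one G).

Definition left_invariant (X : lie) (f : G -> R) : G -> R :=
  fun a => X (f \o lg_mul a).

Definition lie_bracket (X Y : lie) : lie :=
  mktangent (lg_one G)
    (fun f => X (left_invariant Y f) - Y (left_invariant X f)).

Definition one_parameter (X : lie) (gamma : R -> G) : Prop :=
  [/\ smooth_curve gamma,
      forall s t, gamma (s + t) = lg_mul (gamma s) (gamma t)
    & forall f : G -> R, smooth_fun f -> derive1 (f \o gamma) 0 = X f].

Definition lie_exp (X : lie) : G :=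
  xget (fun=> lg_one G) [set gamma | one_parameter X gamma] 1.

Variable M : manifold R.

Definition is_action (act : G -> M -> M) : Prop :=
  [/\ smooth_map2 act, forall m, act (lg_one G) m = m
    & forall a b m, act (lg_mul a b) m = act a (act b m)].

(* The vector field x_M. *)
Definition fundamental (act : G -> M -> M) (x : lie) (m : M) : tangent m :=
  mktangent m
    (fun f => derive1 (fun t : R => f (act (lie_exp (- t *: x)) m)) 0).

End LieGroups.

(** * Group pairs *)

(* Smoothness of the metric follows from its left invariance.  gp_alg_incl is
   the inclusion of Lie algebras, the differential of gp_incl at the unit. *)
Record groupPair (R : realType) (n : nat) := GroupPair {
  gpD : lieGroup R;
  gpG : lieGroup R;
  gp_incl : gpG -> gpD;
  gp_metric : forall a : gpD, tangent a -> tangent a -> R;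
  gp_alg_incl : lie gpG -> lie gpD := @dmap_to R gpG gpD gp_incl _ _;
  gp_D_connected : connected [set: gpD];
  gp_G_connected : connected [set: gpG];
  gp_morph : forall a b,
    gp_incl (lg_mul a b) = lg_mul (gp_incl a) (gp_incl b);
  gp_inj : injective gp_incl;
  gp_immersion : immersion gp_incl;
  gp_closed : closed (range gp_incl);
  gp_bilinear : forall a, bilinear_form (@gp_metric a);
  gp_symmetric : forall a, symmetric_form (@gp_metric a);
  gp_nondegenerate : forall a, nondegenerate_form (@gp_metric a);
  gp_left : forall b a (u v : tangent a),
    gp_metric (dmap (lg_mul b) u) (dmap (lg_mul b) v) = gp_metric u v;
  gp_right : forall b a (u v : tangent a),
    gp_metric (dmap (fun c : gpD => lg_mul c b) u)
              (dmap (fun c : gpD => lg_mul c b) v) = gp_metric u v;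
  gp_manin : manin_pair (@lie_bracket R gpD) (@gp_metric (lg_one gpD))
                        gp_alg_incl n }.

(* A model of D / G: the manifold structure on the quotient is characterized by
   the projection being a surjective submersion. *)
Record homogeneousSpace (R : realType) (n : nat) (DG : groupPair R n) :=
  HomogeneousSpace {
    hs_manifold :> manifold R;
    hs_proj : gpD DG -> hs_manifold;
    hs_surj : forall s, range hs_proj s;
    hs_submersion : submersion hs_proj;
    hs_fibre : forall a b, hs_proj a = hs_proj b <->
      exists g, b = lg_mul a (gp_incl g) }.

Section QuasiHamiltonian.
Variables (R : realType) (n : nat) (DG : groupPair R n).
Variable S : homogeneousSpace DG.

Let D := gpD DG.
Let G := gpG DG.
Let d := lie D.
Let g := lie G.
Let br : d -> d -> d := @lie_bracket R D.
Let B : d -> d -> R := @gp_metric R n DG (lg_one D).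
Let i : g -> d := @gp_alg_incl R n DG.

Definition lagrangian_complement (h : set d) : Prop :=
  isotropic_complement B i h.

Definition dressing (a : D) (s : S) : S :=
  hs_proj S (lg_mul a (xget (lg_one D) [set b | hs_proj S b = s])).

Definition admissible_at (h : set d) (s : S) : Prop :=
  set_bij h [set: tangent s] (fun y => fundamental dressing y s).

Definition hat (h : set d) (x : g) (s : S) : cotangent s :=
  xget 0 [set a : cotangent s |
    forall y, h y -> a (fundamental dressing y s) = - B (i x) y].

Section Space.
Variables (M : manifold R) (act : G -> M -> M).

(* The bivector attached to the complement h', given the one, P, attached
   to h. *)
Definition change_complement (h h' : set d) (P : bifield M) : bifield M :=
  fun m a b =>
    P m a b - push2 (fun x => fundamental act x m) (twist B i h h') a b.

Definition quasi_poisson (h : set d) (P : bifield M) : Prop :=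
  [/\ is_action act, is_bivector P,
      forall (f1 f2 f3 : M -> R) m,
        smooth_fun f1 -> smooth_fun f2 -> smooth_fun f3 ->
        half_schouten P f1 f2 f3 m =
        push3 (fun x => fundamental act x m) (phi_ br B i h)
          (dfun m f1) (dfun m f2) (dfun m f3)
    & forall x (f1 f2 : M -> R) m, smooth_fun f1 -> smooth_fun f2 ->
        lie_derivative (fundamental act x) P f1 f2 m =
        - push2 (fun y => fundamental act y m) (F_ br B i h x)
            (dfun m f1) (dfun m f2)].

Definition moment_map (h : set d) (P : bifield M) (mu : M -> S) : Prop :=
  [/\ smooth_map mu,
      forall a m, mu (act a m) = dressing (gp_incl a) (mu m)
    & forall (Omega : set M) (h' : set d),
        open Omega -> lagrangian_complement h' ->
        (forall m, Omega m -> admissible_at h' (mu m)) ->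
        forall x m, Omega m ->
          sharp (change_complement h h' P)
                (pullback (@dmap _ _ _ mu m) (hat h' x (mu m))) =
          fundamental act x m].

(* (M, P, mu) is a quasi-hamiltonian space, P being the bivector attached
   to h. *)
Definition quasi_hamiltonian (h : set d) (P : bifield M) (mu : M -> S) :
    Prop :=
  quasi_poisson h P /\ moment_map h P mu.

Definition nondegenerate_space (h : set d) (P : bifield M) (mu : M -> S) : Prop :=
  forall m (h' : set d), lagrangian_complement h' ->
    admissible_at h' (mu m) ->
    bijective (@sharp _ _ (change_complement h h' P) m).

Definition image_distribution (h : set d) (P : bifield M) (mu : M -> S) (m : M) :
    set (tangent m) :=
  [set v | exists h' : set d,
    [/\ lagrangian_complement h', admissible_at h' (mu m)
      & range (@sharp _ _ (change_complement h h' P) m) v]].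

End Space.

End QuasiHamiltonian.

(** * Generalized foliations *)

Record foliation (R : realType) (M : manifold R) := Foliation {
  fol_index : Type;
  fol_leaf : fol_index -> manifold R;
  fol_incl : forall k, fol_leaf k -> M;
  fol_nonempty : forall k, [set: fol_leaf k] !=set0;
  fol_connected : forall k, connected [set: fol_leaf k];
  fol_injective : forall k, injective (@fol_incl k);
  fol_immersion : forall k, immersion (@fol_incl k);
  fol_partition : forall m, exists! k, range (@fol_incl k) m }.

Definition integrates (R : realType) (M : manifold R) (Fol : foliation M)
    (Dist : forall m : M, set (tangent m)) : Prop :=
  forall (k : fol_index Fol) (l : fol_leaf k),
    range (@dmap _ _ _ (@fol_incl _ _ Fol k) l) = Dist (fol_incl l).

(* Main.v *)
(** The moment map puts every fundamental field x_M in the image of P^# for each admissible complement, and a change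
    of complement alters P^# a by a fundamental field only.  Hence D_m = Im P^#_m + g_M(m) for the given bivector, whether
    or not h is admissible at mu(m), which gives the independence of the complement.  Admissible complements exist
    because Ad_a has determinant 1, by connectedness of D: this is the parity that allows g and Ad_a g to have a common
    Lagrangian complement.

    Near a point, D is spanned by the Hamiltonian fields of coordinate functions and the x_M of a basis of g, and the
    quasi-Poisson identities write the brackets of these fields as combinations of them with smooth coefficients.  The
    rank may jump: integral plaques are swept out by radial flows of combinations of the fields that span D at the centre,
    and the other fields stay tangent to them by a Gronwall argument.  The same argument shows that curves whose
    velocity is a small combination of fields tangent to D, and which start on a plaque, stay on it.  Leaves are the
    classes of points joined by chains of plaques, with the final topology; they are second countable by the
    Poincare-Volterra argument.

    On an arbitrary leaf L, the capture of curves shows that a.m stays in L for a near 1, so L contains orbits because G is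
    connected, and the action on L is jointly continuous, hence smooth.  Covectors that vanish on TL are annihilated by P,
    so P restricts to L, and the identities on L are those on M for local extensions of functions.  The restricted P^#
    is onto for admissible complements, hence bijective by skewness. *)

Require Import Defs.
From HB Require Import structures.
From mathcomp Require Import all_boot all_order all_algebra.
From mathcomp Require Import all_classical all_reals all_analysis.
From mathcomp Require Import ring lra.
Set Implicit Arguments.
Unset Strict Implicit.
Unset Printing Implicit Defensive.
Import Order.TTheory GRing.Theory Num.Theory.
Import numFieldNormedType.Exports.
Local Open Scope classical_set_scope.
Local Open Scope ring_scope.

(** * Calculus on open subsets of R^n *)

(** Tangent vectors are derivations of globally smooth functions, so smoothness, tangency and
    differential equations are all tested on such functions: bump functions localize these tests and
    Hadamard's lemma makes them finite.

    Admissible complements vary from point to point, while the bracket identities concern the single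
    bivector of [h], possibly admissible nowhere; describing D by that bivector and g_M reconciles
    the two.

    Radial flows are shown to depend smoothly on their direction without any theorem on parameters:
    a frame whose components in r coordinates are constant has brackets that vanish along the
    plaque, and this symmetry identifies the derivative of the time-one map with the frame itself,
    so smoothness bootstraps.

    That the kernel of d -> T_sS is exactly Ad_a g requires one-parameter subgroups of D inside G to
    be tangent to G; the topology of G being a priori finer, a countability argument replaces
    continuity.

    Since the last claim is about an arbitrary foliation integrating D, the capture estimate is
    proved for every integral parametrization. *)

Section RowNorm.
Variables (R : realType) (n : nat).
Implicit Types (x y : 'rV[R]_n).

Lemma ler_coord_norm x i : `|x 0 i| <= `|x|.
Proof.
rewrite [leRHS]/Num.Def.normr/= mx_normrE.
exact: (@le_bigmax _ _ _ 0 (fun ij => `|x ij.1 ij.2|) (0, i)).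
Qed.

Lemma norm_row_le x (e : R) : 0 <= e -> (forall i, `|x 0 i| <= e) -> `|x| <= e.
Proof.
move=> e0 H; rewrite [leLHS]/Num.Def.normr/= mx_normrE.
by apply: bigmax_le => // -[j i] _ /=; rewrite ord1.
Qed.

Lemma norm_delta_le (i : 'I_n) : `|delta_mx 0 i : 'rV[R]_n| <= 1.
Proof.
apply: norm_row_le => // j; rewrite mxE eqxx /=.
by case: (j == i); rewrite ?normr1 ?normr0.
Qed.

Lemma is_derive_line (f : 'rV[R]_n -> R) (z v : 'rV[R]_n) (t : R) :
  derivable f (z + t *: v) v ->
  is_derive t (1 : R) (fun s => f (z + s *: v)) ('D_v f (z + t *: v)).
Proof.
move=> fd; have E : (fun h : R => h^-1 *: (((fun s => f (z + s *: v)) \o shift t) (h *: (1 : R)) - f (z + t *: v)))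
  = (fun h : R => h^-1 *: ((f \o shift (z + t *: v)) (h *: v) - f (z + t *: v))).
  apply/funext => h /=; congr (_ *: (f _ - _)).
  by rewrite [h%:A]mulr1 scalerDl addrCA.
by split; [rewrite /derivable E | rewrite /derive E].
Qed.

End RowNorm.

(** Comparing with the affine function of slope [c] avoids any division by [b], and bounds on the
    symmetric interval cover both signs of [b]. *)
Lemma mvt_dist (R : realType) (f df : R -> R) (b c K : R) :
  (forall t : R, `|t| <= `|b| -> is_derive t (1 : R) f (df t)) ->
  (forall t : R, `|t| <= `|b| -> `|df t - c| <= K) ->
  `|f b - f 0 - c * b| <= K * `|b|.
Proof.
move=> fd fK.
have cf (t : R) : `|t| <= `|b| -> {for t, continuous f}.
  by move=> /fd H; apply/differentiable_continuous/derivable1_diffP.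
have cw (u v : R) : (forall t, u <= t <= v -> `|t| <= `|b|) -> {within `[u, v], continuous f}.
  move=> H; apply: continuous_in_subspaceT => t; rewrite inE /= in_itv /= => tuv.
  by apply: cf; apply: H.
have [b0|b0] := leP 0 b.
  have tb t : 0 <= t <= b -> `|t| <= `|b|.
    by move=> /andP[t0 tb]; rewrite !ger0_norm.
  have [|t|c0 c0b ->] := @MVT_segment R f df 0 b b0.
  - by move=> t; rewrite in_itv /= => /andP[/ltW t0 /ltW tb']; apply: fd; rewrite tb ?t0.
  - exact: cw.
  rewrite subr0 -mulrBl normrM ler_wpM2r//; apply: fK; apply: tb.
  by move: c0b; rewrite in_itv.
have tb t : b <= t <= 0 -> `|t| <= `|b|.
  by move=> /andP[t0 tb]; rewrite !ler0_norm ?lerN2 ?(ltW b0).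
have [|t|c0 c0b] := @MVT_segment R f df b 0 (ltW b0).
- by move=> t; rewrite in_itv /= => /andP[/ltW t0 /ltW tb']; apply: fd; rewrite tb ?t0.
- exact: cw.
rewrite sub0r => E.
have -> : f b - f 0 - c * b = (df c0 - c) * b.
  by rewrite mulrBl; congr (_ - _); rewrite -opprB E mulrN opprK.
rewrite normrM ler_wpM2r//; apply: fK; apply: tb.
by move: c0b; rewrite in_itv.
Qed.

Lemma near_eq_continuous (T U : topologicalType) (f g : T -> U) (x : T) :
  (\forall y \near x, f y = g y) -> {for x, continuous f} -> {for x, continuous g}.
Proof.
move=> fg fc; have fx : f x = g x := nbhs_singleton fg.
have : g @ x --> g x; last by [].
rewrite -fx; apply: cvg_trans fc; apply: near_eq_cvg.
by apply: filterS fg => y ->.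
Qed.

Lemma cvg_bigsum (T : Type) (F : set_system T) {FF : Filter F} (R : numFieldType)
    (V : normedModType R) (I : Type) (r : seq I) (f : I -> T -> V) (l : I -> V) :
  (forall i, f i @ F --> l i) ->
  (fun x => \sum_(i <- r) f i x) @ F --> \sum_(i <- r) l i.
Proof.
move=> fl; elim: r => [|i r IH].
  rewrite big_nil (_ : (fun _ => _) = cst 0); first exact: cvg_cst.
  by apply/funext => x; rewrite big_nil.
rewrite big_cons (_ : (fun _ => _) = f i \+ (fun x => \sum_(i <- r) f i x)).
  exact: cvgD.
by apply/funext => x; rewrite big_cons.
Qed.

Lemma is_diff_littleo (R : realType) (V W : normedModType R) (f : V -> W)
    (L : {linear V -> W}) (x : V) : continuous L ->
  (forall e : R, 0 < e -> \forall h \near (0 : V),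
     `|f (h + x) - f x - L h| <= e * `|h|) -> is_diff x f L.
Proof.
move=> cL H.
have key : f \o shift x = cst (f x) + L +o_ 0 id.
  apply/eqaddoP => e e0; have := H e e0; apply: filterS => h.
  rewrite /= -![(_ - _ : _ -> _) _]/(_ - _) -![(_ + _ : _ -> _) _]/(_ + _) /= /cst.
  by rewrite opprD addrA.
have E := diff_unique cL key.
by split => //; apply/diff_locallyP; rewrite E; split.
Qed.

(** * Classes C^k and differentiability *)

Section CkBasic.
Variables (R : realType) (n : nat).
Implicit Types (f g : 'rV[R]_n -> R) (U V : set 'rV[R]_n) (x : 'rV[R]_n).

(** The clauses of [Ck] quantify over the points of [U] but evaluate the total function [f] around
    each of them, so regularity is a property of germs, even when [U] is a singleton. Restrictions
    and local modifications of [f] are handled through this. *)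
Lemma Ck_pointwise k U f : Ck k U f <-> forall x, U x -> Ck k [set x] f.
Proof.
elim: k f => [|k IH] f /=.
  split => [[fc _] x Ux|H].
    by split => // y ->; apply: fc.
  by split => // x Ux; have [+ _] := H x Ux; apply.
split.
  case=> fc fd x Ux; split; first by move=> y ->; apply: fc.
  move=> i; have [fd1 fd2] := fd i; split; first by move=> y ->; apply: fd1.
  by move: x Ux; apply/IH.
move=> H; split; first by move=> x Ux; have [+ _] := H x Ux; apply.
move=> i; split; first by move=> x Ux; have [_ /(_ i)[+ _]] := H x Ux; apply.
by apply/IH => x Ux; have [_ /(_ i)[]] := H x Ux.
Qed.

Lemma Ck_subset k U V f : V `<=` U -> Ck k U f -> Ck k V f.
Proof. by move=> VU /Ck_pointwise H; apply/Ck_pointwise => x /VU/H. Qed.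

Lemma Ck_near k x f g : (\forall y \near x, f y = g y) ->
  Ck k [set x] f -> Ck k [set x] g.
Proof.
elim: k f g => [|k IH] f g fg /= [fc fd].
  by split => // y ->; apply: near_eq_continuous fg (fc x erefl).
split.
  by move=> y ->; apply: near_eq_continuous fg (fc x erefl).
move=> i; have [fd1 fd2] := fd i; split.
  by move=> y ->; apply: near_eq_derivable (fd1 x erefl).
apply: IH fd2; near=> y; apply: near_eq_derive; near: y.
exact: (nbhs_interior fg).
Unshelve. all: by end_near. Qed.

Lemma Ck_eq k U f g : open U -> (forall x, U x -> f x = g x) ->
  Ck k U f -> Ck k U g.
Proof.
move=> oU fg /Ck_pointwise H; apply/Ck_pointwise => x Ux.
by apply: Ck_near (H x Ux); apply: filterS (open_nbhs_nbhs (conj oU Ux)).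
Qed.

Lemma CkW k U f : Ck k.+1 U f -> Ck k U f.
Proof.
elim: k f => [|k IH] f [fc fd]; first by split.
by split => // i; have [fd1 fd2] := fd i; split => //; apply: IH.
Qed.

Lemma Ck_le k l U f : (k <= l)%N -> Ck l U f -> Ck k U f.
Proof.
move=> /subnKC <-; elim: (l - k)%N => [|m IH]; first by rewrite addn0.
by rewrite addnS => /CkW.
Qed.

Lemma Ck_cont k U f x : Ck k U f -> U x -> {for x, continuous f}.
Proof. by case: k => [|k] [H _]; apply: H. Qed.

Lemma Ck_derivable k U f x i : Ck k.+1 U f -> U x -> derivable f x (delta_mx 0 i).
Proof. by case=> _ /(_ i)[+ _]; apply. Qed.

Lemma Ck_partial k U f i : Ck k.+1 U f -> Ck k U (partial i f).
Proof. by case=> _ /(_ i)[]. Qed.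

Lemma Cinf_partial U f i : Cinf U f -> Cinf U (partial i f).
Proof. by move=> H k; apply: Ck_partial (H k.+1). Qed.

Definition dotp (a : 'I_n -> R) (v : 'rV[R]_n) : R := \sum_i v 0 i * a i.

Lemma dotp_is_linear a : linear (dotp a).
Proof.
move=> k u v; rewrite /dotp scaler_sumr -big_split /=; apply: eq_bigr => i _.
by rewrite !mxE mulrDl -mulrA.
Qed.

HB.instance Definition _ a :=
  GRing.isLinear.Build R 'rV[R]_n R *:%R (dotp a) (dotp_is_linear a).

Lemma dotp_continuous a : continuous (dotp a).
Proof.
move=> x; apply: (@cvg_bigsum _ (nbhs x) _ R R) => i.
exact: cvgM (@coord_continuous R 1 n 0 i x) (cvg_cst _).
Qed.

(** Going from [x] to [x + h] along the coordinate axes, one at a time, reduces the increment of [f]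
    to one-variable mean value estimates; continuity of the partials makes each error small. *)
Lemma Ck1_diff U f x : open U -> Ck 1 U f -> U x -> is_diff x f (dotp (fun i => partial i f x)).
Proof.
move=> oU [fc fd] Ux; set a := (fun i => _).
apply: is_diff_littleo => [|e e0]; first exact: dotp_continuous.
  (* The successor keeps [N] positive in dimension 0 and leaves room for the intermediate points of
     the broken line. *)
  set s := index_enum 'I_n; set N : R := (size s).+1%:R.
  have N0 : 0 < N by rewrite ltr0n.
  have : \forall y \near x, U y /\ forall i, `|partial i f y - partial i f x| <= e / N.
    have H i : \forall y \near x, `|partial i f y - partial i f x| <= e / N.
      have [_ [/(_ x Ux) ci _]] := fd i.
      have /cvgrPdist_le/(_ (e / N)) := ci; rewrite divr_gt0 // => /(_ isT).
      by apply: filterS => y; rewrite distrC.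
    by apply: filterI (open_nbhs_nbhs (conj oU Ux)) (filter_forall _ H).
  move=> /nbhs_ballP[d /= d0 dP].
  near=> h.
  have hd : N * `|h| < d.
    rewrite mulrC -ltr_pdivlMr //; near: h; rewrite near_simpl; apply: nbhs0_lt; exact: divr_gt0.
  have claim (t : seq 'I_n) : (size t)%:R * `|h| + `|h| < d ->
      `|\sum_(i <- t) h 0 i *: delta_mx 0 i : 'rV[R]_n| <= (size t)%:R * `|h| /\
      `|f (x + \sum_(i <- t) h 0 i *: delta_mx 0 i) - f x - \sum_(i <- t) h 0 i * a i|
      <= (size t)%:R * (e / N * `|h|).
    elim: t => [|j t IH] td.
      by split; rewrite !big_nil ?addr0 ?subrr ?subr0 normr0 mul0r.
    have td' : (size t)%:R * `|h| + `|h| < d.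
      apply: le_lt_trans td; rewrite lerD2r /= -natr1 mulrDl lerDl mul1r; exact: normr_ge0.
    have {IH} [IH1 IH2] := IH td'; rewrite !big_cons /=.
    set r := \sum_(i <- t) _ in IH1 IH2 *.
    have hj s' : `|s'| <= `|h 0 j| -> `|s' *: delta_mx 0 j + r| <= (size t).+1%:R * `|h|.
      move=> sh; rewrite -natr1 mulrDl mul1r (le_trans (ler_normD _ _))// [leLHS]addrC lerD//.
      rewrite normrZ -[leRHS]mulr1 ler_pM// ?norm_delta_le//.
      exact: le_trans sh (ler_coord_norm _ _).
    split; first exact: hj.
    have E : x + (h 0 j *: delta_mx 0 j + r) = (x + r) + h 0 j *: delta_mx 0 j.
      by rewrite -addrA (addrC r).
    have inb s' : `|s'| <= `|h 0 j| -> ball x d (x + r + s' *: delta_mx 0 j).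
      move=> /hj sh; rewrite -ball_normE /= opprD addrA opprD addrA subrr sub0r -opprD normrN addrC.
      apply: le_lt_trans sh (le_lt_trans _ td); rewrite lerDl; exact: normr_ge0.
    have := @mvt_dist R (fun s' => f (x + r + s' *: delta_mx 0 j))
       (fun s' => partial j f (x + r + s' *: delta_mx 0 j)) (h 0 j) (a j) (e / N).
    rewrite scale0r addr0 -E.
    have H1 : forall s', `|s'| <= `|h 0 j| -> is_derive s' (1 : R) (fun s' : R => f (x + r + s' *: delta_mx 0 j)) (partial j f (x + r + s' *: delta_mx 0 j)).
      by move=> s' /inb/dP[Us _]; apply: is_derive_line; have [+ _] := fd j; apply.
    have H2 : forall s', `|s'| <= `|h 0 j| -> `|partial j f (x + r + s' *: delta_mx 0 j) - a j| <= e / N.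
      by move=> s' /inb/dP[_ +]; apply.
    move=> /(_ H1 H2) M.
    set A := f (x + (h 0 j *: delta_mx 0 j + r)) in M *.
    set B := f (x + r) in M IH2.
    have -> : A - f x - (h 0 j * a j + \sum_(i <- t) h 0 i * a i) =
       (B - f x - \sum_(i <- t) h 0 i * a i) + (A - B - a j * h 0 j) by ring.
    apply: le_trans (ler_normD _ _) _; rewrite -natr1 mulrDl mul1r lerD//.
    apply: le_trans M _; rewrite ler_wpM2l// ?ler_coord_norm//.
    by rewrite divr_ge0// ltW.
  have : (size s)%:R * `|h| + `|h| < d.
    by rewrite -[X in _ + X]mul1r -mulrDl natr1.
  move=> /claim[_]; rewrite -row_sum_delta (addrC h) => H.
  apply: le_trans H _; rewrite mulrA ler_wpM2r//; rewrite mulrCA -[leRHS]mulr1 ler_wpM2l ?ltW//.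
  by rewrite ltr_pdivrMr// mul1r ltr_nat.
Unshelve. all: by end_near. Qed.

Lemma Ck1_is_derive U f x v : open U -> Ck 1 U f -> U x ->
  is_derive x v f (dotp (fun i => partial i f x) v).
Proof.
move=> oU H Ux; have D := Ck1_diff oU H Ux.
by apply: DeriveDef; [apply: diff_derivable | rewrite deriveE // diff_val].
Qed.

End CkBasic.

Section CkOps.
Variables (R : realType) (n : nat) (U : set 'rV[R]_n) (oU : open U).
Implicit Types (f g : 'rV[R]_n -> R).

Lemma Ck_cst k c : Ck k U (fun=> c).
Proof.
have cc (d : R) (x : 'rV[R]_n) : {for x, continuous (fun=> d)} by exact: cst_continuous.
elim: k c => [|k IH] c; first by split => // x _; exact: cc.
split; first by move=> x _; exact: cc.
move=> i; split; first by move=> x _; exact: derivable_cst.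
rewrite (_ : partial i _ = fun=> 0); first exact: IH.
by apply/funext => x; rewrite /partial derive_cst.
Qed.

Lemma is_diff_dotp (a : 'I_n -> R) x : is_diff x (dotp a) (dotp a).
Proof.
have c : continuous (dotp a) := @dotp_continuous R n a.
by apply: DiffDef; [exact: linear_differentiable | exact: diff_lin].
Qed.

Lemma dotp_delta (a : 'I_n -> R) i : dotp a (delta_mx 0 i) = a i.
Proof.
rewrite /dotp (bigD1 i) //= mxE !eqxx mul1r big1 ?addr0// => j ji.
by rewrite mxE eqxx (negbTE ji) mul0r.
Qed.

Lemma dotp_coord (j : 'I_n) (x : 'rV[R]_n) : dotp (fun i => (i == j)%:R) x = x 0 j.
Proof.
rewrite /dotp (bigD1 j) //= eqxx mulr1 big1 ?addr0// => i ij.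
by rewrite (negbTE ij) mulr0.
Qed.

Lemma Ck_dotp k (a : 'I_n -> R) : Ck k U (dotp a).
Proof.
have c x : {for x, continuous (dotp a)} := @dotp_continuous R n a x.
case: k => [|k]; first by split => // x _; exact: c.
split; first by move=> x _; exact: c.
move=> i; split.
  by move=> x _; apply: diff_derivable; have [] := is_diff_dotp a x.
have -> : partial i (dotp a) = fun=> a i; last exact: Ck_cst.
apply/funext => x; rewrite /partial; have [d E] := is_diff_dotp a x.
by rewrite deriveE// E dotp_delta.
Qed.

Lemma Ck_coord k j : Ck k U (fun x => x 0 j).
Proof.
rewrite (_ : (fun _ => _) = dotp (fun i => (i == j)%:R)); first exact: Ck_dotp.
by apply/funext => x; rewrite dotp_coord.
Qed.

Lemma Ck_add k f g : Ck k U f -> Ck k U g -> Ck k U (fun x => f x + g x).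
Proof.
elim: k f g => [|k IH] f g [fc fd] [gc gd].
  by split => // x Ux; exact: cvgD (fc x Ux) (gc x Ux).
split; first by move=> x Ux; exact: cvgD (fc x Ux) (gc x Ux).
move=> i; have [fd1 fd2] := fd i; have [gd1 gd2] := gd i; split.
  by move=> x Ux; exact: derivableD (fd1 x Ux) (gd1 x Ux).
apply: Ck_eq (IH _ _ fd2 gd2) => // x Ux.
by rewrite /partial -deriveD//; [exact: fd1 | exact: gd1].
Qed.

Lemma Ck_mul k f g : Ck k U f -> Ck k U g -> Ck k U (fun x => f x * g x).
Proof.
elim: k f g => [|k IH] f g H1 H2.
  move: H1 H2 => [fc fd] [gc gd].
  by split => // x Ux; exact: cvgM (fc x Ux) (gc x Ux).
have [fc fd] := H1; have [gc gd] := H2.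
split; first by move=> x Ux; exact: cvgM (fc x Ux) (gc x Ux).
move=> i; have [fd1 fd2] := fd i; have [gd1 gd2] := gd i; split.
  by move=> x Ux; exact: derivableM (fd1 x Ux) (gd1 x Ux).
apply: Ck_eq (Ck_add (IH _ _ (CkW H1) gd2) (IH _ _ (CkW H2) fd2)) => // x Ux.
by rewrite /partial (@deriveM _ _ f g x)//; [exact: fd1 | exact: gd1].
Qed.

Lemma Ck_opp k f : Ck k U f -> Ck k U (fun x => - f x).
Proof.
move=> H; rewrite (_ : (fun _ => _) = (fun x => (-1) * f x)).
  by apply: Ck_mul => //; exact: Ck_cst.
by apply/funext => x; rewrite mulN1r.
Qed.

Lemma Ck_sub k f g : Ck k U f -> Ck k U g -> Ck k U (fun x => f x - g x).
Proof. by move=> H1 H2; apply: Ck_add => //; apply: Ck_opp. Qed.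

Lemma Ck_sum k (I : Type) (r : seq I) (P : pred I) (F : I -> 'rV[R]_n -> R) :
  (forall i, P i -> Ck k U (F i)) -> Ck k U (fun x => \sum_(i <- r | P i) F i x).
Proof.
move=> H; elim: r => [|i r IH].
  rewrite (_ : (fun _ => _) = (fun=> 0)); first exact: Ck_cst.
  by apply/funext => x; rewrite big_nil.
case: (boolP (P i)) => Pi; last first.
  by rewrite (_ : (fun _ => _) = (fun x => \sum_(i <- r | P i) F i x)) //;
    apply/funext => x; rewrite big_cons (negbTE Pi).
rewrite (_ : (fun _ => _) = (fun x => F i x + \sum_(i <- r | P i) F i x)).
  by apply: Ck_add => //; apply: H.
by apply/funext => x; rewrite big_cons Pi.
Qed.

Lemma Ck_prod k (I : Type) (r : seq I) (P : pred I) (F : I -> 'rV[R]_n -> R) :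
  (forall i, P i -> Ck k U (F i)) -> Ck k U (fun x => \prod_(i <- r | P i) F i x).
Proof.
move=> H; elim: r => [|i r IH].
  rewrite (_ : (fun _ => _) = (fun=> 1)); first exact: Ck_cst.
  by apply/funext => x; rewrite big_nil.
case: (boolP (P i)) => Pi; last first.
  by rewrite (_ : (fun _ => _) = (fun x => \prod_(i <- r | P i) F i x)) //;
    apply/funext => x; rewrite big_cons (negbTE Pi).
rewrite (_ : (fun _ => _) = (fun x => F i x * \prod_(i <- r | P i) F i x)).
  by apply: Ck_mul => //; apply: H.
by apply/funext => x; rewrite big_cons Pi.
Qed.

Lemma Ck_inv k f : (forall x, U x -> f x != 0) -> Ck k U f -> Ck k U (fun x => (f x)^-1).
Proof.
move=> f0; elim: k => [|k IH] H.
  by split => // x Ux; exact: cvgV (f0 x Ux) (Ck_cont H Ux).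
split; first by move=> x Ux; exact: cvgV (f0 x Ux) (Ck_cont H Ux).
move=> i; have [fc /(_ i)[fd1 fd2]] := H; split.
  by move=> x Ux; apply: derivableV; [exact: f0 | exact: fd1].
have I := IH (CkW H).
apply: Ck_eq (Ck_opp (Ck_mul (Ck_mul I I) fd2)) => // x Ux.
rewrite /partial deriveV; [|exact: f0 | exact: fd1].
by rewrite -mulNr -invfM -expr2.
Qed.

End CkOps.

Lemma open_preimage_within (T S : topologicalType) (f : T -> S) (U : set T) (V : set S) :
  open U -> open V -> (forall x, U x -> {for x, continuous f}) ->
  open (U `&` f @^-1` V).
Proof.
move=> oU oV fc; rewrite openE => x [Ux Vx]; apply: filterI.
  exact: open_nbhs_nbhs.
exact: (fc x Ux) (open_nbhs_nbhs (conj oV Vx)).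
Qed.

Lemma cvg_row (T : Type) (F : set_system T) {FF : Filter F} (R : realType) n
    (f : T -> 'rV[R]_n) (l : 'rV[R]_n) :
  (forall i, (fun x => f x 0 i) @ F --> l 0 i) -> f @ F --> l.
Proof.
move=> H; apply/cvgrPdist_lt => e e0.
have H' : \forall x \near F, forall i, `|l 0 i - f x 0 i| <= e / 2.
  apply: filter_forall => i; have /cvgrPdist_le := H i; apply; exact: divr_gt0.
apply: filterS H' => x Hx; apply: (@le_lt_trans _ _ (e / 2)).
  by apply: norm_row_le => [|i]; [rewrite divr_ge0// ltW | rewrite !mxE].
by rewrite ltr_pdivrMr// ltr_pMr// ltr1n.
Qed.

Section CkComp.
Variables (R : realType) (n m : nat).

Definition CkV k (U : set 'rV[R]_n) (F : 'rV[R]_n -> 'rV[R]_m) :=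
  forall j, Ck k U (fun x => F x 0 j).

Lemma CkV_cont k U F x : CkV k U F -> U x -> {for x, continuous F}.
Proof. by move=> H Ux; apply: (@cvg_row _ (nbhs x)) => j; exact: Ck_cont (H j) Ux. Qed.

(** The chain rule for Frechet differentials, read on partials; this is where [Ck1_diff] is needed,
    as the existence of partial derivatives alone does not compose. *)
Lemma Ck1_chain (U : set 'rV[R]_n) (V : set 'rV[R]_m) (F : 'rV[R]_n -> 'rV[R]_m) (g : 'rV[R]_m -> R) x v :
  open U -> open V -> (forall x, U x -> V (F x)) -> CkV 1 U F -> Ck 1 V g -> U x ->
  is_derive x v (g \o F) (\sum_j 'D_v (fun x => F x 0 j) x * partial j g (F x)).
Proof.
move=> oU oV UV HF Hg Ux.
have dF : differentiable F x.
  have -> : F = (fun x => \sum_j (fun x => F x 0 j *: delta_mx 0 j) x).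
    by apply/funext => y; rewrite [LHS]row_sum_delta.
  rewrite (_ : (fun x => _) = \sum_j (fun x => F x 0 j *: delta_mx 0 j)); last first.
    by apply/funext => y; rewrite fct_sumE.
  apply: differentiable_sum => j; apply: differentiableZl.
  by have [] := Ck1_diff oU (HF j) Ux.
have [dg dgE] := Ck1_diff oV Hg (UV x Ux).
split; first exact/diff_derivable/differentiable_comp.
rewrite deriveE; last exact/differentiable_comp.
rewrite diff_comp //= dgE /dotp; apply: eq_bigr => j _; congr (_ * _).
rewrite -deriveE// derive_mx ?mxE//; exact: diff_derivable.
Qed.

Lemma Ck_comp k (U : set 'rV[R]_n) (V : set 'rV[R]_m) (F : 'rV[R]_n -> 'rV[R]_m) (g : 'rV[R]_m -> R) :
  open U -> open V -> (forall x, U x -> V (F x)) -> CkV k U F -> Ck k V g ->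
  Ck k U (g \o F).
Proof.
move=> oU oV UV; elim: k g => [|k IH] g HF Hg.
  split => // x Ux; apply: continuous_comp; first exact: CkV_cont HF Ux.
  exact: Ck_cont Hg (UV _ Ux).
have HF1 : CkV 1 U F by move=> j; apply: Ck_le (HF j).
have Hg1 : Ck 1 V g by apply: Ck_le Hg.
have HFk : CkV k U F by move=> j; apply: CkW.
split.
  move=> x Ux; apply: continuous_comp; first exact: CkV_cont HF Ux.
  exact: Ck_cont Hg (UV _ Ux).
move=> i; split.
  by move=> x Ux; have [] := Ck1_chain (delta_mx 0 i) oU oV UV HF1 Hg1 Ux.
apply: (@Ck_eq _ _ _ _ (fun x => \sum_j partial i (fun x => F x 0 j) x * (partial j g \o F) x)) => //.
  by move=> x Ux; have [_ E] := Ck1_chain (delta_mx 0 i) oU oV UV HF1 Hg1 Ux; rewrite /partial E.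
apply: Ck_sum => // j _; apply: Ck_mul => //; first exact: Ck_partial (HF j).
by apply: IH => //; apply: Ck_partial.
Qed.

End CkComp.

Section MatrixCk.
Variables (R : realType) (n : nat) (U : set 'rV[R]_n) (oU : open U).

Definition CkM k p q (F : 'rV[R]_n -> 'M[R]_(p, q)) :=
  forall i j, Ck k U (fun x => F x i j).

Lemma CkM_mul k p q r (F : 'rV[R]_n -> 'M[R]_(p, q)) (G : 'rV[R]_n -> 'M[R]_(q, r)) :
  CkM k F -> CkM k G -> CkM k (fun x => F x *m G x).
Proof.
move=> HF HG i j; rewrite (_ : (fun _ => _) = (fun x => \sum_l F x i l * G x l j)).
  by apply: Ck_sum => // l _; apply: Ck_mul.
by apply/funext => x; rewrite mxE.
Qed.

Lemma Ck_det k p (F : 'rV[R]_n -> 'M[R]_p) : CkM k F -> Ck k U (fun x => \det (F x)).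
Proof.
move=> HF; apply: Ck_sum => // s _; apply: Ck_mul => //; first exact: Ck_cst.
exact: Ck_prod.
Qed.

Lemma CkM_adj k p (F : 'rV[R]_n -> 'M[R]_p) : CkM k F -> CkM k (fun x => \adj (F x)).
Proof.
move=> HF i j; rewrite (_ : (fun _ => _) = (fun x => (-1) ^+ (j + i) * \det (row' j (col' i (F x))))).
  apply: Ck_mul => //; first exact: Ck_cst.
  by apply: Ck_det => a b; rewrite (_ : (fun _ => _) = (fun x => F x (lift j a) (lift i b))) //;
    apply/funext => x; rewrite !mxE.
by apply/funext => x; rewrite mxE.
Qed.

Lemma CkM_inv k p (F : 'rV[R]_n -> 'M[R]_p) : (forall x, U x -> F x \in unitmx) ->
  CkM k F -> CkM k (fun x => invmx (F x)).
Proof.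
move=> Fu HF i j; apply: (@Ck_eq _ _ k U (fun x => (\det (F x))^-1 * (\adj (F x)) i j)) => //.
  by move=> x /Fu; rewrite /invmx => ->; rewrite !mxE.
apply: Ck_mul => //; last exact: CkM_adj.
apply: Ck_inv => //; last exact: Ck_det.
by move=> x /Fu; rewrite unitmxE unitfE.
Qed.

End MatrixCk.

(** Right neighbourhoods of 0 form a filter, which does the work of a finite minimum; [r0] covers an
    empty index type. *)
Lemma min_radius (R : realType) (I : finType) (r : I -> R) (r0 : R) :
  0 < r0 -> (forall i, 0 < r i) -> exists e : R, [/\ 0 < e, e <= r0 & forall i, e <= r i].
Proof.
move=> r00 rp.
have H i : \forall e \near (0 : R)^'+, e <= r i by apply: nbhs_right_le.
have H0 : \forall e \near (0 : R)^'+, e <= r0 by apply: nbhs_right_le.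
have Hi : \forall e \near (0 : R)^'+, forall i, e <= r i by apply: (filter_forall _ H).
have Hp : \forall e \near (0 : R)^'+, 0 < e := nbhs_right_gt 0.
have /filter_ex[e /= [e0 [er0 er]]] : \forall e \near (0 : R)^'+, 0 < e /\ (e <= r0 /\ forall i, e <= r i).
  exact: filterI Hp (filterI H0 Hi).
by exists e.
Qed.

(** * Mean value estimates and a Gronwall inequality *)

Section Segments.
Variables (R : realType).

Lemma mvt01 (f df : R -> R) (c K : R) :
  (forall t : R, 0 <= t <= 1 -> is_derive t (1 : R) f (df t)) ->
  (forall t : R, 0 <= t <= 1 -> `|df t - c| <= K) -> `|f 1 - f 0 - c| <= K.
Proof.
move=> fd fK; have [|t|t0 t01 ->] := @MVT_segment R f df 0 1 ler01.
- by move=> t; rewrite in_itv /= => /andP[/ltW t0 /ltW t1]; apply: fd; rewrite t0 t1.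
- apply: continuous_in_subspaceT => s; rewrite inE /= in_itv /= => s01.
  by apply/differentiable_continuous/derivable1_diffP; have [] := fd s s01.
by rewrite subr0 mulr1; apply: fK; move: t01; rewrite in_itv.
Qed.

Lemma is_derive_rowP m (w : R -> 'rV[R]_m) (t : R) (d : 'rV[R]_m) :
  is_derive t (1 : R) w d <-> forall i, is_derive t (1 : R) (fun s => w s 0 i) (d 0 i).
Proof.
split=> [[wd we] i|H].
  have wdi : forall i, derivable (fun s => w s 0 i) t 1.
    by move=> j; have /derivable_mxP := wd; apply.
  split; first exact: wdi.
  by rewrite -we derive_mx// mxE.
have wd : derivable w t 1 by apply/derivable_mxP => i j; rewrite ord1; have [] := H j.
split => //; rewrite derive_mx//; apply/rowP => j; rewrite mxE.
by have [_ ->] := H j.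
Qed.

Lemma is_derive1_cont (V : normedModType R) (w : R -> V) (t : R) (d : V) :
  is_derive t (1 : R) w d -> {for t, continuous w}.
Proof. by move=> [wd _]; apply/differentiable_continuous/derivable1_diffP. Qed.

Lemma dotp_le n (a : 'I_n -> R) (x : 'rV[R]_n) (K : R) :
  \sum_i `|a i| <= K -> `|dotp a x| <= K * `|x|.
Proof.
move=> aK; rewrite /dotp (le_trans (ler_norm_sum _ _ _))//.
apply: (@le_trans _ _ (\sum_i `|a i| * `|x|)).
  by apply: ler_sum => i _; rewrite normrM mulrC ler_wpM2l// ler_coord_norm.
by rewrite -mulr_suml ler_wpM2r.
Qed.

Lemma segment_mvt n (U : set 'rV[R]_n) (f : 'rV[R]_n -> R) (c : 'I_n -> R) x y (K : R) :
  open U -> Ck 1 U f ->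
  (forall t : R, 0 <= t <= 1 -> U (x + t *: (y - x)) /\
     \sum_i `|partial i f (x + t *: (y - x)) - c i| <= K) ->
  `|f y - f x - dotp c (y - x)| <= K * `|y - x|.
Proof.
move=> oU Cf H.
have := @mvt01 (fun t => f (x + t *: (y - x)))
  (fun t => dotp (fun i => partial i f (x + t *: (y - x))) (y - x)) (dotp c (y - x)) (K * `|y - x|).
rewrite scale1r scale0r addr0 (addrC x) subrK; apply.
  move=> t /H[Ut _]; have [d <-] := Ck1_is_derive (y - x) oU Cf Ut.
  exact: is_derive_line.
move=> t /H[_ le]; rewrite /dotp -sumrB.
apply: le_trans (@dotp_le n (fun i => partial i f (x + t *: (y - x)) - c i) (y - x) K le).
by rewrite le_eqVlt; apply/orP; left; apply/eqP; congr (`|_|); apply: eq_bigr => i _; rewrite -mulrBr.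
Qed.

Lemma ball_segment n (x0 x y : 'rV[R]_n) (r t : R) :
  ball x0 r x -> ball x0 r y -> 0 <= t <= 1 -> ball x0 r (x + t *: (y - x)).
Proof.
rewrite -!ball_normE /= => bx b_y /andP[t0 t1].
have -> : x0 - (x + t *: (y - x)) = (1 - t) *: (x0 - x) + t *: (x0 - y).
  by apply/rowP => j; rewrite !mxE; ring.
have [->|tn0] := eqVneq t 0; first by rewrite subr0 scale1r scale0r addr0.
have tp : 0 < t by rewrite lt_def tn0.
apply: le_lt_trans (ler_normD _ _) _; rewrite !normrZ (ger0_norm t0) ger0_norm ?subr_ge0//.
have -> : r = (1 - t) * r + t * r by ring.
by apply: ler_ltD; [rewrite ler_wpM2l ?subr_ge0// ltW | rewrite ltr_pM2l].
Qed.

(** Strict differentiability: both points move, which is what contraction and injectivity arguments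
    need. Balls are convex, so the mean value theorem can be used along the segment between the
    points. *)
Lemma Ck1_strict n (U : set 'rV[R]_n) (f : 'rV[R]_n -> R) x0 (e : R) :
  open U -> Ck 1 U f -> U x0 -> 0 < e ->
  exists2 r : R, 0 < r & ball x0 r `<=` U /\ forall x y, ball x0 r x -> ball x0 r y ->
    `|f y - f x - dotp (fun i => partial i f x0) (y - x)| <= e * `|y - x|.
Proof.
move=> oU Cf Ux e0; pose N : R := n.+1%:R.
have N0 : 0 < N by rewrite ltr0n.
have Hi i : \forall y \near x0, `|partial i f y - partial i f x0| <= e / N.
  have [_ /(_ i)[_ [/(_ x0 Ux) ci _]]] := Cf.
  have /cvgrPdist_le/(_ (e / N)) := ci; rewrite divr_gt0 // => /(_ isT).
  by apply: filterS => y; rewrite distrC.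
have : \forall y \near x0, U y /\ forall i, `|partial i f y - partial i f x0| <= e / N.
  exact: filterI (open_nbhs_nbhs (conj oU Ux)) (filter_forall _ Hi).
move=> /nbhs_ballP[r /= r0 rP]; exists r => //; split; first by move=> y /rP[].
move=> x y bx b_y; apply: (segment_mvt oU Cf) => t t01.
have /rP[Ut Ht] := ball_segment bx b_y t01; split=> //.
apply: le_trans (ler_sum _ (fun i _ => Ht i)) _.
rewrite sumr_const card_ord -mulr_natl mulrCA ger_pMr// ler_pdivrMr// mul1r ler_nat //.
Qed.

Lemma Ck1_lipschitz n (U : set 'rV[R]_n) (f : 'rV[R]_n -> R) x0 :
  open U -> Ck 1 U f -> U x0 ->
  exists r L : R, [/\ 0 < r, 0 <= L, ball x0 r `<=` U & forall x y, ball x0 r x -> ball x0 r y ->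
    `|f y - f x| <= L * `|y - x|].
Proof.
move=> oU Cf Ux; have [r r0 [rU H]] := Ck1_strict oU Cf Ux ltr01.
exists r, (1 + \sum_i `|partial i f x0|); split=> //; first by rewrite addr_ge0// sumr_ge0.
move=> x y bx b_y; have := H x y bx b_y; set D := dotp _ _ => h.
rewrite -(subrK D (f y - f x)) (le_trans (ler_normD _ _))// mulrDl lerD//.
exact: dotp_le.
Qed.

Lemma CkV_lipschitz n m (U : set 'rV[R]_n) (f : 'rV[R]_n -> 'rV[R]_m) x0 :
  open U -> CkV 1 U f -> U x0 ->
  exists r L : R, [/\ 0 < r, 0 <= L, ball x0 r `<=` U & forall x y, ball x0 r x -> ball x0 r y ->
    `|f y - f x| <= L * `|y - x|].
Proof.
move=> oU Cf Ux.
have /choice[r Hr] : forall j : 'I_m, exists r : R, exists L : R, [/\ 0 < r, 0 <= L, ball x0 r `<=` U & forall x y, ball x0 r x -> ball x0 r y ->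
    `|f y 0 j - f x 0 j| <= L * `|y - x|].
  by move=> j; apply: (Ck1_lipschitz oU (Cf j) Ux).
have /choice[L HL] := Hr.
have /nbhs_ballP[r0 /= r00 r0U] := open_nbhs_nbhs (conj oU Ux).
have [|e [e0 er0 er]] := min_radius r00 (r := r); first by move=> j; have [] := HL j.
exists e, (\sum_j L j); split=> //.
- by rewrite sumr_ge0// => j _; have [] := HL j.
- by apply: subset_trans r0U; apply: le_ball.
move=> x y bx b_y; apply: norm_row_le => [|j].
  by rewrite mulr_ge0// sumr_ge0// => j _; have [] := HL j.
have [_ L0 _ H] := HL j; rewrite !mxE.
apply: le_trans (H x y _ _) _; try by apply: le_ball (er j) _ _.
rewrite ler_wpM2r// (bigD1 j)//= lerDl sumr_ge0// => i _.
by have [] := HL i.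
Qed.

(** On an interval of length 1 the constant 1/2 replaces the exponential of Gronwall's inequality:
    at a maximum [S] of the norm the mean value theorem gives [S <= S / 2 + A]. With [A = 0] it
    proves uniqueness and vanishing statements; callers rescale to reach 1/2. *)
Lemma small_gronwall m (w dw : R -> 'rV[R]_m) (A : R) :
  (forall t : R, 0 <= t <= 1 -> is_derive t (1 : R) w (dw t)) -> w 0 = 0 ->
  (forall t : R, 0 <= t <= 1 -> `|dw t| <= `|w t| / 2 + A) ->
  forall t : R, 0 <= t <= 1 -> `|w t| <= 2 * A.
Proof.
move=> wd w0 H.
have wc : {within `[(0:R), 1], continuous (fun t => `|w t|)}.
  apply: continuous_in_subspaceT => s; rewrite inE /= in_itv /= => s01.
  have wcs := is_derive1_cont (wd s s01).
  by apply: (@continuous_comp _ _ _ w Num.Def.normr s) => //; exact: norm_continuous.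
have [c c01 cmax] := EVT_max ler01 wc.
have {}c01 : 0 <= c <= 1 by move: c01; rewrite in_itv.
set S := `|w c| in cmax *.
have Sb t : 0 <= t <= 1 -> `|w t| <= S by move=> t01; apply: cmax; rewrite in_itv.
have S0 : 0 <= S by exact: normr_ge0.
have A0 : 0 <= A.
  have /H : 0 <= (0 : R) <= 1 by rewrite lexx ler01.
  by rewrite w0 normr0 mul0r add0r; apply: le_trans; exact: normr_ge0.
suff SA : S <= S / 2 + A.
  by move=> t /Sb /le_trans; apply; lra.
apply: norm_row_le => [|i]; first by rewrite addr_ge0// divr_ge0.
have /andP[c0 c1] := c01.
have [|t|t] := @MVT_segment R (fun s => w s 0 i) (fun s => dw s 0 i) 0 c c0.
- move=> t; rewrite in_itv /= => /andP[/ltW t0 /ltW tc].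
  by apply: (is_derive_rowP w t (dw t)).1 => //; apply: wd; rewrite t0 (le_trans tc).
- apply: continuous_in_subspaceT => s; rewrite inE /= in_itv /= => /andP[s0 sc].
  have /is_derive_rowP/(_ i) : is_derive s (1 : R) w (dw s) by apply: wd; rewrite s0 (le_trans sc).
  exact: is_derive1_cont.
rewrite in_itv /= => /andP[t0 tc]; rewrite w0 mxE !subr0 => ->.
have t01 : 0 <= t <= 1 by rewrite t0 (le_trans tc).
rewrite normrM (ger0_norm c0).
apply: (@le_trans _ _ (`|dw t 0 i| * 1)); first by rewrite ler_wpM2l.
rewrite mulr1; apply: le_trans (ler_coord_norm _ _) _.
apply: le_trans (H t t01) _; rewrite lerD2r ler_pM2r ?invr_gt0//.
exact: Sb.
Qed.

End Segments.

Lemma cont_epsP (R : realType) (V W : normedModType R) (f : V -> W) (x : V) :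
  {for x, continuous f} <->
  forall e : R, 0 < e -> exists2 d : R, 0 < d & forall y, `|x - y| < d -> `|f x - f y| <= e.
Proof.
split=> [fc e e0|H].
  have /cvgrPdist_le/(_ e e0)/nbhs_ballP[d /= d0 dP] := fc.
  by exists d => // y yd; apply: dP; rewrite -ball_normE.
apply/(@cvgrPdist_le _ _ _ (nbhs x)) => e /H[d d0 dP].
by apply/nbhs_ballP; exists d => // y; rewrite -ball_normE; exact: dP.
Qed.

Lemma lipschitz_cont (R : realType) (V W : normedModType R) (f : V -> W) (K : R) (x : V) :
  (forall y, `|f x - f y| <= K * `|x - y|) -> {for x, continuous f}.
Proof.
move=> H; apply/cont_epsP => e e0; have K0 : 0 < `|K| + 1 by rewrite ltr_wpDl.
exists (e / (`|K| + 1)); first exact: divr_gt0.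
move=> y /ltW; rewrite ler_pdivlMr// mulrC; apply: le_trans; apply: le_trans (H y) _.
by rewrite ler_wpM2r//; apply: le_trans (ler_norm _) _; rewrite lerDl.
Qed.

Lemma exp2_gtn (R : realType) (k : nat) : k%:R < (2 : R) ^+ k.
Proof. by rewrite -natrX ltr_nat ltn_expl. Qed.

Lemma le0_geometric (R : realType) (a K : R) : (forall k, a <= K / 2 ^+ k) -> a <= 0.
Proof.
move=> H; case: (leP a 0) => // a0.
have K0 : 0 <= K by have := H 0%N; rewrite expr0 divr1; apply: le_trans; exact: ltW.
have [k Hk] : exists k : nat, K / a < k%:R.
  by exists (Num.bound (K / a)); apply: archi_boundP; rewrite divr_ge0// ltW.
have := H k; rewrite ler_pdivlMr ?exprn_gt0// => H1.
move: Hk; rewrite ltr_pdivrMr// => /(le_lt_trans H1).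
by rewrite mulrC ltr_pM2r// => /(lt_trans (exp2_gtn R k)); rewrite ltxx.
Qed.

(** The intervals of radius 2C/2^k around [x k] are nested, so the supremum of their left ends lies
    in all of them. *)
Lemma geometric_limit (R : realType) (x : nat -> R) (C : R) :
  (forall k, `|x k.+1 - x k| <= C / 2 ^+ k) -> exists l, forall k, `|x k - l| <= 2 * C / 2 ^+ k.
Proof.
move=> H; pose a k := x k - 2 * C / 2 ^+ k; pose b k := x k + 2 * C / 2 ^+ k.
have halve k : C / 2 ^+ k = C / 2 ^+ k.+1 + C / 2 ^+ k.+1.
  by rewrite exprS invfM mulrCA; set z := C / _; lra.
have aS k : a k <= a k.+1.
  have := H k; rewrite /a ler_norml => /andP[+ _]; rewrite -!mulrA (halve k); lra.
have bS k : b k.+1 <= b k.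
  have := H k; rewrite /b ler_norml => /andP[_]; rewrite -!mulrA (halve k); lra.
have am : {homo a : k l / (k <= l)%N >-> k <= l}.
  by apply: homo_leq => //; exact: le_trans.
have bm : {homo b : k l / (k <= l)%N >-> l <= k}.
  by apply: homo_leq => // u v w /[swap]; exact: le_trans.
have C0 k : 0 <= 2 * C / 2 ^+ k.
  by rewrite -mulrA mulr_ge0//; apply: le_trans (H k).
have ab k l : a k <= b l.
  apply: (le_trans (am _ _ (leq_maxl k l))); apply: le_trans _ (bm _ _ (leq_maxr k l)).
  by rewrite /a /b; have := C0 (maxn k l); lra.
have ub : ubound (range a) (b 0%N) by move=> _ [k _ <-].
exists (sup (range a)) => k; rewrite distrC ler_distl; apply/andP; split.
  by apply: (@ub_le_sup _ (range a)); [exists (b 0%N) | exists k].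
by apply: ge_sup; [exists (a 0%N), 0%N | move=> _ [l _ <-]; exact: ab].
Qed.

Lemma geometric_limit_row (R : realType) m (x : nat -> 'rV[R]_m) (C : R) :
  (forall k, `|x k.+1 - x k| <= C / 2 ^+ k) -> exists l, forall k, `|x k - l| <= 2 * C / 2 ^+ k.
Proof.
move=> H.
have /choice[l Hl] : forall j : 'I_m, exists lj, forall k, `|x k 0 j - lj| <= 2 * C / 2 ^+ k.
  move=> j; apply: geometric_limit => k; apply: le_trans (H k).
  by have := ler_coord_norm (x k.+1 - x k) j; rewrite !mxE.
exists (\row_j l j) => k; apply: norm_row_le => [|j]; last by rewrite !mxE.
by rewrite -mulrA mulr_ge0//; apply: le_trans (H k).
Qed.

(** * Existence for ordinary differential equations *)

Definition clamp (R : realType) (a b t : R) := if t < a then a else if b < t then b else t.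

Section Clamp.
Variables (R : realType) (a b : R) (ab : a <= b).

Lemma clamp_in t : a <= clamp a b t <= b.
Proof.
by rewrite /clamp; case: (ltP t a) => ta; [rewrite lexx ab|case: (ltP b t) => bt; rewrite ?lexx ?ab ?ta ?bt].
Qed.

Lemma clamp_id t : a <= t <= b -> clamp a b t = t.
Proof. by case/andP => ta tb; rewrite /clamp ltNge ta /= ltNge tb. Qed.

Lemma clamp_lip s t : `|clamp a b s - clamp a b t| <= `|s - t|.
Proof.
wlog st : s t / s <= t.
  move=> W; case: (leP s t) => [|/ltW]; first exact: W.
  by move=> ts; rewrite distrC [leRHS]distrC; apply: W.
rewrite distrC [leRHS]distrC [leRHS]ger0_norm ?subr_ge0//.
rewrite /clamp; case: (ltP s a) => sa; case: (ltP t a) => ta; try case: (ltP b s) => bs;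
  try case: (ltP b t) => bt; rewrite ler_norml; apply/andP; split;
  move: ab; lra.
Qed.

Lemma clamp_continuous : continuous (clamp a b).
Proof.
by move=> t; apply: (@lipschitz_cont _ R R _ 1) => s; rewrite mul1r clamp_lip.
Qed.

End Clamp.

(** Integration starts at -2 so that every point of [-1, 1] is interior and the fundamental theorem
    of calculus gives two-sided derivatives there. *)
Lemma antiderivative (R : realType) (g : R -> R) : continuous g ->
  exists2 G : R -> R, G 0 = 0 & forall t : R, -2 < t -> is_derive t (1 : R) G (g t).
Proof.
move=> gc; pose F (x : R) : R := \int[lebesgue_measure]_(t in `[(-2 : R), x]) g t.
have FD (t : R) : -2 < t -> is_derive t (1 : R) F (g t).
  move=> t2; have tu : t < t + 1 by rewrite ltrDl.
  have int : lebesgue_measure.-integrable `[(-2 : R), t + 1] (EFin \o g).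
    apply: continuous_compact_integrable; first exact: segment_compact.
    exact: continuous_subspaceT.
  have [d E] := continuous_FTC1_closed tu int t2 (gc t).
  by rewrite derive1E in E; exact: (DeriveDef d E).
exists (fun t => F t - F 0) => [|t t2]; first by rewrite subrr.
rewrite -[g t]subr0; apply: is_deriveB; exact: FD.
Qed.

Lemma antiderivative_row (R : realType) m (g : R -> 'rV[R]_m) : continuous g ->
  exists2 G : R -> 'rV[R]_m, G 0 = 0 & forall t : R, -2 < t -> is_derive t (1 : R) G (g t).
Proof.
move=> gc.
have /choice[G HG] : forall j : 'I_m, exists G : R -> R, G 0 = 0 /\
    forall t : R, -2 < t -> is_derive t (1 : R) G (g t 0 j).
  move=> j; have [|G G0 GD] := @antiderivative R (fun t => g t 0 j); last by exists G.
  move=> t; apply: (@continuous_comp _ _ _ g (fun x : 'rV[R]_m => x 0 j)); first exact: gc.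
  exact: coord_continuous.
exists (fun t => \row_j G j t) => [|t t2].
  by apply/rowP => j; rewrite !mxE; have [] := HG j.
apply/is_derive_rowP => j; rewrite (_ : (fun s => _) = G j).
  by have [_] := HG j; apply.
by apply/funext => s; rewrite mxE.
Qed.

Lemma mvt_row (R : realType) m (w dw : R -> 'rV[R]_m) (K t : R) :
  (forall s : R, `|s| <= 1 -> is_derive s (1 : R) w (dw s)) ->
  (forall s : R, `|s| <= 1 -> `|dw s| <= K) -> `|t| <= 1 -> `|w t - w 0| <= K * `|t|.
Proof.
move=> wd wK t1; apply: norm_row_le => [|j].
  rewrite mulr_ge0//; have := wK 0; rewrite normr0 => /(_ ler01); exact: le_trans.
have := @mvt_dist R (fun s => w s 0 j) (fun s => dw s 0 j) t 0 K.
rewrite mul0r subr0 !mxE; apply=> s st; have s1 := le_trans st t1.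
  by move: j; apply/is_derive_rowP; exact: wd.
by rewrite subr0; apply: le_trans (ler_coord_norm _ _) _; exact: wK.
Qed.

(* Picard iteration; the constant 1/2 is reached by rescaling time. *)
Lemma ode_lipschitz (R : realType) m (f : 'rV[R]_m -> 'rV[R]_m) (x0 : 'rV[R]_m) :
  (forall x y, `|f x - f y| <= `|x - y| / 2) ->
  exists2 u : R -> 'rV[R]_m, u 0 = x0 &
    forall t : R, `|t| <= 1 -> is_derive t (1 : R) u (f (u t)).
Proof.
move=> flip.
have fc : continuous f.
  by move=> x; apply: (@lipschitz_cont _ _ _ f 2^-1) => y; rewrite mulrC; exact: flip.
pose P (u : R -> 'rV[R]_m) := forall t : R, -2 < t -> {for t, continuous u}.
have /choice[S HS] : forall u : R -> 'rV[R]_m, exists u' : R -> 'rV[R]_m, P u ->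
    [/\ u' 0 = x0, P u' & forall t : R, `|t| <= 1 -> is_derive t (1 : R) u' (f (u t))].
  move=> u; have [Pu|nPu] := pselect (P u); last by exists u.
  (* Stopping time at -3/2 makes [f (u (c t))] continuous on the whole line without changing it on
     [-1, 1]. *)
  pose c (t : R) : R := if t < -(3 / 2) then -(3 / 2) else t.
  have c2 (s : R) : -2 < c s by rewrite /c; case: (ltP s (-(3/2))) => h; lra.
  have cc : continuous c.
    move=> t; apply: (@lipschitz_cont _ R R c 1) => s; rewrite mul1r.
      rewrite /c; case: (ltP t (-(3/2))) => h1; case: (ltP s (-(3/2))) => h2 //; first by rewrite subrr normr0.
        have ts : t <= s by lra.
        by rewrite !ler0_norm ?subr_le0//; lra.
      have ts : s <= t by lra.
      by rewrite !ger0_norm ?subr_ge0//; lra.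
  have gc : continuous (fun t => f (u (c t))).
    move=> t; apply: (@continuous_comp _ _ _ (u \o c) f t); last exact: fc.
    apply: continuous_comp; first exact: cc.
    by apply: Pu; exact: c2.
  have [G G0 GD] := antiderivative_row gc.
  exists (fun t => x0 + G t) => _.
  have D (t : R) : -2 < t -> is_derive t (1 : R) (fun t => x0 + G t) (f (u (c t))).
    move=> t2; rewrite -[f _]add0r; apply: is_deriveD; exact: GD.
  split; first by rewrite G0 addr0.
    by move=> t /D; exact: is_derive1_cont.
  move=> t t1; have : -2 < t by move: t1; rewrite ler_norml => /andP[]; lra.
  move=> /D; rewrite /c ltNge; suff -> : -(3/2) <= t by [].
  by move: t1; rewrite ler_norml => /andP[]; lra.
pose U k := iter k S (fun=> x0).
have UP k : P (U k).
  by elim: k => [|k IH]; [move=> t _; exact: cst_continuous | have [] := HS _ IH].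
have U0 k : U k 0 = x0 by case: k => // k; have [] := HS _ (UP k).
have UD k t : `|t| <= 1 -> is_derive t (1 : R) (U k.+1) (f (U k t)).
  by have [_ _] := HS _ (UP k); apply.
have step k t : `|t| <= 1 -> `|U k.+1 t - U k t| <= `|f x0| / 2 ^+ k.
  elim: k t => [|k IH] t t1.
    have := @mvt_row R m (U 1%N) (fun=> f x0) `|f x0| t; rewrite U0 => H.
    rewrite expr0 divr1; apply: le_trans (H _ _ t1) _ => //; last by rewrite ler_piMr.
  have := @mvt_row R m (fun t => U k.+2 t - U k.+1 t) (fun t => f (U k.+1 t) - f (U k t)) (`|f x0| / 2 ^+ k.+1) t.
  rewrite !U0 subrr subr0 => H; apply: le_trans (H _ _ t1) _.
  - by move=> s s1; apply: is_deriveB; exact: UD.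
  - move=> s s1; apply: le_trans (flip _ _) _.
    by rewrite exprSr invfM mulrA ler_pM2r ?invr_gt0// IH.
  - by rewrite ler_piMr// divr_ge0.
set C := `|f x0| in step.
have C0 : 0 <= C by exact: normr_ge0.
have /choice[l Hl] : forall t, exists l, `|t| <= 1 -> forall k, `|U k t - l| <= 2 * C / 2 ^+ k.
  move=> t; have [t1|nt1] := pselect (`|t| <= 1); last by exists 0.
  have [|l Hl] := @geometric_limit_row R m (U ^~ t) C; last by exists l.
  by move=> k; exact: step.
pose c := clamp (-1 : R) 1.
have N11 : (-1 : R) <= 1 by lra.
have c1 t : `|c t| <= 1 by rewrite ler_norml clamp_in.
have lc : continuous (fun t => l (c t)).
  move=> t; apply/cont_epsP => e e0.
  have [k Hk] : exists k, 2 * C / 2 ^+ k <= e / 3.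
    apply: contrapT => /forallNP H.
    have : e / 3 <= 0.
      apply: (@le0_geometric R _ (2 * C)) => k.
      by case: (leP (2 * C / 2 ^+ k) (e/3)) => [/H//|/ltW].
    lra.
  have : {for t, continuous (fun s => U k (c s))}.
    apply: (@continuous_comp _ _ _ c (U k) t); first exact: clamp_continuous.
    by apply: UP; have := c1 t; rewrite ler_norml => /andP[]; lra.
  move=> /cont_epsP/(_ (e / 3)); rewrite divr_gt0// => /(_ isT)[d d0 Hd].
  exists d => // s /Hd Hs.
  have -> : l (c t) - l (c s) = - (U k (c t) - l (c t)) + (U k (c t) - U k (c s)) + (U k (c s) - l (c s)).
    by apply/rowP => j; rewrite !mxE; ring.
  apply: le_trans (ler_normD _ _) _.
  have -> : e = (e / 3 + e / 3) + e / 3 by lra.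
  apply: lerD; last exact: le_trans (Hl _ (c1 s) k) Hk.
  apply: le_trans (ler_normD _ _) _; apply: lerD => //.
  rewrite normrN; exact: le_trans (Hl _ (c1 t) k) Hk.
have gc : continuous (fun t => f (l (c t))).
  by move=> t; apply: (@continuous_comp _ _ _ (fun t => l (c t)) f t); [exact: lc | exact: fc].
have [G G0 GD] := antiderivative_row gc.
pose V t := x0 + G t.
have cid t : `|t| <= 1 -> c t = t by rewrite ler_norml => ?; apply: clamp_id.
have VD t : `|t| <= 1 -> is_derive t (1 : R) V (f (l t)).
  move=> t1; rewrite -[f _]add0r -{2}(cid t t1); apply: is_deriveD; apply: GD.
  by move: t1; rewrite ler_norml => /andP[]; lra.
(* [V] is the integral of [f] along [l]; it is as close to [U k.+1] as [l] is to [U k], up to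
   constants, which forces [V = l]. *)
have VE t : `|t| <= 1 -> V t = l t.
  move=> t1; apply/eqP; rewrite -subr_eq0 -normr_le0; apply/eqP/eqP.
  apply: (@le0_geometric R _ (3 * C)) => k.
  have : `|V t - U k.+1 t| <= C / 2 ^+ k.
    have := @mvt_row R m (fun t => V t - U k.+1 t) (fun t => f (l t) - f (U k t)) (C / 2 ^+ k) t.
    rewrite /V U0 G0 addr0 subrr subr0 => H; apply: le_trans (H _ _ t1) _.
    - by move=> s s1; apply: is_deriveB; [exact: VD | exact: UD].
    - move=> s s1; apply: le_trans (flip _ _) _; rewrite distrC.
      by have := Hl s s1 k; rewrite -mulrA; lra.
    - by rewrite ler_piMr// divr_ge0.
  have : `|U k.+1 t - l t| <= 2 * C / 2 ^+ k.
    apply: le_trans (Hl t t1 k.+1) _; rewrite -!mulrA ler_wpM2l// ler_wpM2l//.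
    rewrite lef_pV2 ?posrE ?exprn_gt0// exprS ler_peMl// ?exprn_ge0//; lra.
  move=> h1 h2; rewrite -(subrKA (U k.+1 t)); apply: le_trans (ler_normD _ _) _.
  by move: h1 h2; rewrite -!mulrA; lra.
exists V; first by rewrite /V G0 addr0.
by move=> t t1; rewrite VE//; exact: VD.
Qed.

(* The closed ball around x0 is a cube, onto which coordinatewise clamping is a 1-Lipschitz retraction. *)
Lemma ode_local (R : realType) m (f : 'rV[R]_m -> 'rV[R]_m) (x0 : 'rV[R]_m) (rho : R) : 0 <= rho ->
  (forall x y, `|x - x0| <= rho -> `|y - x0| <= rho -> `|f x - f y| <= `|x - y| / 2) ->
  (forall x, `|x - x0| <= rho -> `|f x| <= rho) ->
  exists2 u : R -> 'rV[R]_m, u 0 = x0 &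
    forall t : R, `|t| <= 1 -> `|u t - x0| <= rho /\ is_derive t (1 : R) u (f (u t)).
Proof.
move=> r0 flip fb; pose p (x : 'rV[R]_m) := \row_j (clamp (x0 0 j - rho) (x0 0 j + rho) (x 0 j)).
have ab j : x0 0 j - rho <= x0 0 j + rho by lra.
have pin x : `|p x - x0| <= rho.
  apply: norm_row_le => // j; rewrite !mxE ler_norml.
  by have /andP[] := clamp_in (ab j) (x 0 j); lra.
have plip x y : `|p x - p y| <= `|x - y|.
  apply: norm_row_le => // j; rewrite !mxE; apply: le_trans (clamp_lip (ab j) _ _) _.
  by have := ler_coord_norm (x - y) j; rewrite !mxE.
have pid x : `|x - x0| <= rho -> p x = x.
  move=> xr; apply/rowP => j; rewrite !mxE; apply: clamp_id.
  by have := le_trans (ler_coord_norm (x - x0) j) xr; rewrite !mxE ler_norml => /andP[]; lra.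
have [|u u0 uD] := @ode_lipschitz R m (f \o p) x0.
  move=> x y; apply: le_trans (flip _ _ (pin x) (pin y)) _.
  by rewrite ler_pM2r ?invr_gt0.
exists u => // t t1.
have ub : `|u t - x0| <= rho.
  have := @mvt_row R m u (fun t => f (p (u t))) rho t.
  rewrite u0 => H; apply: le_trans (H _ _ t1) _ => //; first by move=> s _; exact: fb.
  by rewrite ler_piMr.
by split => //; have := uD t t1; rewrite /= pid.
Qed.

(** * Inverse function theorem *)

Section Jacobian.
Variables (R : realType) (n m : nat).
Implicit Types F : 'rV[R]_n -> 'rV[R]_m.

Definition Jac (F : 'rV[R]_n -> 'rV[R]_m) (x : 'rV[R]_n) : 'M[R]_(n, m) :=
  \matrix_(i, j) partial i (fun y => F y 0 j) x.

Lemma dotp_Jac F x (v : 'rV[R]_n) j :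
  dotp (fun i => partial i (fun y => F y 0 j) x) v = (v *m Jac F x) 0 j.
Proof. by rewrite /dotp mxE; apply: eq_bigr => i _; rewrite mxE. Qed.

Lemma mulmx_bound (A : 'M[R]_(n, m)) : exists2 K : R, 0 <= K & forall v : 'rV[R]_n, `|v *m A| <= K * `|v|.
Proof.
exists (\sum_j \sum_i `|A i j|); first by rewrite sumr_ge0// => j _; rewrite sumr_ge0.
move=> v; apply: norm_row_le => [|j].
  by rewrite mulr_ge0// sumr_ge0// => j _; rewrite sumr_ge0.
rewrite mxE; apply: (@dotp_le R n (A ^~ j)).
by rewrite [leRHS](bigD1 j)//= lerDl sumr_ge0// => i _; rewrite sumr_ge0.
Qed.

Lemma CkV_strict U F x0 (e : R) : open U -> CkV 1 U F -> U x0 -> 0 < e ->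
  exists2 r : R, 0 < r & ball x0 r `<=` U /\ forall x y, ball x0 r x -> ball x0 r y ->
    `|F y - F x - (y - x) *m Jac F x0| <= e * `|y - x|.
Proof.
move=> oU CF Ux e0.
have /choice[r Hr] : forall j : 'I_m, exists r : R, 0 < r /\ forall x y, ball x0 r x -> ball x0 r y ->
    `|F y 0 j - F x 0 j - ((y - x) *m Jac F x0) 0 j| <= e * `|y - x|.
  move=> j; have [r r0 [_ H]] := Ck1_strict oU (CF j) Ux e0.
  by exists r; split => // x y bx b_y; rewrite -dotp_Jac; exact: H.
have /nbhs_ballP[r0 /= r00 r0U] := open_nbhs_nbhs (conj oU Ux).
have [|s [s0 sr0 sr]] := min_radius r00 (r := r); first by move=> j; have [] := Hr j.
exists s => //; split; first by apply: subset_trans r0U; apply: le_ball.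
move=> x y bx b_y; apply: norm_row_le => [|j]; first by rewrite mulr_ge0// ltW.
rewrite [X in `|X|]mxE [X in `|X + _|]mxE [X in `|_ + X + _|]mxE [X in `|_ + X|]mxE.
by have [_] := Hr j; apply; apply: le_ball (sr j) _ _.
Qed.

End Jacobian.

Section InverseFunction.
Variables (R : realType) (n : nat).

(** Newton's iteration with the derivative frozen at [x0] solves [F x = y], and the same contraction
    estimate yields injectivity. The derivative of the inverse is the inverse Jacobian at the
    inverse point, so its smoothness climbs one order at a time. *)
Theorem inverse_function (U : set 'rV[R]_n) (F : 'rV[R]_n -> 'rV[R]_n) (x0 : 'rV[R]_n) :
  open U -> (forall k, CkV k U F) -> U x0 -> Jac F x0 \in unitmx ->
  exists (V W : set 'rV[R]_n) (g : 'rV[R]_n -> 'rV[R]_n),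
   [/\ [/\ open V, open W, V x0 & V `<=` U],
       forall x, V x -> W (F x) /\ g (F x) = x,
       forall y, W y -> V (g y) /\ F (g y) = y
     & forall k, CkV k W g].
Proof.
move=> oU CF Ux0 Ju.
pose U' := U `&` (fun x => \det (Jac F x)) @^-1` [set z | z != 0].
have cJ k : CkM U k (Jac F).
  move=> i j; rewrite (_ : (fun _ => _) = partial i (fun y => F y 0 j)).
    exact: Ck_partial (CF k.+1 j).
  by apply/funext => x; rewrite mxE.
have oU' : open U'.
  apply: open_preimage_within => //.
  by move=> x Ux; apply: (Ck_cont (Ck_det oU (cJ 0%N))).
have U'u x : U' x -> Jac F x \in unitmx by case => _ /= h; rewrite unitmxE unitfE.
have U'U : U' `<=` U by move=> x [].
have CF' k : CkV k U' F by move=> j; apply: Ck_subset (CF k j).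
have U'x0 : U' x0 by split => //=; rewrite -unitfE -unitmxE.
set A := invmx (Jac F x0).
have [K K0 HK] := mulmx_bound A.
(* [K] bounds multiplication by [A], so an error of this size in [F] makes the identity minus [F]
   times [A] a 1/2-Lipschitz map. *)
have e0 : 0 < (2 * (K + 1))^-1 by rewrite invr_gt0 mulr_gt0// ltr_wpDl.
have [r r0 [rU' strict]] := CkV_strict oU' (CF' 1%N) U'x0 e0.
have half x y : ball x0 r x -> ball x0 r y -> `|(y - x) - (F y - F x) *m A| <= `|y - x| / 2.
  move=> bx b_y; have := strict x y bx b_y; set J := Jac F x0 => h.
  have -> : (y - x) - (F y - F x) *m A = - ((F y - F x - (y - x) *m J) *m A).
    by rewrite (mulmxBl (F y - F x)) mulmxK// opprB.
  rewrite normrN; apply: le_trans (HK _) _; apply: le_trans (ler_wpM2l K0 h) _.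
  rewrite mulrA mulrC ler_wpM2l// invfM mulrCA ger_pMr ?invr_gt0//.
  by rewrite ler_pdivrMr ?ltr_wpDl// mul1r lerDl.
have inj x y : ball x0 r x -> ball x0 r y -> `|y - x| <= 2 * `|(F y - F x) *m A|.
  move=> bx b_y; have h := half x y bx b_y.
  have : `|y - x| <= `|(y - x) - (F y - F x) *m A| + `|(F y - F x) *m A|.
    by rewrite -{1}(subrK ((F y - F x) *m A) (y - x)) ler_normD.
  lra.
pose rho := r / 2; have rho0 : 0 < rho by rewrite divr_gt0.
have rhor x : `|x - x0| <= rho -> ball x0 r x.
  rewrite -ball_normE /= distrC => /le_lt_trans; apply.
  by rewrite /rho ltr_pdivrMr// ltr_pMr// ltr1n.
(* The first Newton step has length [|(y - F x0) *m A|] and the steps halve, so the total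
   displacement stays below [rho]. *)
pose W := [set y : 'rV[R]_n | `|(y - F x0) *m A| < rho / 2].
pose V := [set x | `|x - x0| < rho /\ W (F x)].
have surj y : W y -> exists x, `|x - x0| < rho /\ F x = y.
  rewrite /W /=; set c := `|(y - F x0) *m A| => cr.
  pose T x := x - (F x - y) *m A.
  pose X k := iter k T x0.
  have XS k : X k.+1 = X k - (F (X k) - y) *m A by [].
  have c0 : 0 <= c by exact: normr_ge0.
  have ck j : 0 <= 2 * c / 2 ^+ j by rewrite divr_ge0// mulr_ge0.
  have HX k : `|X k - x0| <= 2 * c - 2 * c / 2 ^+ k /\ `|X k.+1 - X k| <= c / 2 ^+ k.
    elim: k => [|k [h1 h2]].
      rewrite expr0 !divr1 subrr normr0 subrr lexx; split => //.
      by rewrite /= /T addrAC subrr sub0r -mulNmx opprB.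
    have h3 : `|X k.+1 - x0| <= 2 * c - 2 * c / 2 ^+ k.+1.
      have : `|X k.+1 - x0| <= `|X k.+1 - X k| + `|X k - x0|.
        by rewrite -(subrKA (X k) (X k.+1)) ler_normD.
      have -> : 2 * c / 2 ^+ k.+1 = c / 2 ^+ k.
        by rewrite exprS invfM mulrACA mulfV// mul1r.
      rewrite -mulrA in h1; lra.
    split => //.
    have b1 : ball x0 r (X k) by apply: rhor; have := ck k; lra.
    have b2 : ball x0 r (X k.+1) by apply: rhor; have := ck k.+1; lra.
    have -> : X k.+2 - X k.+1 = (X k.+1 - X k) - (F (X k.+1) - F (X k)) *m A.
      have -> : X k.+1 - X k = - ((F (X k) - y) *m A) by rewrite XS addrAC subrr sub0r.
      by rewrite (XS k.+1) addrAC subrr sub0r -opprD -mulmxDl (addrC (F (X k) - y)) subrKA.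
    apply: le_trans (half _ _ b1 b2) _.
    by rewrite exprSr invfM mulrA ler_pM2r ?invr_gt0.
  have [|l Hl] := @geometric_limit_row R n X c; first by move=> k; have [] := HX k.
  have lx : `|l - x0| < rho.
    have := Hl 0%N; rewrite expr0 divr1 /= distrC; lra.
  have bl := rhor l (ltW lx).
  exists l; split => //.
  suff : (F l - y) *m A = 0.
    by move=> /(congr1 (mulmx^~ (Jac F x0))); rewrite mulmxKV// mul0mx => /eqP; rewrite subr_eq0 => /eqP.
  apply/eqP; rewrite -normr_eq0 eq_le normr_ge0 andbT; apply: (@le0_geometric R _ (3 * c)) => k.
  have [h1 h2] := HX k.
  have b1 : ball x0 r (X k).
    by apply: rhor; have := ck k; lra.
  have -> : (F l - y) *m A = ((X k - l) - (F (X k) - F l) *m A) - (X k.+1 - l).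
    by rewrite XS; apply/rowP => j; rewrite !mulmxBl !mxE; ring.
  apply: le_trans (ler_normB _ _) _.
  have := half _ _ bl b1; have := Hl k; have := Hl k.+1.
  have -> : 2 * c / 2 ^+ k.+1 = c / 2 ^+ k by rewrite exprS invfM mulrACA mulfV// mul1r.
  by have := ck k; rewrite -!mulrA; lra.
have oW : open W.
  have -> : W = setT `&` (fun y => (y - F x0) *m A) @^-1` ball 0 (rho / 2).
    by apply/seteqP; split => y; rewrite /W /= -ball_normE /= sub0r normrN // => -[].
  apply: open_preimage_within; [exact: openT|exact: ball_open|] => y _.
  apply: (@lipschitz_cont _ 'rV[R]_n 'rV[R]_n _ K) => z.
  by rewrite -mulmxBl; apply: le_trans (HK _) _; rewrite opprB addrA subrK.
have oV : open V.
  have -> : V = (U' `&` F @^-1` W) `&` ball x0 rho.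
    apply/seteqP; split => x; rewrite /V /= -ball_normE /= distrC.
      move=> [h1 h2]; split => //; split => //; apply: rU'; apply: rhor.
      by rewrite distrC ltW.
    by move=> [[_ h1] h2].
  apply: openI; last exact: ball_open.
  by apply: open_preimage_within; [by []|by []|move=> x U'x; exact: CkV_cont (CF' 0%N) U'x].
pose g y := xget x0 [set x | `|x - x0| < rho /\ F x = y].
have gP y : W y -> `|g y - x0| < rho /\ F (g y) = y.
  by move=> /surj[x Hx]; rewrite /g; case: xgetP => [z _ //|/(_ x)].
have gV y : W y -> V (g y) /\ F (g y) = y.
  by move=> Wy; have [h1 h2] := gP y Wy; split => //; split => //; rewrite h2.
have VU' : V `<=` U' by move=> x [/ltW/rhor/rU'].
have glip y z : W y -> W z -> `|g y - g z| <= 2 * K * `|y - z|.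
  move=> /gP[h1 h2] /gP[h3 h4]; apply: le_trans (inj _ _ (rhor _ (ltW h3)) (rhor _ (ltW h1))) _.
  by rewrite h2 h4 -mulrA ler_pM2l// HK.
have gD y : W y -> is_diff y g (mulmxr (invmx (Jac F (g y)))).
  move=> Wy; have [Vg Fg] := gV y Wy; set x := g y in Vg Fg *.
  set B := invmx _; have [KB KB0 HB] := mulmx_bound B.
  apply: is_diff_littleo.
    by move=> v; apply: (@lipschitz_cont _ _ _ _ KB) => w; rewrite /= -mulmxBl HB.
  move=> e e0'; have D0 : 0 < (KB + 1) * (2 * K + 1).
    by rewrite mulr_gt0// ltr_wpDl// mulr_ge0.
  have [s s0 [sU' st]] := CkV_strict oU' (CF' 1%N) (VU' _ Vg) (divr_gt0 e0' D0).
  have K1 : 0 < 2 * K + 1 by rewrite ltr_wpDl// mulr_ge0.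
  have : \forall h \near (0 : 'rV[R]_n), W (h + y) /\ `|h| < s / (2 * K + 1).
    have N1 : \forall h \near (0 : 'rV[R]_n), `|h| < s / (2 * K + 1).
      by apply: nbhs0_lt; rewrite divr_gt0.
    have N2 : \forall h \near (0 : 'rV[R]_n), W (h + y).
      have /nbhs_ballP[d /= d0 dW] : nbhs y W by exact: open_nbhs_nbhs.
      apply/nbhs_ballP; exists d => // z.
      rewrite -ball_normE /= sub0r normrN => hz; apply: dW; rewrite -ball_normE /=.
      by rewrite opprD addrCA subrr addr0 normrN.
    exact: filterI N2 N1.
  apply: filterS => k [Wk ks].
  have gl := glip _ _ Wk Wy; rewrite addrK in gl.
  have ks' : `|g (k + y) - x| < s.
    apply: le_lt_trans gl _; apply: (@le_lt_trans _ _ ((2 * K + 1) * `|k|)).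
      by rewrite ler_wpM2r// lerDl.
    by rewrite mulrC -ltr_pdivlMr.
  have [Vk Fk] := gV _ Wk.
  have := st x (g (k + y)); rewrite Fk Fg addrK => /(_ (ballxx _ s0)).
  rewrite -ball_normE /= distrC => /(_ ks') H.
  have -> : g (k + y) - x - k *m B = - ((k - (g (k + y) - x) *m Jac F x) *m B).
    by rewrite mulmxBl mulmxK ?opprB//; exact: U'u (VU' _ Vg).
  rewrite normrN; apply: le_trans (HB _) _.
  apply: (@le_trans _ _ ((KB + 1) * (e / ((KB + 1) * (2 * K + 1)) * ((2 * K + 1) * `|k|)))).
    rewrite ler_pM// ?lerDl//; apply: le_trans H _; rewrite ler_wpM2l//.
      by rewrite divr_ge0 ?ltW.
    by apply: le_trans gl _; rewrite ler_wpM2r// lerDl.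
  rewrite le_eqVlt; apply/orP; left; apply/eqP; field.
  by rewrite !gt_eqF// ltr_wpDl.
exists V, W, g; split => //.
- split => //; last by move=> x /VU'[].
  split; first by rewrite subrr normr0.
  by rewrite /W /= subrr mul0mx normr0 divr_gt0.
- move=> x [xr WFx]; split => //; have [h1 h2] := gP _ WFx.
  have := inj _ _ (rhor _ (ltW xr)) (rhor _ (ltW h1)).
  rewrite h2 subrr mul0mx normr0 mulr0 normr_le0 => /eqP; exact: subr0_eq.
elim=> [|k IH] j.
  split => // y Wy; apply: (@continuous_comp _ _ _ g (fun x : 'rV[R]_n => x 0 j)).
    by have [d _] := gD y Wy; exact: differentiable_continuous.
  exact: coord_continuous.
have part y i : W y -> is_derive y (delta_mx 0 i) (fun z => g z 0 j) (invmx (Jac F (g y)) i j).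
  move=> Wy; have [d E] := gD y Wy.
  have d1 : derivable g y (delta_mx 0 i) by exact: diff_derivable.
  have d2 : derivable (fun z => g z 0 j) y (delta_mx 0 i).
    by have /derivable_mxP := d1; apply.
  split => //; have := derive_mx d1; rewrite deriveE// E /= -rowE => /rowP/(_ j).
  by rewrite !mxE.
split.
  by move=> y Wy; exact: Ck_cont (IH j) Wy.
move=> i; split; first by move=> y Wy; have [] := part y i Wy.
apply: (@Ck_eq _ _ k W (fun y => (invmx (Jac F (g y))) i j)) => //.
  by move=> y Wy; have [_ <-] := part y i Wy.
apply: (@Ck_comp R n n k W U' g (fun x => invmx (Jac F x) i j)) => //.
  by move=> y /gV[/VU'].
by apply: CkM_inv => // a b; apply: Ck_subset (cJ k a b).
Qed.

End InverseFunction.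

(** * Symmetry of second derivatives *)

Section Schwarz.
Variables (R : realType) (n : nat).

Lemma norm_line_le (s : R) (i : 'I_n) : `|s *: delta_mx 0 i : 'rV[R]_n| <= `|s|.
Proof. by rewrite normrZ -[leRHS]mulr1 ler_wpM2l// norm_delta_le. Qed.

(** The mean value theorem is applied first in direction [i] to the increment in direction [j], then
    in direction [j] to the partial derivative. The second difference is symmetric in [i] and [j],
    so using both orders proves [schwarz]. *)
Lemma second_difference (U : set 'rV[R]_n) (f : 'rV[R]_n -> R) x i j (e : R) :
  open U -> Ck 2 U f -> U x -> 0 < e -> exists2 d : R, 0 < d & forall h : R, `|h| < d ->
  `|(f (x + h *: delta_mx 0 i + h *: delta_mx 0 j) - f (x + h *: delta_mx 0 i))
    - (f (x + h *: delta_mx 0 j) - f x) - partial j (partial i f) x * h * h| <= e * `|h| * `|h|.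
Proof.
move=> oU Cf Ux e0.
have C1 : Ck 1 U f := CkW Cf.
have Ci : Ck 1 U (partial i f) := Ck_partial i Cf.
have Cij : Ck 0 U (partial j (partial i f)) := Ck_partial j Ci.
have /cont_epsP/(_ e e0)[d1 d10 Hd1] := Ck_cont Cij Ux.
have /nbhs_ballP[d2 /= d20 d2U] := open_nbhs_nbhs (conj oU Ux).
have [d [d0 dd1 dd2]] : exists d, [/\ 0 < d, 2 * d <= d1 & 2 * d <= d2].
  exists (Num.min d1 d2 / 2); rewrite divr_gt0 ?lt_min ?d10 ?d20//; split => //;
    by rewrite mulrCA mulfV// mulr1 ge_min lexx ?orbT.
exists d => // h hd.
have near_x s t : `|s| <= `|h| -> `|t| <= `|h| ->
    `|x - (x + s *: delta_mx 0 i + t *: delta_mx 0 j)| < 2 * d.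
  move=> sh th; rewrite -addrA opprD addNKr normrN (le_lt_trans (ler_normD _ _))//.
  have := norm_line_le s i; have := norm_line_le t j; lra.
have inU s t : `|s| <= `|h| -> `|t| <= `|h| -> U (x + s *: delta_mx 0 i + t *: delta_mx 0 j).
  move=> sh th; apply: d2U; rewrite -ball_normE /=; exact: lt_le_trans (near_x s t sh th) dd2.
pose phi s := f (x + h *: delta_mx 0 j + s *: delta_mx 0 i) - f (x + s *: delta_mx 0 i).
have swp (s t : R) : x + t *: delta_mx 0 j + s *: delta_mx 0 i = x + s *: delta_mx 0 i + t *: delta_mx 0 j.
  by rewrite addrAC.
have := @mvt_dist R phi (fun s => partial i f (x + h *: delta_mx 0 j + s *: delta_mx 0 i) - partial i f (x + s *: delta_mx 0 i))
  h (partial j (partial i f) x * h) (e * `|h|).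
rewrite /phi scale0r !addr0 swp => H; apply: H => s sh.
  apply: is_deriveB; apply: is_derive_line.
    by rewrite swp; exact: (Ck_derivable C1 (inU _ _ sh (lexx _))).
  have := inU s 0 sh; rewrite scale0r addr0 normr0 => /(_ (normr_ge0 _)).
  exact: (Ck_derivable C1).
have := @mvt_dist R (fun t => partial i f (x + s *: delta_mx 0 i + t *: delta_mx 0 j))
  (fun t => partial j (partial i f) (x + s *: delta_mx 0 i + t *: delta_mx 0 j)) h (partial j (partial i f) x) e.
rewrite scale0r addr0 swp; apply=> t th.
  by apply: is_derive_line; apply: (Ck_derivable Ci); apply: inU.
rewrite distrC; apply: Hd1; exact: lt_le_trans (near_x s t sh th) dd1.
Qed.

Lemma schwarz (U : set 'rV[R]_n) (f : 'rV[R]_n -> R) x i j :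
  open U -> Ck 2 U f -> U x -> partial i (partial j f) x = partial j (partial i f) x.
Proof.
move=> oU Cf Ux; apply/eqP; rewrite -subr_eq0 -normr_le0; apply/ler_addgt0Pl => e e0; rewrite addr0.
have e2 : 0 < e / 2 by rewrite divr_gt0.
have [d1 d10 H1] := second_difference i j oU Cf Ux e2.
have [d2 d20 H2] := second_difference j i oU Cf Ux e2.
pose h := Num.min d1 d2 / 2.
have h0 : 0 < h by rewrite divr_gt0// lt_min d10.
have hm : h < Num.min d1 d2 by rewrite ltr_pdivrMr// ltr_pMr ?ltr1n// lt_min d10.
have /H1 : `|h| < d1 by rewrite gtr0_norm// (lt_le_trans hm)// ge_min lexx.
have /H2 : `|h| < d2 by rewrite gtr0_norm// (lt_le_trans hm)// ge_min lexx orbT.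
rewrite (addrAC x (h *: delta_mx 0 j)) (gtr0_norm h0).
set a := f _; set b := f (x + h *: delta_mx 0 i); set c := f (x + h *: delta_mx 0 j); set z := f x.
set p := partial i (partial j f) x; set q := partial j (partial i f) x => A2 A1.
have : `|p - q| * (h * h) <= e * (h * h).
  have -> : `|p - q| * (h * h) = `|((a - b) - (c - z) - q * h * h) - ((a - c) - (b - z) - p * h * h)|.
    by rewrite -{1}(gtr0_norm (mulr_gt0 h0 h0)) -normrM; congr (`|_|); ring.
  apply: le_trans (ler_normB _ _) _.
  have -> : e * (h * h) = e / 2 * h * h + e / 2 * h * h by field.
  exact: lerD A1 A2.
by rewrite ler_pM2r// mulr_gt0.
Qed.

End Schwarz.

(** * Hadamard's lemma *)

Section Hadamard.
Variables (R : realType) (n : nat).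

Lemma Ck1_lipschitz_ball (f : 'rV[R]_n -> R) (r s : R) : 0 < r -> s < r ->
  Ck 1 (ball (0 : 'rV[R]_n) r) f ->
  exists2 L : R, 0 <= L & forall x y, `|x| <= s -> `|y| <= s -> `|f y - f x| <= L * `|y - x|.
Proof.
move=> r0 sr Cf.
have [s0|s0] := ltP s 0.
  exists 0 => // x y /le_lt_trans/(_ s0); rewrite ltNge normr_ge0 //.
pose K := [set x : 'rV[R]_n | `|x| <= s].
have Kb x : K x -> ball (0 : 'rV[R]_n) r x.
  by rewrite -ball_normE /K /= sub0r normrN => /le_lt_trans; apply.
have cK : compact K.
  apply: bounded_closed_compact.
    exists s; split; first exact: num_real.
    by move=> M sM x Kx; apply: le_trans Kx (ltW sM).
  have -> : K = (fun x : 'rV[R]_n => `|x|) @^-1` [set z | z <= s] by [].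
  by apply: closed_comp; [move=> x _; exact: norm_continuous | exact: closed_le].
have K0 : K !=set0 by exists 0; rewrite /K /= normr0.
have cg : {within K, continuous (fun x => \sum_i `|partial i f x|)}.
  apply: continuous_in_subspaceT => x /set_mem Kx.
  apply: (@cvg_bigsum _ (nbhs x) _ R R) => i.
  apply: (@continuous_comp _ _ _ (partial i f) Num.Def.normr); last exact: norm_continuous.
  by apply: (Ck_cont (Ck_partial i Cf)); exact: Kb.
have [c cK' cmax] := EVT_max_rV K0 cK cg.
exists (\sum_i `|partial i f c|); first by rewrite sumr_ge0.
move=> x y xs ys.
have := @segment_mvt R n (ball (0 : 'rV[R]_n) r) f (fun=> 0) x y (\sum_i `|partial i f c|).
have -> : dotp (fun=> 0) (y - x) = 0 by rewrite /dotp big1// => i _; rewrite mulr0.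
rewrite subr0.
apply => //; first exact: ball_open.
move=> t /andP[t0 t1].
have Kt : K (x + t *: (y - x)).
  rewrite /K /= (_ : x + _ = (1 - t) *: x + t *: y); last first.
    by apply/rowP => i; rewrite !mxE; ring.
  apply: le_trans (ler_normD _ _) _; rewrite !normrZ (ger0_norm t0) ger0_norm ?subr_ge0//.
  have -> : s = (1 - t) * s + t * s by ring.
  by rewrite lerD// ler_wpM2l// subr_ge0.
split; first exact: Kb.
under eq_bigr do rewrite subr0.
by apply: cmax; rewrite inE.
Qed.

(* The primitive along rays: radial j f x is the integral over [0, 1] of t^j f (t x). *)
Definition radial_primitive (j : nat) (f : 'rV[R]_n -> R) (x : 'rV[R]_n) (P : R -> R) :=
  P 0 = 0 /\ forall t : R, 0 <= t <= 1 -> is_derive t (1 : R) P (t ^+ j * f (t *: x)).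

Definition radial (j : nat) (f : 'rV[R]_n -> R) (x : 'rV[R]_n) : R :=
  xget (fun=> 0) (radial_primitive j f x) 1.

Section RadialBall.
Variables (r : R) (r0 : 0 < r).
Let B := ball (0 : 'rV[R]_n) r.

Let Bt x (t : R) : B x -> 0 <= t <= 1 -> B (t *: x).
Proof.
rewrite /B -!ball_normE /= !sub0r !normrN normrZ => xr /andP[t0 t1].
by apply: le_lt_trans xr; rewrite ger0_norm// ler_piMl.
Qed.

Lemma radialP j f x : Ck 0 B f -> B x ->
  exists2 P, radial_primitive j f x P & radial j f x = P 1.
Proof.
move=> Cf Bx.
have ex : exists P, radial_primitive j f x P.
  pose c := clamp (0 : R) 1.
  have gc : continuous (fun t => c t ^+ j * f (c t *: x)).
    move=> t; have cc : {for t, continuous c} by apply: clamp_continuous; exact: ler01.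
    apply: cvgM; first by apply: (@continuous_comp _ _ _ c (fun t => t ^+ j)) => //; exact: exprn_continuous.
    apply: (@continuous_comp _ _ _ (fun t => c t *: x) f t).
      by apply: cvgZr_tmp.
    apply: (Ck_cont Cf); apply: Bt => //; exact: clamp_in.
  have [G G0 GD] := antiderivative gc.
  exists G; split => // t t01; have := GD t; rewrite /c clamp_id//; apply.
  by case/andP: t01; lra.
case: ex => P0 HP0; exists (xget (fun=> 0) (radial_primitive j f x)) => //.
by apply: xgetPex; exists P0.
Qed.

Lemma mvt01_le (w dw : R -> R) (K : R) : w 0 = 0 ->
  (forall t : R, 0 <= t <= 1 -> is_derive t (1 : R) w (dw t)) ->
  (forall t : R, 0 <= t <= 1 -> `|dw t| <= K) -> `|w 1| <= K.
Proof.
move=> w0 wd wK; have := @mvt01 R w dw 0 K wd; rewrite w0 !subr0; apply.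
by move=> t /wK; rewrite subr0.
Qed.

(** Differentiating t^j f(tx) in x_i gives t^(j+1) times the partial at tx: the weights exist so
    that the family is closed under differentiation. The interchange with the integral is a mean
    value estimate in [t], with a remainder quadratic in [h] because the partials of [f] are
    Lipschitz. *)
Lemma radial_partial j f x i : Cinf B f -> B x ->
  is_derive x (delta_mx 0 i) (radial j f) (radial j.+1 (partial i f) x).
Proof.
move=> Cf Bx.
have Cfi := Cinf_partial i Cf.
have [s xs sr] : exists2 s, `|x| < s & s < r.
  move: Bx; rewrite /B -ball_normE /= sub0r normrN => xr.
  by exists ((`|x| + r) / 2); lra.
have [L L0 HL] := Ck1_lipschitz_ball r0 sr (Cfi 1%N).
have key (h : R) : `|h| < s - `|x| ->
    `|radial j f (x + h *: delta_mx 0 i) - radial j f x - h * radial j.+1 (partial i f) x| <= L * `|h| * `|h|.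
  move=> hs.
  have sB y : `|y| < s -> B y.
    by rewrite /B -ball_normE /= sub0r normrN => /lt_trans; apply.
  have xh (k : R) : `|k| <= `|h| -> `|x + k *: delta_mx 0 i| < s.
    move=> kh; apply: le_lt_trans (ler_normD _ _) _; have := norm_line_le k i; lra.
  have [P1 [P10 P1D] ->] := radialP j (Cf 0%N) (sB _ (xh h (lexx _))).
  have [P2 [P20 P2D] ->] := radialP j (Cf 0%N) Bx.
  have [P3 [P30 P3D] ->] := radialP j.+1 (Cfi 0%N) Bx.
  apply: (@mvt01_le (fun t => P1 t - P2 t - h * P3 t)
    (fun t => t ^+ j * f (t *: (x + h *: delta_mx 0 i)) - t ^+ j * f (t *: x) - h * (t ^+ j.+1 * partial i f (t *: x)))).
  - by rewrite P10 P20 P30 mulr0 !subr0.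
  - move=> t t01; apply: is_deriveB; first by apply: is_deriveB; [exact: P1D|exact: P2D].
    exact: (is_deriveZ h (P3D t t01)).
  move=> t t01; have /andP[t0 t1] := t01.
  have -> : t ^+ j * f (t *: (x + h *: delta_mx 0 i)) - t ^+ j * f (t *: x) - h * (t ^+ j.+1 * partial i f (t *: x))
     = t ^+ j * (f (t *: x + (t * h) *: delta_mx 0 i) - f (t *: x) - partial i f (t *: x) * (t * h)).
    by rewrite scalerDr scalerA exprSr; ring.
  have tn : `|t ^+ j| <= 1 by rewrite normrX ger0_norm// exprn_ile1.
  rewrite normrM -[leRHS]mul1r; apply: ler_pM => //.
  have thh : `|t * h| <= `|h| by rewrite normrM ger0_norm// ler_piMl.
  have lt_s (k : R) : `|k| <= `|t * h| -> `|t *: x + k *: delta_mx 0 i| < s.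
    move=> kh; apply: le_lt_trans (ler_normD _ _) _; rewrite normrZ.
    have : `|t| * `|x| <= `|x| by rewrite ger0_norm// ler_piMl.
    have := norm_line_le k i; move: kh thh hs; lra.
  have := @mvt_dist R (fun k => f (t *: x + k *: delta_mx 0 i))
    (fun k => partial i f (t *: x + k *: delta_mx 0 i)) (t * h) (partial i f (t *: x)) (L * `|h|).
  rewrite scale0r addr0 => H; apply: le_trans (H _ _) _.
  - by move=> k kh; apply: is_derive_line; apply: (Ck_derivable (Cf 1%N)); apply: sB; exact: lt_s.
  - move=> k kh; apply: le_trans (HL _ _ _ _) _.
    + by have := lt_s 0; rewrite scale0r addr0 normr0 => /(_ (normr_ge0 _))/ltW.
    + exact: ltW (lt_s k kh).
    + rewrite addrC addKr ler_wpM2l//; apply: le_trans (norm_line_le _ _) _.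
      exact: le_trans kh thh.
  - by rewrite ler_wpM2l// mulr_ge0.
have key2 : (fun h : R => h^-1 *: ((radial j f \o shift x) (h *: delta_mx 0 i) - radial j f x)) @ 0^'
    --> radial j.+1 (partial i f) x.
  apply/cvgrPdist_le => e e0; near=> h.
  have h0 : h != 0 by near: h; exact: nbhs_dnbhs_neq.
  rewrite distrC /= (addrC _ x).
  set D := radial j f _ - _; set p := radial j.+1 _ _.
  rewrite -(ler_pM2l (_ : 0 < `|h|)) ?normr_gt0// -normrM mulrBr.
  rewrite -[h^-1 *: D]/(h^-1 * D) mulVKf//.
  apply: le_trans (key h _) _.
    by near: h; apply: dnbhs0_lt; lra.
  rewrite mulrC ler_wpM2l//.
  apply: (@le_trans _ _ ((L + 1) * `|h|)); first by rewrite ler_wpM2r// lerDl.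
  rewrite mulrC -ler_pdivlMr ?ltr_wpDl//.
  by near: h; apply: dnbhs0_le; rewrite divr_gt0// ltr_wpDl.
by split; [apply/cvg_ex; exists (radial j.+1 (partial i f) x) | exact: cvg_lim key2].
Unshelve. all: by end_near. Qed.

Lemma radial_continuous j f x : Cinf B f -> B x -> {for x, continuous (radial j f)}.
Proof.
move=> Cf Bx.
have [s xs sr] : exists2 s, `|x| < s & s < r.
  move: Bx; rewrite /B -ball_normE /= sub0r normrN => xr.
  by exists ((`|x| + r) / 2); lra.
have [L L0 HL] := Ck1_lipschitz_ball r0 sr (Cf 1%N).
apply/cont_epsP => e e0.
have L1 : 0 < L + 1 by rewrite ltr_wpDl.
exists (Num.min (s - `|x|) (e / (L + 1))); first by rewrite lt_min subr_gt0 xs divr_gt0.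
move=> y; rewrite lt_min => /andP[h1 h2].
have ys : `|y| < s.
  by have := ler_normB x (x - y); rewrite opprB addrC subrK; lra.
have By : B y by rewrite /B -ball_normE /= sub0r normrN (lt_trans ys).
have [P1 [P10 P1D] ->] := radialP j (Cf 0%N) Bx.
have [P2 [P20 P2D] ->] := radialP j (Cf 0%N) By.
apply: (@mvt01_le (fun t => P1 t - P2 t) (fun t => t ^+ j * f (t *: x) - t ^+ j * f (t *: y))).
- by rewrite P10 P20 subr0.
- by move=> t t01; apply: is_deriveB; [exact: P1D|exact: P2D].
move=> t t01; have /andP[t0 t1] := t01.
rewrite -mulrBr normrM; apply: (@le_trans _ _ (1 * (L * `|x - y|))); last first.
  rewrite mul1r; apply: (@le_trans _ _ ((L + 1) * `|x - y|)); first by rewrite ler_wpM2r// lerDl.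
  by rewrite mulrC -ler_pdivlMr// ltW.
apply: ler_pM => //; first by rewrite normrX ger0_norm// exprn_ile1.
have nt (z : 'rV[R]_n) : `|z| < s -> `|t *: z| <= s.
  by move=> zs; rewrite normrZ ger0_norm//; apply: le_trans (ltW zs); rewrite ler_piMl.
apply: le_trans (HL _ _ (nt _ ys) (nt _ xs)) _; rewrite ler_wpM2l//.
by rewrite -scalerBr normrZ ger0_norm// ler_piMl.
Qed.

Lemma radial_Cinf j f : Cinf B f -> Cinf B (radial j f).
Proof.
move=> Cf k; elim: k j f Cf => [|k IH] j f Cf.
  by split => // x Bx; exact: radial_continuous.
split; first by move=> x Bx; exact: radial_continuous.
move=> i; split; first by move=> x Bx; have [] := radial_partial j i Cf Bx.
apply: (@Ck_eq _ _ k B (radial j.+1 (partial i f))).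
- exact: ball_open.
- by move=> x Bx; have [_ <-] := radial_partial j i Cf Bx.
- by apply: IH; exact: Cinf_partial.
Qed.

(** The derivative of t |-> f(tx) is the sum of x_i times the i-th partial at tx; integrating over
    [0, 1] gives the factors. Derivations are later determined by their values on coordinates
    through this factorization. *)
Lemma hadamard f : Cinf B f -> exists g : 'I_n -> 'rV[R]_n -> R,
  [/\ forall i, Cinf B (g i),
      forall x, B x -> f x = f 0 + \sum_i x 0 i * g i x
    & forall i, g i 0 = partial i f 0].
Proof.
move=> Cf; exists (fun i => radial 0 (partial i f)).
have Cfi i := Cinf_partial i Cf.
split.
- by move=> i; apply: radial_Cinf.
- move=> x Bx; apply/eqP; rewrite addrC -subr_eq; apply/eqP.
  have /choice[P HP] : forall i, exists P, radial_primitive 0 (partial i f) x P /\ radial 0 (partial i f) x = P 1.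
    by move=> i; have [P h1 h2] := radialP 0 (Cfi i 0%N) Bx; exists P.
  under eq_bigr do rewrite (HP _).2.
  apply/eqP; rewrite -subr_eq0 -normr_le0; apply/eqP/eqP.
  have := @mvt01_le (fun t => f (t *: x) - f 0 - \sum_i x 0 i * P i t)
     (fun t => dotp (fun i => partial i f (t *: x)) x - 0 - \sum_i x 0 i * (t ^+ 0 * partial i f (t *: x))) 0.
  rewrite scale1r; apply.
  + rewrite scale0r subrr sub0r big1 ?oppr0// => i _.
    by have [[-> _] _] := HP i; rewrite mulr0.
  + move=> t t01; apply: is_deriveB.
      apply: is_deriveB.
      have := @is_derive_line R n f 0 x t; rewrite add0r.
      have [d <-] := Ck1_is_derive x (@ball_open _ _ (0 : 'rV[R]_n) r) (Cf 1%N) (Bt Bx t01).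
      move=> /(_ d); rewrite (_ : (fun s => f (0 + s *: x)) = (fun s => f (s *: x))) //.
      by apply/funext => s; rewrite add0r.
    rewrite (_ : (fun t => _) = \sum_i (fun t => x 0 i * P i t)); last first.
      by apply/funext => s; rewrite fct_sumE.
    apply: is_derive_sum => i; have [[_ D] _] := HP i.
    exact: (is_deriveZ (x 0 i) (D t t01)).
  + move=> t t01; rewrite subr0 /dotp -sumrB big1 ?normr0// => i _.
    by rewrite expr0 mul1r subrr.
- move=> i; have B0 : B 0 by exact: ballxx.
  have [P [P0 PD] ->] := radialP 0 (Cfi i 0%N) B0.
  apply/eqP; rewrite -subr_eq0 -normr_le0; apply/eqP/eqP.
  have := @mvt01_le (fun t => P t - t * partial i f 0) (fun t => t ^+ 0 * partial i f (t *: 0) - partial i f 0) 0.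
  rewrite mul1r; apply.
  + by rewrite P0 mul0r subr0.
  + move=> t t01; apply: is_deriveB; first exact: PD.
    have := is_deriveM (@is_derive_id R R t 1) (@is_derive_cst R R R (partial i f 0) t 1).
    rewrite scaler0 add0r /GRing.scale /= mulr1.
    by rewrite (_ : _ * _ = (fun t => t * partial i f 0)).
  + by move=> t t01; rewrite scaler0 expr0 mul1r subrr normr0.
Qed.

End RadialBall.
End Hadamard.

(** * Bump functions *)

Section Flat.
Variable R : realType.

(** The factors x^(-j) make the family closed under derivation: the derivative of [flat j] is
    [flat j.+2] minus [j] times [flat j.+1]. Smoothness of exp(-1/x) at 0 thus needs one estimate
    for all orders. *)
Definition flat (j : nat) (x : R) : R := if 0 < x then x^-1 ^+ j * expR (- x^-1) else 0.

Lemma expRN_bound (n : nat) (y : R) : 0 <= y -> y ^+ n * expR (- y) <= n%:R ^+ n.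
Proof.
move=> y0; case: n => [|n].
  by rewrite !expr0 mul1r -expR0 ler_expR oppr_le0.
rewrite expRN ler_pdivrMr ?expR_gt0//.
have -> : y = n.+1%:R * (y / n.+1%:R) by rewrite mulrCA mulfV ?mulr1// pnatr_eq0.
rewrite expRM_natl exprMn ler_wpM2l ?exprn_ge0//.
apply: lerXn2r; rewrite ?nnegrE ?divr_ge0 ?expR_ge0//.
by apply: le_trans (expR_ge1Dx _); rewrite lerDr.
Qed.

Lemma flat_ge0 j x : 0 <= flat j x.
Proof.
rewrite /flat; case: ltP => // x0.
by rewrite mulr_ge0 ?expR_ge0// exprn_ge0// invr_ge0 ltW.
Qed.

(** In terms of y = 1/x this is the boundedness of y^(j+2) exp(-y); quadratic decay gives derivative
    0 at the origin. *)
Lemma flat_quadratic j x : `|flat j x| <= j.+2%:R ^+ j.+2 * x ^+ 2.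
Proof.
rewrite ger0_norm ?flat_ge0// /flat; case: ltP => [x0|_]; last first.
  by rewrite mulr_ge0 ?sqr_ge0// exprn_ge0.
rewrite -ler_pdivrMr ?exprn_gt0// -exprVn mulrAC -exprD addn2.
by apply: expRN_bound; rewrite invr_ge0 ltW.
Qed.

Lemma is_derive_flat j (x : R) :
  is_derive x (1 : R) (flat j) (flat j.+2 x - j%:R * flat j.+1 x).
Proof.
have [x0|x0|->] := ltgtP x 0.
- have E : \forall y \near x, cst 0 y = flat j y.
    have : \forall y \near x, y < 0 by apply: open_nbhs_nbhs; split; [exact: open_lt|].
    by apply: filterS => y /ltW y0; rewrite /flat ltNge y0.
  apply: (near_eq_is_derive E).
  rewrite /flat ltNge (ltW x0) /= mulr0 subr0; exact: is_derive_cst.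
- have xn0 : x != 0 by rewrite gt_eqF.
  have E : \forall y \near x, (fun y => y^-1 ^+ j * expR (- y^-1)) y = flat j y.
    have : \forall y \near x, 0 < y by apply: open_nbhs_nbhs; split; [exact: open_gt|].
    by apply: filterS => y y0; rewrite /flat y0.
  apply: (near_eq_is_derive E); rewrite /flat x0.
  have D1 : is_derive x (1 : R) (fun y : R => y^-1) (- x^-1 ^+ 2).
    have dx : derivable (id : R -> R) x 1 by exact: derivable_id.
    split; first exact: (derivableV xn0 dx).
    by rewrite (deriveV xn0 dx) derive_id exprVn /GRing.scale /= mulr1.
  have D2 : is_derive x (1 : R) (fun y : R => expR (- y^-1)) (x^-1 ^+ 2 * expR (- x^-1)).
    have DN := is_deriveN D1; rewrite opprK in DN.
    have := @is_derive1_comp R expR (fun y => - y^-1) x _ _ (is_derive_expR _) DN.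
    by rewrite mulrC; apply.
  have D3 : is_derive x (1 : R) (fun y : R => y^-1 ^+ j) (- (j%:R * x^-1 ^+ j.+1)).
    have := is_deriveX j D1.
    rewrite (_ : (fun y : R => y^-1) ^+ j = fun y => y^-1 ^+ j); last first.
      by apply/funext => y; rewrite exprfctE.
    move=> /is_derive_eq; apply; case: (j) => [|k]; first by rewrite !mul0r scale0r oppr0.
    by rewrite /= /GRing.scale /= mulrN -mulrA -exprD addn2.
  have := is_deriveM D3 D2; move=> /is_derive_eq; apply.
  rewrite /GRing.scale /= !exprS; ring.
have f0 k : flat k 0 = 0 by rewrite /flat ltxx.
rewrite !f0 mulr0 subr0.
pose C : R := j.+2%:R ^+ j.+2; have C0 : 0 < C by rewrite exprn_gt0.
have key : (fun h : R => h^-1 *: ((flat j \o shift 0) (h *: (1 : R)) - flat j 0)) @ 0^' --> (0 : R).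
  apply/cvgrPdist_le => e e0; near=> h.
  have h0 : h != 0 by near: h; exact: nbhs_dnbhs_neq.
  rewrite sub0r normrN f0 subr0 /= addr0 [h%:A]mulr1 normrZ.
  have hp : 0 < `|h| by rewrite normr_gt0.
  rewrite normfV mulrC ler_pdivrMr//; apply: le_trans (flat_quadratic j h) _.
  rewrite -real_normK ?num_real// expr2 mulrA ler_pM2r//.
  rewrite -/C mulrC -ler_pdivlMr//; near: h; apply: dnbhs0_le; exact: divr_gt0.
by split; [apply/cvg_ex; exists 0 | exact: cvg_lim key].
Unshelve. all: by end_near. Qed.

Lemma Ck_flat_comp n k j (g : 'rV[R]_n -> R) : (forall l, Ck l setT g) ->
  Ck k setT (flat j \o g).
Proof.
move=> Cg; elim: k j => [|k IH] j.
  split => // x _; apply: continuous_comp; first exact: (Ck_cont (Cg 0%N)).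
  exact: is_derive1_cont (is_derive_flat j (g x)).
split.
  move=> x _; apply: continuous_comp; first exact: (Ck_cont (Cg 0%N)).
  exact: is_derive1_cont (is_derive_flat j (g x)).
have D i x : is_derive x (delta_mx 0 i) (flat j \o g)
   (partial i g x * (flat j.+2 (g x) - j%:R * flat j.+1 (g x))).
  have [dg gE] := Ck1_diff openT (Cg 1%N) (I : setT x).
  have [df fE] := is_derive_flat j (g x).
  have dfd : differentiable (flat j) (g x) by apply/derivable1_diffP.
  split; first exact/diff_derivable/differentiable_comp.
  rewrite deriveE; last exact: differentiable_comp.
  rewrite diff_comp //= deriv1E// derive1E fE -deriveE ?diff_derivable//.
move=> i; split; first by move=> x _; have [] := D i x.
apply: (@Ck_eq _ _ k setT (fun x => partial i g x * (flat j.+2 (g x) - j%:R * flat j.+1 (g x)))).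
- exact: openT.
- by move=> x _; have [_ <-] := D i x.
- apply: (Ck_mul openT); first exact: Ck_partial (Cg k.+1).
  apply: (Ck_sub openT); first exact: IH.
  by apply: (Ck_mul openT); [exact: Ck_cst | exact: IH].
Qed.

Lemma flat0_gt0 x : (0 < flat 0 x) = (0 < x).
Proof.
rewrite /flat; case: (ltP 0 x) => x0; last by rewrite ltxx.
by rewrite mul1r expR_gt0.
Qed.

Lemma bump n (x0 : 'rV[R]_n) (r : R) : 0 < r -> exists th : 'rV[R]_n -> R,
  [/\ Cinf setT th, \forall x \near x0, th x = 1 & forall x, r <= `|x - x0| -> th x = 0].
Proof.
(* [q] is twice the squared Euclidean distance over r^2. The quotient a/(a+b) is 1 where [q <= 1]
   and 0 where [q >= 2], and [q < 2] forces every coordinate, hence the sup norm of [x - x0], below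
   [r]. *)
move=> r0; pose q (x : 'rV[R]_n) : R := \sum_i ((x 0 i - x0 0 i) / r * (2 * ((x 0 i - x0 0 i) / r))).
have Cq l : Ck l setT q.
  apply: (Ck_sum openT) => i _.
  have C1 : Ck l setT (fun x : 'rV[R]_n => (x 0 i - x0 0 i) / r).
    apply: (Ck_mul openT); last exact: Ck_cst.
    by apply: (Ck_sub openT); [exact: Ck_coord | exact: Ck_cst].
  apply: (Ck_mul openT) => //; apply: (Ck_mul openT) => //; exact: Ck_cst.
have Ca l : Ck l setT (fun x => 2 - q x) by apply: (Ck_sub openT); [exact: Ck_cst|].
have Cb l : Ck l setT (fun x => q x - 1) by apply: (Ck_sub openT); [|exact: Ck_cst].
pose a x := flat 0 (2 - q x); pose b x := flat 0 (q x - 1).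
have Cfa l : Ck l setT a := Ck_flat_comp l 0 Ca.
have Cfb l : Ck l setT b := Ck_flat_comp l 0 Cb.
have ab x : a x + b x != 0.
  rewrite gt_eqF//; case: (ltP (q x) 2) => h.
    by rewrite ltr_pwDl ?flat_ge0// flat0_gt0 subr_gt0.
  by rewrite ltr_pwDr ?flat_ge0// flat0_gt0 subr_gt0 (lt_le_trans _ h)// ltr1n.
exists (fun x => a x * (a x + b x)^-1); split.
- move=> l; apply: (Ck_mul openT) => //; apply: (Ck_inv openT) => //.
  exact: (Ck_add openT).
- have qc : {for x0, continuous q} by exact: (Ck_cont (Cq 0%N)).
  have q0 : q x0 = 0 by rewrite /q big1// => i _; rewrite subrr mul0r mul0r.
  have /cont_epsP/(_ 1 ltr01)[d d0 Hd] := qc.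
  apply/nbhs_ballP; exists d => // x; rewrite -ball_normE => /Hd.
  rewrite q0 sub0r normrN => /(le_trans (ler_norm _)) q1.
  have bx : b x = 0 by rewrite /b /flat ltNge subr_le0 q1.
  by rewrite bx addr0 mulfV//; have := ab x; rewrite bx addr0.
- move=> x rx; rewrite /a /flat (_ : 0 < 2 - q x = false) ?mul0r//.
  apply/negbTE; rewrite -leNgt subr_le0 leNgt; apply/negP => q2.
  suff : `|x - x0| < r by rewrite ltNge rx.
  have Hi i : ((x 0 i - x0 0 i) / r) ^+ 2 < 1.
    have : 2 * ((x 0 i - x0 0 i) / r) ^+ 2 <= q x.
      have sq (z : R) : z * (2 * z) = 2 * z ^+ 2 by ring.
      by rewrite /q (bigD1 i)//= sq lerDl sumr_ge0// => j _; rewrite sq mulr_ge0// sqr_ge0.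
    by move=> /le_lt_trans/(_ q2); lra.
  rewrite -[`|_|]/(mx_norm _) mx_normrE; apply/bigmax_ltP; split=> [|[j i] _ /=]; first exact: r0.
  rewrite ord1 !mxE; have := Hi i.
  rewrite -(ltr_pM2r (exprn_gt0 2 r0)) mul1r -exprMn divfK ?gt_eqF//.
  by rewrite -[X in X < _]real_normK ?num_real// ltr_pXn2r ?nnegrE// ltW.
Qed.

End Flat.

(** * Manifolds *)

Section Charts.
Variables (R : realType) (M : manifold R).
Local Notation n := (mdim M).
Implicit Types (c : chart R n M) (p q : M) (f g : M -> R).

Lemma chart_dom_open c : atlas c -> open (chart_dom c).
Proof. by move=> /m_chart[]. Qed.

Lemma chart_im_open c : atlas c -> open (chart_im c).
Proof. by move=> /m_chart[]. Qed.

Lemma chart_mapK c p : atlas c -> chart_dom c p -> chart_inv c (chart_map c p) = p.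
Proof. by move=> /m_chart[_ _ H _ _]; exact: H. Qed.

Lemma chart_map_cont c p : atlas c -> chart_dom c p -> {for p, continuous (chart_map c)}.
Proof. by move=> /m_chart[_ _ _ H _]; exact: H. Qed.

Lemma chart_inv_cont c x : atlas c -> chart_im c x -> {for x, continuous (chart_inv c)}.
Proof. by move=> /m_chart[_ _ _ _ H]; exact: H. Qed.

Lemma chart_im_map c p : chart_dom c p -> chart_im c (chart_map c p).
Proof. by exists p. Qed.

Lemma chart_inv_dom c x : atlas c -> chart_im c x -> chart_dom c (chart_inv c x).
Proof. by move=> ac [p dp <-]; rewrite chart_mapK. Qed.

Lemma chart_invK c x : atlas c -> chart_im c x -> chart_map c (chart_inv c x) = x.
Proof. by move=> ac [p dp <-]; rewrite chart_mapK. Qed.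

Lemma chart_pre_open c (W : set M) : atlas c -> open W ->
  open (chart_im c `&` chart_inv c @^-1` W).
Proof.
move=> ac oW; apply: open_preimage_within; [exact: chart_im_open|by []|].
by move=> x; exact: chart_inv_cont.
Qed.

Lemma chart_ball c p (W : set M) : atlas c -> chart_dom c p -> nbhs p W ->
  exists2 e : R, 0 < e & forall x, ball (chart_map c p) e x -> chart_im c x /\ W (chart_inv c x).
Proof.
move=> ac dp Wp.
have : nbhs (chart_map c p) (chart_im c `&` chart_inv c @^-1` W).
  apply: filterI.
    apply: open_nbhs_nbhs; split; [exact: chart_im_open | exact: chart_im_map].
  have := chart_inv_cont ac (chart_im_map dp); rewrite /prop_for /continuous_at chart_mapK//.
  exact.
by move=> /nbhs_ballP[e /= e0 He]; exists e.
Qed.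

Lemma near_chart c p (P : M -> Prop) : atlas c -> chart_dom c p ->
  (\forall x \near chart_map c p, P (chart_inv c x)) -> \forall q \near p, P q.
Proof.
move=> ac dp H.
have : nbhs p (chart_dom c `&` chart_map c @^-1` [set x | P (chart_inv c x)]).
  apply: filterI; first by apply: open_nbhs_nbhs; split => //; exact: chart_dom_open.
  exact: chart_map_cont.
by apply: filterS => q [dq /=]; rewrite chart_mapK.
Qed.

(** Germs are tested in one chart and [smooth_atP] transfers them to any other; functions known only
    near [p] are handled in this form until [smooth_extension] globalizes them. *)
Definition smooth_at f p := exists c, [/\ atlas c, chart_dom c p &
  exists2 e : R, 0 < e & Cinf (ball (chart_map c p) e) (f \o chart_inv c)].

Lemma transition_smooth c c' : atlas c -> atlas c' ->
  let U := chart_im c `&` chart_inv c @^-1` chart_dom c' in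
  forall k, CkV k U (chart_map c' \o chart_inv c).
Proof.
move=> ac ac' /= k i; have := @m_compatible R M c c' ac ac' i k.
apply: Ck_subset => x [imx dx]; exists (chart_inv c x); last by rewrite chart_invK.
by split => //; exact: chart_inv_dom.
Qed.

Lemma smooth_atP f p c : smooth_at f p -> atlas c -> chart_dom c p ->
  exists2 e : R, 0 < e & ball (chart_map c p) e `<=` chart_im c /\
    Cinf (ball (chart_map c p) e) (f \o chart_inv c).
Proof.
move=> [c' [ac' dp' [e' e'0 Cf]]] ac dp.
set V := ball _ _ in Cf.
have oV : open V by exact: ball_open.
pose W := chart_dom c' `&` chart_map c' @^-1` V.
have oW : open W.
  apply: open_preimage_within; [exact: chart_dom_open|by apply: ball_open|].
  by move=> q; exact: chart_map_cont.
have Wp : nbhs p W by apply: open_nbhs_nbhs; split => //; split => //; exact: ballxx.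
have [e e0 He] := chart_ball ac dp Wp.
exists e => //; split; first by move=> x /He[].
move=> k; apply: (@Ck_eq _ _ k _ ((f \o chart_inv c') \o (chart_map c' \o chart_inv c))).
- exact: ball_open.
- by move=> x /He[imx [dx _]] /=; rewrite chart_mapK.
- apply: (@Ck_comp R n n k _ V) => //; first exact: ball_open.
    by move=> x /He[_ []].
  move=> j; apply: Ck_subset (transition_smooth ac ac' k j).
  by move=> x /He[imx [dx _]].
Qed.

Lemma smooth_at_sub f p c (W : set M) : smooth_at f p -> atlas c -> chart_dom c p -> nbhs p W ->
  exists2 e : R, 0 < e &
    (forall x, ball (chart_map c p) e x -> chart_im c x /\ W (chart_inv c x)) /\
    Cinf (ball (chart_map c p) e) (f \o chart_inv c).
Proof.
move=> sf ac dp Wp; have [e1 e10 [_ H1]] := smooth_atP sf ac dp.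
have [e2 e20 H2] := chart_ball ac dp Wp.
exists (Num.min e1 e2); first by rewrite lt_min e10.
split; first by move=> x hx; apply: H2; apply: le_ball hx; rewrite ge_min lexx orbT.
move=> k; apply: Ck_subset (H1 k); apply: le_ball; rewrite ge_min lexx //.
Qed.

Lemma smooth_at_near f g p : (\forall q \near p, f q = g q) -> smooth_at f p -> smooth_at g p.
Proof.
move=> fg sf; have [c ac dp] := m_cover p.
have [e e0 [H1 H2]] := smooth_at_sub sf ac dp fg.
exists c; split => //; exists e => // k; apply: Ck_eq (H2 k); first exact: ball_open.
by move=> x /H1[].
Qed.

Lemma smooth_funP f : smooth_fun f <-> forall p, smooth_at f p.
Proof.
split=> [sf p|sf c ac k].
  have [c ac dp] := m_cover p; exists c; split => //.
  have [e e0 He] := chart_ball ac dp filterT.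
  by exists e => // k; apply: Ck_subset (sf c ac k) => x /He[].
apply/Ck_pointwise => x imx.
have [e e0 [_ He]] := smooth_atP (sf (chart_inv c x)) ac (chart_inv_dom ac imx).
rewrite chart_invK// in He.
by apply: Ck_subset (He k) => y ->; exact: ballxx.
Qed.

Lemma smooth_at_cont f p : smooth_at f p -> {for p, continuous f}.
Proof.
move=> [c [ac dp [e e0 He]]].
have : \forall q \near p, (f \o chart_inv c) (chart_map c q) = f q.
  have : nbhs p (chart_dom c) by apply: open_nbhs_nbhs; split => //; exact: chart_dom_open.
  by apply: filterS => q dq /=; rewrite chart_mapK.
move=> /near_eq_continuous; apply.
apply: continuous_comp; first exact: chart_map_cont.
exact: (Ck_cont (He 0%N) (ballxx _ e0)).
Qed.

Lemma smooth_at_cst (k : R) p : smooth_at (fun=> k) p.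
Proof.
have [c ac dp] := m_cover p; exists c; split => //; exists 1 => // l.
exact: Ck_cst.
Qed.

Lemma smooth_at_op (op : R -> R -> R) f g p :
  (forall m (U : set 'rV[R]_m) k u v, open U -> Ck k U u -> Ck k U v -> Ck k U (fun x => op (u x) (v x))) ->
  smooth_at f p -> smooth_at g p -> smooth_at (fun q => op (f q) (g q)) p.
Proof.
move=> Hop sf sg; have [c ac dp] := m_cover p.
have [e1 e10 [_ H1]] := smooth_atP sf ac dp.
have [e2 e20 [_ H2]] := smooth_atP sg ac dp.
exists c; split => //; exists (Num.min e1 e2); first by rewrite lt_min e10.
move=> k; apply: (Hop _ _ _ (f \o chart_inv c) (g \o chart_inv c)); first exact: ball_open.
  by apply: Ck_subset (H1 k); apply: le_ball; rewrite ge_min lexx.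
by apply: Ck_subset (H2 k); apply: le_ball; rewrite ge_min lexx orbT.
Qed.

Lemma smooth_at_add f g p : smooth_at f p -> smooth_at g p -> smooth_at (fun q => f q + g q) p.
Proof. by apply: smooth_at_op => m U k u v oU; exact: Ck_add. Qed.

Lemma smooth_at_mul f g p : smooth_at f p -> smooth_at g p -> smooth_at (fun q => f q * g q) p.
Proof. by apply: smooth_at_op => m U k u v oU; exact: Ck_mul. Qed.

Lemma smooth_at_opp f p : smooth_at f p -> smooth_at (fun q => - f q) p.
Proof.
move=> sf; have := @smooth_at_op (fun x y => - y) f f p.
by apply => // m U k u v oU _; exact: Ck_opp.
Qed.

Lemma smooth_at_sum (I : Type) (r : seq I) (F : I -> M -> R) p :
  (forall i, smooth_at (F i) p) -> smooth_at (fun q => \sum_(i <- r) F i q) p.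
Proof.
move=> H; elim: r => [|i r IH].
  by rewrite (_ : (fun _ => _) = (fun=> 0)); [exact: smooth_at_cst|apply/funext => q; rewrite big_nil].
rewrite (_ : (fun _ => _) = (fun q => F i q + \sum_(i <- r) F i q)); first exact: smooth_at_add.
by apply/funext => q; rewrite big_cons.
Qed.

Lemma smooth_at_chart c p (phi : 'rV[R]_n -> R) (e : R) : atlas c -> chart_dom c p -> 0 < e ->
  Cinf (ball (chart_map c p) e) phi -> smooth_at (phi \o chart_map c) p.
Proof.
move=> ac dp e0 Cphi; have [e' e'0 He'] := chart_ball ac dp filterT.
exists c; split => //; exists (Num.min e e'); first by rewrite lt_min e0.
move=> k; apply: (@Ck_eq _ _ k _ phi); first exact: ball_open.
- move=> x bx /=; rewrite chart_invK//; have [] // := He' x _.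
  by apply: le_ball bx; rewrite ge_min lexx orbT.
- by apply: Ck_subset (Cphi k); apply: le_ball; rewrite ge_min lexx.
Qed.

Lemma smooth_at_coord c p i : atlas c -> chart_dom c p -> smooth_at (fun q => chart_map c q 0 i) p.
Proof.
move=> ac dp; apply: (@smooth_at_chart c p (fun x => x 0 i) 1) => //.
by move=> k; exact: Ck_coord.
Qed.

(** A cut-off in a chart. The delicate points lie outside the chart domain: the support is contained
    in a compact set, which is closed since [M] is Hausdorff, so [g] vanishes near them. *)
Lemma smooth_extension f p (W : set M) : open W -> W p -> smooth_at f p ->
  exists g, [/\ smooth_fun g, \forall q \near p, g q = f q & forall q, ~ W q -> g q = 0].
Proof.
move=> oW Wp sf; have [c ac dp] := m_cover p.
have [e e0 [He Cf]] := smooth_at_sub sf ac dp (open_nbhs_nbhs (conj oW Wp)).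
have e20 : 0 < e / 2 by rewrite divr_gt0.
have e2e : e / 2 < e by rewrite ltr_pdivrMr// ltr_pMr// ltr1n.
have [th [Cth th1 th0]] := bump (chart_map c p) e20.
pose g q := if `[< chart_dom c q >] then th (chart_map c q) * f q else 0.
have gdom q : chart_dom c q -> g q = th (chart_map c q) * f q.
  by move=> dq; rewrite /g; case: asboolP.
have far q : (chart_dom c q -> e / 2 <= `|chart_map c q - chart_map c p|) -> g q = 0.
  by rewrite /g; case: asboolP => // dq /(_ dq) h; rewrite th0// mul0r.
exists g; split; last first.
- move=> q nWq; apply: far => dq; rewrite leNgt; apply/negP => h; apply: nWq.
  have [] := He (chart_map c q); last by rewrite chart_mapK.
  by rewrite -ball_normE /= distrC (lt_trans h).
- apply: (near_chart ac dp); near=> x.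
  have [imx _] : chart_im c x /\ W (chart_inv c x).
    by apply: He; near: x; exact: nbhsx_ballx.
  rewrite gdom; last exact: chart_inv_dom.
  rewrite chart_invK// (_ : th x = 1) ?mul1r//; near: x; exact: th1.
apply/smooth_funP => q.
have [dq|ndq] := pselect (chart_dom c q).
  have gE : \forall q' \near q, th (chart_map c q') * f q' = g q'.
    have : nbhs q (chart_dom c) by apply: open_nbhs_nbhs; split => //; exact: chart_dom_open.
    by apply: filterS => q' dq'; rewrite gdom.
  have [h|h] := ltP `|chart_map c q - chart_map c p| e.
    apply: (smooth_at_near gE); apply: smooth_at_mul.
      by apply: (@smooth_at_chart c q th 1) => // k; apply: Ck_subset (Cth k).
    exists c; split => //; exists (e - `|chart_map c q - chart_map c p|); first by rewrite subr_gt0.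
    move=> k; apply: Ck_subset (Cf k) => x; rewrite -!ball_normE /= => hx.
    rewrite -(subrKA (chart_map c q)) (le_lt_trans (ler_normD _ _))// distrC.
    by rewrite addrC -ltrBrDr.
  have cc := chart_map_cont ac dq.
  have : \forall q' \near q, 0 = g q'.
    have /cvgrPdist_lt/(_ (e / 2) e20) := cc.
    apply: filterS => q' h'; rewrite far// => dq'.
    have : `|chart_map c q - chart_map c p| <= `|chart_map c q - chart_map c q'| + `|chart_map c q' - chart_map c p|.
      by rewrite -(subrKA (chart_map c q')) ler_normD.
    by move: h h'; lra.
  by move=> /smooth_at_near; apply; exact: smooth_at_cst.
pose K := [set x : 'rV[R]_n | `|x - chart_map c p| <= e / 2].
have KB x : K x -> ball (chart_map c p) e x.
  by rewrite -ball_normE /K /= distrC => /le_lt_trans; apply.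
have cK : compact K.
  apply: bounded_closed_compact.
    exists (e / 2 + `|chart_map c p|); split; first exact: num_real.
    move=> m hm x Kx; apply: le_trans (ltW hm); rewrite -(subrK (chart_map c p) x).
    by apply: le_trans (ler_normD _ _) _; rewrite lerD2r.
  rewrite (_ : K = closed_ball (chart_map c p) (e / 2)); first exact: closed_ball_closed.
  rewrite closed_ballE//; apply/seteqP; split => x; rewrite /K /closed_ball_ /= distrC //.
have cKM : compact (chart_inv c @` K).
  apply: continuous_compact cK; apply: continuous_in_subspaceT => x /set_mem /KB/He[imx _].
  exact: chart_inv_cont.
have clK := compact_closed (@m_hausdorff R M) cKM.
have nK : ~ (chart_inv c @` K) q.
  by move=> [x /KB/He[imx _] xq]; apply: ndq; rewrite -xq; exact: chart_inv_dom.
have : \forall q' \near q, 0 = g q'.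
  have : nbhs q (~` (chart_inv c @` K)).
    by apply: open_nbhs_nbhs; split => //; exact: closed_openC.
  apply: filterS => q' nK'; rewrite far// => dq'; rewrite leNgt; apply/negP => h.
  by apply: nK'; exists (chart_map c q'); [exact: ltW | exact: chart_mapK].
by move=> /smooth_at_near; apply; exact: smooth_at_cst.
Unshelve. all: by end_near. Qed.

Lemma smooth_bump p (W : set M) : nbhs p W ->
  exists g, [/\ smooth_fun g, \forall q \near p, g q = 1 & forall q, ~ W q -> g q = 0].
Proof.
rewrite nbhsE => -[V [oV Vp] VW].
have [g [h1 h2 h3]] := smooth_extension oV Vp (smooth_at_cst 1 p).
by exists g; split => // q nW; apply: h3 => /VW.
Qed.

Lemma smooth_global f p : smooth_at f p -> exists2 g, smooth_fun g & \forall q \near p, g q = f q.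
Proof.
by move=> sf; have [g [h1 h2 _]] := smooth_extension openT I sf; exists g.
Qed.

Lemma smooth_fun_at f p : smooth_fun f -> smooth_at f p.
Proof. by move=> /smooth_funP. Qed.

Lemma smooth_fun_cst (k : R) : smooth_fun (fun _ : M => k).
Proof. by apply/smooth_funP => p; exact: smooth_at_cst. Qed.

Lemma smooth_fun_add f g : smooth_fun f -> smooth_fun g -> smooth_fun (fun q => f q + g q).
Proof. by move=> /smooth_funP sf /smooth_funP sg; apply/smooth_funP => p; exact: smooth_at_add. Qed.

Lemma smooth_fun_mul f g : smooth_fun f -> smooth_fun g -> smooth_fun (fun q => f q * g q).
Proof. by move=> /smooth_funP sf /smooth_funP sg; apply/smooth_funP => p; exact: smooth_at_mul. Qed.

Lemma smooth_fun_opp f : smooth_fun f -> smooth_fun (fun q => - f q).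
Proof. by move=> /smooth_funP sf; apply/smooth_funP => p; exact: smooth_at_opp. Qed.

Lemma smooth_fun_sum (I : Type) (r : seq I) (F : I -> M -> R) :
  (forall i, smooth_fun (F i)) -> smooth_fun (fun q => \sum_(i <- r) F i q).
Proof. by move=> sF; apply/smooth_funP => p; apply: smooth_at_sum => i; exact: smooth_fun_at. Qed.

End Charts.

Section SmoothMapsChar.
Variable R : realType.

(** Bump functions recover the continuity of [F] from that of its compositions, and globalized
    coordinates recover smoothness. From here on, charts of the target are mostly avoided. *)
Lemma smooth_onP n (N : manifold R) (U : set 'rV[R]_n) (F : 'rV[R]_n -> N) : open U ->
  smooth_on U F <-> forall f : N -> R, smooth_fun f -> Cinf U (f \o F).
Proof.
move=> oU; split=> [[Fc Fs] f sf k|H].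
  apply/Ck_pointwise => x Ux; have [c ac dF] := m_cover (F x).
  have [e e0 [He Cf]] := smooth_atP (smooth_fun_at (F x) sf) ac dF.
  pose U1 := U `&` F @^-1` chart_dom c.
  have oU1 : open U1 by apply: open_preimage_within => //; exact: chart_dom_open.
  have C1 l : CkV l U1 (fun x => chart_map c (F x)) by move=> j; exact: Fs.
  pose U2 := U1 `&` (fun x => chart_map c (F x)) @^-1` ball (chart_map c (F x)) e.
  have oU2 : open U2.
    by apply: open_preimage_within; [by [] | exact: ball_open | move=> y; exact: CkV_cont (C1 0%N)].
  have U2x : U2 x by split => //=; exact: ballxx.
  have : Ck k U2 (f \o F); last by apply: Ck_subset => y ->.
  apply: (@Ck_eq _ _ k U2 ((f \o chart_inv c) \o (fun x => chart_map c (F x)))) => //.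
    by move=> y [[_ dy] _] /=; rewrite chart_mapK.
  apply: (@Ck_comp _ _ _ k U2 (ball (chart_map c (F x)) e)) => //; first exact: ball_open.
    by move=> y [].
  by move=> j; apply: Ck_subset (C1 k j) => y [].
have Fc x : U x -> {for x, continuous F}.
  move=> Ux W /= WFx; have [g [sg g1 g0]] := smooth_bump WFx.
  have gc := Ck_cont (H g sg 0%N) Ux.
  have g1x : (g \o F) x = 1 := nbhs_singleton g1.
  have : \forall y \near x, 0 < (g \o F) y.
    apply: (gc [set z | 0 < z]); apply: open_nbhs_nbhs; split; first exact: open_gt.
    by change (0 < (g \o F) x); rewrite g1x.
  move=> hg; suff : \forall y \near x, W (F y) by [].
  apply: filterS hg => y; case: (pselect (W (F y))) => // nW.
  by rewrite /= g0 ?ltxx.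
split => // c ac i k; apply/Ck_pointwise => x [Ux dF].
have [g sg gE] := smooth_global (smooth_at_coord i ac dF).
apply: (@Ck_near _ _ k x (g \o F)); first exact: (Fc x Ux _ gE).
by apply: Ck_subset (H g sg k) => y ->.
Qed.

Lemma smooth_mapP (M N : manifold R) (F : M -> N) :
  smooth_map F <-> forall f : N -> R, smooth_fun f -> smooth_fun (f \o F).
Proof.
split=> [sF f sf c ac|H c ac].
  by have /smooth_onP := sF c ac; apply => //; exact: chart_im_open.
apply/smooth_onP; first exact: chart_im_open.
by move=> f sf; exact: (H f sf c ac).
Qed.

Lemma smooth_map2_dom_open (L M : manifold R) (c : chart R (mdim L) L) (c' : chart R (mdim M) M) :
  atlas c -> atlas c' ->
  open [set x : 'rV[R]_(mdim L + mdim M) | chart_im c (lsubmx x) /\ chart_im c' (rsubmx x)].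
Proof.
move=> ac ac'; set U := [set x | _].
have -> : U = (setT `&` (@lsubmx R 1 (mdim L) (mdim M)) @^-1` chart_im c) `&`
   (setT `&` (@rsubmx R 1 (mdim L) (mdim M)) @^-1` chart_im c').
  by apply/seteqP; split => x; [move=> [] | move=> [[]] + ? []].
apply: openI; apply: open_preimage_within; try exact: openT; try exact: chart_im_open.
  by move=> x _; exact/differentiable_continuous/differentiable_lsubmx.
by move=> x _; exact/differentiable_continuous/differentiable_rsubmx.
Qed.

Lemma smooth_map2P (L M N : manifold R) (F : L -> M -> N) :
  smooth_map2 F <-> forall f : N -> R, smooth_fun f ->
   forall (c : chart R (mdim L) L) (c' : chart R (mdim M) M), atlas c -> atlas c' ->
   Cinf [set x : 'rV[R]_(mdim L + mdim M) | chart_im c (lsubmx x) /\ chart_im c' (rsubmx x)]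
        (fun x => f (F (chart_inv c (lsubmx x)) (chart_inv c' (rsubmx x)))).
Proof.
split=> [sF f sf c c' ac ac'|H c c' ac ac'].
  have /smooth_onP := sF c c' ac ac'; apply => //; exact: smooth_map2_dom_open.
apply/smooth_onP; first exact: smooth_map2_dom_open.
by move=> f sf; exact: (H f sf c c' ac ac').
Qed.

Lemma smooth_map_cont (M N : manifold R) (F : M -> N) p : smooth_map F -> {for p, continuous F}.
Proof.
move=> /smooth_mapP H W /= WFp; have [g [sg g1 g0]] := smooth_bump WFp.
have gc := smooth_at_cont (smooth_fun_at p (H g sg)).
have g1x : (g \o F) p = 1 := nbhs_singleton g1.
have : \forall y \near p, 0 < (g \o F) y.
  apply: (gc [set z | 0 < z]); apply: open_nbhs_nbhs; split; first exact: open_gt.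
  by change (0 < (g \o F) p); rewrite g1x.
move=> hg; suff : \forall y \near p, W (F y) by [].
apply: filterS hg => y; case: (pselect (W (F y))) => // nW.
by rewrite /= g0 ?ltxx.
Qed.

Lemma smooth_map_comp (L M N : manifold R) (F : L -> M) (G : M -> N) :
  smooth_map F -> smooth_map G -> smooth_map (G \o F).
Proof.
move=> /smooth_mapP sF /smooth_mapP sG; apply/smooth_mapP => f sf.
exact: (sF (f \o G) (sG f sf)).
Qed.

Lemma smooth_map_id (M : manifold R) : smooth_map (id : M -> M).
Proof. by apply/smooth_mapP. Qed.

End SmoothMapsChar.

(** * Linear forms and tangent vectors *)

Section DualFacts.
Variables (R : realType) (V : lmodType R).

Lemma dual_linear (a : dual V) k u v : a (k *: u + v) = k * a u + a v.
Proof. by have /asboolP := dual_prop a; apply. Qed.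

Lemma dual0 (a : dual V) : a 0 = 0.
Proof. by have := dual_linear a (-1) 0 0; rewrite scaler0 add0r mulN1r addNr. Qed.

Lemma dualD (a : dual V) u v : a (u + v) = a u + a v.
Proof. by have := dual_linear a 1 u v; rewrite scale1r mul1r. Qed.

Lemma dualZ (a : dual V) k u : a (k *: u) = k * a u.
Proof. by have := dual_linear a k u 0; rewrite !addr0 dual0 addr0. Qed.

Lemma dual_sum (a : dual V) (I : Type) (r : seq I) (P : pred I) (F : I -> V) :
  a (\sum_(i <- r | P i) F i) = \sum_(i <- r | P i) a (F i).
Proof. by elim/big_rec2 : _ => [|i u v _ <-]; [exact: dual0|exact: dualD]. Qed.

Lemma dual_ext (a b : dual V) : (forall v, a v = b v) -> a = b.
Proof. by move=> H; apply: val_inj; apply/funext. Qed.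

Lemma mkdualE (f : V -> R) v : (forall k u v, f (k *: u + v) = k * f u + f v) -> mkdual f v = f v.
Proof.
move=> H; rewrite /mkdual; have Hf : f \in @linear_form R V by apply/asboolP.
by rewrite -[RHS](congr1 (@^~ v) (insubdK (0 : dual V) Hf)).
Qed.

Lemma dual_addE (a b : dual V) v : (a + b) v = a v + b v.
Proof. by []. Qed.

Lemma dual_scaleE k (a : dual V) v : (k *: a) v = k * a v.
Proof. by []. Qed.

Lemma dual_sumE (I : Type) (r : seq I) (P : pred I) (F : I -> dual V) v :
  (\sum_(i <- r | P i) F i) v = \sum_(i <- r | P i) F i v.
Proof. by elim/big_rec2 : _ => [|i u w _ <-]. Qed.

End DualFacts.

Lemma pullbackE (R : realType) (V W : lmodType R) (f : V -> W) (a : dual W) v :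
  (forall k u v, f (k *: u + v) = k *: f u + f v) -> pullback f a v = a (f v).
Proof. by move=> Hf; rewrite mkdualE// => k u w /=; rewrite Hf dual_linear. Qed.

Section TangentFacts.
Variables (R : realType) (M : manifold R).
Local Notation n := (mdim M).
Implicit Types (p : M) (f g : M -> R) (c : chart R n M).

Lemma tangentP p (v : tangent p) :
  [/\ forall f, ~ smooth_fun f -> v f = 0,
    forall (k : R) f g, smooth_fun f -> smooth_fun g -> v (k *: f + g) = k * v f + v g
  & forall f g, smooth_fun f -> smooth_fun g -> v (fun q => f q * g q) = v f * g p + f p * v g].
Proof. by have /asboolP := tangent_prop v. Qed.

Lemma tan_lin p (v : tangent p) k f g : smooth_fun f -> smooth_fun g ->
  v (fun q => k * f q + g q) = k * v f + v g.
Proof. by move=> sf sg; have [_ H _] := tangentP v; exact: H. Qed.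

Lemma tan_mul p (v : tangent p) f g : smooth_fun f -> smooth_fun g ->
  v (fun q => f q * g q) = v f * g p + f p * v g.
Proof. by move=> sf sg; have [_ _ H] := tangentP v; exact: H. Qed.

Lemma tan_cst p (v : tangent p) k : v (fun=> k) = 0.
Proof.
have v1 : v (fun=> 1) = 0.
  have := tan_mul v (smooth_fun_cst 1) (smooth_fun_cst 1).
  rewrite (_ : (fun q => 1 * 1) = (fun=> 1)); last by apply/funext => q; rewrite mulr1.
  by rewrite mulr1 mul1r => /eqP; rewrite -subr_eq0 opprD addNKr oppr_eq0 => /eqP.
have v0 : v (fun=> 0) = 0.
  have := tan_lin v (-1) (smooth_fun_cst 0) (smooth_fun_cst 0).
  rewrite (_ : (fun q => -1 * 0 + 0) = (fun=> 0)); last by apply/funext => q; rewrite mulr0 addr0.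
  by rewrite mulN1r addNr.
have := tan_lin v k (smooth_fun_cst 1) (smooth_fun_cst 0).
rewrite (_ : (fun q => k * 1 + 0) = (fun=> k)); last by apply/funext => q; rewrite mulr1 addr0.
by rewrite v1 v0 mulr0 addr0.
Qed.

Lemma tan_add p (v : tangent p) f g : smooth_fun f -> smooth_fun g ->
  v (fun q => f q + g q) = v f + v g.
Proof.
move=> sf sg; have := tan_lin v 1 sf sg; rewrite mul1r => <-.
by congr (tangent_fun v); apply/funext => q; rewrite mul1r.
Qed.

Lemma tan_scale p (v : tangent p) k f : smooth_fun f -> v (fun q => k * f q) = k * v f.
Proof.
move=> sf; have := tan_lin v k sf (smooth_fun_cst 0); rewrite tan_cst addr0 => <-.
by congr (tangent_fun v); apply/funext => q; rewrite addr0.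
Qed.

Lemma tan_opp p (v : tangent p) f : smooth_fun f -> v (fun q => - f q) = - v f.
Proof.
move=> sf; rewrite -mulN1r -tan_scale//.
by congr (tangent_fun v); apply/funext => q; rewrite mulN1r.
Qed.

Lemma tan_sub p (v : tangent p) f g : smooth_fun f -> smooth_fun g ->
  v (fun q => f q - g q) = v f - v g.
Proof. by move=> sf sg; rewrite tan_add ?tan_opp//; exact: smooth_fun_opp. Qed.

Lemma tan_sum p (v : tangent p) (I : Type) (r : seq I) (F : I -> M -> R) :
  (forall i, smooth_fun (F i)) -> v (fun q => \sum_(i <- r) F i q) = \sum_(i <- r) v (F i).
Proof.
move=> sF; elim: r => [|i r IH].
  rewrite big_nil (_ : (fun _ => _) = (fun=> 0)) ?tan_cst//.
  by apply/funext => q; rewrite big_nil.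
rewrite big_cons -IH -tan_add//; last exact: smooth_fun_sum.
by congr (tangent_fun v); apply/funext => q; rewrite big_cons.
Qed.

(** The product of [f - g] with a bump supported where [f = g] is zero, and Leibniz's rule at [p]
    gives back the value of [v] on [f - g]. *)
Lemma tan_local p (v : tangent p) f g : smooth_fun f -> smooth_fun g ->
  (\forall q \near p, f q = g q) -> v f = v g.
Proof.
move=> sf sg fg; apply/eqP; rewrite -subr_eq0 -tan_sub//; apply/eqP.
have [x [sx x1 x0]] := smooth_bump fg.
have sh : smooth_fun (fun q => f q - g q) by apply: smooth_fun_add => //; exact: smooth_fun_opp.
have := tan_mul v sx sh.
rewrite (nbhs_singleton fg) subrr mulr0 add0r (nbhs_singleton x1) mul1r => <-.
rewrite (_ : (fun q => x q * _) = (fun=> 0)) ?tan_cst//.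
apply/funext => q; have [->|nfg] := pselect (f q = g q); first by rewrite subrr mulr0.
by rewrite x0// mul0r.
Qed.

Lemma tangent_ext p (u v : tangent p) : (forall f, smooth_fun f -> u f = v f) -> u = v.
Proof.
move=> H; apply: val_inj; apply/funext => f /=.
have [sf|nsf] := pselect (smooth_fun f); first exact: H.
by have [-> // _ _] := tangentP u; have [-> // _ _] := tangentP v.
Qed.

Lemma mktangentE p (v : (M -> R) -> R) f :
  (forall (k : R) f g, smooth_fun f -> smooth_fun g -> v (fun q => k * f q + g q) = k * v f + v g) ->
  (forall f g, smooth_fun f -> smooth_fun g -> v (fun q => f q * g q) = v f * g p + f p * v g) ->
  smooth_fun f -> mktangent p v f = v f.
Proof.
move=> vl vM sf; rewrite /mktangent; set w := fun f => _.
have Hw : w \in @derivation_at R M p.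
  apply/asboolP; split.
  - by move=> h nh; rewrite /w; case: asboolP.
  - move=> k h1 h2 s1 s2; rewrite /w.
    have s3 : smooth_fun (k *: h1 + h2).
      by apply: smooth_fun_add => //; apply: smooth_fun_mul => //; exact: smooth_fun_cst.
    by do 3 case: asboolP => //; move=> _ _ _; exact: vl.
  - move=> h1 h2 s1 s2; rewrite /w; have s3 := smooth_fun_mul s1 s2.
    by do 3 case: asboolP => //; move=> _ _ _; exact: vM.
have E : tangent_fun (insubd (0 : tangent p) w) f = w f := congr1 (@^~ f) (insubdK (0 : tangent p) Hw).
by rewrite E /w; case: asboolP.
Qed.

Lemma tangent_addE p (u v : tangent p) f : (u + v) f = u f + v f.
Proof. by []. Qed.

Lemma tangent_scaleE p k (u : tangent p) f : (k *: u) f = k * u f.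
Proof. by []. Qed.

Lemma tangent_sumE p (I : Type) (r : seq I) (P : pred I) (F : I -> tangent p) f :
  (\sum_(i <- r | P i) F i) f = \sum_(i <- r | P i) F i f.
Proof. by elim/big_rec2 : _ => [|i u w _ <-]. Qed.

Lemma dfunE p f (v : tangent p) : dfun p f v = v f.
Proof. by rewrite /dfun mkdualE. Qed.

End TangentFacts.

Lemma derive_translate (R : realType) n (h : 'rV[R]_n -> R) (x0 v : 'rV[R]_n) :
  'D_v (fun x => h (x + x0)) 0 = 'D_v h x0.
Proof.
have E : (fun k : R => k^-1 *: (((fun x => h (x + x0)) \o shift 0) (k *: v) - h (0 + x0)))
  = (fun k : R => k^-1 *: ((h \o shift x0) (k *: v) - h x0)).
  by apply/funext => k /=; rewrite addr0 add0r.
by rewrite /derive E.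
Qed.

Section TangentCoordinates.
Variables (R : realType) (M : manifold R).
Local Notation n := (mdim M).
Variables (c : chart R n M) (p : M) (ac : atlas c) (dp : chart_dom c p).
Implicit Types (f g : M -> R).

(** Derivations act on global functions only, so the chart coordinates are replaced by global
    functions with the same germ at [p]. *)
Definition coord_ext (i : 'I_n) : M -> R :=
  xget (fun=> 0) [set g | smooth_fun g /\ \forall q \near p, g q = chart_map c q 0 i].

Lemma coord_extP i : smooth_fun (coord_ext i) /\ \forall q \near p, coord_ext i q = chart_map c q 0 i.
Proof.
have [g sg gE] := smooth_global (smooth_at_coord i ac dp).
by rewrite /coord_ext; case: xgetP => [_ _ //|/(_ g)[]].
Qed.

Definition tcoord (v : tangent p) : 'rV[R]_n := \row_i v (coord_ext i).

Definition dchart f (i : 'I_n) : R := partial i (f \o chart_inv c) (chart_map c p).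

(** By Hadamard's lemma [f - f p] is, near [p], a sum of centred coordinates times smooth functions.
    Leibniz's rule leaves only the values of these functions at [p], which are the partials. *)
Lemma tan_expand (v : tangent p) f : smooth_fun f -> v f = dotp (dchart f) (tcoord v).
Proof.
move=> sf; have [e e0 [He Cf]] := smooth_atP (smooth_fun_at p sf) ac dp.
set x0 := chart_map c p in He Cf.
pose F (x : 'rV[R]_n) := f (chart_inv c (x + x0)).
have Ctr k : CkV k (ball (0 : 'rV[R]_n) e) (fun x => x + x0).
  move=> j; rewrite (_ : (fun x => _) = (fun x : 'rV[R]_n => x 0 j + x0 0 j)).
    by apply: Ck_add; [exact: ball_open | exact: Ck_coord | exact: Ck_cst].
  by apply/funext => x; rewrite mxE.
have tr x : ball (0 : 'rV[R]_n) e x -> ball x0 e (x + x0).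
  by rewrite -!ball_normE /= opprD addrCA subrr addr0 sub0r.
have CF : Cinf (ball (0 : 'rV[R]_n) e) F.
  move=> k; apply: (@Ck_comp _ _ _ k _ (ball x0 e) (fun x => x + x0) (f \o chart_inv c)) => //;
    exact: ball_open.
have [g [Cg gE g0]] := hadamard e0 CF.
have tr' x : ball x0 e x -> ball (0 : 'rV[R]_n) e (x - x0).
  by rewrite -!ball_normE /= sub0r opprB.
have sgi i : smooth_at (fun q => g i (chart_map c q - x0)) p.
  apply: (@smooth_at_chart _ _ c p (fun x => g i (x - x0)) e) => // k.
  apply: (@Ck_comp _ _ _ k _ (ball (0 : 'rV[R]_n) e) (fun x => x - x0) (g i)) => //; try exact: ball_open; last exact: Cg.
  move=> j; rewrite (_ : (fun x => _) = (fun x : 'rV[R]_n => x 0 j - x0 0 j)).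
    by apply: Ck_sub; [exact: ball_open | exact: Ck_coord | exact: Ck_cst].
  by apply/funext => x; rewrite !mxE.
have /choice[G HG] : forall i, exists G : M -> R, smooth_fun G /\ \forall q \near p, G q = g i (chart_map c q - x0).
  by move=> i; have [G sG GE] := smooth_global (sgi i); exists G.
have sx i : smooth_fun (fun q => coord_ext i q - x0 0 i).
  apply: smooth_fun_add; first by have [] := coord_extP i.
  by apply: smooth_fun_opp; exact: smooth_fun_cst.
have sxG i : smooth_fun (fun q => (coord_ext i q - x0 0 i) * G i q).
  by apply: smooth_fun_mul => //; have [] := HG i.
have E : \forall q \near p, f q = f p + \sum_i (coord_ext i q - x0 0 i) * G i q.
  have h1 : \forall q \near p, forall i, G i q = g i (chart_map c q - x0).
    by apply: filter_forall => i; have [] := HG i.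
  have h2 : \forall q \near p, forall i, coord_ext i q = chart_map c q 0 i.
    by apply: filter_forall => i; have [] := coord_extP i.
  have h3 : \forall q \near p, chart_dom c q.
    by apply: open_nbhs_nbhs; split => //; exact: chart_dom_open.
  have h4 : \forall q \near p, ball x0 e (chart_map c q).
    by apply: (chart_map_cont ac dp); exact: nbhsx_ballx.
  have h5 : \forall q \near p, (chart_dom c q /\ ball x0 e (chart_map c q)) /\
      ((forall i, coord_ext i q = chart_map c q 0 i) /\ forall i, G i q = g i (chart_map c q - x0)).
    exact: filterI (filterI h3 h4) (filterI h2 h1).
  apply: filterS h5 => q [[dq bq] [e2 e1]].
  have := gE _ (tr' _ bq); rewrite /F subrK add0r !chart_mapK// => ->.
  by congr (_ + _); apply: eq_bigr => i _; rewrite !mxE e1 e2.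
rewrite (tan_local v sf _ E); last first.
  by apply: smooth_fun_add; [exact: smooth_fun_cst | exact: smooth_fun_sum].
rewrite tan_add; [|exact: smooth_fun_cst|exact: smooth_fun_sum].
rewrite tan_cst add0r tan_sum// /dotp; apply: eq_bigr => i _.
have [sG GE] := HG i; rewrite tan_mul// tan_sub; [|by have [] := coord_extP i|exact: smooth_fun_cst].
have [_ ce] := coord_extP i.
rewrite tan_cst subr0 (nbhs_singleton ce) -/x0 subrr mul0r addr0 mxE; congr (_ * _).
rewrite (nbhs_singleton GE) -/x0 subrr g0 /dchart.
exact: (derive_translate (f \o chart_inv c) x0 (delta_mx 0 i)).
Qed.

Lemma chart_Cinf f : smooth_fun f -> exists2 U : set 'rV[R]_n, open U /\ U (chart_map c p) & Cinf U (f \o chart_inv c).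
Proof.
move=> sf; have [e e0 [He Cf]] := smooth_atP (smooth_fun_at p sf) ac dp.
by exists (ball (chart_map c p) e) => //; split; [exact: ball_open | exact: ballxx].
Qed.

Definition tvec (a : 'rV[R]_n) : tangent p := mktangent p (fun f => dotp (dchart f) a).

Lemma dchart_lin k f g i : smooth_fun f -> smooth_fun g ->
  dchart (fun q => k * f q + g q) i = k * dchart f i + dchart g i.
Proof.
move=> /chart_Cinf[U [oU Ux] Cf] /chart_Cinf[V [oV Vx] Cg].
have df := Ck_derivable (i := i) (Cf 1%N) Ux; have dg := Ck_derivable (i := i) (Cg 1%N) Vx.
have [_ E] := is_deriveD (is_deriveZ k (derivableP df)) (derivableP dg).
exact: E.
Qed.

Lemma dchart_mul f g i : smooth_fun f -> smooth_fun g ->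
  dchart (fun q => f q * g q) i = dchart f i * g p + f p * dchart g i.
Proof.
move=> /chart_Cinf[U [oU Ux] Cf] /chart_Cinf[V [oV Vx] Cg].
have df := Ck_derivable (i := i) (Cf 1%N) Ux; have dg := Ck_derivable (i := i) (Cg 1%N) Vx.
have [_ E] := is_deriveM (derivableP df) (derivableP dg).
rewrite addrC; move: E; rewrite /GRing.scale /= !chart_mapK// => E.
by rewrite [X in _ = _ + X]mulrC; exact: E.
Qed.

Lemma tvecE a f : smooth_fun f -> tvec a f = dotp (dchart f) a.
Proof.
move=> sf; apply: mktangentE => //.
- move=> k g h sg sh; rewrite /dotp mulr_sumr -big_split /=; apply: eq_bigr => i _.
  by rewrite dchart_lin// mulrDr mulrCA.
- move=> g h sg sh; rewrite /dotp mulr_suml mulr_sumr -big_split /=; apply: eq_bigr => i _.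
  by rewrite dchart_mul// mulrDr mulrA mulrCA.
Qed.

Lemma dchart_coord i j : dchart (coord_ext i) j = (j == i)%:R.
Proof.
have [sx xE] := coord_extP i.
have E : \forall x \near chart_map c p, (coord_ext i \o chart_inv c) x = dotp (fun j => (j == i)%:R) x.
  have [e e0 He] := chart_ball ac dp xE.
  apply/nbhs_ballP; exists e => // x /He[imx /=] ->.
  by rewrite dotp_coord chart_invK.
rewrite /dchart /partial (near_eq_derive _ E).
have [d Ed] := is_diff_dotp (fun j => (j == i)%:R) (chart_map c p).
by rewrite deriveE// Ed dotp_delta.
Qed.

Lemma tcoordK : cancel tcoord tvec.
Proof. by move=> v; apply: tangent_ext => f sf; rewrite tvecE// tan_expand. Qed.

Lemma tvecK : cancel tvec tcoord.
Proof.
move=> a; apply/rowP => i; rewrite mxE tvecE; last by have [] := coord_extP i.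
rewrite -[RHS]dotp_coord /dotp; apply: eq_bigr => j _.
by rewrite dchart_coord.
Qed.

Lemma tcoord_is_linear : linear tcoord.
Proof. by move=> k u v; apply/rowP => i; rewrite !mxE. Qed.

HB.instance Definition _ :=
  GRing.isLinear.Build R (tangent p) 'rV[R]_n *:%R tcoord tcoord_is_linear.

Lemma tangent_basis (v : tangent p) : v = \sum_i v (coord_ext i) *: tvec (delta_mx 0 i).
Proof.
apply: tangent_ext => f sf; rewrite tangent_sumE tan_expand// /dotp.
by apply: eq_bigr => i _; rewrite tangent_scaleE tvecE// dotp_delta mxE.
Qed.

Lemma dfun_surj (a : cotangent p) : exists2 f, smooth_fun f & a = dfun p f.
Proof.
exists (fun q => \sum_i a (tvec (delta_mx 0 i)) * coord_ext i q).
  apply: smooth_fun_sum => i; apply: smooth_fun_mul; first exact: smooth_fun_cst.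
  by have [] := coord_extP i.
apply: dual_ext => v; rewrite dfunE tan_sum; last first.
  move=> i; apply: smooth_fun_mul; first exact: smooth_fun_cst.
  by have [] := coord_extP i.
rewrite {1}(tangent_basis v) dual_sum; apply: eq_bigr => i _.
have [sx _] := coord_extP i.
rewrite dualZ (tan_scale v (a (tvec (delta_mx 0 i))) sx).
exact: mulrC.
Qed.

End TangentCoordinates.

Section TangentMapFacts.
Variables (R : realType) (M N : manifold R).

Lemma dmap_toE (F : M -> N) p q (v : tangent p) f : F p = q ->
  smooth_map F -> smooth_fun f -> dmap_to F q v f = v (f \o F).
Proof.
move=> <- /smooth_mapP sF sf; apply: mktangentE => //.
- by move=> k g h sg sh; exact: (tan_lin v k (sF _ sg) (sF _ sh)).
- by move=> g h sg sh; exact: (tan_mul v (sF _ sg) (sF _ sh)).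
Qed.

Lemma dmapE (F : M -> N) p (v : tangent p) f :
  smooth_map F -> smooth_fun f -> dmap F v f = v (f \o F).
Proof. by move=> sF sf; exact: (@dmap_toE F p (F p) v f). Qed.

Lemma dmap_linear (F : M -> N) p k (u v : tangent p) : smooth_map F ->
  dmap F (k *: u + v) = k *: dmap F u + dmap F v.
Proof. by move=> sF; apply: tangent_ext => f sf; rewrite tangent_addE tangent_scaleE !dmapE. Qed.

Lemma dmap_to_linear (F : M -> N) p q k (u v : tangent p) : F p = q -> smooth_map F ->
  dmap_to F q (k *: u + v) = k *: dmap_to F q u + dmap_to F q v.
Proof.
by move=> Fp sF; apply: tangent_ext => f sf; rewrite tangent_addE tangent_scaleE !(dmap_toE _ Fp).
Qed.

Lemma pullback_dfun (F : M -> N) p f : smooth_map F -> smooth_fun f ->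
  pullback (@dmap R M N F p) (dfun (F p) f) = dfun p (f \o F).
Proof.
move=> sF sf; apply: dual_ext => v; rewrite pullbackE ?dfunE ?dmapE//.
by move=> k u w; exact: dmap_linear.
Qed.

End TangentMapFacts.

Section TangentAny.
Variables (R : realType) (M : manifold R) (p : M).

Lemma cotangent_dfun (a : cotangent p) : exists2 f, smooth_fun f & a = dfun p f.
Proof. by have [c ac dp] := m_cover p; exact: (dfun_surj ac dp a). Qed.

Lemma dfun_near (f g : M -> R) : smooth_fun f -> smooth_fun g ->
  (\forall q \near p, f q = g q) -> dfun p f = dfun p g.
Proof. by move=> sf sg fg; apply: dual_ext => v; rewrite !dfunE; exact: tan_local fg. Qed.

Lemma cotangent_separates (u v : tangent p) : (forall a : cotangent p, a u = a v) -> u = v.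
Proof. by move=> H; apply: tangent_ext => f sf; rewrite -!dfunE. Qed.

End TangentAny.

Section Sharp.
Variables (R : realType) (M : manifold R) (P : bifield M) (m : M).
Hypothesis (bP : bilinear_form (@P m)).

Lemma dfun_lin k (f g : M -> R) : smooth_fun f -> smooth_fun g ->
  dfun m (fun q => k * f q + g q) = k *: dfun m f + dfun m g.
Proof.
by move=> sf sg; apply: dual_ext => v; rewrite dual_addE dual_scaleE !dfunE tan_lin.
Qed.

Lemma dfun_mul (f g : M -> R) : smooth_fun f -> smooth_fun g ->
  dfun m (fun q => f q * g q) = g m *: dfun m f + f m *: dfun m g.
Proof.
move=> sf sg; apply: dual_ext => v.
by rewrite dual_addE !dual_scaleE !dfunE tan_mul// (mulrC (g m)).
Qed.

Lemma bilin0r (a : cotangent m) : @P m a 0 = 0.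
Proof. by have := bP.2 1 0 0 a; rewrite scaler0 addr0 mul1r => /eqP; rewrite -subr_eq0 opprD addNKr oppr_eq0 => /eqP. Qed.

Lemma bilin0l (a : cotangent m) : @P m 0 a = 0.
Proof. by have := bP.1 1 0 0 a; rewrite scaler0 addr0 mul1r => /eqP; rewrite -subr_eq0 opprD addNKr oppr_eq0 => /eqP. Qed.

Lemma bilinZl k (a b : cotangent m) : @P m (k *: a) b = k * @P m a b.
Proof. by have := bP.1 k a 0 b; rewrite addr0 bilin0l addr0. Qed.

Lemma sharpE (a b : cotangent m) : b (sharp P a) = @P m b a.
Proof.
have ex : exists v : tangent m, forall b : cotangent m, b v = @P m b a.
  pose w (f : M -> R) := @P m (dfun m f) a.
  have wE f : smooth_fun f -> mktangent m w f = w f.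
    apply: mktangentE => [k g h sg sh|g h sg sh]; first by rewrite /w dfun_lin// bP.1.
    by rewrite /w dfun_mul// bP.1 bilinZl mulrC.
  exists (mktangent m w) => b'; have [f sf ->] := cotangent_dfun b'.
  by rewrite dfunE wE.
case: ex => v Hv; by rewrite /sharp; case: xgetP => [w _ //|/(_ v)].
Qed.

End Sharp.

Section RowSplit.
Variables (R : realType) (m n : nat).

Lemma delta_rshift (j : 'I_n) : delta_mx 0 (rshift m j) = row_mx 0 (delta_mx 0 j) :> 'rV[R]_(m + n).
Proof.
apply/rowP => i; rewrite -(splitK i); case: (fintype.split i) => k /=.
  by rewrite row_mxEl !mxE eqxx eq_lrshift.
by rewrite row_mxEr !mxE eqxx eq_rshift.
Qed.

Lemma delta_lshift (j : 'I_m) : delta_mx 0 (lshift n j) = row_mx (delta_mx 0 j) 0 :> 'rV[R]_(m + n).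
Proof.
apply/rowP => i; rewrite -(splitK i); case: (fintype.split i) => k /=.
  by rewrite row_mxEl !mxE eqxx eq_lshift.
by rewrite row_mxEr !mxE eqxx eq_rlshift.
Qed.

Lemma partial_rshift (F : 'rV[R]_(m + n) -> R) x y j :
  partial (rshift m j) F (row_mx x y) = partial j (fun y => F (row_mx x y)) y.
Proof.
rewrite /partial /derive.
have -> : (fun h : R => h^-1 *: ((F \o shift (row_mx x y)) (h *: delta_mx 0 (rshift m j)) - F (row_mx x y)))
  = (fun h : R => h^-1 *: (((fun y => F (row_mx x y)) \o shift y) (h *: delta_mx 0 j) - F (row_mx x y))); last by [].
by apply/funext => h /=; rewrite delta_rshift scale_row_mx scaler0 add_row_mx add0r.
Qed.

Lemma partial_lshift (F : 'rV[R]_(m + n) -> R) x y j :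
  partial (lshift n j) F (row_mx x y) = partial j (fun x => F (row_mx x y)) x.
Proof.
rewrite /partial /derive.
have -> : (fun h : R => h^-1 *: ((F \o shift (row_mx x y)) (h *: delta_mx 0 (lshift n j)) - F (row_mx x y)))
  = (fun h : R => h^-1 *: (((fun x => F (row_mx x y)) \o shift x) (h *: delta_mx 0 j) - F (row_mx x y))); last by [].
by apply/funext => h /=; rewrite delta_lshift scale_row_mx scaler0 add_row_mx add0r.
Qed.

Lemma CkV_row_mx l k (U : set 'rV[R]_l) (f : 'rV[R]_l -> 'rV[R]_m) (g : 'rV[R]_l -> 'rV[R]_n) :
  CkV k U f -> CkV k U g -> CkV k U (fun x => row_mx (f x) (g x)).
Proof.
move=> Cf Cg j; rewrite -(splitK j); case: (fintype.split j) => i /=.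
  by rewrite (_ : (fun _ => _) = (fun x => f x 0 i)) //; apply/funext => x; rewrite row_mxEl.
by rewrite (_ : (fun _ => _) = (fun x => g x 0 i)) //; apply/funext => x; rewrite row_mxEr.
Qed.

Lemma CkV_lsubmx k (U : set 'rV[R]_(m + n)) : CkV k U lsubmx.
Proof.
move=> j; rewrite (_ : (fun _ => _) = (fun x : 'rV[R]_(m + n) => x 0 (lshift n j))); first exact: Ck_coord.
by apply/funext => x; rewrite mxE.
Qed.

Lemma CkV_rsubmx k (U : set 'rV[R]_(m + n)) : CkV k U rsubmx.
Proof.
move=> j; rewrite (_ : (fun _ => _) = (fun x : 'rV[R]_(m + n) => x 0 (rshift m j))); first exact: Ck_coord.
by apply/funext => x; rewrite mxE.
Qed.

End RowSplit.

Lemma CkV_id (R : realType) n k (U : set 'rV[R]_n) : CkV k U id.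
Proof. by move=> j; exact: Ck_coord. Qed.

Lemma CkV_cst (R : realType) n m k (U : set 'rV[R]_n) (a : 'rV[R]_m) : CkV k U (fun=> a).
Proof. by move=> j; exact: Ck_cst. Qed.

(** * Functions of two variables *)

Section SmoothFun2.
Variables (R : realType) (L M : manifold R).

Definition pair_dom (c : chart R (mdim L) L) (c' : chart R (mdim M) M) :=
  [set x : 'rV[R]_(mdim L + mdim M) | chart_im c (lsubmx x) /\ chart_im c' (rsubmx x)].

(** Product manifolds are never formed: joint smoothness is tested in all products of charts, in the
    same form as [smooth_map2]. *)
Definition smooth_fun2 (F : L -> M -> R) := forall c c', atlas c -> atlas c' ->
  Cinf (pair_dom c c') (fun x => F (chart_inv c (lsubmx x)) (chart_inv c' (rsubmx x))).

Lemma pair_dom_open c c' : atlas c -> atlas c' -> open (pair_dom c c').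
Proof. exact: smooth_map2_dom_open. Qed.

Lemma pair_dom_mx c c' l m : chart_dom c l -> chart_dom c' m ->
  pair_dom c c' (row_mx (chart_map c l) (chart_map c' m)).
Proof. by move=> dl dm; rewrite /pair_dom /= row_mxKl row_mxKr; split; exact: chart_im_map. Qed.

(** In charts [v] is a combination of partials in the second group of variables, and these stay
    smooth in the first group. *)
Lemma smooth_fun2_tanr (F : L -> M -> R) (m : M) (v : tangent m) :
  smooth_fun2 F -> (forall l, smooth_fun (F l)) -> smooth_fun (fun l => v (F l)).
Proof.
move=> sF sFl; apply/smooth_funP => l.
have [c ac dl] := m_cover l; have [c' ac' dm] := m_cover m.
have [e e0 He] := chart_ball ac dl filterT.
exists c; split => //; exists e => // k.
pose Psi x := F (chart_inv c (lsubmx x)) (chart_inv c' (rsubmx x)).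
pose a := tcoord c' v.
apply: (@Ck_eq _ _ k _ (fun x => \sum_j a 0 j * (partial (rshift _ j) Psi \o (fun x => row_mx x (chart_map c' m))) x)).
- exact: ball_open.
- move=> x bx /=; rewrite (tan_expand ac' dm v (sFl _)) /dotp; apply: eq_bigr => j _; congr (_ * _).
  rewrite partial_rshift /dchart; congr (partial j _ _).
  by apply/funext => y; rewrite /Psi row_mxKl row_mxKr.
apply: Ck_sum; first exact: ball_open.
move=> j _; apply: Ck_mul; [exact: ball_open | exact: Ck_cst |].
apply: (@Ck_comp _ _ _ k _ (pair_dom c c')); [exact: ball_open | exact: pair_dom_open | | |].
- move=> x /He[imx _]; rewrite /pair_dom /= row_mxKl row_mxKr; split => //.
  exact: chart_im_map.
- by apply: CkV_row_mx; [exact: CkV_id | exact: CkV_cst].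
- exact: Ck_partial (sF c c' ac ac' k.+1).
Qed.

Lemma smooth_fun2_dchart_bounded (F : L -> M -> R) c c' l m : smooth_fun2 F ->
  atlas c -> atlas c' -> chart_dom c l -> chart_dom c' m ->
  exists e K : R, [/\ 0 < e, 0 <= K & forall x y, ball (chart_map c l) e x -> ball (chart_map c' m) e y ->
    [/\ chart_im c x, chart_im c' y &
     forall j, `|dchart c (chart_inv c x) (F^~ (chart_inv c' y)) j| <= K]].
Proof.
move=> sF ac ac' dl dm.
pose Psi x := F (chart_inv c (lsubmx x)) (chart_inv c' (rsubmx x)).
set z0 := row_mx (chart_map c l) (chart_map c' m).
have oD := pair_dom_open ac ac'; have Dz : pair_dom c c' z0 by exact: pair_dom_mx.
have cont j : {for z0, continuous (partial (lshift _ j) Psi)}.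
  exact: (Ck_cont (Ck_partial (lshift _ j) (sF c c' ac ac' 1%N)) Dz).
have : \forall z \near z0, pair_dom c c' z /\ forall j,
    `|partial (lshift _ j) Psi z0 - partial (lshift _ j) Psi z| <= 1.
  apply: filterI; first exact: open_nbhs_nbhs.
  have H j : \forall z \near z0, `|partial (lshift _ j) Psi z0 - partial (lshift _ j) Psi z| <= 1.
    have /cont_epsP/(_ 1 ltr01)[d d0 Hd] := cont j.
    by apply/nbhs_ballP; exists d => // z; rewrite -ball_normE; exact: Hd.
  by apply: (filter_forall _ H).
move=> /nbhs_ballP[e /= e0 He].
exists e, (1 + \sum_j `|partial (lshift _ j) Psi z0|); split => //.
  by rewrite addr_ge0// sumr_ge0.
move=> x y bx b_y.
have bx' : `|chart_map c l - x| < e by move: bx; rewrite -ball_normE.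
have by' : `|chart_map c' m - y| < e by move: b_y; rewrite -ball_normE.
have : ball z0 e (row_mx x y).
  rewrite -ball_normE /= /z0 opp_row_mx add_row_mx.
  rewrite -[`|_|]/(mx_norm _) mx_normrE; apply/bigmax_ltP; split=> // -[i k] _ /=.
  rewrite ord1 -(splitK k); case: (fintype.split k) => k' /=.
    rewrite row_mxEl; exact: le_lt_trans (ler_coord_norm _ _) bx'.
  rewrite row_mxEr; exact: le_lt_trans (ler_coord_norm _ _) by'.
move=> /He[[]]; rewrite row_mxKl row_mxKr => imx imy Hj; split => // j.
rewrite /dchart chart_invK//.
have -> : partial j (F^~ (chart_inv c' y) \o chart_inv c) x = partial (lshift _ j) Psi (row_mx x y).
  rewrite partial_lshift; apply: (congr1 (fun g => partial j g x)).
  by apply/funext => x'; rewrite /Psi row_mxKl row_mxKr.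
rewrite -(subrK (partial (lshift _ j) Psi z0) (partial _ _ _)) (le_trans (ler_normD _ _))//.
rewrite lerD//; first by rewrite distrC.
by rewrite (bigD1 j)//= lerDl sumr_ge0.
Qed.

End SmoothFun2.

Section SmoothFun2More.
Variables (R : realType).

Lemma smooth_map2_fun2 (L M N : manifold R) (F : L -> M -> N) (f : N -> R) :
  smooth_map2 F -> smooth_fun f -> smooth_fun2 (fun l m => f (F l m)).
Proof. by move=> /smooth_map2P H sf; exact: H. Qed.

Lemma smooth_fun2_comp (K L M : manifold R) (F : L -> M -> R) (u : K -> L) (v : K -> M) :
  smooth_fun2 F -> smooth_map u -> smooth_map v -> smooth_fun (fun k => F (u k) (v k)).
Proof.
move=> sF su sv; apply/smooth_funP => p.
have [b ab dp] := m_cover p.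
have [c ac dl] := m_cover (u p); have [c' ac' dm] := m_cover (v p).
have Wp : nbhs p (u @^-1` chart_dom c `&` v @^-1` chart_dom c').
  apply: filterI.
    by apply: (smooth_map_cont su); apply: open_nbhs_nbhs; split => //; exact: chart_dom_open.
  by apply: (smooth_map_cont sv); apply: open_nbhs_nbhs; split => //; exact: chart_dom_open.
have [e e0 He] := chart_ball ab dp Wp.
exists b; split => //; exists e => // k; set B := ball _ _ in He *.
have oB : open B by exact: ball_open.
have Cu j : Ck k B (fun x => chart_map c (u (chart_inv b x)) 0 j).
  apply/Ck_pointwise => x Bx; have [imx [du dv]] := He x Bx.
  have [_ /(_ c ac j k) H] := su b ab.
  by apply: Ck_subset H => y ->; split.
have Cv j : Ck k B (fun x => chart_map c' (v (chart_inv b x)) 0 j).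
  apply/Ck_pointwise => x Bx; have [imx [du dv]] := He x Bx.
  have [_ /(_ c' ac' j k) H] := sv b ab.
  by apply: Ck_subset H => y ->; split.
apply: (@Ck_eq _ _ k B ((fun x => F (chart_inv c (lsubmx x)) (chart_inv c' (rsubmx x))) \o
   (fun x => row_mx (chart_map c (u (chart_inv b x))) (chart_map c' (v (chart_inv b x)))))) => //.
  move=> x Bx; have [imx [du dv]] := He x Bx.
  by rewrite /= row_mxKl row_mxKr !chart_mapK.
apply: (@Ck_comp _ _ _ k B (pair_dom c c')) => //; first exact: pair_dom_open.
- move=> x Bx; have [imx [du dv]] := He x Bx; exact: pair_dom_mx.
- by apply: CkV_row_mx => j.
- exact: sF.
Qed.

Lemma smooth_map_cst (L M : manifold R) (m : M) : smooth_map (fun _ : L => m).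
Proof. by apply/smooth_mapP => f sf; exact: smooth_fun_cst. Qed.

Lemma smooth_fun2_r (L M : manifold R) (F : L -> M -> R) l : smooth_fun2 F -> smooth_fun (F l).
Proof. by move=> sF; exact: (smooth_fun2_comp sF (smooth_map_cst l) (@smooth_map_id R M)). Qed.

Lemma smooth_fun2_l (L M : manifold R) (F : L -> M -> R) m : smooth_fun2 F -> smooth_fun (F^~ m).
Proof. by move=> sF; exact: (smooth_fun2_comp sF (@smooth_map_id R L) (smooth_map_cst m)). Qed.

Lemma smooth_fun2_tan (L M : manifold R) (F : L -> M -> R) m (v : tangent m) :
  smooth_fun2 F -> smooth_fun (fun l => v (F l)).
Proof. by move=> sF; apply: smooth_fun2_tanr => // l; exact: smooth_fun2_r. Qed.

Lemma smooth_fun2_swap (L M : manifold R) (F : L -> M -> R) :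
  smooth_fun2 F -> smooth_fun2 (fun m l => F l m).
Proof.
move=> sF c c' ac ac' k.
apply: (@Ck_eq _ _ k _ ((fun x => F (chart_inv c' (lsubmx x)) (chart_inv c (rsubmx x))) \o
   (fun x => row_mx (rsubmx x) (lsubmx x)))).
- exact: pair_dom_open.
- by move=> x _ /=; rewrite row_mxKl row_mxKr.
apply: (@Ck_comp _ _ _ k _ (pair_dom c' c)); [exact: pair_dom_open | exact: pair_dom_open | | |].
- by move=> x [h1 h2]; rewrite /pair_dom /= row_mxKl row_mxKr.
- by apply: CkV_row_mx; [exact: CkV_rsubmx | exact: CkV_lsubmx].
- exact: sF.
Qed.

(** Both sides are the same combination of mixed second partials of one chart expression, up to the
    order of differentiation. *)
Lemma tan_swap (L M : manifold R) (F : L -> M -> R) l m (u : tangent l) (v : tangent m) :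
  smooth_fun2 F -> u (fun l => v (F l)) = v (fun m => u (F^~ m)).
Proof.
move=> sF; have [c ac dl] := m_cover l; have [c' ac' dm] := m_cover m.
have sFs := smooth_fun2_swap sF.
pose Psi x := F (chart_inv c (lsubmx x)) (chart_inv c' (rsubmx x)).
set a := tcoord c u; set b := tcoord c' v.
set z0 := row_mx (chart_map c l) (chart_map c' m).
have oD := pair_dom_open ac ac'; have Dz : pair_dom c c' z0 by exact: pair_dom_mx.
have C2 := sF c c' ac ac' 2%N; rewrite -/Psi in C2.
have E1 : u (fun l => v (F l)) = \sum_i a 0 i * \sum_j b 0 j * partial (lshift _ i) (partial (rshift _ j) Psi) z0.
  rewrite (tan_expand ac dl u (smooth_fun2_tan v sF)) /dotp; apply: eq_bigr => i _; congr (_ * _).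
  rewrite /dchart.
  have -> : ((fun l => v (F l)) \o chart_inv c) = fun x => \sum_j b 0 j * partial (rshift _ j) Psi (row_mx x (chart_map c' m)).
    apply/funext => x /=; rewrite (tan_expand ac' dm v (smooth_fun2_r _ sF)) /dotp.
    apply: eq_bigr => j _; congr (_ * _); rewrite partial_rshift /dchart; congr (partial j _ _).
    by apply/funext => y; rewrite /Psi row_mxKl row_mxKr.
  rewrite {1}/partial.
  have D j : is_derive (chart_map c l) (delta_mx 0 i) (fun x => b 0 j * partial (rshift _ j) Psi (row_mx x (chart_map c' m)))
     (b 0 j * partial (lshift _ i) (partial (rshift _ j) Psi) z0).
    apply: is_deriveZ; rewrite partial_lshift; apply: derivableP.
    pose U := [set x | pair_dom c c' (row_mx x (chart_map c' m))].
    have oU : open U.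
      rewrite (_ : U = setT `&` (fun x => row_mx x (chart_map c' m)) @^-1` pair_dom c c'); last by rewrite setTI.
      apply: open_preimage_within; [exact: openT|exact: pair_dom_open|].
      move=> x _; apply: (@CkV_cont _ _ _ 0 setT) => //.
      by apply: CkV_row_mx; [exact: CkV_id | exact: CkV_cst].
    have CU : Ck 1 U (fun x => partial (rshift _ j) Psi (row_mx x (chart_map c' m))).
      apply: (@Ck_comp _ _ _ 1 U (pair_dom c c') (fun x => row_mx x (chart_map c' m))) => //.
        by apply: CkV_row_mx; [exact: CkV_id | exact: CkV_cst].
      exact: Ck_partial C2.
    exact: (Ck_derivable CU Dz).
  rewrite (_ : (fun x => _) = \sum_j (fun x => b 0 j * partial (rshift _ j) Psi (row_mx x (chart_map c' m)))); last first.
    by apply/funext => x; rewrite fct_sumE.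
  by have [_ ->] := is_derive_sum D.
have E2 : v (fun m => u (F^~ m)) = \sum_j b 0 j * \sum_i a 0 i * partial (rshift _ j) (partial (lshift _ i) Psi) z0.
  rewrite (tan_expand ac' dm v (smooth_fun2_tan u sFs)) /dotp; apply: eq_bigr => j _; congr (_ * _).
  rewrite /dchart.
  have -> : ((fun m => u (F^~ m)) \o chart_inv c') = fun y => \sum_i a 0 i * partial (lshift _ i) Psi (row_mx (chart_map c l) y).
    apply/funext => y /=; rewrite (tan_expand ac dl u (smooth_fun2_l _ sF)) /dotp.
    apply: eq_bigr => i _; congr (_ * _); rewrite partial_lshift /dchart; congr (partial i _ _).
    by apply/funext => x; rewrite /Psi row_mxKl row_mxKr.
  rewrite {1}/partial.
  have D i : is_derive (chart_map c' m) (delta_mx 0 j) (fun y => a 0 i * partial (lshift _ i) Psi (row_mx (chart_map c l) y))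
     (a 0 i * partial (rshift _ j) (partial (lshift _ i) Psi) z0).
    apply: is_deriveZ; rewrite partial_rshift; apply: derivableP.
    pose U := [set y | pair_dom c c' (row_mx (chart_map c l) y)].
    have oU : open U.
      rewrite (_ : U = setT `&` (fun y => row_mx (chart_map c l) y) @^-1` pair_dom c c'); last by rewrite setTI.
      apply: open_preimage_within; [exact: openT|exact: pair_dom_open|].
      move=> x _; apply: (@CkV_cont _ _ _ 0 setT) => //.
      by apply: CkV_row_mx; [exact: CkV_cst | exact: CkV_id].
    have CU : Ck 1 U (fun y => partial (lshift _ i) Psi (row_mx (chart_map c l) y)).
      apply: (@Ck_comp _ _ _ 1 U (pair_dom c c') (fun y => row_mx (chart_map c l) y)) => //.
        by apply: CkV_row_mx; [exact: CkV_cst | exact: CkV_id].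
      exact: Ck_partial C2.
    exact: (Ck_derivable CU Dz).
  rewrite (_ : (fun y => _) = \sum_i (fun y => a 0 i * partial (lshift _ i) Psi (row_mx (chart_map c l) y))); last first.
    by apply/funext => x; rewrite fct_sumE.
  by have [_ ->] := is_derive_sum D.
rewrite E1 E2; under eq_bigr do rewrite mulr_sumr.
rewrite exchange_big /=; apply: eq_bigr => j _; rewrite mulr_sumr; apply: eq_bigr => i _.
by rewrite mulrCA (schwarz _ _ oD C2 Dz).
Qed.

End SmoothFun2More.

(** * Lie groups and fundamental vector fields *)

Section GroupFacts.
Variables (R : realType) (G : lieGroup R).
Implicit Types (a b : G).
Local Notation "a ** b" := (lg_mul a b) (at level 40, left associativity).
Local Notation one := (lg_one G).
Local Notation inv := (@lg_inv R G).

Lemma lgA a b (x : G) : a ** (b ** x) = a ** b ** x. Proof. exact: lg_mulA. Qed.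
Lemma lg1m a : one ** a = a. Proof. exact: lg_mul1. Qed.
Lemma lgVm a : inv a ** a = one. Proof. exact: lg_mulV. Qed.

Lemma lgmV a : a ** inv a = one.
Proof. by rewrite -[a ** inv a]lg1m -{1}(lgVm (inv a)) -lgA (lgA (inv a)) lgVm lg1m lgVm. Qed.

Lemma lgm1 a : a ** one = a.
Proof. by rewrite -(lgVm a) lgA lgmV lg1m. Qed.

Lemma lgVK a b : inv a ** (a ** b) = b.
Proof. by rewrite lgA lgVm lg1m. Qed.

Lemma lgKV a b : a ** (inv a ** b) = b.
Proof. by rewrite lgA lgmV lg1m. Qed.

Lemma lgmK a b : b ** a ** inv a = b.
Proof. by rewrite -lgA lgmV lgm1. Qed.

Lemma lgmVK a b : b ** inv a ** a = b.
Proof. by rewrite -lgA lgVm lgm1. Qed.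

Lemma lg_inv_uniq a b : a ** b = one -> b = inv a.
Proof. by move=> h; rewrite -(lgVK a b) h lgm1. Qed.

Lemma lg_invK a : inv (inv a) = a.
Proof. by apply/esym/lg_inv_uniq; rewrite lgVm. Qed.

Lemma lg_inv1 : inv one = one.
Proof. by apply/esym/lg_inv_uniq; rewrite lg1m. Qed.

Lemma smooth_mul2 (f : G -> R) : smooth_fun f -> smooth_fun2 (fun a b => f (a ** b)).
Proof. exact: smooth_map2_fun2 (@lg_mul_smooth R G). Qed.

Lemma smooth_lmul a : smooth_map (lg_mul a : G -> G).
Proof. by apply/smooth_mapP => f sf; exact: (smooth_fun2_r a (smooth_mul2 sf)). Qed.

Lemma smooth_rmul b : smooth_map (fun a : G => a ** b).
Proof. by apply/smooth_mapP => f sf; exact: (smooth_fun2_l b (smooth_mul2 sf)). Qed.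

Lemma smooth_map_mul (M : manifold R) (u v : M -> G) : smooth_map u -> smooth_map v ->
  smooth_map (fun m => u m ** v m).
Proof.
by move=> su sv; apply/smooth_mapP => f sf; exact: (smooth_fun2_comp (smooth_mul2 sf) su sv).
Qed.

Lemma left_invariant_smooth (X : lie G) (f : G -> R) : smooth_fun f -> smooth_fun (left_invariant X f).
Proof. by move=> sf; exact: (smooth_fun2_tan X (smooth_mul2 sf)). Qed.

Definition integral_curve (X : lie G) (d : R) (u : R -> G) :=
  forall t : R, `|t| <= d -> forall f, smooth_fun f -> is_derive t (1 : R) (f \o u) (left_invariant X f (u t)).

Lemma is_derive_affine (f : R -> R) (a b t d : R) : is_derive (a * t + b) (1 : R) f d ->
  is_derive t (1 : R) (fun s => f (a * s + b)) (a * d).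
Proof.
move=> Df.
have Dg : is_derive t (1 : R) (fun s : R => a * s + b) a.
  have := is_deriveD (is_deriveZ a (@is_derive_id R R t 1)) (@is_derive_cst R R R b t 1).
  by rewrite addr0 /GRing.scale /= mulr1; exact.
have := @is_derive1_comp R f (fun s => a * s + b) t _ _ Df Dg.
by rewrite mulrC.
Qed.

Lemma is_derive_mull (f : R -> R) (a t d : R) : is_derive (a * t) (1 : R) f d ->
  is_derive t (1 : R) (fun s => f (a * s)) (a * d).
Proof.
move=> H; have := @is_derive_affine f a 0 t d; rewrite addr0 => /(_ H).
by rewrite (_ : (fun s => f (a * s + 0)) = (fun s => f (a * s))) //; apply/funext => s; rewrite addr0.
Qed.

Definition linv_coord (c : chart R (mdim G) G) (X : lie G) (x : 'rV[R]_(mdim G)) : 'rV[R]_(mdim G) :=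
  \row_i left_invariant X (coord_ext c one i) (chart_inv c x).

Section AtUnit.
Variables (c : chart R (mdim G) G) (ac : atlas c) (d1 : chart_dom c one).
Local Notation x0 := (chart_map c one).

Lemma unit_chart_ball : exists2 e : R, 0 < e & forall x, ball x0 e x ->
  chart_im c x /\ \forall q \near chart_inv c x, forall i, coord_ext c one i q = chart_map c q 0 i.
Proof.
have H : \forall q \near one, forall i, coord_ext c one i q = chart_map c q 0 i.
  by apply: filter_forall => i; have [] := coord_extP ac d1 i.
exact: (chart_ball ac d1 (nbhs_interior H)).
Qed.

Lemma linv_Ck (X : lie G) k : CkV k (chart_im c) (linv_coord c X).
Proof.
move=> i; rewrite (_ : (fun _ => _) = left_invariant X (coord_ext c one i) \o chart_inv c).
  by apply: (left_invariant_smooth X _ ac); have [] := coord_extP ac d1 i.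
by apply/funext => x; rewrite mxE.
Qed.

Lemma tan_expand_ext (p : G) (dp : chart_dom c p) (v : tangent p) f (g : 'I_(mdim G) -> G -> R) :
  smooth_fun f -> (forall i, smooth_fun (g i)) ->
  (\forall q \near p, forall i, g i q = chart_map c q 0 i) ->
  v f = \sum_i v (g i) * dchart c p f i.
Proof.
move=> sf sg gE; rewrite (tan_expand ac dp v sf) /dotp; apply: eq_bigr => i _; congr (_ * _).
have [sx xE] := coord_extP ac dp i.
rewrite mxE; apply: tan_local => //.
by apply: filterS (filterI gE xE) => q [-> ->].
Qed.

Lemma integral_curve_of_coord (X : lie G) (e d s : R) (u : R -> 'rV[R]_(mdim G)) :
  (forall x, ball x0 e x -> chart_im c x /\ \forall q \near chart_inv c x, forall i, coord_ext c one i q = chart_map c q 0 i) ->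
  (forall t : R, `|t| <= d -> ball x0 e (u t) /\ is_derive t (1 : R) u (s *: linv_coord c X (u t))) ->
  integral_curve (s *: X) d (chart_inv c \o u).
Proof.
move=> He Hu t td f sf; have [bu Du] := Hu t td; have [imu ext] := He _ bu.
have dp := chart_inv_dom ac imu.
have E : left_invariant (s *: X) f (chart_inv c (u t)) =
   \sum_i s * linv_coord c X (u t) 0 i * dchart c (chart_inv c (u t)) f i.
  pose v : tangent (chart_inv c (u t)) := mktangent _ (fun f => (s *: X) (f \o lg_mul (chart_inv c (u t)))).
  have vE h : smooth_fun h -> v h = (s *: X) (h \o lg_mul (chart_inv c (u t))).
    move=> sh; have sl g : smooth_fun g -> smooth_fun (g \o lg_mul (chart_inv c (u t))).
      by move: g; apply/smooth_mapP; exact: smooth_lmul.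
    apply: mktangentE => //.
      by move=> k g g' sg sg'; exact: (tan_lin _ k (sl _ sg) (sl _ sg')).
    move=> g g' sg sg'; have := tan_mul (s *: X) (sl _ sg) (sl _ sg'); rewrite /= lgm1; exact.
  rewrite /left_invariant -vE// (@tan_expand_ext _ dp v f (coord_ext c one))//; last first.
    by move=> i; have [] := coord_extP ac d1 i.
  apply: eq_bigr => i _; congr (_ * _); rewrite vE; last by have [] := coord_extP ac d1 i.
  by rewrite mxE.
rewrite E.
have oim := chart_im_open ac.
have Cf : Ck 1 (chart_im c) (f \o chart_inv c) := sf c ac 1%N.
have [df dE] := Ck1_diff oim Cf imu.
have du : differentiable u t by apply/derivable1_diffP; case: Du.
have Eu : 'D_1 u t = s *: linv_coord c X (u t) by case: Du.
have -> : f \o (chart_inv c \o u) = (f \o chart_inv c) \o u by [].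
split; first exact/diff_derivable/differentiable_comp.
rewrite deriveE; last exact: differentiable_comp.
rewrite diff_comp //= dE -(deriveE _ du) Eu /dotp; apply: eq_bigr => i _.
by rewrite mxE /dchart chart_invK.
Qed.

(** Passing from [X] to [s *: X] trades a short time of existence for the unit interval on which
    [ode_local] works. *)
Lemma integral_curve_exists (X : lie G) (r : R) : 0 < r -> exists s : R, [/\ 0 < s &
   exists u : R -> 'rV[R]_(mdim G), [/\ u 0 = x0, forall t, `|t| <= 1 -> ball x0 r (u t) &
     integral_curve (s *: X) 1 (chart_inv c \o u)]].
Proof.
move=> r0; have [e e0 He] := unit_chart_ball.
have oim := chart_im_open ac.
have [r1 [L [r10 L0 r1im HL]]] := CkV_lipschitz oim (linv_Ck X 1%N) (chart_im_map d1).
pose rho := Num.min r (Num.min e r1) / 2.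
have m0 : 0 < Num.min r (Num.min e r1) by rewrite !lt_min r0 e0 r10.
have rho0 : 0 < rho by rewrite divr_gt0.
have rhom : rho < Num.min r (Num.min e r1) by rewrite ltr_pdivrMr// ltr_pMr ?ltr1n.
have [rr [re rr1]] : rho < r /\ rho < e /\ rho < r1.
  by move: rhom; rewrite !lt_min => /andP[-> /andP[-> ->]].
have b1 x : `|x - x0| <= rho -> ball x0 r1 x.
  by rewrite -ball_normE /= distrC => /le_lt_trans; apply.
set F := linv_coord c X in HL.
pose K := `|F x0| + L * rho.
have K0 : 0 <= K by rewrite addr_ge0// mulr_ge0// ltW.
have D0 : 0 < 2 * (L + K / rho + 1).
  by rewrite mulr_gt0// ltr_wpDl// addr_ge0// divr_ge0// ltW.
(* Small enough that [s *: F] is 1/2-Lipschitz and bounded by [rho] on the closed ball of radius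
   [rho], where [K] bounds [F]. *)
pose s := (2 * (L + K / rho + 1))^-1.
have s0 : 0 < s by rewrite invr_gt0.
have sL : s * L <= 2^-1.
  rewrite /s mulrC ler_pdivrMr// mulrA mulVf// mul1r; have : 0 <= K / rho by rewrite divr_ge0// ltW.
  lra.
have sK : s * K <= rho.
  rewrite /s mulrC ler_pdivrMr//.
  have -> : rho * (2 * (L + K / rho + 1)) = 2 * (rho * L) + 2 * K + 2 * rho.
    by field; rewrite gt_eqF.
  have : 0 <= rho * L by rewrite mulr_ge0// ltW.
  lra.
have [| |u u0 Hu] := @ode_local R _ (fun x => s *: F x) x0 rho (ltW rho0).
- move=> x y /b1 bx /b1 b_y; rewrite -scalerBr normrZ gtr0_norm//.
  apply: (@le_trans _ _ (s * (L * `|x - y|))); first by rewrite ler_pM2l//; exact: HL.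
  by rewrite mulrA mulrC ler_wpM2l.
- move=> x xr; rewrite normrZ gtr0_norm//; apply: le_trans sK; rewrite ler_pM2l//.
  have := HL x0 x (ballxx _ r10) (b1 _ xr); have : L * `|x - x0| <= L * rho by rewrite ler_wpM2l.
  have := ler_normD (F x - F x0) (F x0); rewrite subrK /K; lra.
have bu t : `|t| <= 1 -> ball x0 r (u t) /\ ball x0 e (u t).
  move=> t1; have [h _] := Hu t t1; rewrite -!ball_normE /= distrC.
  by split; apply: le_lt_trans h _.
exists s; split => //; exists u; split => //; first by move=> t /bu[].
apply: (@integral_curve_of_coord X e 1 s) => // t t1.
by split; [have [] := bu t t1 | have [] := Hu t t1].
Qed.

(** Reparametrized by [0, 1], the difference of the two curves satisfies [small_gronwall] with
    [A = 0] as soon as [|t| * L <= 1/2], which is the role of [d']. Coordinates are read through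
    [coord_ext], because the curves are only known to be differentiable on global functions. *)
Lemma integral_curve_unique (X : lie G) : exists r d' : R, [/\ 0 < r, 0 < d' &
  forall (d : R) (u v : R -> G), u 0 = v 0 -> integral_curve X d u -> integral_curve X d v ->
  (forall t, `|t| <= d -> [/\ chart_dom c (u t), ball x0 r (chart_map c (u t)), chart_dom c (v t) & ball x0 r (chart_map c (v t))]) ->
  forall t, `|t| <= d -> `|t| <= d' -> u t = v t].
Proof.
have [e e0 He] := unit_chart_ball.
have oim := chart_im_open ac.
have [r1 [L [r10 L0 r1im HL]]] := CkV_lipschitz oim (linv_Ck X 1%N) (chart_im_map d1).
pose d' := (2 * (L + 1))^-1.
exists (Num.min e r1), d'; split.
- by rewrite lt_min e0.
- by rewrite invr_gt0 mulr_gt0// ltr_wpDl.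
move=> d u v uv0 Du Dv Huv t td td'.
have d'L : d' * L <= 2^-1.
  by rewrite /d' mulrC ler_pdivrMr ?mulr_gt0 ?ltr_wpDl// mulrA mulVf// mul1r lerDl.
have DC (w : R -> G) (s : R) : (forall s : R, `|s| <= d -> chart_dom c (w s) /\ ball x0 e (chart_map c (w s))) ->
  integral_curve X d w ->
  0 <= s <= 1 -> is_derive s (1 : R) (fun s => (\row_i coord_ext c one i (w (t * s)) : 'rV[R]_(mdim G)))
     (t *: linv_coord c X (chart_map c (w (t * s)))) /\
     (\row_i coord_ext c one i (w (t * s)) = chart_map c (w (t * s)) :> 'rV[R]_(mdim G)).
  move=> Hw Dw /andP[s0 s1].
  have tsd : `|t * s| <= d by rewrite normrM (ger0_norm s0); apply: le_trans td; rewrite ler_piMr.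
  have [dw bw] := Hw _ tsd; have [_ ext] := He _ bw; rewrite chart_mapK// in ext.
  split; last by apply/rowP => i; rewrite mxE (nbhs_singleton ext).
  apply/is_derive_rowP => i; rewrite (_ : (fun s => _) = fun s => (coord_ext c one i \o w) (t * s)).
    rewrite !mxE chart_mapK//; apply: is_derive_mull; apply: Dw => //.
    by have [] := coord_extP ac d1 i.
  by apply/funext => s'; rewrite mxE.
pose U s : 'rV[R]_(mdim G) := \row_i coord_ext c one i (u (t * s)).
pose V s : 'rV[R]_(mdim G) := \row_i coord_ext c one i (v (t * s)).
have Hu (s : R) : `|s| <= d -> chart_dom c (u s) /\ ball x0 e (chart_map c (u s)).
  by move=> /Huv[h1 h2 _ _]; split => //; apply: le_ball h2; rewrite ge_min lexx.
have Hv (s : R) : `|s| <= d -> chart_dom c (v s) /\ ball x0 e (chart_map c (v s)).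
  by move=> /Huv[_ _ h1 h2]; split => //; apply: le_ball h2; rewrite ge_min lexx.
have := @small_gronwall R _ (fun s => U s - V s)
  (fun s => t *: linv_coord c X (chart_map c (u (t * s))) - t *: linv_coord c X (chart_map c (v (t * s)))) 0.
move=> /(_ _ _ _ 1); rewrite ler01 lexx mulr0 => H.
have : `|U 1 - V 1| <= 0.
  apply: H => //.
  - by move=> s s01; apply: is_deriveB; [have [] := DC u s Hu Du s01 | have [] := DC v s Hv Dv s01].
  - by apply/rowP => i; rewrite !mxE mulr0 uv0 subrr.
  move=> s s01; rewrite addr0 -scalerBr normrZ.
  have [_ EU] := DC u s Hu Du s01; have [_ EV] := DC v s Hv Dv s01.
  rewrite /U /V EU EV; have /andP[s0 s1] := s01.
  have tsd : `|t * s| <= d by rewrite normrM (ger0_norm s0); apply: le_trans td; rewrite ler_piMr.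
  have [_ b1 _ b2] := Huv _ tsd.
  have := HL (chart_map c (v (t * s))) (chart_map c (u (t * s))).
  move=> /(_ (le_ball _ b2) (le_ball _ b1)); rewrite !ge_min lexx !orbT => /(_ isT isT) HL'.
  apply: (@le_trans _ _ (d' * (L * `|chart_map c (u (t * s)) - chart_map c (v (t * s))|))).
    by rewrite ler_pM.
  by rewrite mulrA mulrC ler_wpM2l.
rewrite normr_le0 subr_eq0 => /eqP E.
have one01 : 0 <= (1 : R) <= 1 by rewrite ler01 lexx.
have [_ EU] := DC u 1 Hu Du one01; have [_ EV] := DC v 1 Hv Dv one01.
move: E; rewrite /U /V EU EV mulr1 => /(congr1 (chart_inv c)).
have [du _] := Hu t td; have [dv _] := Hv t td.
by rewrite !chart_mapK.
Qed.

End AtUnit.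
End GroupFacts.

Lemma continuous_of_smooth (R : realType) (T : topologicalType) (M : manifold R) (u : T -> M) (t : T) :
  (forall f, smooth_fun f -> {for t, continuous (f \o u)}) -> {for t, continuous u}.
Proof.
move=> H W /= Wu; have [g [sg g1 g0]] := smooth_bump Wu.
have g1x : (g \o u) t = 1 := nbhs_singleton g1.
have : \forall y \near t, 0 < (g \o u) y.
  apply: (H g sg [set z | 0 < z]); apply: open_nbhs_nbhs; split; first exact: open_gt.
  by change (0 < (g \o u) t); rewrite g1x.
move=> hg; suff : \forall y \near t, W (u y) by [].
apply: filterS hg => y; case: (pselect (W (u y))) => // nW.
by rewrite /= g0 ?ltxx.
Qed.

Lemma smooth_map2_nbhs (R : realType) (L M N : manifold R) (F : L -> M -> N) l m (W : set N) :
  smooth_map2 F -> nbhs (F l m) W ->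
  exists V1 V2, [/\ nbhs l V1, nbhs m V2 & forall x y, V1 x -> V2 y -> W (F x y)].
Proof.
move=> sF WF; have [g [sg g1 g0]] := smooth_bump WF.
have sg2 := smooth_map2_fun2 sF sg.
have [c ac dl] := m_cover l; have [c' ac' dm] := m_cover m.
have Dz := pair_dom_mx dl dm.
have cont := Ck_cont (sg2 c c' ac ac' 0%N) Dz.
have /cont_epsP/(_ (2^-1))[|d d0 Hd] := cont; first by rewrite invr_gt0.
have d20 : 0 < d / 2 by rewrite divr_gt0.
pose V1 := chart_dom c `&` chart_map c @^-1` ball (chart_map c l) (d / 2).
pose V2 := chart_dom c' `&` chart_map c' @^-1` ball (chart_map c' m) (d / 2).
exists V1, V2; split.
- apply: filterI; first by apply: open_nbhs_nbhs; split => //; exact: chart_dom_open.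
  by apply: (chart_map_cont ac dl); exact: nbhsx_ballx.
- apply: filterI; first by apply: open_nbhs_nbhs; split => //; exact: chart_dom_open.
  by apply: (chart_map_cont ac' dm); exact: nbhsx_ballx.
move=> x y [dx bx] [dy b_y]; apply: contrapT => nW.
have := Hd (row_mx (chart_map c x) (chart_map c' y)).
rewrite !row_mxKl !row_mxKr !chart_mapK// (nbhs_singleton g1) (g0 _ nW) subr0 normr1.
have -> : (1 <= 2^-1 :> R) = false by apply/negbTE; rewrite -ltNge invf_lt1// ltr1n.
suff h : `|row_mx (chart_map c l) (chart_map c' m) - row_mx (chart_map c x) (chart_map c' y)| < d by move=> /(_ h).
rewrite opp_row_mx add_row_mx; apply: (@le_lt_trans _ _ (d / 2)); last first.
  by rewrite ltr_pdivrMr// ltr_pMr// ltr1n.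
apply: norm_row_le => [|k]; first exact: ltW.
rewrite -(splitK k); case: (fintype.split k) => k' /=.
  rewrite row_mxEl; apply: le_trans (ler_coord_norm _ _) _.
  by move: bx; rewrite /= -ball_normE => /ltW.
rewrite row_mxEr; apply: le_trans (ler_coord_norm _ _) _.
by move: b_y; rewrite /= -ball_normE => /ltW.
Qed.

(** * One-parameter subgroups *)

Section OneParameter.
Variables (R : realType) (G : lieGroup R).
Implicit Types (a b : G) (X : lie G).
Local Notation "a ** b" := (lg_mul a b) (at level 40, left associativity).
Local Notation one := (lg_one G).

Definition hom_curve (u : R -> G) := forall s t, u (s + t) = u s ** u t.

Lemma hom_curve0 u : hom_curve u -> u 0 = one.
Proof. by move=> h; have := h 0 0; rewrite addr0 => /(congr1 (lg_mul (lg_inv (u 0)))); rewrite lgVm lgVK. Qed.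

Lemma integral_curve_cont X d (u : R -> G) (t : R) : integral_curve X d u -> `|t| <= d -> {for t, continuous u}.
Proof.
by move=> H td; apply: continuous_of_smooth => f sf; exact: is_derive1_cont (H t td f sf).
Qed.

Lemma left_invariant_lmul X a (f : G -> R) b :
  left_invariant X (f \o lg_mul a) b = left_invariant X f (a ** b).
Proof. by rewrite /left_invariant; congr (tangent_fun X); apply/funext => x /=; rewrite lgA. Qed.

Lemma hom_integral_curve X (u : R -> G) : hom_curve u ->
  (forall f, smooth_fun f -> is_derive (0 : R) (1 : R) (f \o u) (X f)) ->
  forall (t : R) f, smooth_fun f -> is_derive t (1 : R) (f \o u) (left_invariant X f (u t)).
Proof.
move=> hu Du t f sf.
have sf' : smooth_fun (f \o lg_mul (u t)) by have /smooth_mapP := smooth_lmul (u t); exact.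
have := @is_derive_affine R ((f \o lg_mul (u t)) \o u) 1 (- t) t (X (f \o lg_mul (u t))).
rewrite !mul1r subrr => /(_ (Du _ sf')).
rewrite (_ : (fun s => _) = f \o u) //.
by apply/funext => s /=; rewrite mul1r -hu addrC subrK.
Qed.

Lemma is_derive_row1 (phi : R -> R) (x : 'rV[R]_1) d :
  is_derive (x 0 0) (1 : R) phi d ->
  is_derive x (delta_mx 0 0 : 'rV[R]_1) (fun x : 'rV[R]_1 => phi (x 0 0)) d.
Proof.
have E : (fun h : R => h^-1 *: (((fun x : 'rV[R]_1 => phi (x 0 0)) \o shift x) (h *: delta_mx 0 0) - phi (x 0 0)))
  = (fun h : R => h^-1 *: ((phi \o shift (x 0 0)) (h *: (1 : R)) - phi (x 0 0))).
  by apply/funext => h /=; rewrite !mxE eqxx.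
by move=> [D1 D2]; split; [rewrite /derivable E | rewrite /derive E].
Qed.

(** The homomorphism property carries the derivative at 0 to all times, and the derivative of
    [f \o u] is again a smooth function composed with [u]; smoothness follows by induction on the
    order. *)
Lemma hom_one_parameter X (u : R -> G) : hom_curve u ->
  (forall f, smooth_fun f -> is_derive (0 : R) (1 : R) (f \o u) (X f)) -> one_parameter X u.
Proof.
move=> hu Du; have D := hom_integral_curve hu Du.
split => //; last by move=> f sf; rewrite derive1E; have [_ ->] := Du f sf.
apply/smooth_onP; first exact: openT.
move=> f sf k; elim: k f sf => [|k IH] f sf.
  split => // x _.
  apply: (@continuous_comp _ _ _ (fun x : 'rV[R]_1 => x 0 0) (f \o u)).
    exact: coord_continuous.
  exact: is_derive1_cont (D (x 0 0) f sf).
split.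
  move=> x _; apply: (@continuous_comp _ _ _ (fun x : 'rV[R]_1 => x 0 0) (f \o u)).
    exact: coord_continuous.
  exact: is_derive1_cont (D (x 0 0) f sf).
have D' (i : 'I_1) (x : 'rV[R]_1) : is_derive x (delta_mx 0 i : 'rV[R]_1) (f \o (fun x : 'rV[R]_1 => u (x 0 0))) (left_invariant X f (u (x 0 0))).
  by rewrite ord1; exact: (is_derive_row1 (D (x 0 0) f sf)).
move=> i; split; first by move=> x _; have [] := D' i x.
apply: (@Ck_eq _ _ k setT ((left_invariant X f) \o (fun x : 'rV[R]_1 => u (x 0 0)))).
- exact: openT.
- by move=> x _; have [_ E] := D' i x; rewrite /partial E.
- exact: (IH _ (left_invariant_smooth X sf)).
Qed.

Lemma one_parameter_derive X u : one_parameter X u -> hom_curve u /\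
  forall f, smooth_fun f -> is_derive (0 : R) (1 : R) (f \o u) (X f).
Proof.
move=> [su hu Du]; split => // f sf.
have /smooth_onP := su; move=> /(_ openT f sf 1%N) C1.
pose L (t : R) : 'rV[R]_1 := t *: delta_mx 0 0.
have D : is_derive (0 : R) (1 : R) (f \o u) ('D_(delta_mx 0 0) (f \o (fun x : 'rV[R]_1 => u (x 0 0))) (0 + (0 : R) *: delta_mx 0 0)).
  have := @is_derive_line R 1 (f \o (fun x : 'rV[R]_1 => u (x 0 0))) 0 (delta_mx 0 0) 0.
  rewrite (_ : (fun s => _) = f \o u); last first.
    by apply/funext => s /=; rewrite add0r mxE mxE !eqxx mulr1.
  apply; exact: (Ck_derivable C1 I).
have [d E] := D; split => //.
by rewrite -derive1E Du.
Qed.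

(** The power a^(2^k); doubling is the only rescaling needed to extend local homomorphisms. *)
Definition sq (k : nat) (a : G) : G := iter k (fun a => a ** a) a.

Lemma sqM k a b : a ** b = b ** a -> sq k (a ** b) = sq k a ** sq k b.
Proof.
move=> ab; suff [] : sq k (a ** b) = sq k a ** sq k b /\ sq k a ** sq k b = sq k b ** sq k a by [].
elim: k => [|k [IH1 IH2]] //=; rewrite -!/(sq k _) IH1; set x := sq k a in IH1 IH2 *; set y := sq k b in IH1 IH2 *.
have E : x ** y ** (x ** y) = x ** x ** (y ** y) by rewrite -!lgA (lgA y) -IH2 !lgA.
split => //; rewrite -E IH2 -!lgA; congr (y ** _).
by rewrite !lgA IH2.
Qed.

Lemma sqS k a : sq k.+1 a = sq k (a ** a).
Proof. by rewrite /sq iterSr. Qed.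

Lemma hom_curve_sq u k t : hom_curve u -> u t = sq k (u (t / 2 ^+ k)).
Proof.
move=> hu; elim: k t => [|k IH] t; first by rewrite expr0 divr1.
rewrite sqS -hu IH; congr (sq k (u _)).
by rewrite exprS invfM mulrA mulrAC -mulrDr (_ : 2^-1 + 2^-1 = 1 :> R) ?mulr1//; lra.
Qed.

Lemma local_agree_unique u v (d : R) : 0 < d -> hom_curve u -> hom_curve v ->
  (forall t, `|t| <= d -> u t = v t) -> u = v.
Proof.
move=> d0 hu hv H; apply/funext => t.
have [k Hk] : exists k : nat, `|t| / d < k%:R.
  by exists (Num.bound (`|t| / d)); apply: archi_boundP; rewrite divr_ge0// ltW.
rewrite (hom_curve_sq k t hu) (hom_curve_sq k t hv) H//.
rewrite normrM normfV (ger0_norm (exprn_ge0 k _))// ler_pdivrMr ?exprn_gt0//.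
rewrite mulrC -ler_pdivrMr// ltW// (lt_trans Hk)//; exact: exp2_gtn.
Qed.

Lemma curve_near (u : R -> G) (W : set G) : {for (0 : R), continuous u} -> nbhs (u 0) W ->
  exists2 d : R, 0 < d & forall t, `|t| <= d -> W (u t).
Proof.
move=> uc Wu; have /nbhs_ballP[d /= d0 Hd] := uc _ Wu.
exists (d / 2); first by rewrite divr_gt0.
move=> t td; apply: Hd; rewrite -ball_normE /= sub0r normrN.
by apply: le_lt_trans td _; rewrite ltr_pdivrMr// ltr_pMr// ltr1n.
Qed.

Lemma one_parameter_unique X u v : one_parameter X u -> one_parameter X v -> u = v.
Proof.
move=> /one_parameter_derive[hu Du] /one_parameter_derive[hv Dv].
have [c ac d1] := m_cover one.
have [r [d' [r0 d'0 U]]] := integral_curve_unique ac d1 X.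
have Iu d : integral_curve X d u by move=> t _ f sf; exact: hom_integral_curve.
have Iv d : integral_curve X d v by move=> t _ f sf; exact: hom_integral_curve.
pose W := chart_dom c `&` chart_map c @^-1` ball (chart_map c one) r.
have W1 : nbhs one W.
  apply: filterI; first by apply: open_nbhs_nbhs; split => //; exact: chart_dom_open.
  by apply: (chart_map_cont ac d1); exact: nbhsx_ballx.
have cont w : (forall d, integral_curve X d w) -> {for (0 : R), continuous w}.
  by move=> Iw; apply: (integral_curve_cont (Iw 0)); rewrite normr0.
have [e1 e10 H1] : exists2 d : R, 0 < d & forall t, `|t| <= d -> W (u t).
  by apply: curve_near; [exact: cont | rewrite hom_curve0].
have [e2 e20 H2] : exists2 d : R, 0 < d & forall t, `|t| <= d -> W (v t).
  by apply: curve_near; [exact: cont | rewrite hom_curve0].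
pose e := Num.min d' (Num.min e1 e2).
have e0 : 0 < e by rewrite !lt_min d'0 e10.
apply: (local_agree_unique e0 hu hv) => t te.
have [ed [ee1 ee2]] : e <= d' /\ e <= e1 /\ e <= e2.
  by rewrite /e !ge_min !lexx !orbT.
apply: (U e u v) => //; first by rewrite !hom_curve0.
  move=> s se; have [h1 h2] := H1 s (le_trans se ee1); have [h3 h4] := H2 s (le_trans se ee2).
  by split.
exact: le_trans te ed.
Qed.

(** The integral curve of a small multiple of [X] is a local homomorphism, as its translates solve
    the same equation. Repeated squaring extends it to the line, and the multiple is undone by
    rescaling time. *)
Lemma one_parameter_exists X : exists u, one_parameter X u.
Proof.
have [c ac d1] := m_cover one.
have [s [s0 [w [w0 _ Iu]]]] := integral_curve_exists ac d1 X ltr01.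
set u := chart_inv c \o w in Iu; set Y := s *: X in Iu.
have u0 : u 0 = one by rewrite /u /= w0 chart_mapK.
have [r [d' [r0 d'0 U]]] := integral_curve_unique ac d1 Y.
pose W := chart_dom c `&` chart_map c @^-1` ball (chart_map c one) r.
have W1 : nbhs one W.
  apply: filterI; first by apply: open_nbhs_nbhs; split => //; exact: chart_dom_open.
  by apply: (chart_map_cont ac d1); exact: nbhsx_ballx.
have W11 : nbhs (one ** one) W by rewrite lg1m.
have [V1 [V2 [nV1 nV2 V12]]] := smooth_map2_nbhs (@lg_mul_smooth R G) W11.
have uc : {for (0 : R), continuous u} by apply: (integral_curve_cont Iu); rewrite normr0.
have [e e0 He] : exists2 d : R, 0 < d & forall t, `|t| <= d -> (W `&` (V1 `&` V2)) (u t).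
  by apply: curve_near => //; rewrite u0; apply: filterI => //; exact: filterI.
(* 1/2 keeps sums of two parameters in [-1, 1], where [u] solves the equation; [d'] is the time of
   uniqueness; [e / 2] keeps such sums where [u] lies in the ball [W]. *)
pose d := Num.min (2^-1) (Num.min d' (e / 2)).
have dd0 : 0 < d by rewrite !lt_min invr_gt0 d'0 divr_gt0// ltr0n.
have [h2 [hd' he]] : d <= 2^-1 /\ d <= d' /\ d <= e / 2 by rewrite /d !ge_min !lexx !orbT.
(* Both sides are, as functions of [b], integral curves of the same left-invariant field with the
   same value at [b = 0]. *)
have loc (a b : R) : `|a| <= d -> `|b| <= d -> u (a + b) = u a ** u b.
  move=> ad bd.
  have ad1 (t : R) : `|t| <= d -> `|a + t| <= 1.
    by move=> td; apply: le_trans (ler_normD _ _) _; move: h2 ad td; lra.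
  apply: (U d (fun t => u (a + t)) (fun t => u a ** u t)) => //.
  - by rewrite addr0 u0 lgm1.
  - move=> t td f sf; have := Iu (a + t) (ad1 t td) f sf.
    have := @is_derive_affine R (f \o u) 1 a t (left_invariant Y f (u (a + t))).
    rewrite !mul1r (addrC t a) => H /H.
    by rewrite (_ : (fun s => _) = f \o (fun t => u (a + t))) //; apply/funext => z /=; rewrite mul1r addrC.
  - move=> t td f sf.
    have sf' : smooth_fun (f \o lg_mul (u a)) by have /smooth_mapP := smooth_lmul (u a); exact.
    have t1 : `|t| <= 1 by apply: le_trans td _; move: h2; lra.
    by have := Iu t t1 _ sf'; rewrite left_invariant_lmul.
  - move=> t td.
    have ate : `|a + t| <= e by apply: le_trans (ler_normD _ _) _; move: he ad td; lra.
    have de : d <= e by move: he e0; lra.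
    have [[h3 h4] _] := He _ ate.
    have [_ [Va _]] := He a (le_trans ad de).
    have [_ [_ Vt]] := He t (le_trans td de).
    by have [h5 h6] := V12 _ _ Va Vt; split.
  - exact: le_trans bd hd'.
have bound (t : R) : exists k : nat, `|t| <= d * 2 ^+ k.
  exists (Num.bound (`|t| / d)).
  have h : `|t| / d < (Num.bound (`|t| / d))%:R by apply: archi_boundP; rewrite divr_ge0// ltW.
  rewrite mulrC -ler_pdivrMr//; exact: le_trans (ltW h) (ltW (exp2_gtn _ _)).
have /choice[K HK] := bound.
(* For [|t| <= d * 2 ^+ k] the value no longer changes when [k] grows, so any large enough [k] may
   be chosen, for several parameters at once if needed. *)
pose gk k t := sq k (u (t / 2 ^+ k)).
have gkS k (t : R) : `|t| <= d * 2 ^+ k -> gk k.+1 t = gk k t.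
  move=> tk; have tk' : `|t / 2 ^+ k.+1| <= d.
    rewrite normrM normfV (ger0_norm (exprn_ge0 _ _))// ler_pdivrMr ?exprn_gt0//.
    by apply: le_trans tk _; rewrite ler_pM2l// exprS ler_peMl ?exprn_ge0// ler1n.
  rewrite /gk sqS -loc//; congr (sq k (u _)).
  by rewrite exprS invfM mulrA mulrAC -mulrDr (_ : 2^-1 + 2^-1 = 1 :> R) ?mulr1//; lra.
have gkle k l (t : R) : `|t| <= d * 2 ^+ k -> (k <= l)%N -> gk l t = gk k t.
  move=> tk /subnKC <-; elim: (l - k)%N => [|m IH]; first by rewrite addn0.
  rewrite addnS gkS ?IH//; apply: le_trans tk _; rewrite ler_pM2l// exprD ler_peMr ?exprn_ge0//.
  by apply: exprn_ege1; rewrite ler1n.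
pose g t := gk (K t) t.
have gE k (t : R) : `|t| <= d * 2 ^+ k -> g t = gk k t.
  move=> tk; rewrite /g; case: (leqP k (K t)) => h; first by rewrite (gkle k).
  by rewrite [RHS](gkle (K t))// ltnW.
have gu (t : R) : `|t| <= d -> g t = u t.
  by move=> td; rewrite (gE 0%N) ?expr0 ?mulr1// /gk /sq /= expr0 divr1.
have hg : hom_curve g.
  move=> a b; pose k := maxn (K (a + b)) (maxn (K a) (K b)).
  have le (t : R) : (K t <= k)%N -> `|t| <= d * 2 ^+ k.
    move=> tk; apply: le_trans (HK t) _; rewrite ler_pM2l//; apply: ler_weXn2l => //; by rewrite ler1n.
  have a1 : `|a| <= d * 2 ^+ k by apply: le; rewrite !leq_max leqnn orbT.
  have b1 : `|b| <= d * 2 ^+ k by apply: le; rewrite !leq_max leqnn !orbT.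
  have c1 : `|a + b| <= d * 2 ^+ k by apply: le; rewrite !leq_max leqnn.
  have sc (t : R) : `|t| <= d * 2 ^+ k -> `|t / 2 ^+ k| <= d.
    by rewrite normrM normfV (ger0_norm (exprn_ge0 _ _))// ler_pdivrMr ?exprn_gt0.
  rewrite (gE k (a + b) c1) (gE k a a1) (gE k b b1) /gk mulrDl loc ?sc// sqM//.
  by rewrite -!loc ?sc// addrC.
have Dg f : smooth_fun f -> is_derive (0 : R) (1 : R) (f \o g) (Y f).
  move=> sf; have near_eq : \forall t \near (0 : R), (f \o u) t = (f \o g) t.
    apply/nbhs_ballP; exists d => // t; rewrite -ball_normE /= sub0r normrN => /ltW td.
    by rewrite gu.
  apply: (near_eq_is_derive near_eq).
  have := Iu 0; rewrite normr0 ler01 => /(_ isT f sf).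
  rewrite u0 /left_invariant (_ : f \o lg_mul one = f) //.
  by apply/funext => x /=; rewrite lg1m.
exists (fun t => g (s^-1 * t)); apply: hom_one_parameter.
  by move=> a b; rewrite mulrDr hg.
move=> f sf; have := @is_derive_mull R (f \o g) s^-1 0 (Y f).
by rewrite mulr0 /Y tangent_scaleE mulrA mulVf ?gt_eqF// mul1r => /(_ (Dg f sf)).
Qed.

Lemma one_parameter_scale X u (s : R) : one_parameter X u -> one_parameter (s *: X) (fun t => u (s * t)).
Proof.
move=> /one_parameter_derive[hu Du]; apply: hom_one_parameter.
  by move=> a b; rewrite mulrDr hu.
move=> f sf; have := @is_derive_mull R (f \o u) s 0 (X f).
by rewrite mulr0 tangent_scaleE => /(_ (Du f sf)).
Qed.

Lemma lie_exp_one_parameter X : one_parameter X (fun t => lie_exp (t *: X)).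
Proof.
have [u Hu] := one_parameter_exists X.
rewrite (_ : (fun t => _) = u) //; apply/funext => t; rewrite /lie_exp.
case: xgetP => [v _ Hv|/(_ _ (one_parameter_scale t Hu))//].
by rewrite (one_parameter_unique Hv (one_parameter_scale t Hu)) mulr1.
Qed.

End OneParameter.

Lemma is_derive1_derive1 (R : realType) (f : R -> R) (t d : R) :
  is_derive t (1 : R) f d -> derive1 f t = d.
Proof. by move=> [_ <-]; rewrite derive1E. Qed.

(** * Fundamental vector fields *)

Section Fundamental.
Variables (R : realType) (G : lieGroup R) (M : manifold R) (act : G -> M -> M).

(** Only the orbit map of [m] must be smooth and [m] be fixed by the unit. The dressing action is
    covered in this form, through the smooth projection of D, before anything is known about its
    joint smoothness. *)
Lemma fundamentalE (x : lie G) (m : M) f :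
  (forall f, smooth_fun f -> smooth_fun (fun a => f (act a m))) -> act (lg_one G) m = m ->
  smooth_fun f -> fundamental act x m f = - x (fun a => f (act a m)).
Proof.
move=> sact act1 sf.
have [hu Du] := one_parameter_derive (lie_exp_one_parameter x).
have EF (g : M -> R) : (fun t : R => g (act (lie_exp (- t *: x)) m)) =
    (fun t : R => ((fun a => g (act a m)) \o (fun t : R => lie_exp (t *: x))) (-1 * t)).
  by apply/funext => t; rewrite -[- t](mulN1r t).
have E g : smooth_fun g -> derive1 (fun t : R => g (act (lie_exp (- t *: x)) m)) 0 = - x (fun a => g (act a m)).
  move=> sg; rewrite EF; apply: is_derive1_derive1; rewrite -[- tangent_fun x _]mulN1r.
  have K : is_derive (-1 * 0 : R) (1 : R) ((fun a => g (act a m)) \o (fun t : R => lie_exp (t *: x))) (x (fun a => g (act a m))).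
    by rewrite mulr0; exact: (Du _ (sact g sg)).
  exact: (is_derive_mull K).
rewrite /fundamental mktangentE ?E//.
- move=> k g h sg sh; rewrite (E (fun q => k * g q + h q)); last first.
    by apply: smooth_fun_add => //; apply: smooth_fun_mul => //; exact: smooth_fun_cst.
  by rewrite (E g sg) (E h sh) (tan_lin x k (sact g sg) (sact h sh)) opprD mulrN.
- move=> g h sg sh; rewrite (E (fun q => g q * h q)); last exact: smooth_fun_mul.
  by rewrite (E g sg) (E h sh) (tan_mul x (sact g sg) (sact h sh)) act1 opprD mulNr mulrN.
Qed.

Hypothesis Hact : is_action act.

Lemma action_fun2 f : smooth_fun f -> smooth_fun2 (fun a m => f (act a m)).
Proof. by have [H _ _] := Hact; exact: smooth_map2_fun2. Qed.

Lemma action_orbit_smooth m f : smooth_fun f -> smooth_fun (fun a => f (act a m)).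
Proof. by move=> sf; exact: (smooth_fun2_l m (action_fun2 sf)). Qed.

Lemma action_fundE (x : lie G) (m : M) f : smooth_fun f ->
  fundamental act x m f = - x (fun a => f (act a m)).
Proof. by move=> sf; apply: fundamentalE => //; [exact: action_orbit_smooth | have [] := Hact]. Qed.

Lemma fundamental_linear m k (x y : lie G) :
  fundamental act (k *: x + y) m = k *: fundamental act x m + fundamental act y m.
Proof.
apply: tangent_ext => f sf; rewrite tangent_addE tangent_scaleE !action_fundE//.
by rewrite tangent_addE tangent_scaleE opprD mulrN.
Qed.

Lemma fundamental_smooth (x : lie G) f : smooth_fun f -> smooth_fun (fun m => fundamental act x m f).
Proof.
move=> sf; rewrite (_ : (fun m => _) = (fun m => - x (fun a => f (act a m)))).
  by apply: smooth_fun_opp; exact: (smooth_fun2_tan x (smooth_fun2_swap (action_fun2 sf))).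
by apply/funext => m; rewrite action_fundE.
Qed.

Lemma lie_bracketE (X Y : lie G) f : smooth_fun f ->
  lie_bracket X Y f = X (left_invariant Y f) - Y (left_invariant X f).
Proof.
move=> sf; have sl a g : smooth_fun g -> smooth_fun (g \o @lg_mul R G a).
  by move: g; apply/smooth_mapP; exact: smooth_lmul.
have lin (Z : lie G) k g h : smooth_fun g -> smooth_fun h ->
    left_invariant Z (fun q => k * g q + h q) = (fun a => k * left_invariant Z g a + left_invariant Z h a).
  by move=> sg sh; apply/funext => a; exact: (tan_lin Z k (sl a g sg) (sl a h sh)).
have prd (Z : lie G) g h : smooth_fun g -> smooth_fun h ->
    left_invariant Z (fun q => g q * h q) = (fun a => left_invariant Z g a * h a + g a * left_invariant Z h a).
  move=> sg sh; apply/funext => a; have := tan_mul Z (sl a g sg) (sl a h sh).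
  by rewrite /= !lgm1; exact.
have one_ (Z : lie G) g : left_invariant Z g (lg_one G) = Z g.
  by rewrite /left_invariant; congr (tangent_fun Z); apply/funext => q /=; rewrite lg1m.
have ls (Z : lie G) g : smooth_fun g -> smooth_fun (left_invariant Z g) by exact: left_invariant_smooth.
rewrite /lie_bracket mktangentE// => [k g h sg sh|g h sg sh].
  rewrite !lin// !(tan_lin _ k)//; try exact: ls; ring.
rewrite !prd// !tan_add; try by apply: smooth_fun_mul => //; exact: ls.
rewrite !tan_mul//; try exact: ls.
rewrite !one_; ring.
Qed.

(** The signs of the two fundamental fields cancel in an iterated derivative, which differentiates
    f(abm) in reverse order; [tan_swap] restores the order of left-invariant fields. The minus sign
    in x_M is what makes x |-> x_M a morphism of brackets. *)
Lemma fundamental_bracket (x y : lie G) m f : smooth_fun f ->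
  fundamental act x m (fun q => fundamental act y q f) - fundamental act y m (fun q => fundamental act x q f)
  = fundamental act (lie_bracket x y) m f.
Proof.
move=> sf; have [sact act1 actM] := Hact.
have fE z : (fun q => fundamental act z q f) = (fun q => - z (fun a => f (act a q))).
  by apply/funext => q; rewrite action_fundE.
have s2 := action_fun2 sf; have s2' := smooth_fun2_swap s2.
pose phi a := f (act a m); have sphi : smooth_fun phi by exact: action_orbit_smooth.
have E z w : fundamental act z m (fun q => fundamental act w q f) = z (fun b => w (fun a => phi (lg_mul a b))).
  rewrite fE action_fundE; last by apply: smooth_fun_opp; exact: (smooth_fun2_tan w s2').
  rewrite tan_opp ?opprK; last first.
    exact: (action_orbit_smooth m (smooth_fun2_tan w s2')).
  congr (tangent_fun z); apply/funext => b; congr (tangent_fun w); apply/funext => a.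
  by rewrite /phi actM.
rewrite !E action_fundE// lie_bracketE// opprB.
have sm := smooth_mul2 sphi.
by congr (_ - _); [rewrite [LHS](tan_swap _ _ (smooth_fun2_swap sm))|rewrite [LHS](tan_swap _ _ (smooth_fun2_swap sm))].
Qed.

End Fundamental.

(** * Lagrangian complements *)

Section Parity.
Variable R : fieldType.

Let blockE := (@mulmx0 R, @mul0mx R, @mulmx1 R, @mul1mx R, @mulNmx R, @mulmxN R,
  fun m n => @opprK 'M[R]_(m, n), fun m n => @oppr0 'M[R]_(m, n),
  fun m n => @addr0 'M[R]_(m, n), fun m n => @add0r 'M[R]_(m, n)).

Lemma skew_unit_exists r : ~~ odd r -> exists J : 'M[R]_r, J^T = - J /\ J \in unitmx.
Proof.
move=> /negbTE er; have := odd_double_half r; rewrite er add0n -addnn => <-.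
set k := r./2; pose J : 'M[R]_(k + k) := block_mx 0 1%:M (- 1%:M) 0.
exists J; split.
  by rewrite tr_block_mx !trmx0 opp_block_mx !oppr0 linearN /= !trmx1 opprK.
suff /mulmx1_unit[] : J *m - J = 1%:M by [].
by rewrite /J opp_block_mx mulmx_block !blockE -scalar_mx_block.
Qed.

(** Gram matrix of the form in a basis of g followed by the dual basis of a Lagrangian
    complement. *)
Definition hyp n : 'M[R]_(n + n) := block_mx 0 1%:M 1%:M 0.

Definition hyp_isom n (A : 'M[R]_(n + n)) := A^T *m hyp n *m A = hyp n.

Lemma hyp_isomM n (A B : 'M[R]_(n + n)) : hyp_isom A -> hyp_isom B -> hyp_isom (A *m B).
Proof.
rewrite /hyp_isom => hA hB; rewrite trmx_mul !mulmxA.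
by rewrite -(mulmxA B^T A^T) -(mulmxA B^T _ A) hA.
Qed.

Lemma hyp_isom_block n (a b c d : 'M[R]_n) : hyp_isom (block_mx a b c d) <->
  block_mx (c^T *m a + a^T *m c) (c^T *m b + a^T *m d) (d^T *m a + b^T *m c) (d^T *m b + b^T *m d) = hyp n.
Proof.
by rewrite /hyp_isom tr_block_mx mulmx_block !mulmx0 !mulmx1 !add0r !addr0 mulmx_block.
Qed.

(** Row operations eliminate [c]. As a^T c is skew, a^T times the Schur complement equals a^T d +
    c^T b, which is the identity. *)
Lemma hyp_isom_det1 n (a b c d : 'M[R]_n) : hyp_isom (block_mx a b c d) -> a \in unitmx ->
  \det (block_mx a b c d) = 1.
Proof.
move=> /hyp_isom_block/eq_block_mx[h1 h2 _ _] ua.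
have E : block_mx 1%:M 0 (- (c *m invmx a)) 1%:M *m block_mx a b c d = block_mx a b 0 (d - c *m invmx a *m b).
  by rewrite mulmx_block !mul1mx !mul0mx !addr0 !mulNmx mulmxKV// addNr addrC.
have := congr1 determinant E; rewrite det_mulmx det_lblock !det1 !mul1r det_ublock => ->.
rewrite -(det_tr a) -det_mulmx mulmxBr.
have -> : a^T *m (c *m invmx a *m b) = - (c^T *m b).
  rewrite !mulmxA; move: h1 => /eqP; rewrite addrC addr_eq0 => /eqP ->.
  by rewrite !mulNmx mulmxK.
by rewrite opprK addrC h2 det1.
Qed.

Lemma hyp_isom_diag n (L : 'M[R]_n) : L \in unitmx -> hyp_isom (block_mx L^T 0 0 (invmx L)).
Proof.
move=> uL; apply/hyp_isom_block; rewrite !trmx0 !mul0mx !mulmx0 !addr0 !add0r trmxK mulmxV//.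
by rewrite -trmx_mul mulmxV// trmx1.
Qed.

Section Swap.
Variables r s : nat.
Let e : 'M[R]_(r + s) := block_mx 0 0 0 1%:M.
Let f : 'M[R]_(r + s) := block_mx 1%:M 0 0 0.

(** The isometry that exchanges the first [r] basis vectors of g with their duals. *)
Definition partial_swap : 'M[R]_((r + s) + (r + s)) := block_mx e f f e.

Lemma partial_swap_isom : hyp_isom partial_swap.
Proof.
apply/hyp_isom_block; rewrite !tr_block_mx !trmx0 !trmx1 /e /f !mulmx_block.
rewrite !blockE !add_block_mx !blockE /hyp.
by rewrite -!scalar_mx_block -block_mx0.
Qed.

Lemma det_partial_swap : \det partial_swap = (-1) ^+ r.
Proof.
have ef : e + f = 1%:M by rewrite /e /f add_block_mx !addr0 !add0r -scalar_mx_block.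
have E : block_mx 1%:M 0 (- 1%:M) 1%:M *m partial_swap *m block_mx 1%:M 0 1%:M 1%:M = block_mx 1%:M f 0 (e - f).
  rewrite !mulmx_block !blockE ef.
  by rewrite (addrC (- f)) addrACA addNr subrr addr0.
have := congr1 determinant E; rewrite !det_mulmx !det_lblock !det_ublock !det1 !mul1r !mulr1 => ->.
by rewrite /e /f opp_block_mx add_block_mx !oppr0 !addr0 !add0r det_ublock det1 mulr1 -scaleN1r detZ det1 mulr1.
Qed.

(** After composition with the swap, the upper left block is block triangular with diagonal blocks 1
    and the invertible lower right block of [a], so [hyp_isom_det1] applies. The determinant thus
    records the parity of the rank [r] of [c], the codimension in g of its intersection with its
    image. *)
Lemma hyp_isom_parity (a b c d : 'M[R]_(r + s)) : hyp_isom (block_mx a b c d) -> c = f ->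
  [/\ (ulsubmx a)^T = - ulsubmx a, ursubmx a = 0, drsubmx a \in unitmx &
   \det (block_mx a b c d) = (-1) ^+ r].
Proof.
move=> H cf; move: cf H => -> H.
set a1 := ulsubmx a; set a2 := ursubmx a; set a3 := dlsubmx a; set a4 := drsubmx a.
set d2 := ursubmx d; set d4 := drsubmx d.
have [h1 a20 k4] : [/\ a1 + a1^T = 0, a2 = 0 & a2^T *m d2 + a4^T *m d4 = 1%:M].
  have aE : a = block_mx a1 a2 a3 a4 by rewrite submxK.
  have dE : d = block_mx (ulsubmx d) d2 (dlsubmx d) d4 by rewrite submxK.
  clearbody a1 a2 a3 a4 d2 d4.
  move: H; rewrite aE dE -(submxK b) => /hyp_isom_block/eq_block_mx[].
  rewrite /f !tr_block_mx !mulmx_block !trmx0 !trmx1 !blockE !add_block_mx !blockE -{1}block_mx0.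
  move=> /eq_block_mx[h1 h2 h3 _].
  by rewrite scalar_mx_block => /eq_block_mx[_ _ _ k4] _ _.
have u4 : a4 \in unitmx.
  by move: k4; rewrite a20 trmx0 mul0mx add0r => /mulmx1_unit[]; rewrite unitmx_tr.
split => //; first by apply/eqP; rewrite -addr_eq0 addrC h1.
have HS := hyp_isomM partial_swap_isom H.
have E : partial_swap *m block_mx a b f d = block_mx (e *m a + f *m f) (e *m b + f *m d) (f *m a + e *m f) (f *m b + e *m d).
  by rewrite /partial_swap mulmx_block.
have uS : e *m a + f *m f \in unitmx.
  rewrite -(submxK a) -/a1 -/a2 -/a3 -/a4 /e /f !mulmx_block !blockE add_block_mx !blockE.
  by rewrite unitmxE det_lblock det1 mul1r -unitmxE.
move: HS; rewrite E => /hyp_isom_det1 /(_ uS); rewrite -E det_mulmx det_partial_swap => D.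
have s2 : ((-1) ^+ r * (-1) ^+ r = 1 :> R) by rewrite -exprMn mulrNN mulr1 expr1n.
by have := congr1 (fun x => (-1) ^+ r * x) D; rewrite mulrA s2 mul1r mulr1.
Qed.

End Swap.

(** A skew [t] describes a Lagrangian graph over the complement, transverse to the image of g when
    [a - t *m c] is invertible. In normal form this requires an invertible skew block of size the
    rank of [c], and determinant 1 makes that rank even. *)
Lemma common_complement n (a b c d : 'M[R]_n) : (1 : R) != -1 ->
  hyp_isom (block_mx a b c d) -> \det (block_mx a b c d) = 1 ->
  exists t : 'M[R]_n, t^T = - t /\ a - t *m c \in unitmx.
Proof.
move=> two H D.
have key (L U : 'M[R]_n) r s (nE : n = (r + s)%N) : L \in unitmx -> U \in unitmx -> c = L *m pid_mx r *m U ->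
    exists t : 'M[R]_n, t^T = - t /\ a - t *m c \in unitmx.
  move: a b c d H D L U; rewrite {}nE => {n} a b c d H D L U uL uU cE.
  have uV : invmx U \in unitmx by rewrite unitmx_inv.
  (* Block diagonal isometries on both sides preserve the splitting, change bases in g, and bring
     [c] to [pid_mx r]. *)
  have HN := hyp_isomM (hyp_isomM (hyp_isom_diag uL) H) (hyp_isom_diag (L := (invmx U)^T) _).
  move: HN; rewrite unitmx_tr => /(_ uV); rewrite !trmxK !mulmx_block !blockE => HN.
  have [] := hyp_isom_parity HN.
    by rewrite cE !mulmxA mulVmx// mul1mx -mulmxA mulmxV// mulmx1 pid_mx_block.
  set a' := L^T *m a *m invmx U; set N := block_mx _ _ _ _ => h1 h2 h4 hd.
  have dN : \det N = 1.
    have -> : N = block_mx L^T 0 0 (invmx L) *m block_mx a b c d *m block_mx (invmx U) 0 0 (invmx (invmx U)^T).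
      by rewrite !mulmx_block !blockE.
    rewrite !det_mulmx !det_ublock D mulr1 !det_inv !det_tr det_inv invrK divff ?mul1r ?mulVf//; rewrite -unitfE -unitmxE//.
  have er : ~~ odd r.
    by move: hd; rewrite dN -signr_odd; case: (odd r) => // /eqP; rewrite expr1 (negbTE two).
  have [J [Jt uJ]] := skew_unit_exists er.
  (* Chosen so that [a' - t *m pid_mx r] is block diagonal with blocks [J] and the invertible lower
     right block of [a']; the upper right block of [t] is then forced by skewness. *)
  pose t := block_mx (ulsubmx a' - J) (- (dlsubmx a')^T) (dlsubmx a') 0 : 'M[R]_(r + s).
  exists ((invmx L)^T *m t *m invmx L); split.
    suff tt : t^T = - t by rewrite !trmx_mul trmxK tt mulNmx mulmxN mulmxA.
    by rewrite /t tr_block_mx opp_block_mx trmx0 oppr0 !linearN /= linearB /= h1 Jt trmxK !opprK opprD opprK.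
  have -> : a - (invmx L)^T *m t *m invmx L *m c = (invmx L)^T *m (a' - t *m pid_mx r) *m U.
    rewrite mulmxBr mulmxBl /a' !mulmxA -trmx_mul mulmxV// trmx1 mul1mx mulmxKV//; congr (_ - _).
    by rewrite cE !mulmxA mulmxKV.
  rewrite !unitmx_mul unitmx_tr unitmx_inv uL uU andbT /=.
  rewrite -(submxK a') h2 pid_mx_block /t mulmx_block !blockE opp_block_mx add_block_mx !blockE subrr.
  by rewrite opprB addrC subrK unitmxE det_ublock unitrM -!unitmxE uJ.
apply: (key (col_ebase c) (row_ebase c) (\rank c) (n - \rank c)%N).
- by rewrite subnKC// rank_leq_row.
- exact: col_ebase_unit.
- exact: row_ebase_unit.
- by rewrite mulmx_ebase.
Qed.

End Parity.

(** * Linear algebra of a Manin pair *)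

Section ManinAlgebra.
Variables (R : realType) (d g : lmodType R) (br : d -> d -> d) (B : d -> d -> R) (i : g -> d) (n : nat).
Hypothesis mp : manin_pair br B i n.

Let Blin k u v w : B (k *: u + v) w = k * B u w + B v w.
Proof. by have [[H _] _ _ _ _ _ _ _ _ _] := mp; exact: H. Qed.
Let Bsym u v : B u v = B v u.
Proof. by have [_ H _ _ _ _ _ _ _ _] := mp; exact: H. Qed.
Let ilin k x y : i (k *: x + y) = k *: i x + i y.
Proof. by have [_ _ _ _ _ H _ _ _ _] := mp; exact: H. Qed.
Let iinj : injective i.
Proof. by have [_ _ _ _ _ _ H _ _ _] := mp; exact: H. Qed.
Let Bii x y : B (i x) (i y) = 0.
Proof. by have [_ _ _ _ _ _ _ _ H _] := mp; apply: H; eexists. Qed.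
Let Bnd u : (forall v, B u v = 0) -> u = 0.
Proof. by have [_ _ H _ _ _ _ _ _ _] := mp; exact: H. Qed.

Lemma formD u v w : B (u + v) w = B u w + B v w.
Proof. by rewrite -[u]scale1r Blin mul1r scale1r. Qed.
Lemma form0 w : B 0 w = 0.
Proof. by have := formD 0 0 w; rewrite addr0 => /eqP; rewrite -subr_eq subrr => /eqP <-. Qed.
Lemma formZ k u w : B (k *: u) w = k * B u w.
Proof. by rewrite -[k *: u]addr0 Blin form0 addr0. Qed.
Lemma formN u w : B (- u) w = - B u w.
Proof. by rewrite -scaleN1r formZ mulN1r. Qed.
Lemma formB u v w : B (u - v) w = B u w - B v w.
Proof. by rewrite formD formN. Qed.
Lemma form_sum I (r : seq I) (F : I -> d) w : B (\sum_(k <- r) F k) w = \sum_(k <- r) B (F k) w.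
Proof. by elim/big_ind2: _ => // [|x x' y y' <- <-]; rewrite ?form0// formD. Qed.
Lemma incl0 : i 0 = 0.
Proof. by have := ilin 1 0 0; rewrite !scale1r addr0 => /eqP; rewrite -subr_eq subrr => /eqP <-. Qed.
Lemma inclD x y : i (x + y) = i x + i y.
Proof. by rewrite -[x]scale1r ilin !scale1r. Qed.
Lemma inclZ k x : i (k *: x) = k *: i x.
Proof. by rewrite -[k *: x]addr0 ilin incl0 addr0. Qed.
Lemma incl_sum I (r : seq I) (F : I -> g) : i (\sum_(k <- r) F k) = \sum_(k <- r) i (F k).
Proof. by elim/big_ind2: _ => // [|x x' y y' <- <-]; rewrite ?incl0// inclD. Qed.

(** The orthogonal basis given by the signature supplies the representing vector, with a minus sign
    on the vectors of square -1. *)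
Lemma riesz (xi : dual d) : exists y, forall z, B y z = xi z.
Proof.
have [_ _ _ [e [f [ee ff ef He]]] _ _ _ _ _ _] := mp.
exists (\sum_k xi (e k) *: e k - \sum_k xi (f k) *: f k) => z.
have [a [b ->]] := He z.
have Be k : B (e k) (\sum_l a l *: e l + \sum_l b l *: f l) = a k.
  rewrite Bsym formD !form_sum (bigD1 k)//= big1 => [|l lk]; last by rewrite formZ ee (negbTE lk) mulr0.
  rewrite big1 => [|l _]; last by rewrite formZ Bsym ef mulr0.
  by rewrite !addr0 formZ ee eqxx mulr1.
have Bf k : B (f k) (\sum_l a l *: e l + \sum_l b l *: f l) = - b k.
  rewrite Bsym formD !form_sum [X in _ + X](bigD1 k)//= !big1 => [|l lk|l _].
  - by rewrite add0r addr0 formZ ff eqxx mulrN1.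
  - by rewrite formZ ff (negbTE lk) oppr0 mulr0.
  - by rewrite formZ ef mulr0.
rewrite formB !form_sum dualD !dual_sum -sumrN.
congr (_ + _); apply: eq_bigr => k _; rewrite dualZ formZ ?Be ?Bf mulrC//.
by rewrite mulNr opprK.
Qed.

Section Complement.
Variable h : set d.
Hypothesis Hh : isotropic_complement B i h.

Local Notation pg := (proj_g i h).
Local Notation j := (j_iso B i h).

Let h0 : h 0. Proof. by have [[]] := Hh. Qed.
Let hlin k u v : h u -> h v -> h (k *: u + v). Proof. by have [[_ H] _ _] := Hh; exact: H. Qed.
Let hh u v : h u -> h v -> B u v = 0. Proof. by have [_ H _] := Hh; exact: H. Qed.

Lemma proj_gP z : h (z - i (pg z)).
Proof.
by have [_ _ /(_ z)[x [hx _]]] := Hh; rewrite /proj_g; case: xgetP => [y _ //|/(_ x)].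
Qed.

Lemma proj_g_uniq z x : h (z - i x) -> pg z = x.
Proof.
have [_ _ /(_ z)[y [hy U]]] := Hh.
by move=> hx; rewrite -(U _ hx) -(U _ (proj_gP z)).
Qed.

Lemma proj_g_linear k u v : pg (k *: u + v) = k *: pg u + pg v.
Proof.
apply: proj_g_uniq; rewrite ilin opprD addrACA -scalerBr; apply: hlin; exact: proj_gP.
Qed.

Lemma complement_separated y : h y -> (forall x, B y (i x) = 0) -> y = 0.
Proof.
move=> hy Hy; apply: Bnd => z; have hz := proj_gP z.
by rewrite -[z](subrK (i (pg z))) Bsym formD Bsym hh// add0r Bsym Hy.
Qed.

Lemma subalgebra_separated x : (forall y, h y -> B (i x) y = 0) -> x = 0.
Proof.
move=> Hx; apply: iinj; rewrite incl0; apply: Bnd => z; have hz := proj_gP z.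
by rewrite -[z](subrK (i (pg z))) Bsym formD Bsym Hx// add0r Bii.
Qed.

(** The vector that represents [xi] composed with the projection to g pairs to zero with [h]; so
    does its component in g, which therefore vanishes. *)
Lemma j_isoP xi : h (j xi) /\ forall x, B (j xi) (i x) = xi x.
Proof.
suff [y Hy] : exists y, h y /\ forall x, B y (i x) = xi x.
  by rewrite /j_iso; case: xgetP => [z _ //|/(_ y)].
have [y Hy] := riesz (mkdual (xi \o pg)).
have plin (k : R) u v : (xi \o pg) (k *: u + v) = k * (xi \o pg) u + (xi \o pg) v.
  by rewrite /= proj_g_linear dual_linear.
exists y; split; last first.
  move=> x; rewrite Hy mkdualE//=; congr (xi _).
  by apply: proj_g_uniq; rewrite subrr.
have hy := proj_gP y; suff : pg y = 0 by move=> y0; move: hy; rewrite y0 incl0 subr0.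
apply: subalgebra_separated => z hz.
have -> : i (pg y) = y - (y - i (pg y)) by rewrite opprB addrC subrK.
rewrite formB Hy mkdualE//= hh// subr0.
by rewrite (@proj_g_uniq z 0) ?incl0 ?subr0 ?dual0.
Qed.

Lemma j_iso_uniq (xi : dual g) y : h y -> (forall x, B y (i x) = xi x) -> j xi = y.
Proof.
move=> hy Hy; have [hj Hj] := j_isoP xi.
apply/eqP; rewrite -subr_eq0; apply/eqP; apply: complement_separated.
  by rewrite addrC -scaleN1r; exact: hlin.
by move=> x; rewrite formB Hj Hy subrr.
Qed.

Lemma j_iso_linear k xi eta : j (k *: xi + eta) = k *: j xi + j eta.
Proof.
have [h1 H1] := j_isoP xi; have [h2 H2] := j_isoP eta.
apply: j_iso_uniq; first exact: hlin.
by move=> x; rewrite Blin H1 H2 dual_addE dual_scaleE.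
Qed.

End Complement.

(** The component of [y] along [h] also pairs to zero with g, hence vanishes: g is its own
    orthogonal. *)
Lemma isotropic_range h y : isotropic_complement B i h -> (forall x, B y (i x) = 0) -> exists x, i x = y.
Proof.
move=> Hh Hy; exists (proj_g i h y).
have := complement_separated Hh (proj_gP Hh y) => H.
apply/esym/eqP; rewrite -subr_eq0 H// => x.
by rewrite formB Hy Bii subrr.
Qed.

Section Twist.
Variables h h' : set d.
Hypotheses (Hh : isotropic_complement B i h) (Hh' : isotropic_complement B i h').
Local Notation tw := (twist_map B i h h').

Lemma twist_mapP xi : i (tw xi) = j_iso B i h' xi - j_iso B i h xi.
Proof.
have [x Hx] : exists x, i x = j_iso B i h' xi - j_iso B i h xi.
  apply: (isotropic_range Hh) => x.
  by rewrite formB (j_isoP Hh xi).2 (j_isoP Hh' xi).2 subrr.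
by rewrite /twist_map; case: xgetP => [z _ //|/(_ x)].
Qed.

Lemma twist_map_linear k xi eta : tw (k *: xi + eta) = k *: tw xi + tw eta.
Proof.
apply: iinj; rewrite ilin !twist_mapP (j_iso_linear Hh) (j_iso_linear Hh').
by rewrite opprD addrACA scalerBr.
Qed.

(** Paired with j' eta, the twist of xi keeps only -(j xi | j' eta), by isotropy of [h']; paired
    with j xi, the twist of eta keeps (j xi | j' eta), by isotropy of [h]. *)
Lemma twist_skew (xi eta : dual g) : eta (tw xi) = - xi (tw eta).
Proof.
have [h1 H1] := j_isoP Hh xi; have [h2 H2] := j_isoP Hh eta.
have [h1' H1'] := j_isoP Hh' xi; have [h2' H2'] := j_isoP Hh' eta.
have [_ iso _] := Hh; have [_ iso' _] := Hh'.
rewrite -H2' -H1 !twist_mapP ![B (j_iso _ _ _ _) (_ - _)]Bsym !formB.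
by rewrite (iso' _ _ h1' h2') (iso _ _ h2 h1) sub0r subr0 [in RHS]Bsym [in LHS]Bsym [in RHS]Bsym.
Qed.

End Twist.

Section Isometry.
Variable h : set d.
Hypothesis Hh : isotropic_complement B i h.
Variables (N : nat) (e : 'I_N -> g) (eps : 'I_N -> dual g).
Hypothesis eps_e : forall k l, eps k (e l) = (k == l)%:R.
Hypothesis basis : forall x, x = \sum_k eps k x *: e k.
Local Notation j := (j_iso B i h).
Let hj xi : h (j xi). Proof. by have [] := j_isoP Hh xi. Qed.
Let Bji xi x : B (j xi) (i x) = xi x. Proof. by have [_ ->] := j_isoP Hh xi. Qed.
Let hh u v : h u -> h v -> B u v = 0. Proof. by have [_ H _] := Hh; exact: H. Qed.
Let hlin k u v : h u -> h v -> h (k *: u + v). Proof. by have [[_ H] _ _] := Hh; exact: H. Qed.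

Let gv (v : 'cV[R]_N) : g := \sum_k v k 0 *: e k.
Let hv (v : 'cV[R]_N) : d := \sum_k v k 0 *: j (eps k).
Let vec v w : d := i (gv v) + hv w.

Let h_hv v : h (hv v).
Proof.
rewrite /hv; elim/big_rec: _ => [|k y _ hy]; last exact: hlin.
by have [[]] := Hh.
Qed.

Let B_hv_i v x : B (hv v) (i x) = \sum_k v k 0 * eps k x.
Proof. by rewrite form_sum; apply: eq_bigr => k _; rewrite formZ Bji. Qed.

Let eps_gv k v : eps k (gv v) = v k 0.
Proof.
rewrite dual_sum (bigD1 k)//= big1 ?addr0 => [|l lk]; first by rewrite dualZ eps_e eqxx mulr1.
by rewrite dualZ eps_e eq_sym (negbTE lk) mulr0.
Qed.

Let B_vec v w v' w' : B (vec v w) (vec v' w') = \sum_k v k 0 * w' k 0 + \sum_k w k 0 * v' k 0.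
Proof.
rewrite /vec formD ![B _ (i (gv v') + hv w')]Bsym !formD Bii add0r (hh (h_hv _) (h_hv _)) addr0.
rewrite B_hv_i [B (i _) _]Bsym B_hv_i; congr (_ + _); apply: eq_bigr => k _; rewrite eps_gv//.
by rewrite mulrC.
Qed.

Let repr z : z = vec (\col_k B z (j (eps k))) (\col_k B z (i (e k))).
Proof.
set v := \col_k _; set w := \col_k _.
have E1 : z - i (proj_g i h z) = hv w.
  have hz := proj_gP Hh z.
  apply/eqP; rewrite -subr_eq0; apply/eqP; apply: (complement_separated Hh).
    by rewrite [_ - hv w]addrC -scaleN1r; exact: hlin.
  move=> x; rewrite formB B_hv_i formB Bii subr0 {1}(basis x) Bsym incl_sum form_sum.
  apply/eqP; rewrite subr_eq0; apply/eqP; apply: eq_bigr => k _.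
  by rewrite inclZ formZ mxE mulrC Bsym.
suff E2 : proj_g i h z = gv v by rewrite /vec -E1 -E2 addrC subrK.
rewrite [LHS]basis; apply: eq_bigr => k _; congr (_ *: _); rewrite mxE.
by rewrite -[z in RHS](subrK (i (proj_g i h z))) formD (hh (proj_gP Hh z) (hj _)) add0r Bsym Bji.
Qed.

Let parseval z z' : B z z' = \sum_k B z (j (eps k)) * B z' (i (e k)) + \sum_k B z (i (e k)) * B z' (j (eps k)).
Proof.
rewrite {1}(repr z) {1}(repr z') B_vec.
by congr (_ + _); apply: eq_bigr => k _; rewrite !mxE.
Qed.

(** Matrix of [A] in the basis formed by [e] and [j eps]: the coordinate along one vector is read by
    pairing with its dual, hence the crossed arguments. *)
Definition isom_mx (A : d -> d) : 'M[R]_(N + N) :=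
  block_mx (\matrix_(k, l) B (A (i (e l))) (j (eps k))) (\matrix_(k, l) B (A (j (eps l))) (j (eps k)))
           (\matrix_(k, l) B (A (i (e l))) (i (e k))) (\matrix_(k, l) B (A (j (eps l))) (i (e k))).

Lemma isom_mx_hyp A : (forall u v, B (A u) (A v) = B u v) -> hyp_isom (isom_mx A).
Proof.
move=> HA; apply/hyp_isom_block; rewrite /hyp.
congr block_mx; apply/matrixP => k l; rewrite !mxE.
- transitivity (B (A (i (e k))) (A (i (e l)))); last by rewrite HA Bii.
  by rewrite parseval addrC; congr (_ + _); apply: eq_bigr => m _; rewrite !mxE.
- transitivity (B (A (i (e k))) (A (j (eps l)))); last by rewrite HA Bsym Bji eps_e eq_sym.
  by rewrite parseval addrC; congr (_ + _); apply: eq_bigr => m _; rewrite !mxE.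
- transitivity (B (A (j (eps k))) (A (i (e l)))); last by rewrite HA Bji eps_e.
  by rewrite parseval addrC; congr (_ + _); apply: eq_bigr => m _; rewrite !mxE.
- transitivity (B (A (j (eps k))) (A (j (eps l)))); last by rewrite HA hh.
  by rewrite parseval addrC; congr (_ + _); apply: eq_bigr => m _; rewrite !mxE.
Qed.

Lemma isom_mx_id : isom_mx id = 1%:M.
Proof.
rewrite scalar_mx_block; congr block_mx; apply/matrixP => k l; rewrite !mxE.
- by rewrite Bsym Bji eps_e.
- by rewrite hh.
- by rewrite Bii.
- by rewrite Bji eps_e eq_sym.
Qed.

Lemma isom_mx_det A : (forall u v, B (A u) (A v) = B u v) -> \det (isom_mx A) ^+ 2 = 1.
Proof.
move=> /isom_mx_hyp/(congr1 determinant); rewrite !det_mulmx det_tr => H.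
have hypu : \det (hyp R N) != 0.
  have : hyp R N *m hyp R N = 1%:M.
    by rewrite /hyp mulmx_block !mulmx0 !mul0mx !mulmx1 !addr0 !add0r -scalar_mx_block.
  by move=> /mulmx1_unit[]; rewrite unitmxE unitfE.
by apply: (mulIf hypu); rewrite mul1r -[RHS]H expr2 mulrAC.
Qed.

(** The graph of (t w, w) is a complement of g for every [t] and is isotropic because [t] is skew.
    Decomposing a vector along this graph and the image of g is a linear system with matrix
    [a - t *m c]. *)
Lemma lagrangian_common_complement A :
  (forall k u v, A (k *: u + v) = k *: A u + A v) ->
  (forall u v, B (A u) (A v) = B u v) -> \det (isom_mx A) = 1 ->
  exists h', isotropic_complement B i h' /\ forall z, exists! x, h' (z - A (i x)).
Proof.
move=> Alin HA dA; have two : (1 : R) != -1 by rewrite gt_eqF// ltrN10 ?ltr01//; lra.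
have [t [tt ut]] := common_complement two (isom_mx_hyp HA) dA.
set a := \matrix_(k, l) B (A (i (e l))) (j (eps k)) in ut.
set c := \matrix_(k, l) B (A (i (e l))) (i (e k)) in ut.
have gv_lin k v w : gv (k *: v + w) = k *: gv v + gv w.
  rewrite /gv scaler_sumr -big_split; apply: eq_bigr => m _ /=.
  by rewrite !mxE scalerDl scalerA.
have hv_lin k v w : hv (k *: v + w) = k *: hv v + hv w.
  rewrite /hv scaler_sumr -big_split; apply: eq_bigr => m _ /=.
  by rewrite !mxE scalerDl scalerA.
have vec_lin k v w v' w' : vec (k *: v + v') (k *: w + w') = k *: vec v w + vec v' w'.
  by rewrite /vec gv_lin hv_lin ilin scalerDr addrACA.
have vec0 : vec 0 0 = 0.
  by have := vec_lin (-1) 0 0 0 0; rewrite !scaler0 !addr0 scaleN1r addNr.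
have vecB v w v' w' : vec v w - vec v' w' = vec (v - v') (w - w').
  by rewrite -scaleN1r addrC -vec_lin !scaleN1r ![- _ + _]addrC.
have vec_inj v w v' w' : vec v w = vec v' w' -> v = v' /\ w = w'.
  have col z v0 w0 : z = vec v0 w0 -> (\col_k B z (j (eps k)) = v0) /\ (\col_k B z (i (e k)) = w0).
    move=> ->; split; apply/colP => k; rewrite !mxE /vec formD.
      by rewrite (hh (h_hv _) (hj _)) addr0 Bsym Bji eps_gv.
    rewrite Bii add0r B_hv_i (bigD1 k)//= big1 ?addr0 => [|l lk]; first by rewrite eps_e eqxx mulr1.
    by rewrite eps_e (negbTE lk) mulr0.
  by move=> E; have [e1 e2] := col _ v w (erefl (vec v w)); have [e3 e4] := col _ _ _ E; split;
    [exact: etrans (esym e1) e3|exact: etrans (esym e2) e4].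
have gvE x : gv (\col_k eps k x) = x.
  by rewrite [RHS]basis; apply: eq_bigr => k _; rewrite mxE.
have gv_inj v v' : gv v = gv v' -> v = v'.
  by move=> E; apply/colP => k; rewrite -!eps_gv E.
have AE v : A (i (gv v)) = vec (a *m v) (c *m v).
  have Asum (I : Type) (r : seq I) (F : I -> d) : A (\sum_(k <- r) F k) = \sum_(k <- r) A (F k).
    have A0 : A 0 = 0 by have := Alin (-1) 0 0; rewrite scaler0 addr0 scaleN1r addNr.
    elim: r => [|k r IH]; first by rewrite !big_nil.
    by rewrite !big_cons -[F k]scale1r Alin IH !scale1r.
  rewrite [LHS]repr; congr vec; apply/colP => k; rewrite !mxE /gv incl_sum Asum form_sum;
  apply: eq_bigr => l _; rewrite mxE inclZ -[_ *: i _]addr0 Alin.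
    by rewrite (_ : A 0 = 0) ?addr0 ?formZ 1?mulrC//; have := Alin (-1) 0 0; rewrite scaler0 addr0 scaleN1r addNr.
  by rewrite (_ : A 0 = 0) ?addr0 ?formZ 1?mulrC//; have := Alin (-1) 0 0; rewrite scaler0 addr0 scaleN1r addNr.
pose h' : set d := [set z | exists w, z = vec (t *m w) w].
have h'vec v w : h' (vec v w) <-> v = t *m w.
  by split => [[w' /vec_inj[-> ->]]//|->]; exists w.
exists h'; split.
  split.
  - split; first by exists 0; rewrite mulmx0 vec0.
    by move=> k _ _ [w ->] [w' ->]; exists (k *: w + w'); rewrite mulmxDr -scalemxAr vec_lin.
  - move=> _ _ [w ->] [w' ->]; rewrite B_vec.
    have -> : \sum_k (t *m w) k 0 * w' k 0 = ((t *m w)^T *m w') 0 0.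
      by rewrite [RHS]mxE; apply: eq_bigr => k _; rewrite [((t *m w)^T) 0 k]mxE.
    have -> : \sum_k w k 0 * (t *m w') k 0 = (w^T *m (t *m w')) 0 0.
      by rewrite [RHS]mxE; apply: eq_bigr => k _; rewrite [(w^T) 0 k]mxE.
    by rewrite trmx_mul tt mulmxN mulNmx mulmxA mxE addNr.
  - move=> z; rewrite (repr z); set v := \col_k _; set w := \col_k _.
    have E x : vec v w - i x = vec (v - \col_k eps k x) w.
      have -> : i x = vec (\col_k eps k x) 0 by rewrite /vec gvE /hv big1 ?addr0// => k _; rewrite mxE scale0r.
      by rewrite vecB subr0.
    exists (gv (v - t *m w)); split.
      rewrite E; apply/h'vec; rewrite (_ : \col_k _ = v - t *m w) ?opprB 1?addrC ?subrK//.
      by apply/colP => k; rewrite mxE eps_gv.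
    move=> x; rewrite E => /h'vec H; rewrite -[RHS]gvE; congr gv.
    by rewrite -H opprB addrC subrK.
move=> z; rewrite (repr z); set v := \col_k _; set w := \col_k _.
have E u : h' (vec v w - A (i (gv u))) <-> (a - t *m c) *m u = v - t *m w.
  rewrite AE vecB h'vec mulmxBr mulmxBl mulmxA; set X := a *m u; set Y := t *m c *m u; set Z := t *m w.
  split => H.
    have -> : v = Z - Y + X by rewrite -H subrK.
    by rewrite addrAC [Z - Y]addrC addrK addrC.
  have -> : v = X - Y + Z by rewrite H subrK.
  by rewrite addrAC [X - Y]addrC addrK addrC.
exists (gv (invmx (a - t *m c) *m (v - t *m w))); split.
  by apply/E; rewrite mulKVmx.
move=> x; rewrite -(gvE x) => /E <-.
by rewrite mulKmx.
Qed.

End Isometry.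

End ManinAlgebra.

(** * Immersions and submersions *)

Section SmoothComposition.
Variables (R : realType) (M : manifold R).
Local Notation n := (mdim M).

Lemma smooth_at_compn m (psi : 'I_m -> M -> R) (W : set 'rV[R]_m) (phi : 'rV[R]_m -> R) (p : M) :
  open W -> W (\row_j psi j p) -> (forall j, smooth_at (psi j) p) -> Cinf W phi ->
  smooth_at (fun q => phi (\row_j psi j q)) p.
Proof.
move=> oW Wp spsi Cphi; have [c ac dp] := m_cover p.
have /choice[r Hr] : forall j : 'I_m, exists r : R, 0 < r /\ (ball (chart_map c p) r `<=` chart_im c /\
    Cinf (ball (chart_map c p) r) (psi j \o chart_inv c)).
  by move=> j; have [r r0 H] := smooth_atP (spsi j) ac dp; exists r.
have nd : nbhs p (chart_dom c) by apply: open_nbhs_nbhs; split => //; exact: chart_dom_open.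
have [r0 r00 Hr0] := chart_ball ac dp nd.
have [e [e0 _ er]] := min_radius r00 (fun j => (Hr j).1).
pose F x := \row_j psi j (chart_inv c x).
have CF k : CkV k (ball (chart_map c p) e) F.
  move=> j; apply: (@Ck_eq _ _ k _ (psi j \o chart_inv c)); first exact: ball_open.
    by move=> x _; rewrite /F mxE.
  by have [_ [_ C]] := Hr j; apply: Ck_subset (C k) => x; exact: le_ball.
have oU : open (ball (chart_map c p) e `&` F @^-1` W).
  apply: open_preimage_within; [exact: ball_open|by []|].
  by move=> x bx; exact: CkV_cont (CF 0%N) bx.
have Up : (ball (chart_map c p) e `&` F @^-1` W) (chart_map c p).
  split; first exact: ballxx.
  by rewrite /= /F chart_mapK.
have /nbhs_ballP[d /= d0 Hd] : nbhs (chart_map c p) (ball (chart_map c p) e `&` F @^-1` W).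
  exact: open_nbhs_nbhs.
have C : Cinf (ball (chart_map c p) d) (phi \o F).
  move=> k; apply: (@Ck_comp R n m k _ W) => //; first exact: ball_open.
    by move=> x /Hd[].
  by move=> j; apply: Ck_subset (CF k j) => x /Hd[].
apply: smooth_at_near (smooth_at_chart ac dp d0 C).
apply: filterS nd => q dq; rewrite /= /F; congr phi.
by apply/rowP => j; rewrite !mxE chart_mapK.
Qed.

Lemma tangent_coordinates_row (p : M) c (ac : atlas c) (dp : chart_dom c p) m (phi : 'I_m -> M -> R) (v : tangent p) :
  (forall j, smooth_fun (phi j)) ->
  tcoord c v *m (\matrix_(i, j) dchart c p (phi j) i) = \row_j v (phi j).
Proof.
move=> sphi; apply/rowP => j; rewrite !mxE (tan_expand ac dp v (sphi j)) /dotp.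
by apply: eq_bigr => i _; rewrite !mxE.
Qed.

(** Independent differentials make the Jacobian in a chart invertible, so [mdim M] global functions
    become coordinates near [p], with [g] in the role of the inverse chart. *)
Lemma smooth_coordinates (p : M) (phi : 'I_n -> M -> R) :
  (forall j, smooth_fun (phi j)) -> (forall v : tangent p, (forall j, v (phi j) = 0) -> v = 0) ->
  exists (V : set M) (W : set 'rV[R]_n) (g : 'rV[R]_n -> M),
    [/\ [/\ open V, open W & V p],
        forall q, V q -> W (\row_j phi j q) /\ g (\row_j phi j q) = q,
        forall y, W y -> V (g y) /\ \row_j phi j (g y) = y
      & forall f, smooth_fun f -> Cinf W (f \o g)].
Proof.
move=> sphi sep; have [c ac dp] := m_cover p.
pose F x := \row_j phi j (chart_inv c x).
have oim := chart_im_open ac.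
have CF k : CkV k (chart_im c) F.
  move=> j; apply: (@Ck_eq _ _ k _ (phi j \o chart_inv c)) => //.
    by move=> x _; rewrite /F mxE.
  exact: sphi.
have JE : Jac F (chart_map c p) = \matrix_(i, j) dchart c p (phi j) i.
  apply/matrixP => i j; rewrite !mxE /dchart; congr (partial i _ _).
  by apply/funext => x; rewrite /F mxE.
have uJ : Jac F (chart_map c p) \in unitmx.
  rewrite -row_free_unit; apply: inj_row_free => v; rewrite JE -(tvecK ac dp v) tangent_coordinates_row// => E.
  have -> : tvec c p v = 0.
    apply: sep => j; have := congr1 (fun A : 'rV[R]_n => A 0 j) E; by rewrite !mxE.
  have Z : @tcoord R M c p 0 = 0 by apply/rowP => j; rewrite !mxE.
  exact: Z.
have [V [W [g [[oV oW Vp VU] VW WV Cg]]]] := inverse_function oim CF (chart_im_map dp) uJ.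
pose V' := chart_dom c `&` chart_map c @^-1` V.
exists V', W, (chart_inv c \o g); split.
- split=> //; apply: open_preimage_within; [exact: chart_dom_open|by []|].
  by move=> q; exact: chart_map_cont.
- move=> q [dq Vq]; have := VW _ Vq; rewrite /F chart_mapK//.
  by move=> -[? E]; split => //=; rewrite E chart_mapK.
- move=> y Wy; have [Vg E] := WV y Wy; split; last exact: E.
  have im := VU _ Vg; split; first exact: chart_inv_dom.
  by rewrite /= chart_invK.
- move=> f sf k; change (Ck k W ((f \o chart_inv c) \o g)).
  apply: (@Ck_comp R n n k _ (chart_im c)) => //.
    by move=> y /WV[] /VU.
  exact: sf.
Qed.

End SmoothComposition.

Section ImmersionSubmersion.
Variables (R : realType).

(* Composing the coordinates of M with a left inverse of the matrix of the
   differential gives functions whose pullbacks are coordinates on L. *)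
Lemma immersion_retraction (L M : manifold R) (F : L -> M) (l : L) : immersion F ->
  exists (psi : 'I_(mdim L) -> M -> R) (V : set L) (W : set 'rV[R]_(mdim L)) (g : 'rV[R]_(mdim L) -> L),
    [/\ forall j, smooth_fun (psi j),
        [/\ open V, open W & V l],
        forall q, V q -> W (\row_j psi j (F q)) /\ g (\row_j psi j (F q)) = q,
        forall y, W y -> V (g y) /\ \row_j psi j (F (g y)) = y
      & forall f, smooth_fun f -> Cinf W (f \o g)].
Proof.
move=> [sF iF]; have [c ac dl] := m_cover l; have [c' ac' dm] := m_cover (F l).
pose x i := coord_ext c' (F l) i.
have sx i : smooth_fun (x i) by have [] := coord_extP ac' dm i.
have sxF i : smooth_fun (x i \o F) by have /smooth_mapP := sF; apply.
pose A := \matrix_(i, j) dchart c l (x j \o F) i.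
have AE (v : tangent l) : tcoord c v *m A = tcoord c' (dmap F v).
  rewrite (tangent_coordinates_row ac dl v sxF); apply/rowP => j; rewrite !mxE.
  by rewrite dmapE.
have /row_freeP[K AK] : row_free A.
  apply: inj_row_free => v; rewrite -(tvecK ac dl v) AE => E.
  suff -> : tvec c l v = 0 by apply/rowP => j; rewrite !mxE.
  apply: (iF l); rewrite -(tcoordK ac' dm (dmap F _)) E; apply: tangent_ext => f sf.
  by rewrite tvecE// dmapE// /dotp big1 // => i _; rewrite mxE mul0r.
pose psi j (q : M) := \sum_k K k j * x k q.
have spsi j : smooth_fun (psi j).
  by apply: smooth_fun_sum => k; apply: smooth_fun_mul => //; exact: smooth_fun_cst.
have spsiF j : smooth_fun (psi j \o F) by have /smooth_mapP := sF; apply.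
have [|V [W [g [V0 VW WV Cg]]]] := @smooth_coordinates R L l (fun j => psi j \o F) spsiF.
  move=> v Hv; rewrite -(tcoordK ac dl v) -[tcoord c v]mulmx1 -AK mulmxA AE.
  suff -> : tcoord c' (dmap F v) *m K = 0.
    by apply: tangent_ext => f sf; rewrite tvecE// /dotp big1 // => i _; rewrite mxE mul0r.
  apply/rowP => j; rewrite !mxE -[RHS](Hv j) -[RHS](dmapE v sF (spsi j)) tan_sum.
    apply: eq_bigr => k _; rewrite mxE tan_scale//; exact: mulrC.
  by move=> k; apply: smooth_fun_mul => //; exact: smooth_fun_cst.
by exists psi, V, W, g.
Qed.

(** [f] is expressed in the functions [psi] and then globalized. Agreement is near [l] in the
    topology of [L] only, since other sheets of [L] may accumulate at [F l]. *)
Lemma immersion_extension (L M : manifold R) (F : L -> M) (l : L) (f : L -> R) : immersion F -> smooth_fun f ->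
  exists2 f' : M -> R, smooth_fun f' & \forall q \near l, f' (F q) = f q.
Proof.
move=> iF sf; have [psi [V [W [g [spsi [oV oW Vl] VW WV Cg]]]]] := immersion_retraction l iF.
have sat : smooth_at (fun q => (f \o g) (\row_j psi j q)) (F l).
  apply: (smooth_at_compn oW) => //; last exact: Cg.
    by have [] := VW _ Vl.
  by move=> j; exact: smooth_fun_at.
have [f' sf' E] := smooth_global sat; exists f' => //.
have [sF _] := iF.
have nV : \forall q \near l, V q by apply: open_nbhs_nbhs.
have nE : \forall q \near l, f' (F q) = (f \o g) (\row_j psi j (F q)).
  exact: (smooth_map_cont sF E).
apply: filterS (filterI nV nE) => q [/VW[_ Eq] ->].
by rewrite /= Eq.
Qed.

(** A right inverse of the differential picks an affine slice through [p], to which the inverse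
    function theorem applies; the section is the inverse of the restriction of [F] to the slice. *)
Lemma submersion_section (D S : manifold R) (F : D -> S) (p : D) : submersion F ->
  exists sigma : S -> D, [/\ sigma (F p) = p, forall f, smooth_fun f -> smooth_at (f \o sigma) (F p) &
     \forall s \near F p, F (sigma s) = s].
Proof.
move=> [sF surF]; have [c ac dl] := m_cover p; have [c' ac' dm] := m_cover (F p).
set x0 := chart_map c p; set y0 := chart_map c' (F p).
pose x i := coord_ext c' (F p) i.
have sx i : smooth_fun (x i) by have [] := coord_extP ac' dm i.
have sxF i : smooth_fun (x i \o F) by have /smooth_mapP := sF; apply.
have xE : \forall q \near F p, \row_i x i q = chart_map c' q.
  have : \forall q \near F p, forall i, x i q = chart_map c' q 0 i.
    by apply: filter_forall => i; have [] := coord_extP ac' dm i.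
  by apply: filterS => q H; apply/rowP => i; rewrite mxE.
pose A := \matrix_(i, j) dchart c p (x j \o F) i.
have AE (v : tangent p) : tcoord c v *m A = tcoord c' (dmap F v).
  rewrite (tangent_coordinates_row ac dl v sxF); apply/rowP => j; rewrite !mxE.
  by rewrite dmapE.
have [K KA] : exists K, K *m A = 1%:M.
  have /choice[u Hu] : forall k : 'I_(mdim S), exists u : tangent p, dmap F u = tvec c' (F p) (delta_mx 0 k).
    by move=> k; have [u _ Hu] := surF p (tvec c' (F p) (delta_mx 0 k)); exists u.
  exists (\matrix_k tcoord c (u k)); apply/row_matrixP => k.
  by rewrite row_mul rowK AE Hu tvecK// rowE mulmx1.
have im0 := chart_im_map dl.
pose h (y : 'rV[R]_(mdim S)) : 'rV[R]_(mdim D) := x0 + y *m K.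
have Ch k U : CkV k U h.
  move=> j; have oT := @openT ('rV[R]_(mdim S)).
  apply: (@Ck_subset _ _ k setT); first by [].
  apply: (@Ck_eq _ _ k _ (fun y => x0 0 j + dotp (fun i => K i j) y)) => //.
    by move=> y _; rewrite !mxE.
  by apply: Ck_add => //; [exact: Ck_cst|exact: Ck_dotp].
have hc y : {for y, continuous h} by apply: (CkV_cont (Ch 0%N setT)).
pose U := setT `&` h @^-1` chart_im c.
have oU : open U by apply: open_preimage_within; [exact: openT|exact: chart_im_open|move=> y _; exact: hc].
have h0 : h 0 = x0 by rewrite /h mul0mx addr0.
have U0 : U 0 by split => //; rewrite /= h0.
pose G y := \row_i x i (F (chart_inv c (h y))).
have CG k : CkV k U G.
  move=> j; apply: (@Ck_eq _ _ k _ ((x j \o F \o chart_inv c) \o h)) => //.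
    by move=> y _; rewrite /G mxE.
  apply: (@Ck_comp R _ _ k _ (chart_im c)) => //; first exact: chart_im_open.
    by move=> y [].
  exact: sxF.
have JG : Jac G 0 = 1%:M.
  rewrite -KA; apply/matrixP => k j; rewrite !mxE.
  have D1 : CkV 1 (chart_im c) (fun z => \row_j (x j \o F \o chart_inv c) z).
    move=> i; apply: (@Ck_eq _ _ 1 _ (x i \o F \o chart_inv c)); first exact: chart_im_open.
      by move=> z _; rewrite mxE.
    exact: sxF.
  have := @Ck1_chain R _ _ U (chart_im c) h (x j \o F \o chart_inv c) 0 (delta_mx 0 k) oU (chart_im_open ac).
  move=> /(_ (fun y => @proj2 _ _) (Ch 1%N U) (sxF j c ac 1%N) U0)[_].
  rewrite /partial (_ : (fun y => G y 0 j) = (x j \o F \o chart_inv c) \o h); last by apply/funext => y; rewrite /G mxE.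
  move=> ->; apply: eq_bigr => i _; rewrite !mxE h0 /dchart; congr (_ * _).
  have E : (fun y => h y 0 i) = (fun y => x0 0 i + dotp (fun k => K k i) y).
    by apply/funext => y; rewrite !mxE.
  have [diff0 val0] := @is_diff_dotp R _ (fun k => K k i) 0.
  have der0 : derivable (dotp (fun k => K k i)) 0 (delta_mx 0 k : 'rV[R]_(mdim S)) by exact: diff_derivable.
  rewrite E (deriveD (f := fun=> x0 0 i) (derivable_cst _ _ _) der0).
  by rewrite derive_cst add0r deriveE// val0 dotp_delta.
have uJ : Jac G 0 \in unitmx by rewrite JG unitmx1.
have [V [W [g [[oV oW V0 VU] VW WV Cg]]]] := inverse_function oU CG U0 uJ.
have G0 : G 0 = y0.
  by rewrite /G h0 chart_mapK//; exact: (nbhs_singleton xE).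
have [Wy0 gy0] := VW _ V0; rewrite G0 in Wy0 gy0.
pose sigma := chart_inv c \o h \o g \o chart_map c'.
have sp : sigma (F p) = p by rewrite /sigma /= -/y0 gy0 h0 chart_mapK.
have ssigma f : smooth_fun f -> smooth_at (f \o sigma) (F p).
  move=> sf; have /nbhs_ballP[e /= e0 He] : nbhs y0 W by exact: open_nbhs_nbhs.
  apply: (@smooth_at_chart R S c' (F p) ((f \o chart_inv c \o h) \o g) e) => //.
  move=> k; apply: (@Ck_comp R _ _ k _ U) => //; first exact: ball_open.
  + by move=> y /He /WV[/VU].
  + by move=> j; apply: Ck_subset (Cg k j).
  + apply: (@Ck_comp R _ _ k _ (chart_im c)) => //; first exact: chart_im_open.
      by move=> y [].
    exact: sf.
exists sigma; split => //.
- have nW : \forall s \near F p, W (chart_map c' s).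
    by apply: (chart_map_cont ac' dm); exact: open_nbhs_nbhs.
  have nd : \forall s \near F p, chart_dom c' s.
    by apply: open_nbhs_nbhs; split => //; exact: chart_dom_open.
  have Fs : {for F p, continuous (F \o sigma)}.
    apply: continuous_of_smooth => f sf; apply: smooth_at_cont.
    by apply: (ssigma (f \o F)); have /smooth_mapP := sF; exact.
  have Es : (F \o sigma) (F p) = F p by rewrite /= sp.
  have nN : \forall s \near F p, (chart_dom c' `&` [set q | \row_i x i q = chart_map c' q]) (F (sigma s)).
    apply: Fs; rewrite Es; exact: filterI.
  apply: filterS (filterI nW (filterI nd nN)) => s [Ws [ds [dF EF]]].
  rewrite -[RHS](chart_mapK ac' ds) -[LHS](chart_mapK ac' dF) -EF.
  by have [_ <-] := WV _ Ws.
Qed.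

Lemma submersion_descend (D S : manifold R) (F : D -> S) (f : S -> R) : submersion F ->
  (forall s, range F s) -> smooth_fun (f \o F) -> smooth_fun f.
Proof.
move=> subF surF sf; apply/smooth_funP => s; have [p _ <-] := surF s.
have [sigma [sp ss Es]] := submersion_section p subF.
apply: smooth_at_near (ss _ sf); apply: filterS Es => q Eq.
by rewrite /= Eq.
Qed.

End ImmersionSubmersion.

(** * The homogeneous space D/G *)

Lemma smooth_on_fun2 (R : realType) (L M : manifold R) m (U : set 'rV[R]_m) (F : L -> M -> R)
    (u : 'rV[R]_m -> L) (v : 'rV[R]_m -> M) : open U ->
  smooth_fun2 F -> smooth_on U u -> smooth_on U v -> Cinf U (fun x => F (u x) (v x)).
Proof.
move=> oU sF [cu su] [cv sv] k; apply/Ck_pointwise => p Up.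
have [c ac dl] := m_cover (u p); have [c' ac' dm] := m_cover (v p).
pose B := (U `&` u @^-1` chart_dom c) `&` v @^-1` chart_dom c'.
have oB0 : open (U `&` u @^-1` chart_dom c).
  by apply: open_preimage_within => //; exact: chart_dom_open.
have oB : open B.
  by apply: open_preimage_within => //; [exact: chart_dom_open|move=> x [/cv]].
have Bp : B p by [].
suff : Ck k B (fun x => F (u x) (v x)) by apply: Ck_subset => y ->.
apply: (@Ck_eq _ _ k B ((fun x => F (chart_inv c (lsubmx x)) (chart_inv c' (rsubmx x))) \o
   (fun x => row_mx (chart_map c (u x)) (chart_map c' (v x))))) => //.
  by move=> x [[Ux du] dv]; rewrite /= row_mxKl row_mxKr !chart_mapK.
apply: (@Ck_comp _ _ _ k B (pair_dom c c')) => //; first exact: pair_dom_open.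
- by move=> x [[Ux du] dv]; exact: pair_dom_mx.
- apply: CkV_row_mx => j.
    by apply: Ck_subset (su c ac j k) => x [].
  by apply: Ck_subset (sv c' ac' j k) => x [[]].
- exact: sF.
Qed.

Lemma smooth_fun2_comp2 (R : realType) (K K' L M : manifold R) (F : L -> M -> R) (u : K -> K' -> L) (v : K -> K' -> M) :
  smooth_fun2 F -> smooth_map2 u -> smooth_map2 v -> smooth_fun2 (fun k l => F (u k l) (v k l)).
Proof.
move=> sF su sv c c' ac ac'; apply: smooth_on_fun2 => //; [exact: pair_dom_open|exact: su|exact: sv].
Qed.

Lemma smooth_map2_fst (R : realType) (K L M : manifold R) (u : K -> M) :
  smooth_map u -> smooth_map2 (fun k (_ : L) => u k).
Proof.
move=> su; apply/smooth_map2P => f sf c c' ac ac' k.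
have sfu : smooth_fun (f \o u) by have /smooth_mapP := su; exact.
have oD := @pair_dom_open R K L c c' ac ac'.
apply: (@Ck_comp _ _ _ k _ (chart_im c) lsubmx ((f \o u) \o chart_inv c)) => //.
- exact: chart_im_open.
- by move=> x [].
- exact: CkV_lsubmx.
- exact: sfu.
Qed.

Lemma smooth_map2_snd (R : realType) (K L M : manifold R) (u : L -> M) :
  smooth_map u -> smooth_map2 (fun (_ : K) l => u l).
Proof.
move=> su; apply/smooth_map2P => f sf c c' ac ac' k.
have sfu : smooth_fun (f \o u) by have /smooth_mapP := su; exact.
have oD := @pair_dom_open R K L c c' ac ac'.
apply: (@Ck_comp _ _ _ k _ (chart_im c') rsubmx ((f \o u) \o chart_inv c')) => //.
- exact: chart_im_open.
- by move=> x [].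
- exact: CkV_rsubmx.
- exact: sfu.
Qed.

Lemma smooth_fun_prod (R : realType) (M : manifold R) (I : Type) (r : seq I) (F : I -> M -> R) :
  (forall k, smooth_fun (F k)) -> smooth_fun (fun q => \prod_(k <- r) F k q).
Proof.
move=> sF; elim: r => [|k r IH].
  by rewrite (_ : (fun q => _) = fun=> 1); [exact: smooth_fun_cst|apply/funext => q; rewrite big_nil].
rewrite (_ : (fun q => _) = fun q => F k q * \prod_(k <- r) F k q); first exact: smooth_fun_mul.
by apply/funext => q; rewrite big_cons.
Qed.

Lemma smooth_fun_det (R : realType) (M : manifold R) k (A : M -> 'M[R]_k) :
  (forall a b, smooth_fun (fun q => A q a b)) -> smooth_fun (fun q => \det (A q)).
Proof.
move=> sA; apply: smooth_fun_sum => s; apply: smooth_fun_mul; first exact: smooth_fun_cst.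
by apply: smooth_fun_prod => a; exact: sA.
Qed.

Lemma connected_clopen (T : topologicalType) (E : set T) : connected [set: T] ->
  E !=set0 -> open E -> open (~` E) -> E = setT.
Proof.
move=> cT E0 oE oE'; apply: (cT E E0).
  by exists E => //; rewrite setTI.
by exists E; rewrite ?setTI//; rewrite -[E]setCK; exact: open_closedC.
Qed.

(** * The adjoint action *)

Section Adjoint.
Variables (R : realType) (G : lieGroup R).
Local Notation "a ** b" := (lg_mul a b) (at level 40, left associativity).
Local Notation one := (lg_one G).
Local Notation inv := (@lg_inv R G).

Definition Ad (a : G) (X : lie G) : lie G := dmap_to (fun b => a ** b ** inv a) one X.

Lemma smooth_conj (a : G) : smooth_map (fun b => a ** b ** inv a).
Proof. exact: (smooth_map_comp (smooth_lmul a) (smooth_rmul (inv a))). Qed.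

Lemma AdE a X f : smooth_fun f -> Ad a X f = X (fun b => f (a ** b ** inv a)).
Proof.
by move=> sf; rewrite /Ad dmap_toE//; [rewrite lgm1 lgmV|exact: smooth_conj].
Qed.

Lemma Ad_linear a k X Y : Ad a (k *: X + Y) = k *: Ad a X + Ad a Y.
Proof. by rewrite /Ad dmap_to_linear//; [rewrite lgm1 lgmV|exact: smooth_conj]. Qed.

Lemma Ad1 X : Ad one X = X.
Proof.
apply: tangent_ext => f sf; rewrite AdE//; congr (tangent_fun X); apply/funext => b.
by rewrite lg1m lg_inv1 lgm1.
Qed.

Lemma smooth_conj2 (f : G -> R) : smooth_fun f -> smooth_fun2 (fun a b => f (a ** b ** inv a)).
Proof.
move=> sf; apply: (smooth_fun2_comp2 (smooth_mul2 sf) (@lg_mul_smooth R G)).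
apply: smooth_map2_fst; exact: lg_inv_smooth.
Qed.

Lemma Ad_smooth X f : smooth_fun f -> smooth_fun (fun a => Ad a X f).
Proof.
move=> sf; rewrite (_ : (fun a => _) = (fun a => X (fun b => f (a ** b ** inv a)))).
  exact: smooth_fun2_tan (smooth_conj2 sf).
by apply/funext => a; rewrite AdE.
Qed.

End Adjoint.

(** Conjugation leads back to the unit only up to a propositional equality of points, so vectors at
    the two points are compared by their values on functions. *)
Lemma metric_transport (R : realType) (M : manifold R) (g : forall a : M, tangent a -> tangent a -> R)
    (p q : M) (u v : tangent p) (u' v' : tangent q) : p = q ->
  (forall f, smooth_fun f -> u f = u' f) -> (forall f, smooth_fun f -> v f = v' f) -> g p u v = g q u' v'.
Proof. by move=> E; case: _ / E u' v' => u' v' /tangent_ext -> /tangent_ext ->. Qed.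

Section GroupPairFacts.
Variables (R : realType) (n : nat) (DG : groupPair R n).
Local Notation D := (gpD DG).
Local Notation G := (gpG DG).
Local Notation incl := (@gp_incl R n DG).
Local Notation B := (@gp_metric R n DG (lg_one D)).
Local Notation i := (@gp_alg_incl R n DG).
Local Notation "a ** b" := (lg_mul a b) (at level 40, left associativity).
Local Notation one := (lg_one _).
Local Notation inv := (@lg_inv R _).

Lemma incl_smooth : smooth_map incl.
Proof. by have [] := gp_immersion DG. Qed.

Lemma incl_one : incl one = one.
Proof.
have := gp_morph (lg_one G) (lg_one G); rewrite lg1m => /(congr1 (lg_mul (inv (incl one)))).
by rewrite lgVm lgVK.
Qed.

Lemma alg_inclE x f : smooth_fun f -> i x f = x (f \o incl).
Proof. by move=> sf; rewrite /gp_alg_incl dmap_toE//; [exact: incl_one|exact: incl_smooth]. Qed.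

Lemma Ad_isometry a X Y : B (Ad a X) (Ad a Y) = B X Y.
Proof.
rewrite -(gp_left a X Y) -(gp_right (inv a) (dmap (lg_mul a) X) (dmap (lg_mul a) Y)).
have sR := smooth_rmul (inv a); have sL := smooth_lmul a.
have H (Z : lie D) f : smooth_fun f -> Ad a Z f = dmap (fun c : D => c ** inv a) (dmap (lg_mul a) Z) f.
  move=> sf; rewrite AdE// dmapE// dmapE//.
  by have /smooth_mapP := sR; exact.
by apply: metric_transport; [rewrite lgm1 lgmV|exact: H|exact: H].
Qed.

Lemma form_smooth (X : D -> lie D) (Y : lie D) :
  (forall f, smooth_fun f -> smooth_fun (fun a => X a f)) -> smooth_fun (fun a => B (X a) Y).
Proof.
move=> sX; have [c ac d1] := m_cover (lg_one D).
have mp := gp_manin DG.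
rewrite (_ : (fun a => _) = fun a => \sum_k X a (coord_ext c one k) * B (tvec c one (delta_mx 0 k)) Y); last first.
  apply/funext => a; rewrite {1}(tangent_basis ac d1 (X a)) (form_sum mp).
  by apply: eq_bigr => k _; rewrite (formZ mp).
apply: smooth_fun_sum => k; apply: smooth_fun_mul; last exact: smooth_fun_cst.
by apply: sX; have [] := coord_extP ac d1 k.
Qed.

(* det Ad_a = 1 by connectedness of D: this parity is what allows a
   Lagrangian complement common to g and Ad_a g. *)
Lemma Ad_det h (Hh : isotropic_complement B i h) N (e : 'I_N -> lie G) (eps : 'I_N -> dual (lie G)) :
  (forall k l, eps k (e l) = (k == l)%:R) -> (forall x, x = \sum_k eps k x *: e k) ->
  forall a, \det (isom_mx B i h e eps (Ad a)) = 1.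
Proof.
move=> He Hb; have mp := gp_manin DG; pose phi a := \det (isom_mx B i h e eps (Ad a)).
have phi2 a : phi a ^+ 2 = 1 by apply: (isom_mx_det mp Hh He Hb) => u v; exact: Ad_isometry.
have phi1 : phi one = 1.
  rewrite /phi (_ : @Ad R D one = id) ?(isom_mx_id mp Hh He)// ?det1//.
  by apply/funext => X; rewrite Ad1.
have sm k l : smooth_fun (fun a => isom_mx B i h e eps (Ad a) k l).
  have cc X Y : smooth_fun (fun a => B (Ad a X) Y).
    by apply: form_smooth => f sf; exact: Ad_smooth.
  rewrite -(splitK k) -(splitK l); case: (fintype.split k) => k'; case: (fintype.split l) => l' /=.
  - rewrite (_ : (fun a => _) = fun a => B (Ad a (i (e l'))) (j_iso B i h (eps k'))); first exact: cc.
    by apply/funext => b; rewrite /isom_mx block_mxEul mxE.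
  - rewrite (_ : (fun a => _) = fun a => B (Ad a (j_iso B i h (eps l'))) (j_iso B i h (eps k'))); first exact: cc.
    by apply/funext => b; rewrite /isom_mx block_mxEur mxE.
  - rewrite (_ : (fun a => _) = fun a => B (Ad a (i (e l'))) (i (e k'))); first exact: cc.
    by apply/funext => b; rewrite /isom_mx block_mxEdl mxE.
  - rewrite (_ : (fun a => _) = fun a => B (Ad a (j_iso B i h (eps l'))) (i (e k'))); first exact: cc.
    by apply/funext => b; rewrite /isom_mx block_mxEdr mxE.
have sphi : smooth_fun phi by exact: smooth_fun_det.
have cphi : continuous phi by move=> a; apply: smooth_at_cont; exact: smooth_fun_at.
(* [phi] takes only the values 1 and -1, so its positivity is an open and closed condition. *)
pose E := [set a | 0 < phi a].
have cl : E = setT.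
  apply: connected_clopen; first exact: gp_D_connected.
  - by exists one; rewrite /E /= phi1.
  - by apply: (@open_comp _ _ phi [set x | 0 < x]) => [a _|]; [exact: cphi|exact: open_gt].
  rewrite (_ : ~` E = phi @^-1` [set x | x < 0]).
    by apply: open_comp => [a _|]; [exact: cphi|exact: open_lt].
  apply/seteqP; split=> a /=; last by move=> /lt_gtF; rewrite /E /= => ->.
  move=> /negP; rewrite -leNgt le_eqVlt => /orP[/eqP p0|//].
  by have /eqP := phi2 a; rewrite p0 expr0n /= eq_sym oner_eq0.
move=> a; have : 0 < phi a by have : E a by rewrite cl.
by move=> /ltW p0; have /eqP := phi2 a; rewrite sqrf_eq1 => /orP[/eqP//|/eqP E1]; move: p0; rewrite -/(phi a) E1 lerNr oppr0 ler10.
Qed.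

End GroupPairFacts.

Lemma is_derive_eps (R : realType) (phi : R -> R) (d e : R) :
  is_derive (0 : R) (1 : R) phi d -> 0 < e ->
  exists2 r : R, 0 < r & forall s : R, `|s| < r -> `|phi s - phi 0 - s * d| <= e * `|s|.
Proof.
move=> [dr vl] e0.
have cv : (fun h : R => h^-1 *: ((phi \o shift 0) (h *: (1 : R)) - phi 0)) @ 0^' --> d by rewrite -vl; exact: dr.
have /cvgrPdist_le/(_ e e0) /nbhs_ballP[r /= r0 Hr] := cv.
exists r => // s sr; have [->|s0] := eqVneq s 0; first by rewrite subrr mul0r subrr !normr0 mulr0.
have := Hr s; rewrite -ball_normE /= sub0r normrN => /(_ sr s0).
rewrite /shift addr0 [s *: 1]mulr1 [_ *: _]mulrC distrC => H.
have -> : phi s - phi 0 - s * d = ((phi s - phi 0) / s - d) * s by field.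
by rewrite normrM ler_wpM2r.
Qed.

(** If [F] were injective on the interval, the interval would be countable, hence of Lebesgue
    measure zero. *)
Lemma uncountable_interval (R : realType) (T : Type) (A : set T) (F : R -> T) (d : R) : 0 < d -> countable A ->
  (forall t, 0 < t < d -> A (F t)) -> exists s t, [/\ 0 < s < d, 0 < t < d, s != t & F s = F t].
Proof.
move=> d0 cA FA; apply: contrapT => nH.
have inj : {in [set t | 0 < t < d] &, injective F}.
  move=> s t /set_mem/= hs /set_mem/= ht E; apply/eqP/negPn/negP => st; apply: nH.
  by exists s, t.
have [f fi] := countable_injP _ cA.
have cI : countable [set t : R | 0 < t < d].
  apply/countable_injP; exists (f \o F) => s t hs ht /= E.
  apply: inj => //; apply: fi => //; apply/mem_set; apply: FA; exact: set_mem.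
have := countable_lebesgue_measure0 cI.
have -> : [set t : R | 0 < t < d] = [set` `]0, d[%R] by apply/seteqP; split => t /=; rewrite in_itv.
rewrite lebesgue_measure_itv /= lte_fin d0 sube0 => /eqP; rewrite eqe => /eqP dd.
by move: d0; rewrite dd ltxx.
Qed.

Lemma smooth_separates (R : realType) (M : manifold R) (p q : M) :
  (forall f, smooth_fun f -> f p = f q) -> p = q.
Proof.
move=> H; apply: contrapT => npq.
have cp : closed [set p] by apply/accessible_closed_set1/hausdorff_accessible; exact: m_hausdorff.
have nq : nbhs q (~` [set p]).
  by apply: open_nbhs_nbhs; split; [exact: closed_openC|move=> /= E; apply: npq].
have [f [sf f1 f0]] := smooth_bump nq.
have := H f sf; rewrite (nbhs_singleton f1) f0 => [/eqP|]; last by apply.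
by rewrite eq_sym oner_eq0.
Qed.

Lemma tangent_oppE (R : realType) (M : manifold R) (p : M) (u : tangent p) f : (- u) f = - u f.
Proof. by []. Qed.

Lemma tangent_dual_basis (R : realType) (M : manifold R) (p : M) :
  exists (e : 'I_(mdim M) -> tangent p) (x : 'I_(mdim M) -> M -> R),
  [/\ forall k, smooth_fun (x k), forall k l, e l (x k) = (k == l)%:R
    & forall v : tangent p, v = \sum_k v (x k) *: e k].
Proof.
have [c ac dp] := m_cover p.
have sx k := (coord_extP ac dp k).1.
exists (fun k => tvec c p (delta_mx 0 k)), (fun k => coord_ext c p k); split => //.
  by move=> k l; rewrite tvecE// dotp_delta dchart_coord// eq_sym.
by move=> v; exact: tangent_basis.
Qed.

Section HomogeneousFacts.
Variables (R : realType) (n : nat) (DG : groupPair R n) (S : homogeneousSpace DG).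
Local Notation D := (gpD DG).
Local Notation G := (gpG DG).
Local Notation incl := (@gp_incl R n DG).
Local Notation B := (@gp_metric R n DG (lg_one D)).
Local Notation i := (@gp_alg_incl R n DG).
Local Notation pi := (hs_proj S).
Local Notation dress := (@dressing R n DG S).
Local Notation "a ** b" := (lg_mul a b) (at level 40, left associativity).
Local Notation one := (lg_one _).
Local Notation inv := (@lg_inv R _).

Lemma proj_smooth : smooth_map pi.
Proof. by have [] := hs_submersion S. Qed.

Lemma proj_smooth_fun f : smooth_fun f -> smooth_fun (f \o pi).
Proof. by have /smooth_mapP := proj_smooth; apply. Qed.

Lemma lmul_smooth_fun (H : lieGroup R) (f : H -> R) a : smooth_fun f -> smooth_fun (fun b => f (a ** b)).
Proof. by have /smooth_mapP := @smooth_lmul R H a; apply. Qed.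

Lemma rmul_smooth_fun (H : lieGroup R) (f : H -> R) a : smooth_fun f -> smooth_fun (fun b => f (b ** a)).
Proof. by have /smooth_mapP := @smooth_rmul R H a; apply. Qed.

(** Representatives of a coset differ by a right factor in G, which commutes with left
    multiplication, so the choice made in [dressing] does not matter. *)
Lemma dressing_proj b a : dressing b (pi a) = pi (b ** a).
Proof.
rewrite /dressing; case: xgetP => [c _ /= E|/(_ a)[]//].
have /(hs_fibre S c a)[g ->] := E.
by apply/(hs_fibre S); exists g; rewrite lgA.
Qed.

Lemma proj_incl a g : pi (a ** incl g) = pi a.
Proof. by apply/esym/(hs_fibre S); exists g. Qed.

Lemma dressing_smooth a : smooth_map (dressing a : S -> S).
Proof.
apply/smooth_mapP => f sf; apply: (submersion_descend (hs_submersion S)) => [s|].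
  exact: hs_surj.
rewrite (_ : _ \o _ = fun b => (f \o pi) (a ** b)).
  exact: lmul_smooth_fun (proj_smooth_fun sf).
by apply/funext => b; rewrite /= dressing_proj.
Qed.

Lemma fund_dressing y a f : smooth_fun f ->
  fundamental dress y (pi a) f = - y (fun b => f (pi (b ** a))).
Proof.
move=> sf; have E f' : (fun b => f' (dressing b (pi a))) = (fun b => f' (pi (b ** a))).
  by apply/funext => b; rewrite dressing_proj.
rewrite fundamentalE// ?E ?dressing_proj ?lg1m// => f' sf'.
rewrite E; exact: rmul_smooth_fun (proj_smooth_fun sf').
Qed.

Lemma fund_dressing_linear s k x y :
  fundamental dress (k *: x + y) s = k *: fundamental dress x s + fundamental dress y s.
Proof.
have [a _ <-] := hs_surj s; apply: tangent_ext => f sf.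
by rewrite tangent_addE tangent_scaleE !fund_dressing// tangent_addE tangent_scaleE opprD mulrN.
Qed.

Lemma fund_dressing_surj s (w : tangent s) : exists y, fundamental dress y s = w.
Proof.
have [a _ sE] := hs_surj s; case: _ / sE w => w.
have [_ /(_ a w)[v _ <-]] := hs_submersion S.
pose y := dmap_to (fun b => b ** inv a) one v.
have sr := smooth_rmul (inv a).
exists (- y); apply: tangent_ext => f sf.
rewrite fund_dressing// dmapE//; last exact: proj_smooth.
have sfp := rmul_smooth_fun a (proj_smooth_fun sf).
rewrite tangent_oppE opprK /y dmap_toE//; last by rewrite lgmV.
by congr (tangent_fun v); apply/funext => b /=; rewrite lgmVK.
Qed.

(** The conjugate of G by [a] fixes the point [pi a]. *)
Lemma fund_dressing_Ad a x : fundamental dress (Ad a (i x)) (pi a) = 0.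
Proof.
apply: tangent_ext => f sf; have sfp := rmul_smooth_fun a (proj_smooth_fun sf).
rewrite fund_dressing// AdE//.
have -> : (fun b => f (pi (a ** b ** inv a ** a))) = (fun b => (f \o pi) (a ** b)).
  by apply/funext => b /=; rewrite lgmVK.
rewrite alg_inclE; last exact: lmul_smooth_fun (proj_smooth_fun sf).
rewrite (_ : _ \o _ = fun=> f (pi a)) ?tan_cst ?oppr0//.
by apply/funext => g /=; rewrite proj_incl.
Qed.

(* Since exp(tX) stays in the closed subgroup, second countability of the
   immersed group G yields small parameters s with exp(sX) close to the unit
   in the topology of G itself. *)
Lemma subgroup_recurrence (gam : R -> G) (W : set G) (d : R) : hom_curve gam ->
  nbhs one W -> 0 < d -> exists s, [/\ s != 0, `|s| < d & W (gam s)].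
Proof.
move=> hg nW d0; have [Bs cB [oB bB]] := m_countable G.
have H t : exists b, Bs b /\ b (gam t) /\ b `<=` [set x | W (x ** inv (gam t))].
  have nb : nbhs (gam t) [set x | W (x ** inv (gam t))].
    by apply: (smooth_map_cont (smooth_rmul (inv (gam t)))); rewrite lgmV.
  by have [b [Bb bt] sb] := bB (gam t) _ nb; exists b.
have /choice[F HF] := H.
have [s [t [hs ht st E]]] := uncountable_interval d0 cB (fun t _ => (HF t).1).
exists (s - t); split; first by rewrite subr_eq0.
  by move: hs ht => /andP[? ?] /andP[? ?]; rewrite ltr_norml; apply/andP; split; lra.
have [_ [bs _]] := HF s; have [_ [_ Wt]] := HF t; rewrite E in bs.
have := Wt _ bs => /=; suff -> : gam s ** inv (gam t) = gam (s - t) by [].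
by rewrite -[in LHS](subrK t s) hg lgmK.
Qed.

(** The candidate [x] has as coordinates the derivatives along X of functions on D that extend the
    coordinates of G. Otherwise some function would vary at first order along [gam] while being
    stationary on G at the unit, which the parameters of [subgroup_recurrence] contradict. *)
Lemma subgroup_tangent (X : lie D) (gam : R -> G) : hom_curve gam ->
  (forall f, smooth_fun f -> is_derive (0 : R) (1 : R) (fun t => f (incl (gam t))) (X f)) ->
  exists x, i x = X.
Proof.
move=> hg Dg; have [c ac d1] := m_cover (lg_one G).
have sx k := (coord_extP ac d1 k).1.
have /choice[Y HY] : forall k, exists Y : D -> R, smooth_fun Y /\
    \forall q \near lg_one G, Y (incl q) = coord_ext c one k q.
  by move=> k; have [Y sY EY] := immersion_extension one (gp_immersion DG) (sx k); exists Y.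
exists (\sum_k X (Y k) *: tvec c one (delta_mx 0 k)); apply: tangent_ext => f sf.
have sfi : smooth_fun (f \o incl) by have /smooth_mapP := @incl_smooth R n DG; apply.
rewrite alg_inclE// tangent_sumE.
under eq_bigr => k _ do rewrite tangent_scaleE tvecE// dotp_delta.
set a := dchart c one (f \o incl).
(* [f'] has zero differential along G at the unit, and its derivative along X is the difference that
   has to vanish. *)
pose f' q := f q - \sum_k Y k q * a k.
have sYa k : smooth_fun (fun q => Y k q * a k).
  by apply: smooth_fun_mul; [exact: (HY k).1|exact: smooth_fun_cst].
have ssum : smooth_fun (fun q => \sum_k Y k q * a k) by exact: smooth_fun_sum.
have sf' : smooth_fun f' by apply: smooth_fun_add => //; exact: smooth_fun_opp.
have kE (p : D) (Z : tangent p) : Z f' = Z f - \sum_k Z (Y k) * a k.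
  rewrite tan_sub// tan_sum//; congr (_ - _); apply: eq_bigr => k _.
  have -> : (fun q => Y k q * a k) = (fun q => a k * Y k q) by apply/funext => q; rewrite mulrC.
  by rewrite (tan_scale Z (a k) (HY k).1) mulrC.
apply/esym/eqP; rewrite -subr_eq0 -kE; apply/negPn/negP => kap0.
have sf'i : smooth_fun (f' \o incl) by have /smooth_mapP := @incl_smooth R n DG; apply.
have d0 k : dchart c one (f' \o incl) k = 0.
  rewrite -[LHS](dotp_delta (dchart c one (f' \o incl))) -tvecE//.
  have sYi l : smooth_fun (Y l \o incl) by have /smooth_mapP := @incl_smooth R n DG; apply; exact: (HY l).1.
  have sYia l : smooth_fun (fun q => a l * (Y l \o incl) q).
    by apply: smooth_fun_mul => //; exact: smooth_fun_cst.
  have -> : f' \o incl = fun q => (f \o incl) q - \sum_l a l * (Y l \o incl) q.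
    by apply/funext => q; rewrite /= /f'; congr (_ - _); apply: eq_bigr => l _; rewrite mulrC.
  rewrite tan_sub//; last exact: smooth_fun_sum.
  have T l : tvec c one (delta_mx 0 k) (fun q => a l * (Y l \o incl) q) = a l * (k == l)%:R.
    rewrite (tan_scale _ (a l) (sYi l)) (tan_local _ (sYi l) (sx l) (HY l).2) tvecE//.
    by rewrite dotp_delta dchart_coord.
  rewrite tan_sum// tvecE// dotp_delta -/a (eq_bigr _ (fun l _ => T l)) (bigD1 k)//= big1 => [|l lk].
    by rewrite eqxx mulr1 addr0 subrr.
  by rewrite eq_sym (negbTE lk) mulr0.
pose C := \sum_k `|X (Y k)| + 1.
have C0 : 0 < C by rewrite ltr_wpDl// sumr_ge0.
(* The variation of [f'] over time [s] is at most [eps * C * |s|] through G, with error [eps * |s|]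
   along [gam]; together they are half of [|X f'| * |s|]. *)
pose eps := `|X f'| / (2 * (1 + C)).
have eps0 : 0 < eps by rewrite divr_gt0 ?normr_gt0// mulr_gt0// ltr_wpDl// ltW.
have x0im := chart_im_map d1.
have [r r0 [rU Hr]] := Ck1_strict (chart_im_open ac) (sf'i c ac 1%N) x0im eps0.
have nW : nbhs (lg_one G) ((chart_dom c `&` chart_map c @^-1` ball (chart_map c one) r) `&`
    [set q | forall k, Y k (incl q) = chart_map c q 0 k]).
  apply: filterI; first apply: filterI.
  - by apply: open_nbhs_nbhs; split => //; exact: chart_dom_open.
  - by apply: (chart_map_cont ac d1); exact: nbhsx_ballx.
  have : \forall q \near lg_one G, forall k, Y k (incl q) = chart_map c q 0 k.
    apply: filter_forall => k; apply: filterS (filterI (HY k).2 (coord_extP ac d1 k).2).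
    by move=> q [-> ->].
  exact.
have [rf rf0 Hrf] := is_derive_eps (Dg f' sf') eps0.
have /choice[rk Hrk] : forall k, exists rk : R, 0 < rk /\ forall s : R, `|s| < rk ->
    `|Y k (incl (gam s)) - Y k (incl (gam 0)) - s * X (Y k)| <= 1 * `|s|.
  by move=> k; have [rk rk0 H] := is_derive_eps (Dg (Y k) (HY k).1) ltr01; exists rk.
have [d [dd0 drf drk]] := min_radius rf0 (fun k => (Hrk k).1).
have [s [s0 sd [[ds bs] ys]]] := subgroup_recurrence hg nW dd0.
have g0 := hom_curve0 hg.
have n0 : nbhs (lg_one G) [set q | forall k, Y k (incl q) = chart_map c q 0 k] by apply: filterS nW => q [].
have y0 := nbhs_singleton n0.
have E1 := Hrf s (lt_le_trans sd drf).
(* [gam] is not known to be continuous into G; the functions [Y k] on D, differentiable along [gam],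
   control the coordinates of [gam s] for the recurrent [s]. *)
have E2 : `|chart_map c (gam s) - chart_map c one| <= C * `|s|.
  apply: norm_row_le => [|k]; first by rewrite mulr_ge0// ltW.
  rewrite !mxE -ys -y0.
  have [_ /(_ s (lt_le_trans sd (drk k)))] := Hrk k; rewrite g0 mul1r => H.
  have -> : Y k (incl (gam s)) - Y k (incl one) = (Y k (incl (gam s)) - Y k (incl one) - s * X (Y k)) + s * X (Y k) by ring.
  apply: le_trans (ler_normD _ _) _; rewrite /C mulrDl addrC mul1r; apply: lerD => //.
  by rewrite normrM mulrC ler_wpM2r// (bigD1 k)//= lerDl sumr_ge0.
have E3 : `|f' (incl (gam s)) - f' (incl (gam 0))| <= eps * (C * `|s|).
  have := Hr _ _ (ballxx (chart_map c one) r0) bs.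
  rewrite /= !chart_mapK// g0 (_ : dotp _ _ = 0) ?subr0; last first.
    by rewrite /dotp big1// => k _; have := d0 k; rewrite /dchart => ->; rewrite mulr0.
  move=> H; apply: le_trans H _; apply: ler_wpM2l E2; exact: ltW.
have E4 : `|X f'| * `|s| <= eps * (1 + C) * `|s|.
  rewrite -normrM (mulrC (X f')).
  have -> : s * X f' = (f' (incl (gam s)) - f' (incl (gam 0))) - (f' (incl (gam s)) - f' (incl (gam 0)) - s * X f') by ring.
  apply: le_trans (ler_normB _ _) _.
  have -> : eps * (1 + C) * `|s| = eps * (C * `|s|) + eps * `|s| by ring.
  exact: lerD.
move: E4; rewrite ler_pM2r ?normr_gt0// /eps.
have -> : `|X f'| / (2 * (1 + C)) * (1 + C) = `|X f'| / 2.
  by field; rewrite gt_eqF// ltr_wpDl// ltW.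
have : 0 < `|X f'| by rewrite normr_gt0.
lra.
Qed.

(** Translated to the unit, [y] becomes a vector X that kills every function lifted from [S] at
    every point, so exp(tX) stays in one coset, namely in G, and [subgroup_tangent] applies. *)
Lemma fund_dressing_ker y a : fundamental dress y (pi a) = 0 -> exists x, Ad a (i x) = y.
Proof.
move=> y0; pose X := Ad (inv a) y.
have X0 f c : smooth_fun f -> X (fun b => f (pi (c ** b))) = 0.
  move=> sf; pose f' := f \o (dressing (c ** inv a) : S -> S).
  have sf' : smooth_fun f' by have /smooth_mapP := dressing_smooth (c ** inv a); apply.
  have -> : (fun b => f (pi (c ** b))) = (fun b => (f' \o pi) (a ** b)).
    by apply/funext => b; rewrite /f' /= dressing_proj lgA lgmVK.
  rewrite AdE; last exact: lmul_smooth_fun (proj_smooth_fun sf').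
  have -> : (fun b => (f' \o pi) (a ** (inv a ** b ** inv (inv a)))) = (fun b => f' (pi (b ** a))).
    by apply/funext => b; rewrite /= lg_invK -!lgA lgKV.
  have := congr1 (fun v => tangent_fun v f') y0; rewrite /= fund_dressing// => /eqP.
  by rewrite oppr_eq0 => /eqP.
have [hu Du] := one_parameter_derive (lie_exp_one_parameter X).
pose u t := lie_exp (t *: X); rewrite -/u in hu Du.
have cst t : pi (u t) = pi one.
  apply: smooth_separates => f sf.
  have D0 (s : R) : is_derive s (1 : R) (fun s => f (pi (u s))) 0.
    have := hom_integral_curve hu Du s (proj_smooth_fun sf).
    by rewrite /left_invariant (_ : X _ = 0)//; exact: (X0 f (u s) sf).
  have := @mvt_dist R (fun s => f (pi (u s))) (fun=> 0) t 0 0 (fun s _ => D0 s).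
  rewrite mul0r subr0 mul0r (hom_curve0 hu) => H.
  by apply/eqP; rewrite -subr_eq0 -normr_le0 -[_ - _]subr0; apply: H => s _; rewrite normr0.
have /choice[gam Hgam] : forall t, exists g, incl g = u t.
  by move=> t; have /esym/(hs_fibre S)[g E] := cst t; exists g; rewrite E lg1m.
have hgam : hom_curve gam.
  by move=> s t; apply: (gp_inj (g := DG)); rewrite gp_morph !Hgam hu.
have [|x Hx] := @subgroup_tangent X gam hgam.
  move=> f sf; rewrite (_ : (fun t => f (incl (gam t))) = f \o u); first exact: Du.
  by apply/funext => t; rewrite Hgam.
exists x; rewrite Hx; apply: tangent_ext => f sf; rewrite AdE// AdE.
  by congr (tangent_fun y); apply/funext => b; rewrite lg_invK !lgA lgmV lg1m -!lgA lgmV lgm1.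
by have /smooth_mapP := smooth_conj a; apply.
Qed.

(** The kernel of y |-> y_S at [pi a] is Ad_a g, so any linear complement of it maps bijectively
    onto the tangent space. *)
Lemma admissible_of_complement h' a : Defs.subspace h' -> (forall z, exists! x, h' (z - Ad a (i x))) ->
  admissible_at h' (pi a).
Proof.
move=> [h0 hl] Hc; split => //.
- move=> y y' /set_mem hy /set_mem hy' E.
  have hd : h' (y - y') by rewrite addrC -scaleN1r; exact: hl.
  have [|x Hx] := @fund_dressing_ker (y - y') a.
    by rewrite addrC -scaleN1r fund_dressing_linear E scaleN1r addNr.
  have [x0 [_ U]] := Hc (y - y').
  have i0 : i 0 = 0 := incl0 (gp_manin DG).
  have A0 : Ad a (i 0) = 0 by rewrite i0; have := Ad_linear a (-1) 0 0; rewrite scaler0 addr0 scaleN1r addNr.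
  have E1 : x0 = x by apply: U; rewrite Hx subrr.
  have E2 : x0 = 0 by apply: U; rewrite A0 subr0.
  apply/eqP; rewrite -subr_eq0 -Hx -E1 E2 A0; exact/eqP.
- move=> w _; have [z <-] := fund_dressing_surj w; have [x [hx _]] := Hc z.
  exists (z - Ad a (i x)); first exact: hx.
  by rewrite addrC -scaleN1r fund_dressing_linear fund_dressing_Ad scaler0 add0r.
Qed.

Lemma admissible_exists h s : isotropic_complement B i h ->
  exists h' : set (lie D), isotropic_complement B i h' /\ admissible_at h' (s : S).
Proof.
move=> Hh; have [a _ <-] := hs_surj s; have mp := gp_manin DG.
have [e [x [sx ex Hb]]] := tangent_dual_basis (lg_one G).
pose eps k : dual (lie G) := dfun _ (x k).
have He k l : eps k (e l) = (k == l)%:R by rewrite /eps dfunE.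
have Hb' y : y = \sum_k eps k y *: e k by rewrite {1}(Hb y); apply: eq_bigr => k _; rewrite /eps dfunE.
have [h' [Hh' Hc]] := lagrangian_common_complement mp Hh He Hb' (Ad_linear a) (Ad_isometry a) (Ad_det Hh He Hb' a).
exists h'; split => //; apply: admissible_of_complement => //.
by have [] := Hh'.
Qed.

End HomogeneousFacts.

Lemma tan_expand_coord (R : realType) (M : manifold R) (c : chart R (mdim M) M) (p : M)
    (v : tangent p) f (g : 'I_(mdim M) -> M -> R) : atlas c -> chart_dom c p ->
  smooth_fun f -> (forall i, smooth_fun (g i)) ->
  (\forall q \near p, forall i, g i q = chart_map c q 0 i) ->
  v f = \sum_i v (g i) * dchart c p f i.
Proof.
move=> ac dp sf sg H; rewrite (tan_expand ac dp v sf) /dotp; apply: eq_bigr => i _; congr (_ * _).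
rewrite mxE; apply: tan_local => //; first by have [] := coord_extP ac dp i.
apply: filterS (filterI H (coord_extP ac dp i).2) => q [-> ->] //.
Qed.

(** * Admissibility is an open condition *)

Section AdmissibleOpen.
Variables (R : realType) (n : nat) (DG : groupPair R n) (S : homogeneousSpace DG).
Local Notation D := (gpD DG).
Local Notation G := (gpG DG).
Local Notation B := (@gp_metric R n DG (lg_one D)).
Local Notation i := (@gp_alg_incl R n DG).
Local Notation pi := (hs_proj S).
Local Notation dress := (@dressing R n DG S).
Local Notation "a ** b" := (lg_mul a b) (at level 40, left associativity).

Lemma fund_dressing_smooth y f : smooth_fun f -> smooth_fun (fun s => fundamental dress y s f).
Proof.
move=> sf; apply: (submersion_descend (hs_submersion S)) => [s|]; first exact: hs_surj.
rewrite (_ : _ \o _ = fun a => - y (fun b => (f \o pi) (b ** a))).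
  apply: smooth_fun_opp; apply: smooth_fun2_tan; apply: smooth_fun2_swap.
  exact: smooth_mul2 (proj_smooth_fun sf).
by apply/funext => a; rewrite /= fund_dressing.
Qed.

Lemma complement_basis h : isotropic_complement B i h -> exists b : 'I_(mdim G) -> lie D,
  [/\ forall k, h (b k), forall v : 'rV[R]_(mdim G), \sum_k v 0 k *: b k = 0 -> v = 0
    & forall y, h y -> exists v : 'rV[R]_(mdim G), y = \sum_k v 0 k *: b k].
Proof.
move=> Hh; have mp := gp_manin DG; have [e [x [sx ex Hb]]] := tangent_dual_basis (lg_one G).
pose eps k : dual (lie G) := dfun _ (x k).
exists (fun k => j_iso B i h (eps k)); split => [k|v v0|y hy]; first by have [] := j_isoP mp Hh (eps k).
  apply/rowP => l; have := congr1 (fun z => B z (i (e l))) v0; rewrite (form_sum mp) (form0 mp) mxE => <-.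
  rewrite (bigD1 l)//= (formZ mp) (j_isoP mp Hh (eps l)).2 /eps dfunE ex eqxx mulr1 big1 ?addr0// => k kl.
  by rewrite (formZ mp) (j_isoP mp Hh (eps k)).2 /eps dfunE ex (negbTE kl) mulr0.
exists (\row_k B y (i (e k))).
have [[h0 hl] _ _] := Hh.
apply/eqP; rewrite -subr_eq0; apply/eqP; apply: (complement_separated mp Hh).
  rewrite addrC -scaleN1r; apply: (hl) => //.
  elim/big_rec: _ => // k z _ hz; apply: (hl) => //; by have [] := j_isoP mp Hh (eps k).
move=> z; rewrite (formB mp) (form_sum mp).
under eq_bigr => k _ do rewrite (formZ mp) (j_isoP mp Hh (eps k)).2 mxE.
rewrite {1}(Hb z) (incl_sum mp) (mp_symmetric mp) (form_sum mp) -sumrB big1// => k _.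
by rewrite (inclZ mp) (formZ mp) (mp_symmetric mp) /eps dfunE mulrC subrr.
Qed.

(** Admissibility is invertibility of the matrix [Q] of the fields of a basis of [h] in coordinates
    of [S]. Its two sizes, [mdim G] and [mdim S], are not identified, so a right inverse [K] and a
    left inverse [K'] at [s] are used, with one determinant for each. *)
Lemma admissible_near h (s : S) : isotropic_complement B i h -> admissible_at h s ->
  \forall s' \near s, admissible_at h s'.
Proof.
move=> Hh [_ hinj hsurj]; have [b [hb bind bgen]] := complement_basis Hh.
have [[h0 hl] _ _] := Hh.
have [c ac ds] := m_cover s; pose x l := coord_ext c s l.
have sx l : smooth_fun (x l) by have [] := coord_extP ac ds l.
pose fd y s' : tangent s' := fundamental dress y s'.
have fdsum s' (v : 'rV[R]_(mdim G)) : fd (\sum_k v 0 k *: b k) s' = \sum_k v 0 k *: fd (b k) s'.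
  have fd0 : fd 0 s' = 0 by have := @fund_dressing_linear _ _ _ S s' (-1) 0 0; rewrite scaler0 addr0 scaleN1r addNr.
  elim/big_rec2: _ => // k y y' _ <-; exact: fund_dressing_linear.
pose Q s' := \matrix_(k, l) fd (b k) s' (x l) : 'M[R]_(mdim G, mdim S).
have QE s' (v : 'rV[R]_(mdim G)) : v *m Q s' = \row_l fd (\sum_k v 0 k *: b k) s' (x l).
  apply/rowP => l; rewrite !mxE fdsum tangent_sumE; apply: eq_bigr => k _.
  by rewrite mxE tangent_scaleE.
have hsum (v : 'rV[R]_(mdim G)) : h (\sum_k v 0 k *: b k).
  elim/big_rec: _ => // k z _ hz; exact: hl.
have xloc s' : chart_dom c s' -> (\forall q \near s', forall l, x l q = chart_map c q 0 l) ->
    forall w w' : tangent s', (forall l, w (x l) = w' (x l)) -> w = w'.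
  move=> ds' nx w w' E; apply: tangent_ext => f sf.
  rewrite (tan_expand_coord w ac ds' sf sx nx) (tan_expand_coord w' ac ds' sf sx nx).
  by apply: eq_bigr => l _; rewrite E.
have nx : \forall q \near s, forall l, x l q = chart_map c q 0 l.
  by apply: filter_forall => l; have [] := coord_extP ac ds l.
have /row_freeP[K QK] : row_free (Q s).
  apply: inj_row_free => v; rewrite QE => E; apply: bind; apply: hinj; rewrite ?inE//.
  apply: (xloc s ds nx) => l.
  have := congr1 (fun A : 'rV_(mdim S) => A 0 l) E; rewrite !mxE => El.
  rewrite [LHS]El; have fd0 : fd 0 s = 0 by have := @fund_dressing_linear _ _ _ S s (-1) 0 0; rewrite scaler0 addr0 scaleN1r addNr.
  by rewrite -/(fd 0 s) fd0.
have [K' KQ] : exists K', K' *m Q s = 1%:M.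
  have /choice[u Hu] : forall l : 'I_(mdim S), exists u : 'rV[R]_(mdim G), u *m Q s = delta_mx 0 l.
    move=> l; have [y hy Ey] := hsurj (tvec c s (delta_mx 0 l)) I.
    have [v vE] := bgen y hy; exists v; rewrite QE -vE; apply/rowP => m; rewrite !mxE.
    rewrite /fd Ey tvecE// dotp_delta dchart_coord// eqxx /=; congr (_%:R).
    by rewrite eq_sym.
  exists (\matrix_l u l); apply/row_matrixP => l.
  by rewrite row_mul rowK Hu row1.
have sQ k l : smooth_fun (fun s' => Q s' k l).
  rewrite (_ : (fun s' => _) = fun s' => fd (b k) s' (x l)); first exact: fund_dressing_smooth.
  by apply/funext => s'; rewrite mxE.
have near_det m (A : S -> 'M[R]_m) : (forall k l, smooth_fun (fun s' => A s' k l)) -> A s = 1%:M ->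
    \forall s' \near s, A s' \in unitmx.
  move=> sA A1; have sd := smooth_fun_det sA.
  have cd := smooth_at_cont (smooth_fun_at s sd).
  have : \forall s' \near s, 0 < \det (A s').
    apply: (cd [set z | 0 < z]); apply: open_nbhs_nbhs; split; first exact: open_gt.
    by rewrite /= A1 det1.
  by apply: filterS => s' d0; rewrite unitmxE unitfE gt_eqF.
have n1 : \forall s' \near s, Q s' *m K \in unitmx.
  apply: near_det => // k l.
  rewrite (_ : (fun s' => _) = fun s' => \sum_m Q s' k m * K m l); last by apply/funext => s'; rewrite mxE.
  by apply: smooth_fun_sum => m; apply: smooth_fun_mul => //; exact: smooth_fun_cst.
have n2 : \forall s' \near s, K' *m Q s' \in unitmx.
  apply: near_det => // k l.
  rewrite (_ : (fun s' => _) = fun s' => \sum_m K' k m * Q s' m l); last by apply/funext => s'; rewrite mxE.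
  by apply: smooth_fun_sum => m; apply: smooth_fun_mul => //; exact: smooth_fun_cst.
have nd : \forall s' \near s, chart_dom c s'.
  by apply: open_nbhs_nbhs; split => //; exact: chart_dom_open.
have nx' := near_join nx.
apply: filterS (filterI (filterI n1 n2) (filterI nd nx')) => s' [[u1 u2] [ds' nxs']].
split => //.
- move=> y y' /set_mem hy /set_mem hy' E.
  have hd : h (y - y') by rewrite addrC -scaleN1r; exact: hl.
  have [v Ev] := bgen _ hd.
  have fd0 : fd (y - y') s' = 0.
    by rewrite /fd addrC -scaleN1r fund_dressing_linear E scaleN1r addNr.
  apply/eqP; rewrite -subr_eq0 Ev; suff -> : v = 0 by rewrite big1// => k _; rewrite mxE scale0r.
  have vQ : v *m Q s' = 0 by rewrite QE -Ev; apply/rowP => l; rewrite !mxE fd0.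
  by rewrite -[v](mulmxK u1) mulmxA vQ !mul0mx.
- move=> w _; pose r := \row_l w (x l).
  pose v := r *m invmx (K' *m Q s') *m K'.
  exists (\sum_k v 0 k *: b k) => //; apply: (xloc s' ds' nxs') => l.
  have := QE s' v; rewrite /v -!mulmxA mulVmx// mulmx1 => /rowP/(_ l).
  by rewrite !mxE => ->.
Qed.

End AdmissibleOpen.

(** * Integral plaques of distributions of varying rank *)

Lemma sum_ord_le (R : realType) n (F : 'I_n -> R) (K : R) : (forall i, F i <= K) -> \sum_i F i <= n%:R * K.
Proof.
by move=> H; apply: le_trans (ler_sum _ (fun i _ => H i)) _; rewrite sumr_const card_ord mulr_natl.
Qed.

Section LocalBounds.
Variables (R : realType) (n : nat).
Implicit Types (U : set 'rV[R]_n) (f : 'rV[R]_n -> R).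

Lemma Ck0_bounded U f x0 : open U -> Ck 0 U f -> U x0 ->
  exists r : R, 0 < r /\ (ball x0 r `<=` U /\ forall x, ball x0 r x -> `|f x| <= `|f x0| + 1).
Proof.
move=> oU Cf Ux; have /nbhs_ballP[r1 /= r10 H1] : nbhs x0 U by exact: open_nbhs_nbhs.
have /cont_epsP/(_ _ ltr01)[d d0 Hd] := Ck_cont Cf Ux.
exists (Num.min r1 d); split; first by rewrite lt_min r10.
split=> [x bx|x]; first by apply: H1; apply: le_ball bx; rewrite ge_min lexx.
rewrite -ball_normE /= lt_min => /andP[_ /Hd H].
have -> : f x = f x0 - (f x0 - f x) by ring.
by apply: le_trans (ler_normB _ _) _; rewrite lerD2l.
Qed.

Lemma Ck0_bounded_fin (I : finType) U (f : I -> 'rV[R]_n -> R) x0 : open U ->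
  (forall i, Ck 0 U (f i)) -> U x0 ->
  exists r K : R, [/\ 0 < r, 0 <= K, ball x0 r `<=` U & forall i x, ball x0 r x -> `|f i x| <= K].
Proof.
move=> oU Cf Ux; have /choice[r Hr] := fun i => Ck0_bounded oU (Cf i) Ux.
have /nbhs_ballP[r1 /= r10 H1] : nbhs x0 U by exact: open_nbhs_nbhs.
have [e [e0 er1 er]] := min_radius r10 (fun i => (Hr i).1).
exists e, (\sum_i (`|f i x0| + 1)); split => //.
- by apply: sumr_ge0 => i _; rewrite addr_ge0.
- by move=> x bx; apply: H1; exact: le_ball bx.
- move=> i x bx; have [_ [_ H]] := Hr i; apply: le_trans (H x (le_ball (er i) bx)) _.
  by rewrite (bigD1 i)//= lerDl sumr_ge0// => k _; rewrite addr_ge0.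
Qed.

Lemma bounded_partials_lipschitz f x0 (r K : R) : Ck 1 (ball x0 r) f ->
  (forall l x, ball x0 r x -> `|partial l f x| <= K) ->
  forall x y, ball x0 r x -> ball x0 r y -> `|f y - f x| <= n%:R * K * `|y - x|.
Proof.
move=> Cf H x y bx b_y.
have := @segment_mvt R n (ball x0 r) f (fun=> 0) x y (n%:R * K) (ball_open _ _) Cf.
have -> : dotp (fun=> 0 : R) (y - x) = 0 by rewrite /dotp big1// => i _; rewrite mulr0.
rewrite subr0; apply => t t01; have bt := ball_segment bx b_y t01; split => //.
apply: sum_ord_le => i; rewrite subr0; exact: H.
Qed.

Lemma bounded_partials_taylor f x0 (r K : R) : 0 <= K -> Ck 2 (ball x0 r) f ->
  (forall l m x, ball x0 r x -> `|partial m (partial l f) x| <= K) ->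
  forall x y, ball x0 r x -> ball x0 r y ->
  `|f y - f x - dotp (fun l => partial l f x) (y - x)| <= n%:R * (n%:R * K * `|y - x|) * `|y - x|.
Proof.
move=> K0 Cf H x y bx b_y.
apply: (@segment_mvt R n (ball x0 r) f) => //; [exact: ball_open|exact: CkW|].
move=> t t01; have bt := ball_segment bx b_y t01; split => //.
apply: sum_ord_le => i; apply: le_trans (bounded_partials_lipschitz (Ck_partial i Cf) (H i) bx bt) _.
rewrite addrAC subrr add0r normrZ; apply: ler_wpM2l; first by rewrite mulr_ge0.
by move: t01 => /andP[t0 t1]; rewrite (ger0_norm t0) ler_piMl.
Qed.

End LocalBounds.

Section Directional.
Variables (R : realType) (n : nat) (U : set 'rV[R]_n) (oU : open U).
Implicit Types (f g : 'rV[R]_n -> R) (x w : 'rV[R]_n).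

Definition dird f x w := dotp (fun i => partial i f x) w.

Lemma dirdZ f x k w : dird f x (k *: w) = k * dird f x w.
Proof. exact: linearZ. Qed.

Lemma dird_sumr f x (I : Type) (r : seq I) (w : I -> 'rV[R]_n) :
  dird f x (\sum_(k <- r) w k) = \sum_(k <- r) dird f x (w k).
Proof. exact: raddf_sum. Qed.

Lemma dird_is_derive f x w : Ck 1 U f -> U x -> is_derive x w f (dird f x w).
Proof. by move=> Cf Ux; exact: (Ck1_is_derive w oU Cf Ux). Qed.

Lemma dird_mul f g x w : Ck 1 U f -> Ck 1 U g -> U x ->
  dird (fun y => f y * g y) x w = f x * dird g x w + dird f x w * g x.
Proof.
move=> Cf Cg Ux; have [_ <-] := dird_is_derive w (Ck_mul oU Cf Cg) Ux.
have D := is_deriveM (dird_is_derive w Cf Ux) (dird_is_derive w Cg Ux).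
by have [_ ->] := D; rewrite [dird f x w * _]mulrC.
Qed.

Lemma dird_add f g x w : Ck 1 U f -> Ck 1 U g -> U x ->
  dird (fun y => f y + g y) x w = dird f x w + dird g x w.
Proof.
move=> Cf Cg Ux; have [_ <-] := dird_is_derive w (Ck_add oU Cf Cg) Ux.
have D := is_deriveD (dird_is_derive w Cf Ux) (dird_is_derive w Cg Ux).
by have [_ ->] := D.
Qed.

Lemma dird_cst (k : R) x w : dird (fun=> k) x w = 0.
Proof. by rewrite /dird /dotp big1// => i _; rewrite /partial derive_cst mulr0. Qed.

Lemma dird_sum (I : Type) (r : seq I) (F : I -> 'rV[R]_n -> R) x w : (forall k, Ck 1 U (F k)) -> U x ->
  dird (fun y => \sum_(k <- r) F k y) x w = \sum_(k <- r) dird (F k) x w.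
Proof.
move=> CF Ux; elim: r => [|k r IH].
  by rewrite big_nil (_ : (fun y => _) = fun=> 0) ?dird_cst//; apply/funext => y; rewrite big_nil.
rewrite big_cons -IH -dird_add//; last exact: Ck_sum.
by apply: (congr1 (fun g => dird g x w)); apply/funext => y; rewrite big_cons.
Qed.

Lemma dird_eq f g x w : (forall y, U y -> f y = g y) -> U x -> dird f x w = dird g x w.
Proof.
move=> E Ux; rewrite /dird /dotp; apply: eq_bigr => i _; congr (_ * _).
apply: near_eq_derive; apply: filterS E _; exact: open_nbhs_nbhs.
Qed.

Lemma dird_curve f (u : R -> 'rV[R]_n) (t : R) d : Ck 1 U f -> U (u t) -> is_derive t (1 : R) u d ->
  is_derive t (1 : R) (f \o u) (dird f (u t) d).
Proof.
move=> Cf Uu [du Eu]; have [df dE] := Ck1_diff oU Cf Uu.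
have du' : differentiable u t by apply/derivable1_diffP.
split; first exact/diff_derivable/differentiable_comp.
rewrite deriveE; last exact: differentiable_comp.
by rewrite diff_comp //= dE -(deriveE _ du') Eu.
Qed.

Lemma Ck_dird k f (w : 'rV[R]_n -> 'rV[R]_n) : Ck k.+1 U f -> CkV k U w -> Ck k U (fun x => dird f x (w x)).
Proof.
move=> Cf Cw; apply: Ck_sum => // i _; apply: Ck_mul => //; exact: Ck_partial.
Qed.

(** The coordinate formula of the Lie bracket [V, W]. *)
Definition vbrk (V W : 'rV[R]_n -> 'rV[R]_n) x : 'rV[R]_n :=
  \row_j (dird (fun y => W y 0 j) x (V x) - dird (fun y => V y 0 j) x (W x)).

Lemma vbrkC V W x : vbrk V W x = - vbrk W V x.
Proof. by apply/rowP => j; rewrite !mxE opprB. Qed.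

Lemma vbrk_suml N (b : 'I_N -> 'rV[R]_n -> R) (Y : 'I_N -> 'rV[R]_n -> 'rV[R]_n) W x :
  (forall a, Ck 1 U (b a)) -> (forall a, CkV 1 U (Y a)) -> U x ->
  vbrk (fun y => \sum_a b a y *: Y a y) W x =
  \sum_a (b a x *: vbrk (Y a) W x - dird (b a) x (W x) *: Y a x).
Proof.
move=> Cb CY Ux; apply/rowP => j; rewrite mxE summxE.
rewrite dird_sumr (@dird_eq _ (fun y => \sum_a b a y * Y a y 0 j))//; last first.
  by move=> y _; rewrite summxE; apply: eq_bigr => a _; rewrite mxE.
rewrite dird_sum//; last by move=> a; apply: Ck_mul => //; exact: CY.
rewrite -sumrB; apply: eq_bigr => a _.
rewrite dirdZ dird_mul//; last exact: CY.
by rewrite !mxE; ring.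
Qed.

End Directional.

Lemma dotp_bound (R : realType) n (a : 'I_n -> R) (v : 'rV[R]_n) (M : R) :
  (forall i, `|a i| <= M) -> `|dotp a v| <= n%:R * (`|v| * M).
Proof.
move=> H; rewrite /dotp; apply: le_trans (ler_norm_sum _ _ _) _; apply: sum_ord_le => i.
by rewrite normrM ler_pM// ler_coord_norm.
Qed.

Lemma rowBE (R : realType) n (v w : 'rV[R]_n) j : (v - w) 0 j = v 0 j - w 0 j.
Proof. by rewrite !mxE. Qed.

Lemma mulmx_dotp (R : realType) n m (v : 'rV[R]_n) (A : 'M[R]_(n, m)) j : (v *m A) 0 j = dotp (fun i => A i j) v.
Proof. by rewrite mxE. Qed.

Lemma dird_dotp (R : realType) n (a : 'I_n -> R) x w : dird (dotp a) x w = dotp a w.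
Proof.
rewrite /dird /dotp; apply: eq_bigr => i _; congr (_ * _); rewrite /partial.
by have [d E] := is_diff_dotp a x; rewrite deriveE// E dotp_delta.
Qed.

Section MatrixFamilies.
Variables (R : realType) (n : nat) (U : set 'rV[R]_n) (oU : open U).

Lemma CkM_cst k p q (A : 'M[R]_(p, q)) : CkM U k (fun=> A).
Proof. by move=> i j; exact: Ck_cst. Qed.

Lemma CkM_sub k p q (A B : 'rV[R]_n -> 'M[R]_(p, q)) : CkM U k A -> CkM U k B -> CkM U k (fun x => A x - B x).
Proof.
move=> CA CB i j; apply: (@Ck_eq _ _ k U (fun x => A x i j - B x i j)) => //.
  by move=> x _; rewrite !mxE.
exact: Ck_sub.
Qed.

Lemma CkM_row k p q (A : 'rV[R]_n -> 'M[R]_(p, q)) a : CkM U k A -> CkV k U (fun x => row a (A x)).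
Proof.
by move=> CA j; apply: (@Ck_eq _ _ k U (fun x => A x a j)) => // x _; rewrite mxE.
Qed.

Lemma CkM_lin k p q (A : 'rV[R]_n -> 'M[R]_(p, q)) (v : 'rV[R]_p) j : CkM U k A -> Ck k U (fun x => (v *m A x) 0 j).
Proof.
move=> CA; apply: (@Ck_eq _ _ k U (fun x => \sum_i v 0 i * A x i j)) => //.
  by move=> x _; rewrite mxE.
by apply: Ck_sum => // i _; apply: Ck_mul => //; exact: Ck_cst.
Qed.

End MatrixFamilies.

(** * Integrability with varying rank *)

Section Frobenius.
Variables (R : realType) (n N r : nat) (U : set 'rV[R]_n) (oU : open U).
Variables (Y : 'rV[R]_n -> 'M[R]_(N, n)) (C : 'I_N -> 'I_N -> 'I_N -> 'rV[R]_n -> R) (x0 : 'rV[R]_n).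
Variables (F : 'M[R]_(r, N)) (E : 'M[R]_(n, r)).
Hypothesis Ux0 : U x0.
Hypothesis CY : forall k, CkM U k Y.
Hypothesis CC : forall a b c, Ck 0 U (C a b c).
Hypothesis brY : forall a b x, U x ->
  vbrk (fun y => row a (Y y)) (fun y => row b (Y y)) x = \sum_c C a b c x *: row c (Y x).
Hypothesis uQ : forall x, U x -> F *m Y x *m E \in unitmx.

(** [F] selects [r] combinations of the generators [Y] and [E] selects [r] linear coordinates. [X]
    is the resulting frame with [X x *m E = 1]; [Z] is what is left of the generators once their
    E-components are removed, and detects directions beyond the frame. *)
Let b x : 'M[R]_(r, N) := invmx (F *m Y x *m E) *m F.
Let X x : 'M[R]_(r, n) := b x *m Y x.
Let d x : 'M[R]_N := 1%:M - Y x *m E *m b x.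
Let Z x : 'M[R]_(N, n) := d x *m Y x.

Hypothesis Z0 : Z x0 = 0.

Let XE x : U x -> X x *m E = 1%:M.
Proof. by move=> Ux; rewrite /X /b -!mulmxA (mulmxA F) mulVmx// uQ. Qed.

Let ZYE x : Z x = Y x - Y x *m E *m X x.
Proof. by rewrite /Z /d mulmxBl mul1mx /X !mulmxA. Qed.

Let ZE x : U x -> Z x *m E = 0.
Proof. by move=> Ux; rewrite ZYE mulmxBl -(mulmxA _ (X x)) XE// mulmx1 subrr. Qed.

Let Cb k : CkM U k b.
Proof.
apply: CkM_mul => //; last exact: CkM_cst.
apply: CkM_inv => //; apply: CkM_mul => //; last exact: CkM_cst.
by apply: CkM_mul => //; exact: CkM_cst.
Qed.

Let CX k : CkM U k X.
Proof. exact: CkM_mul. Qed.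

Let Cd k : CkM U k d.
Proof.
apply: CkM_sub => //; first exact: CkM_cst.
by apply: CkM_mul => //; apply: CkM_mul => //; exact: CkM_cst.
Qed.

Let CZ k : CkM U k Z.
Proof. exact: CkM_mul. Qed.

Let comb (f : 'rV[R]_n -> 'rV[R]_N) x : 'rV[R]_n := f x *m Y x.

Let combE f : comb f = fun x => \sum_a f x 0 a *: row a (Y x).
Proof. by apply/funext => x; rewrite /comb mulmx_sum_row. Qed.

(** By Leibniz's rule the bracket of two combinations is again one, with coefficients that involve
    [C] and the first derivatives of those given. *)
Let comb_brk f g : CkV 1 U f -> CkV 1 U g -> exists h : 'rV[R]_n -> 'rV[R]_N, CkV 0 U h /\
  forall x, U x -> vbrk (comb f) (comb g) x = h x *m Y x.
Proof.
move=> Cf Cg.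
have CYr a k : CkV k U (fun y => row a (Y y)) by exact: CkM_row.
have Ccg : CkV 0 U (comb g).
  move=> j; rewrite combE; apply: (@Ck_eq _ _ 0 U (fun x => \sum_a g x 0 a * Y x a j)) => //.
    by move=> x _; rewrite summxE; apply: eq_bigr => a _; rewrite !mxE.
  by apply: Ck_sum => // a _; apply: Ck_mul => //; [exact: CkW|exact: CY].
pose h x : 'rV[R]_N := \row_c (\sum_a f x 0 a * (- (\sum_e g x 0 e * C e a c x) + dird (fun y => g y 0 c) x (row a (Y x)))
   - dird (fun y => f y 0 c) x (comb g x)).
exists h; split.
  move=> c; pose h' x := \sum_a f x 0 a * (- (\sum_e g x 0 e * C e a c x) + dird (fun y => g y 0 c) x (row a (Y x)))
   - dird (fun y => f y 0 c) x (comb g x).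
  apply: (@Ck_eq _ _ 0 U h') => //; first by move=> x _; rewrite mxE.
  apply: (Ck_sub oU); last exact: (Ck_dird oU (Cf c) Ccg).
  apply: (Ck_sum oU) => a _; apply: (Ck_mul oU); first exact: CkW (Cf a).
  apply: (Ck_add oU); last exact: (Ck_dird oU (Cg c) (CYr a 0%N)).
  by apply: (Ck_opp oU); apply: (Ck_sum oU) => e _; apply: (Ck_mul oU); [exact: CkW (Cg e)|exact: CC].
move=> x Ux; rewrite {1}combE (vbrk_suml oU _ Cf (fun a => CYr a 1%N) Ux).
have brg a : vbrk (fun y => row a (Y y)) (comb g) x =
    \sum_c (- (\sum_e g x 0 e * C e a c x) + dird (fun y => g y 0 c) x (row a (Y x))) *: row c (Y x).
  rewrite vbrkC combE (vbrk_suml oU _ Cg (fun a => CYr a 1%N) Ux).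
  rewrite sumrB opprB addrC.
  under [in LHS]eq_bigr => e _ do rewrite brY// scaler_sumr.
  rewrite exchange_big /= -sumrN -big_split /=; apply: eq_bigr => c _.
  rewrite [in RHS]scalerDl [in RHS]scaleNr; congr (- _ + _).
  by rewrite (scaler_suml (row c (Y x)) _ _ (fun e => g x 0 e * C e a c x)); apply: eq_bigr => e _; rewrite scalerA.
under [LHS]eq_bigr => a _ do rewrite brg scaler_sumr.
rewrite sumrB exchange_big /= -sumrB mulmx_sum_row; apply: eq_bigr => c _.
rewrite mxE scalerBl; congr (_ - _).
rewrite (scaler_suml (row c (Y x)) _ _ (fun a => f x 0 a * _)); apply: eq_bigr => a _.
by rewrite scalerA.
Qed.

(** Constant E-components make the E-components of the bracket vanish; a combination [h *m Y] with
    this property equals [h *m Z], because [Z = Y - Y *m E *m X]. *)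
Let comb_brkZ f g kf kg : CkV 1 U f -> CkV 1 U g ->
  (forall x, U x -> comb f x *m E = kf) -> (forall x, U x -> comb g x *m E = kg) ->
  exists h : 'rV[R]_n -> 'rV[R]_N, CkV 0 U h /\ forall x, U x -> vbrk (comb f) (comb g) x = h x *m Z x.
Proof.
move=> Cf Cg Ef Eg; have [h [Ch hE]] := comb_brk Cf Cg; exists h; split => // x Ux.
have comp k f1 j : CkV k U f1 -> Ck k U (fun y => comb f1 y 0 j).
  move=> Cf1; rewrite combE; apply: (@Ck_eq _ _ k U (fun x => \sum_a f1 x 0 a * Y x a j)) => //.
    by move=> y _; rewrite summxE; apply: eq_bigr => a _; rewrite !mxE.
  by apply: Ck_sum => // a _; apply: Ck_mul => //; exact: CY.
have dE f1 k1 w k : CkV 1 U f1 -> (forall x, U x -> comb f1 x *m E = k1) ->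
    \sum_j dird (fun y => comb f1 y 0 j) x w * E j k = 0.
  move=> Cf1 E1; rewrite -[RHS](dird_cst (k1 0 k) x w).
  rewrite -(@dird_eq _ _ U oU (fun y => \sum_j comb f1 y 0 j * E j k))//; last by move=> y Uy; rewrite -(E1 y Uy) mxE.
  rewrite (dird_sum oU)//; last by move=> j; apply: Ck_mul => //; [exact: comp|exact: Ck_cst].
  apply: eq_bigr => j _; rewrite (dird_mul oU)//; [|exact: comp|exact: Ck_cst].
  by rewrite dird_cst mulr0 add0r.
have v0 : vbrk (comb f) (comb g) x *m E = 0.
  apply/rowP => k; rewrite mxE.
  under eq_bigr => j _ do rewrite mxE mulrBl.
  by rewrite sumrB (dE _ _ _ _ Cg Eg) (dE _ _ _ _ Cf Ef) subrr mxE.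
rewrite hE// ZYE mulmxBr !mulmxA; move: v0; rewrite hE// => ->.
by rewrite !mul0mx subr0.
Qed.

Let brXX : exists h : 'I_r -> 'I_r -> 'rV[R]_n -> 'rV[R]_N, forall i k, CkV 0 U (h i k) /\
  forall x, U x -> vbrk (fun y => row i (X y)) (fun y => row k (X y)) x = h i k x *m Z x.
Proof.
have H i k : exists h : 'rV[R]_n -> 'rV[R]_N, CkV 0 U h /\
  forall x, U x -> vbrk (fun y => row i (X y)) (fun y => row k (X y)) x = h x *m Z x.
  have Ei k' : (fun y => row k' (X y)) = comb (fun y => row k' (b y)).
    by apply/funext => y; rewrite /X row_mul.
  have EE k' x : U x -> comb (fun y => row k' (b y)) x *m E = row k' 1%:M.
    by move=> Ux; rewrite /comb -!row_mul XE.
  rewrite !Ei; apply: comb_brkZ; [exact: CkM_row|exact: CkM_row|exact: EE|exact: EE].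
have /choice[h Hh] : forall i, exists h : 'I_r -> 'rV[R]_n -> 'rV[R]_N, forall k, CkV 0 U (h k) /\
  forall x, U x -> vbrk (fun y => row i (X y)) (fun y => row k (X y)) x = h k x *m Z x.
  by move=> i; have /choice[h Hh] := H i; exists h.
by exists h.
Qed.

Let brXZ : exists h : 'I_r -> 'I_N -> 'rV[R]_n -> 'rV[R]_N, forall i a, CkV 0 U (h i a) /\
  forall x, U x -> vbrk (fun y => row i (X y)) (fun y => row a (Z y)) x = h i a x *m Z x.
Proof.
have H i a : exists h : 'rV[R]_n -> 'rV[R]_N, CkV 0 U h /\
  forall x, U x -> vbrk (fun y => row i (X y)) (fun y => row a (Z y)) x = h x *m Z x.
  have Ei : (fun y => row i (X y)) = comb (fun y => row i (b y)).
    by apply/funext => y; rewrite /X row_mul.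
  have Ea : (fun y => row a (Z y)) = comb (fun y => row a (d y)).
    by apply/funext => y; rewrite /Z row_mul.
  rewrite Ei Ea; apply: (@comb_brkZ _ _ (row i 1%:M) (row a 0)); [exact: CkM_row|exact: CkM_row| |].
    by move=> x Ux; rewrite /comb -!row_mul XE.
  by move=> x Ux; rewrite /comb -!row_mul -/(Z x) ZE.
have /choice[h Hh] : forall i, exists h : 'I_N -> 'rV[R]_n -> 'rV[R]_N, forall a, CkV 0 U (h a) /\
  forall x, U x -> vbrk (fun y => row i (X y)) (fun y => row a (Z y)) x = h a x *m Z x.
  by move=> i; have /choice[h Hh] := H i; exists h.
by exists h.
Qed.

(** [sigma v] is the time-one point of the flow of [v *m X] from [x0]. Along such a curve [Z] solves
    a linear equation with zero initial value, so the generators are combinations of the frame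
    there. The last equality then says that all generators are tangent to the image of [sigma], and
    [K] later bounds coefficients of velocities. *)
Theorem frobenius_flow_box : exists (eps K : R) (sigma : 'rV[R]_r -> 'rV[R]_n),
  [/\ 0 < eps, sigma 0 = x0, forall k, CkV k (ball 0 eps) sigma &
   forall v, ball 0 eps v -> [/\ U (sigma v), (sigma v - x0) *m E = v, Jac sigma v = b (sigma v) *m Y (sigma v),
     forall i a, `|b (sigma v) i a| <= K & Y (sigma v) = Y (sigma v) *m E *m Jac sigma v]].
Proof.
have [hX HX] := brXX; have [hZ HZ] := brXZ.
(* All families of coefficients are coded into one finite sum type, so that a single radius and a
   single bound serve every estimate. *)
have [r1 [K [r10 K0 bU HK]]] : exists r1 K : R, [/\ 0 < r1, 0 <= K, ball x0 r1 `<=` U & forall x, ball x0 r1 x ->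
    [/\ forall i j, `|X x i j| <= K, forall i j l, `|partial l (fun y => X y i j) x| <= K,
     forall i j l m, `|partial m (partial l (fun y => X y i j)) x| <= K,
     forall i a c, `|hZ i a x 0 c| <= K & forall i a, `|b x i a| <= K]].
  pose I1 : finType := ('I_r * 'I_n)%type.
  pose f (s : (((I1 + I1 * 'I_n) + I1 * 'I_n * 'I_n) + 'I_r * 'I_N * 'I_N) + 'I_r * 'I_N) : 'rV[R]_n -> R :=
    match s with
    | inl (inl (inl (inl (i, j)))) => fun x => X x i j
    | inl (inl (inl (inr ((i, j), l)))) => partial l (fun x => X x i j)
    | inl (inl (inr ((i, j), l, m))) => partial m (partial l (fun x => X x i j))
    | inl (inr ((i, a), c)) => fun x => hZ i a x 0 c
    | inr (i, a) => fun x => b x i a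
    end.
  have Cf s : Ck 0 U (f s).
    case: s => [[[[[i j]|[[i j] l]]|[[[i j] l] m]]|[[i a] c]]|[i a]].
    - exact: (CX 0%N i j).
    - exact: (Ck_partial l (CX 1%N i j)).
    - exact: (Ck_partial m (Ck_partial l (CX 2%N i j))).
    - exact: ((HZ i a).1 c).
    - exact: (Cb 0%N i a).
  have [r1 [K [r10 K0 bU H]]] := Ck0_bounded_fin oU Cf Ux0.
  exists r1, K; split => // x bx; split => *.
  - exact: (H (inl (inl (inl (inl (_, _))))) x bx).
  - exact: (H (inl (inl (inl (inr ((_, _), _))))) x bx).
  - exact: (H (inl (inl (inr ((_, _), _, _)))) x bx).
  - exact: (H (inl (inr ((_, _), _))) x bx).
  - exact: (H (inr (_, _)) x bx).
have Xlip (v : 'rV[R]_r) x y j : ball x0 r1 x -> ball x0 r1 y ->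
    `|(v *m X y) 0 j - (v *m X x) 0 j| <= r%:R * (`|v| * (n%:R * K * `|y - x|)).
  move=> bx b_y; have -> : (v *m X y) 0 j - (v *m X x) 0 j = dotp (fun i => X y i j - X x i j) v.
    by rewrite !mulmx_dotp /dotp -sumrB; apply: eq_bigr => i _; rewrite mulrBr.
  apply: dotp_bound => i; apply: (@bounded_partials_lipschitz R n (fun z => X z i j) x0 r1 K) => //.
    by apply: Ck_subset (CX 1%N i j).
  by move=> l z bz; have [_ H _ _ _] := HK z bz.
have Xtay (v : 'rV[R]_r) x y j : ball x0 r1 x -> ball x0 r1 y ->
    `|(v *m X y) 0 j - (v *m X x) 0 j - dird (fun z => (v *m X z) 0 j) x (y - x)|
     <= r%:R * (`|v| * (n%:R * (n%:R * K * `|y - x|) * `|y - x|)).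
  move=> bx b_y.
  have -> : (v *m X y) 0 j - (v *m X x) 0 j - dird (fun z => (v *m X z) 0 j) x (y - x) =
     dotp (fun i => X y i j - X x i j - dird (fun z => X z i j) x (y - x)) v.
    have -> : (fun z => (v *m X z) 0 j) = (fun z => \sum_i v 0 i * X z i j) by apply/funext => z; rewrite mxE.
    rewrite (dird_sum oU) ?mxE; [|by move=> i; apply: (Ck_mul oU); [exact: Ck_cst|exact: CX]|exact: bU].
    rewrite /(dotp _ v) -!sumrB; apply: eq_bigr => i _.
    by rewrite (dird_mul oU) ?dird_cst; [ring|exact: Ck_cst|exact: CX|exact: bU].
  apply: dotp_bound => i; apply: (@bounded_partials_taylor R n (fun z => X z i j) x0 r1 K) => //.
    by apply: Ck_subset (CX 2%N i j).
  by move=> l m z bz; have [_ _ H _ _] := HK z bz.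
have Xbnd (v : 'rV[R]_r) x : ball x0 r1 x -> `|v *m X x| <= r%:R * (`|v| * K).
  move=> bx; apply: norm_row_le => [|j]; first by rewrite ?mulr_ge0.
  by rewrite mulmx_dotp; apply: dotp_bound => i; have [H _ _ _ _] := HK x bx.
(* A common bound for the constants that multiply [|v|] in the contraction and Gronwall estimates
   below. *)
pose Kb := r%:R * ((1 + n%:R + N%:R) * K) : R.
have Kb0 : 0 <= Kb by rewrite ?mulr_ge0// !addr_ge0.
have rK : r%:R * K <= Kb.
  by rewrite /Kb ler_wpM2l// -[X in X <= _]mul1r ler_wpM2r// -addrA lerDl addr_ge0.
have rnK : r%:R * (n%:R * K) <= Kb.
  by rewrite /Kb ler_wpM2l// ler_wpM2r// addrAC lerDr addr_ge0.
have rNK : r%:R * ((N%:R + n%:R) * K) <= Kb.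
  by rewrite /Kb ler_wpM2l// ler_wpM2r// -addrA (addrC N%:R) lerDr.
pose rho := r1 / 2; have rho0 : 0 < rho by rewrite divr_gt0.
(* The factor 6 leaves room for [|v| + |h| < 3 * eps], where the Gronwall constant must be 1/2, and
   for a displacement by [h *m X] of at most [rho / 3]. *)
pose eps := Num.min 1 rho / (6 * (Kb + 1)).
have m0 : 0 < Num.min 1 rho by rewrite lt_min ltr01.
have Kb1 : 0 < Kb + 1 by rewrite ltr_wpDl.
have eps0 : 0 < eps by rewrite divr_gt0// mulr_gt0.
have epsK : eps * Kb <= Num.min 1 rho / 6.
  rewrite /eps; have -> : Num.min 1 rho / (6 * (Kb + 1)) * Kb = Num.min 1 rho / 6 * (Kb / (Kb + 1)).
    by field; rewrite gt_eqF.
  apply: ler_piMr; first by rewrite divr_ge0// ltW.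
  by rewrite ler_pdivrMr// mul1r lerDl.
have epsK1 : eps * Kb <= 1 / 6.
  by apply: le_trans epsK _; rewrite ler_pM2r// ge_min lexx.
have epsKr : eps * Kb <= rho / 6.
  by apply: le_trans epsK _; rewrite ler_pM2r// ge_min lexx orbT.
have rho_ball x : `|x - x0| <= rho -> ball x0 r1 x.
  by rewrite -ball_normE /= distrC => h; apply: le_lt_trans h _; rewrite /rho; move: r10; lra.
have r1E : r1 = 2 * rho by rewrite /rho; field.
have eps2 : eps * Kb <= 2^-1 by apply: le_trans epsK1 _; lra.
clearbody eps rho Kb.
have small (v : 'rV[R]_r) (M : R) : `|v| < eps -> 0 <= M -> M <= Kb -> `|v| * M <= eps * Kb.
  by move=> ve M0 MK; apply: ler_pM => //; exact: ltW.
have /choice[u Hu] : forall v : 'rV[R]_r, exists u : R -> 'rV[R]_n, `|v| < eps -> u 0 = x0 /\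
    forall t : R, `|t| <= 1 -> `|u t - x0| <= rho /\ is_derive t (1 : R) u (v *m X (u t)).
  move=> v; have [ve|ve] := ltP `|v| eps; last by exists (fun=> 0).
  have [|x y xr yr|x xr|w w0 Hw] := @ode_local R n (fun x => v *m X x) x0 rho; first exact: ltW.
  - rewrite distrC; apply: norm_row_le => [|j]; first by rewrite divr_ge0.
    rewrite rowBE; apply: le_trans (Xlip v x y j (rho_ball x xr) (rho_ball y yr)) _; rewrite distrC.
    have := small v _ ve _ rnK; rewrite !mulr_ge0// => /(_ isT) h.
    have -> : r%:R * (`|v| * (n%:R * K * `|x - y|)) = (`|v| * (r%:R * (n%:R * K))) * `|x - y| by ring.
    have -> : `|x - y| / 2 = 2^-1 * `|x - y| by ring.
    by rewrite ler_wpM2r ?normr_ge0 ?(le_trans h eps2).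
  - apply: le_trans (Xbnd v x (rho_ball x xr)) _.
    have := small v _ ve _ rK; rewrite !mulr_ge0// => /(_ isT) h.
    have -> : r%:R * (`|v| * K) = `|v| * (r%:R * K) by ring.
    by move: h epsKr rho0; lra.
  by exists w.
have ub (v : 'rV[R]_r) (t : R) : `|v| < eps -> `|t| <= 1 -> ball x0 r1 (u v t).
  by move=> ve t1; have [_ /(_ t t1)[h _]] := Hu v ve; exact: rho_ball.
have uD (v : 'rV[R]_r) (t : R) : `|v| < eps -> `|t| <= 1 -> is_derive t (1 : R) (u v) (v *m X (u v t)).
  by move=> ve t1; have [_ /(_ t t1)[_ h]] := Hu v ve.
have t01 (t : R) : 0 <= t <= 1 -> `|t| <= 1 by move=> /andP[t0 t1]; rewrite ger0_norm.
have brD (i : 'I_r) (w : 'rV[R]_n -> 'rV[R]_n) x : ball x0 r1 x -> (forall j, dird (fun y => w y 0 j) x (row i (X x)) =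
     vbrk (fun y => row i (X y)) w x 0 j + dird (fun y => X y i j) x (w x)).
  move=> bx j; rewrite mxE.
  have -> : (fun y => row i (X y) 0 j) = (fun y => X y i j) by apply/funext => y; rewrite mxE.
  by rewrite subrK.
(* By [brXZ], the derivative of [Z] along the frame is linear in [Z], with coefficients bounded by
   [K]; smallness of [v] brings the constant to 1/2. *)
have Zu (v : 'rV[R]_r) (t : R) : `|v| < eps -> 0 <= t <= 1 -> Z (u v t) = 0.
  move=> ve tt.
  pose w s := mxvec (Z (u v s)).
  pose dw s := mxvec (\matrix_(a, j) dird (fun y => Z y a j) (u v s) (v *m X (u v s))).
  suff : `|w t| <= 2 * 0.
    by rewrite mulr0 normr_le0 => /eqP E0; rewrite -[Z _]mxvecK -/(w t) E0 linear0.
  apply: (@small_gronwall R _ w dw 0) => // [s ss||s ss].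
  - apply/is_derive_rowP => k; case/mxvec_indexP: k => a j; rewrite /dw mxvecE mxE.
    have -> : (fun z => w z 0 (mxvec_index a j)) = (fun y => Z y a j) \o u v.
      by apply/funext => z; rewrite /w mxvecE.
    apply: (dird_curve oU (CZ 1%N a j)); first by apply: bU; apply: ub => //; exact: t01.
    by apply: uD => //; exact: t01.
  - by rewrite /w (Hu v ve).1 Z0 linear0.
  have bs := ub v s ve (t01 s ss); set x := u v s in bs *.
  apply: norm_row_le => [|k]; first by rewrite addr0 divr_ge0.
  have wZ a j : `|Z x a j| <= `|w s| by rewrite -(mxvecE (Z x)) ler_coord_norm.
  case/mxvec_indexP: k => a j; rewrite /dw mxvecE mxE addr0 -/x mulmx_sum_row dird_sumr.
  have -> : \sum_i dird (fun y => Z y a j) x (v 0 i *: row i (X x)) =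
     dotp (fun i => (hZ i a x *m Z x) 0 j + dird (fun y => X y i j) x (row a (Z x))) v.
    apply: eq_bigr => i _; rewrite dirdZ; congr (_ * _).
    have := brD i (fun y => row a (Z y)) x bs j.
    have -> : (fun y => row a (Z y) 0 j) = (fun y => Z y a j) by apply/funext => y; rewrite mxE.
    by move=> ->; have [_ ->] := HZ i a; last exact: bU.
  apply: le_trans (@dotp_bound _ _ _ v (N%:R * (K * `|w s|) + n%:R * (`|w s| * K)) _) _ => [i|].
    apply: le_trans (ler_normD _ _) _; apply: lerD.
      rewrite mulmx_dotp /dotp; apply: le_trans (ler_norm_sum _ _ _) _; apply: sum_ord_le => c.
      by rewrite normrM ler_pM//; have [_ _ _ H _] := HK x bs.
    rewrite /dird; apply: le_trans (ler_norm_sum _ _ _) _; apply: sum_ord_le => l.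
    by rewrite normrM [row _ _ _ _]mxE; have [_ H _ _ _] := HK x bs; apply: ler_pM.
  have -> : r%:R * (`|v| * (N%:R * (K * `|w s|) + n%:R * (`|w s| * K))) = (`|v| * (r%:R * ((N%:R + n%:R) * K))) * `|w s| by ring.
  have -> : `|w s| / 2 = 2^-1 * `|w s| by ring.
  have := small v _ ve _ rNK; rewrite !mulr_ge0 ?addr_ge0// => /(_ isT) hh.
  by rewrite ler_wpM2r ?normr_ge0 ?(le_trans hh eps2).
pose sigma (v : 'rV[R]_r) := u v 1.
have one01 : 0 <= (1 : R) <= 1 by rewrite ler01 lexx.
have sb (v : 'rV[R]_r) : `|v| < eps -> ball x0 r1 (sigma v) by move=> ve; apply: ub; rewrite ?normr1.
have sE (v : 'rV[R]_r) : `|v| < eps -> (sigma v - x0) *m E = v.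
  move=> ve; apply/rowP => k; rewrite mulmxBl rowBE.
  have D (t : R) : 0 <= t <= 1 -> is_derive t (1 : R) (dotp (fun j => E j k) \o u v) (v 0 k).
    move=> tt; have bt := ub v t ve (t01 t tt).
    have := dird_curve oU (Ck_dotp U 1 (fun j => E j k)) (bU _ bt) (uD v t ve (t01 t tt)).
    by rewrite dird_dotp -mulmx_dotp -mulmxA XE ?mulmx1//; exact: bU.
  have := @mvt01 R (dotp (fun j => E j k) \o u v) (fun=> v 0 k) (v 0 k) 0 D.
  rewrite subrr normr0 => /(_ (fun _ _ => lexx _)); rewrite normr_le0 /= (Hu v ve).1 subr_eq0 => /eqP <-.
  by rewrite !mulmx_dotp.
pose C1 := 2 * (r%:R * (eps * (n%:R * (n%:R * K * (r%:R * K)) * (r%:R * K))) + r%:R * (n%:R * K * (r%:R * K))).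
have eps_ge0 : 0 <= eps by exact: ltW.
have C10 : 0 <= C1 by rewrite /C1 !(mulr_ge0, addr_ge0).
have DvX (v : 'rV[R]_r) x w j : ball x0 r1 x ->
    dird (fun y => (v *m X y) 0 j) x w = \sum_i v 0 i * dird (fun y => X y i j) x w.
  move=> bx; have -> : (fun z => (v *m X z) 0 j) = (fun z => \sum_i v 0 i * X z i j) by apply/funext => z; rewrite mxE.
  rewrite (dird_sum oU); [|by move=> i; apply: (Ck_mul oU); [exact: Ck_cst|exact: CX]|exact: bU].
  apply: eq_bigr => i _; rewrite (dird_mul oU) ?dird_cst ?mul0r ?addr0//; [exact: Ck_cst|exact: CX|exact: bU].
(* The frame commutes where [Z] vanishes, by [brXX], so differentiating one combination along the
   other is symmetric. *)
have sym v h (t : R) j : `|v| < eps -> 0 <= t <= 1 ->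
    dird (fun y => (v *m X y) 0 j) (u v t) (h *m X (u v t)) = dird (fun y => (h *m X y) 0 j) (u v t) (v *m X (u v t)).
  move=> ve tt; have bx := ub v t ve (t01 t tt); have Zx := Zu v t ve tt; set x := u v t in bx Zx *.
  have S i k : dird (fun y => X y i j) x (row k (X x)) = dird (fun y => X y k j) x (row i (X x)).
    have := brD k (fun y => row i (X y)) x bx j.
    have -> : (fun y => row i (X y) 0 j) = (fun y => X y i j) by apply/funext => y; rewrite mxE.
    by move=> ->; have [_ ->] := HX k i; [rewrite Zx mulmx0 mxE add0r|exact: bU].
  rewrite !DvX// !mulmx_sum_row.
  under eq_bigr => i _ do rewrite dird_sumr mulr_sumr.
  under [RHS]eq_bigr => i _ do rewrite dird_sumr mulr_sumr.
  rewrite exchange_big /=; apply: eq_bigr => k _; apply: eq_bigr => i _.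
  by rewrite !dirdZ S; ring.
(* By [sym], [t *: (h *m X)] along the curve of [v] solves the linearized equation, so it is the
   first variation of the flow. The error [w] satisfies the Gronwall hypothesis with [A0] quadratic
   in [|h|]: two Lipschitz terms and one Taylor remainder. *)
have est (v h : 'rV[R]_r) : `|v| < eps -> `|v + h| < eps -> `|sigma (v + h) - sigma v - h *m X (sigma v)| <= C1 * `|h| * `|h|.
  move=> ve vhe.
  have he : `|h| < 2 * eps.
    have -> : h = (v + h) - v by rewrite addrAC subrr add0r.
    by apply: le_lt_trans (ler_normB _ _) _; move: ve vhe; lra.
  have [p pE] : exists p : R -> 'rV[R]_n, forall t, p t = h *m X (u v t) by exists (fun t => h *m X (u v t)).
  have [dp dpE] : exists dp : R -> 'rV[R]_n, forall t j, dp t 0 j = dird (fun x => (h *m X x) 0 j) (u v t) (v *m X (u v t)).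
    by exists (fun t => \row_j dird (fun x => (h *m X x) 0 j) (u v t) (v *m X (u v t))) => t j; rewrite mxE.
  pose w (t : R) := u (v + h) t - u v t - t *: p t.
  pose dw (t : R) := \row_j (((v + h) *m X (u (v + h) t)) 0 j - (v *m X (u v t)) 0 j - (p t 0 j + t * dp t 0 j)).
  pose A0 := r%:R * (eps * (n%:R * (n%:R * K * (r%:R * K * `|h|)) * (r%:R * K * `|h|))) + r%:R * (`|h| * (n%:R * K * (r%:R * K * `|h|))).
  have -> : C1 * `|h| * `|h| = 2 * A0 by rewrite /C1 /A0; ring.
  have -> : sigma (v + h) - sigma v - h *m X (sigma v) = w 1 by rewrite /w /sigma pE scale1r.
  apply: (@small_gronwall R n w dw A0) => //.
  - move=> t tt; have t1 := t01 t tt; apply/is_derive_rowP => j; rewrite /dw mxE.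
    have D1 := (is_derive_rowP _ _ _).1 (uD _ _ vhe t1) j.
    have D2 := (is_derive_rowP _ _ _).1 (uD _ _ ve t1) j.
    have D3 : is_derive t (1 : R) (fun s => p s 0 j) (dp t 0 j).
      rewrite dpE (_ : (fun s => p s 0 j) = (fun x => (h *m X x) 0 j) \o u v); last by apply/funext => s; rewrite pE.
      apply: (dird_curve oU); [exact: (CkM_lin oU)|apply: bU; exact: ub|exact: uD].
    have D4 := is_deriveM (is_derive_id t (1 : R)) D3.
    have D5 := is_deriveB (is_deriveB D1 D2) D4.
    have -> : (fun s => w s 0 j) = (fun s => u (v + h) s 0 j) - (fun s => u v s 0 j) - (id * (fun s => p s 0 j)).
      by apply/funext => s; rewrite /w !mxE.
    apply: is_derive_eq D5 _; rewrite /GRing.scale /= mulr1; congr (_ - _); ring.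
  - by rewrite /w scale0r subr0 (Hu v ve).1 (Hu _ vhe).1 subrr.
  - move=> t tt; have t1 := t01 t tt; have /andP[t_0 t_1] := tt.
    have bx := ub v t ve t1; have bx' := ub (v + h) t vhe t1.
    have pn : `|p t| <= r%:R * K * `|h|.
      by rewrite pE; apply: le_trans (Xbnd h _ bx) _; rewrite mulrAC mulrA.
    have tpn : `|t *: p t| <= r%:R * K * `|h|.
      by rewrite normrZ ger0_norm//; apply: le_trans pn; rewrite ler_piMl.
    have rKh : r%:R * K * `|h| <= rho / 3.
      have := ler_pM (mulr_ge0 (ler0n R r) K0) (normr_ge0 h) rK (ltW he).
      have -> : Kb * (2 * eps) = 2 * (eps * Kb) by ring.
      by move=> hh; apply: le_trans hh _; move: epsKr; lra.
    pose x1 := u v t + t *: p t.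
    have x1u : x1 - u v t = t *: p t by rewrite /x1 addrAC subrr add0r.
    have bx1 : ball x0 r1 x1.
      rewrite -ball_normE /= distrC.
      have -> : x1 - x0 = (u v t - x0) + t *: p t by rewrite /x1 addrAC.
      apply: le_lt_trans (ler_normD _ _) _.
      by have [_ /(_ t t1)[h1 _]] := Hu v ve; move: rho0 h1 tpn rKh; rewrite r1E; lra.
    have x'x1 : u (v + h) t - x1 = w t by rewrite /w /x1 opprD addrA.
    have A00 : 0 <= A0 by rewrite /A0 !(mulr_ge0, addr_ge0).
    apply: norm_row_le => [|j]; first by rewrite addr_ge0// divr_ge0.
    rewrite /dw mxE.
    have EA := Xlip v x1 (u (v + h) t) j bx1 bx'.
    have EB := Xtay v (u v t) x1 j bx bx1.
    have EC := Xlip h (u v t) (u (v + h) t) j bx bx'.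
    rewrite x1u dirdZ pE sym// -dpE -pE in EB.
    have hXE : (h *m X (u v t)) 0 j = p t 0 j by rewrite pE.
    have vhX : ((v + h) *m X (u (v + h) t)) 0 j = (v *m X (u (v + h) t)) 0 j + (h *m X (u (v + h) t)) 0 j.
      by rewrite mulmxDl mxE.
    rewrite vhX; rewrite hXE in EC; rewrite x'x1 in EA.
    have x'x : `|u (v + h) t - u v t| <= `|w t| + r%:R * K * `|h|.
      have -> : u (v + h) t - u v t = w t + t *: p t by rewrite /w subrK.
      by apply: le_trans (ler_normD _ _) _; rewrite lerD2l.
    set a1 := (v *m X (u (v + h) t)) 0 j in EA *; set a2 := (v *m X x1) 0 j in EA EB.
    set a3 := (h *m X (u (v + h) t)) 0 j in EC *; set a4 := (v *m X (u v t)) 0 j in EB *.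
    have -> : a1 + a3 - a4 - (p t 0 j + t * dp t 0 j) = (a1 - a2) + (a2 - a4 - t * dp t 0 j) + (a3 - p t 0 j) by ring.
    apply: le_trans (ler_normD _ _) _; apply: le_trans (lerD (le_trans (ler_normD _ _) (lerD EA EB)) EC) _.
    set q := `|h| in he pn tpn rKh x'x A0 A00 *; set s := `|v| in ve EA EB *; set W := `|w t| in x'x EA *.
    set T := r%:R * K * q in pn tpn rKh x'x A0 A00 *.
    have q0 : 0 <= q by exact: normr_ge0. have s0 : 0 <= s by exact: normr_ge0. have W0 : 0 <= W by exact: normr_ge0.
    have T0 : 0 <= T by rewrite ?mulr_ge0.
    have B2 : r%:R * (s * (n%:R * (n%:R * K * `|t *: p t|) * `|t *: p t|)) <= r%:R * (eps * (n%:R * (n%:R * K * T) * T)).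
      apply: ler_wpM2l => //; apply: ler_pM => //; [by rewrite ?mulr_ge0|exact: ltW|].
      apply: ler_pM => //; first by rewrite ?mulr_ge0.
      by apply: ler_wpM2l => //; apply: ler_wpM2l => //; rewrite mulr_ge0.
    have B3 : r%:R * (q * (n%:R * K * `|u (v + h) t - u v t|)) <= r%:R * (q * (n%:R * K * (W + T))).
      by apply: ler_wpM2l => //; apply: ler_wpM2l => //; apply: ler_wpM2l => //; rewrite mulr_ge0.
    have B1 : (s + q) * (r%:R * (n%:R * K)) <= 1 / 2.
      have : (s + q) * (r%:R * (n%:R * K)) <= (3 * eps) * Kb.
        apply: ler_pM => //; [by rewrite addr_ge0|by rewrite ?mulr_ge0|by move: ve he; lra].
      have -> : 3 * eps * Kb = 3 * (eps * Kb) by ring.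
      by move=> hh; apply: le_trans hh _; move: epsK1; lra.
    have B1W := ler_wpM2r W0 B1.
    have -> : W / 2 + A0 = 1 / 2 * W + A0 by ring.
    have E5 : (s + q) * (r%:R * (n%:R * K)) * W = r%:R * (s * (n%:R * K * W)) + r%:R * (q * (n%:R * K * W)) by ring.
    have E6 : r%:R * (q * (n%:R * K * (W + T))) = r%:R * (q * (n%:R * K * W)) + r%:R * (q * (n%:R * K * T)) by ring.
    rewrite E5 in B1W; rewrite E6 in B3; rewrite /A0.
    by move: B1W B2 B3; lra.
have bE (v : 'rV[R]_r) : ball 0 eps v -> `|v| < eps by rewrite -ball_normE /= sub0r normrN.
have sdiff (v : 'rV[R]_r) j : `|v| < eps -> is_diff v (fun y => sigma y 0 j) (dotp (fun i => X (sigma v) i j)).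
  move=> ve; apply: is_diff_littleo => [|e e0]; first exact: dotp_continuous.
  apply/nbhs_ballP; exists (Num.min (eps - `|v|) (e / (C1 + 1))) => /=.
    by rewrite lt_min subr_gt0 ve divr_gt0// ltr_wpDl.
  move=> h; rewrite -ball_normE /= sub0r normrN lt_min => /andP[h1 h2].
  have vh : `|v + h| < eps by apply: le_lt_trans (ler_normD _ _) _; move: h1; lra.
  have -> : sigma (h + v) 0 j - sigma v 0 j - dotp (fun i => X (sigma v) i j) h = (sigma (v + h) - sigma v - h *m X (sigma v)) 0 j.
    by rewrite -mulmx_dotp [h + v]addrC !rowBE.
  apply: le_trans (ler_coord_norm _ _) _; apply: le_trans (est v h ve vh) _; apply: ler_wpM2r => //.
  have C11 : 0 < C1 + 1 by rewrite ltr_wpDl.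
  by move: h2; rewrite ltr_pdivlMr// => /ltW; apply: le_trans; rewrite mulrC ler_wpM2l// lerDl.
have spart (v : 'rV[R]_r) i j : `|v| < eps -> derivable (fun y => sigma y 0 j) v (delta_mx 0 i) /\
    partial i (fun y => sigma y 0 j) v = X (sigma v) i j.
  move=> ve; have [dd dE] := sdiff v j ve; split; first exact: diff_derivable.
  by rewrite /partial deriveE// dE dotp_delta.
have scont (v : 'rV[R]_r) j : `|v| < eps -> {for v, continuous (fun y => sigma y 0 j)}.
  by move=> ve; have [dd _] := sdiff v j ve; exact: differentiable_continuous.
have oB : open (ball (0 : 'rV[R]_r) eps) by exact: ball_open.
(* The Jacobian of [sigma] is [X] composed with [sigma], so each order of smoothness gives the
   next. *)
have Cs k : CkV k (ball 0 eps) sigma.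
  elim: k => [|k IH] j; first by split => // v /bE; exact: scont.
  split=> [v /bE|i]; first exact: scont.
  split=> [v /bE ve|]; first by have [] := spart v i j ve.
  apply: (@Ck_eq _ _ k _ ((fun x => X x i j) \o sigma)) => //.
    by move=> v /bE ve; have [_ ->] := spart v i j ve.
  apply: (@Ck_comp _ _ _ k _ U) => //; first by move=> v /bE/sb/bU.
  exact: CX.
exists eps, K, sigma; split => //.
- have z0 : `|0 : 'rV[R]_r| < eps by rewrite normr0.
  apply/rowP => j; have H := @mvt01 R (fun t => u 0 t 0 j) (fun=> 0) 0 0.
  rewrite !subr0 normr0 (Hu 0 z0).1 in H.
  apply/eqP; rewrite -subr_eq0 -normr_le0; apply: H => // t tt.
  have := (is_derive_rowP _ _ _).1 (uD 0 t z0 (t01 t tt)) j; by rewrite mul0mx mxE.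
- move=> v /bE ve; have bs := sb v ve.
  have J : Jac sigma v = X (sigma v) by apply/matrixP => i j; rewrite mxE; have [_ ->] := spart v i j ve.
  split => //; [exact: bU|exact: sE|by move=> i a; have [_ _ _ _ H] := HK _ bs|].
  by rewrite J; apply/eqP; rewrite -subr_eq0 -ZYE; apply/eqP; exact: (Zu v 1 ve one01).
Qed.

End Frobenius.

Lemma rank_factorization (R : fieldType) (N n : nat) (A : 'M[R]_(N, n)) :
  exists r (L : 'M[R]_(N, r)) (Q : 'M[R]_(r, n)) (F : 'M[R]_(r, N)) (E : 'M[R]_(n, r)),
    [/\ A = L *m Q, F *m L = 1%:M & Q *m E = 1%:M].
Proof.
have /row_fullP[F FA] : row_full (col_base A) by exact: col_base_full.
have /row_freeP[E AE] : row_free (row_base A) by exact: row_base_free.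
by exists (\rank A), (col_base A), (row_base A), F, E; rewrite mulmx_base.
Qed.

(** A full rank factorization of [Y x0] supplies [F] and [E], for which [F *m Y x0 *m E] is the
    identity and the remainder vanishes at [x0]. The domain is shrunk to where this minor stays
    invertible. *)
Theorem frobenius_local (R : realType) (n N : nat) (U : set 'rV[R]_n) (Y : 'rV[R]_n -> 'M[R]_(N, n))
    (C : 'I_N -> 'I_N -> 'I_N -> 'rV[R]_n -> R) (x0 : 'rV[R]_n) : open U -> U x0 ->
  (forall k, CkM U k Y) -> (forall a b c, Ck 0 U (C a b c)) ->
  (forall a b x, U x -> vbrk (fun y => row a (Y y)) (fun y => row b (Y y)) x = \sum_c C a b c x *: row c (Y x)) ->
  exists (r : nat) (E : 'M[R]_(n, r)) (eps K : R) (sigma : 'rV[R]_r -> 'rV[R]_n) (b : 'rV[R]_r -> 'M[R]_(r, N)),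
  [/\ 0 < eps, sigma 0 = x0, forall k, CkV k (ball 0 eps) sigma &
   forall v, ball 0 eps v -> [/\ U (sigma v), (sigma v - x0) *m E = v, Jac sigma v = b v *m Y (sigma v),
     forall i a, `|b v i a| <= K & Y (sigma v) = Y (sigma v) *m E *m Jac sigma v]].
Proof.
move=> oU Ux CY CC br.
have [r [L [Q [F [E [dA FL QE]]]]]] := rank_factorization (Y x0).
have FAE : F *m Y x0 *m E = 1%:M by rewrite dA mulmxA FL mul1mx QE.
pose U1 := U `&` (fun x => \det (F *m Y x *m E)) @^-1` [set z | 0 < z].
have CQ k : CkM U k (fun x => F *m Y x *m E).
  apply: CkM_mul => //; last exact: CkM_cst.
  by apply: CkM_mul => //; exact: CkM_cst.
have oU1 : open U1.
  apply: open_preimage_within => //.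
  by move=> x; exact: (Ck_cont (Ck_det oU (CQ 0%N))).
have U1x : U1 x0 by split => //; rewrite /= FAE det1.
have sub k f : Ck k U f -> Ck k U1 f by apply: Ck_subset => x [].
have [|||||eps [K [sigma [e0 s0 Cs Hs]]]] := @frobenius_flow_box R n N r U1 oU1 Y C x0 F E U1x.
- by move=> k i j; apply: sub; exact: CY.
- by move=> a b c; apply: sub; exact: CC.
- by move=> a b x [Ux' _]; exact: br.
- by move=> x [_ /= d0]; rewrite unitmxE unitfE gt_eqF.
- rewrite FAE invmx1 mul1mx mulmxBl mul1mx.
  suff -> : Y x0 *m E *m F *m Y x0 = Y x0 by rewrite subrr.
  by rewrite {1}dA -!mulmxA {1}dA (mulmxA F) FL mul1mx (mulmxA Q) QE mul1mx dA.
exists r, E, eps, K, sigma, (fun v => invmx (F *m Y (sigma v) *m E) *m F); split => // v bv.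
by have [[Us _] ? ? ? ?] := Hs v bv.
Qed.

(** * Plaques and the capture of curves *)

Section Plaques.
Variables (R : realType) (M : manifold R) (D : forall m : M, set (tangent m)).

Definition smooth_field (X : forall q : M, tangent q) := forall f, smooth_fun f -> smooth_fun (fun q => X q f).

(* tau parametrizes an integral manifold of D by the open set W; it is
   inverted by the globally defined functions psi. *)
Definition plaque r (W : set 'rV[R]_r) (tau : 'rV[R]_r -> M) (psi : 'I_r -> M -> R) : Prop :=
  [/\ open W, forall f, smooth_fun f -> Cinf W (f \o tau), forall j, smooth_fun (psi j),
     forall v, W v -> \row_j psi j (tau v) = v
   & forall v, W v -> forall w : tangent (tau v), @D (tau v) w <->
       exists a : 'rV[R]_r, forall f, smooth_fun f -> w f = dird (f \o tau) v a].

Lemma plaque_continuous r (W : set 'rV[R]_r) tau psi v : plaque W tau psi -> W v -> {for v, continuous tau}.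
Proof.
move=> [oW Ct _ _ _] Wv; apply: continuous_of_smooth => f sf; exact: Ck_cont (Ct f sf 0%N) Wv.
Qed.

Lemma row_smooth_continuous r (psi : 'I_r -> M -> R) q : (forall j, smooth_fun (psi j)) ->
  {for q, continuous (fun q => \row_j psi j q)}.
Proof.
move=> spsi; apply: (@cvg_row _ (nbhs q)) => j; rewrite mxE.
rewrite (_ : (fun x => _) = psi j); last by apply/funext => x; rewrite mxE.
by apply: smooth_at_cont; exact: smooth_fun_at.
Qed.

Lemma chart_coordinates (p : M) : exists (c : chart R (mdim M) M) (x : 'I_(mdim M) -> M -> R),
  [/\ atlas c, chart_dom c p, forall j, smooth_fun (x j) &
   \forall q \near p, [/\ chart_dom c q, \row_j x j q = chart_map c q &
     forall (w : tangent q) f, smooth_fun f -> w f = dird (f \o chart_inv c) (chart_map c q) (\row_j w (x j))]].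
Proof.
have [c ac dp] := m_cover p; pose x j := coord_ext c p j.
have sx j : smooth_fun (x j) by have [] := coord_extP ac dp j.
exists c, x; split => //.
have nx : \forall q \near p, forall j, x j q = chart_map c q 0 j.
  by apply: filter_forall => j; have [] := coord_extP ac dp j.
have nd : \forall q \near p, chart_dom c q by apply: open_nbhs_nbhs; split => //; exact: chart_dom_open.
apply: filterS (filterI nd (near_join nx)) => q [dq nq]; split => //.
  by apply/rowP => j; rewrite mxE; have := nbhs_singleton nq; exact.
move=> w f sf; rewrite (tan_expand_coord w ac dq sf sx nq) /dird /dotp.
by apply: eq_bigr => j _; rewrite mxE.
Qed.

(** The functions [z k] compare the coordinates of a point with those of its projection to the
    plaque. A field tangent to D annihilates them on the plaque, so off the plaque its action on
    them is bounded by a constant times their size, and Gronwall keeps them zero. The rank of D near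
    the plaque does not matter. *)
Lemma plaque_capture r (W : set 'rV[R]_r) tau psi v0 N (Y : 'I_N -> forall q : M, tangent q) :
  plaque W tau psi -> W v0 -> (forall i, smooth_field (Y i)) ->
  (\forall q \near tau v0, forall i, @D q (Y i q)) ->
  exists (O : set M) (e : R), [/\ nbhs (tau v0) O, 0 < e &
    forall (gam : R -> M) (c : 'I_N -> R -> R),
     (forall t : R, 0 <= t <= 1 -> [/\ O (gam t), forall i, `|c i t| <= e &
        forall f, smooth_fun f -> is_derive t (1 : R) (f \o gam) (\sum_i c i t * Y i (gam t) f)]) ->
     (exists2 v1, W v1 & gam 0 = tau v1) ->
     forall t : R, 0 <= t <= 1 -> W (\row_j psi j (gam t)) /\ gam t = tau (\row_j psi j (gam t))].
Proof.
move=> plq Wv0 sY nD; have [oW Ct spsi inv Dt] := plq.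
have [c [x [ac dp sx nx]]] := chart_coordinates (tau v0).
(* The projection is meaningful only where the values of [psi] lie in [W]; its coordinates are
   therefore replaced by the global functions [phi]. *)
pose pr q := tau (\row_j psi j q).
have prp : pr (tau v0) = tau v0 by rewrite /pr inv.
have sat f : smooth_fun f -> smooth_at (f \o pr) (tau v0).
  move=> sf; apply: (@smooth_at_compn R M r psi W (f \o tau)) => //; first by rewrite inv.
    by move=> j; exact: smooth_fun_at.
  exact: Ct.
have /choice[phi Hphi] : forall k, exists phi : M -> R, smooth_fun phi /\ \forall q \near tau v0, phi q = x k (pr q).
  by move=> k; have [g sg E] := smooth_global (sat _ (sx k)); exists g.
pose z k q := x k q - phi k q.
have sz k : smooth_fun (z k) by apply: smooth_fun_add => //; apply: smooth_fun_opp; exact: (Hphi k).1.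
have sh i k : smooth_fun (fun q => Y i q (z k)) by exact: sY.
have nW : \forall q \near tau v0, W (\row_j psi j q).
  have rc : {for tau v0, continuous (fun q => \row_j psi j q)} by exact: row_smooth_continuous.
  by apply: (rc W) => /=; rewrite inv//; exact: open_nbhs_nbhs.
have prc : {for tau v0, continuous pr}.
  by apply: continuous_of_smooth => f sf; exact: smooth_at_cont (sat f sf).
have nphi : \forall q \near tau v0, forall k, phi k q = x k (pr q).
  by apply: filter_forall => k; exact: (Hphi k).2.
have [rad [L [rad0 L0 radU HL]]] : exists rad L : R, [/\ 0 < rad, 0 <= L, ball (chart_map c (tau v0)) rad `<=` chart_im c &
    forall i k x y, ball (chart_map c (tau v0)) rad x -> ball (chart_map c (tau v0)) rad y ->
     `|Y i (chart_inv c y) (z k) - Y i (chart_inv c x) (z k)| <= L * `|y - x|].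
  pose g i k := (fun q => Y i q (z k)) \o chart_inv c.
  pose f (s : 'I_N * 'I_(mdim M) * 'I_(mdim M)) := partial s.2 (g s.1.1 s.1.2).
  have Cf s : Ck 0 (chart_im c) (f s) by exact: (Ck_partial s.2 (sh s.1.1 s.1.2 c ac 1%N)).
  have [rad [K [rad0 K0 radU HK]]] := Ck0_bounded_fin (chart_im_open ac) Cf (chart_im_map dp).
  exists rad, ((mdim M)%:R * K); split => //; first by rewrite mulr_ge0.
  move=> i k y y' by_ by'; apply: (@bounded_partials_lipschitz R _ (g i k) (chart_map c (tau v0)) rad K) => //.
    by apply: Ck_subset (sh i k c ac 1%N).
  by move=> l y1 by1; exact: (HK (i, k, l) y1 by1).
pose N0 := [set q | [/\ chart_dom c q, \row_j x j q = chart_map c q,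
   \forall q' \near q, forall k, phi k q' = x k (pr q'),
   W (\row_j psi j q) & forall i, @D q (Y i q)] /\ ball (chart_map c (tau v0)) rad (chart_map c q)].
have nN0 : nbhs (tau v0) N0.
  have nb : nbhs (tau v0) (chart_map c @^-1` ball (chart_map c (tau v0)) rad).
    by apply: (chart_map_cont ac dp); exact: nbhsx_ballx.
  by apply: filterS (filterI nx (filterI (near_join nphi) (filterI nW (filterI nD nb)))) => q [[h1 h2 _] [h3 [h4 [h5 h6]]]].
have nN1 : nbhs (tau v0) (pr @^-1` N0) by apply: prc; rewrite prp.
have NL0 : 0 < 2 * (N%:R * L + 1) by rewrite mulr_gt0// ltr_wpDl// mulr_ge0.
(* Coefficients of this size let the [N] fields, [L]-Lipschitz on the functions [z k], contribute at
   most half of [|w|]. Points and their projections must both lie in the controlled region. *)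
exists (N0 `&` (pr @^-1` N0)), (2 * (N%:R * L + 1))^-1; split; [exact: filterI|by rewrite invr_gt0|].
move=> gam cc Hg [v1 Wv1 g0].
(* At the projected point the field is tangent to the plaque, along which [z k] is constantly
   zero. *)
have z0 i k q : (N0 `&` (pr @^-1` N0)) q -> Y i (pr q) (z k) = 0.
  move=> [[[_ _ _ Wq _] _] [[_ _ nq _ Dq] _]].
  have [+ _] := Dt _ Wq (Y i (pr q)); move=> /(_ (Dq i))[a Ha].
  rewrite (Ha _ (sz k)).
  rewrite /dird /dotp big1// => l _; rewrite /partial.
  have E0 : \forall v \near \row_j psi j q, (z k \o tau) v = (cst 0 : 'rV[R]_r -> R) v.
    have nv : \forall v \near \row_j psi j q, W v by exact: open_nbhs_nbhs.
    have nt : \forall v \near \row_j psi j q, forall k, phi k (tau v) = x k (pr (tau v)).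
      exact: (plaque_continuous plq Wq nq).
    apply: filterS (filterI nv nt) => v [Wv /(_ k) Ev].
    by rewrite /= /z Ev /pr inv// subrr.
  by rewrite (near_eq_derive _ E0) derive_cst mulr0.
have zd q : (N0 `&` (pr @^-1` N0)) q -> chart_map c q - chart_map c (pr q) = \row_k z k q.
  move=> [[[_ <- nq _ _] _] [[_ <- _ _ _] _]]; apply/rowP => k; rewrite !mxE /z.
  by rewrite (nbhs_singleton nq).
pose w (t : R) := \row_k z k (gam t); pose dw (t : R) := \row_k \sum_i cc i t * Y i (gam t) (z k).
have w0 (t : R) : 0 <= t <= 1 -> `|w t| <= 2 * 0.
  apply: (@small_gronwall R _ w dw 0) => // [s s01||s s01].
  - apply/is_derive_rowP => k; rewrite mxE (_ : (fun s => w s 0 k) = z k \o gam); last by apply/funext => y; rewrite mxE.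
    by have [_ _ H] := Hg s s01; exact: H.
  - have o01 : 0 <= (0 : R) <= 1 by rewrite lexx ler01.
    have [Og _ _] := Hg 0 o01.
    by rewrite /w -(zd _ Og) g0 /pr inv// subrr.
  - have [Og ce _] := Hg s s01.
    apply: norm_row_le => [|k]; first by rewrite addr0 divr_ge0.
    rewrite mxE addr0; apply: le_trans (ler_norm_sum _ _ _) _.
    have Yb i : `|cc i s * Y i (gam s) (z k)| <= (2 * (N%:R * L + 1))^-1 * (L * `|w s|).
      rewrite normrM; apply: ler_pM => //.
      have [[[d1 _ _ _ _] b1] [[d2 _ _ _ _] b2]] := Og.
      have := HL i k _ _ b2 b1; rewrite !chart_mapK// z0// subr0 => H.
      by apply: le_trans H _; rewrite zd.
    apply: le_trans (sum_ord_le Yb) _.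
    have -> : N%:R * ((2 * (N%:R * L + 1))^-1 * (L * `|w s|)) = (N%:R * L / (2 * (N%:R * L + 1))) * `|w s|.
      by rewrite mulrCA !mulrA; ring.
    have -> : `|w s| / 2 = 2^-1 * `|w s| by rewrite mulrC.
    apply: ler_wpM2r => //; rewrite ler_pdivrMr// mulrA mulVf// mul1r.
    by rewrite lerDl.
move=> t tt; have [Og _ _] := Hg t tt.
have [[[dq _ _ Wq _] _] [[dq' _ _ _ _] _]] := Og.
split => //; rewrite -[LHS](chart_mapK ac dq) -[RHS](chart_mapK ac dq'); congr (chart_inv c _).
apply/eqP; rewrite -subr_eq0 (zd _ Og) -normr_le0.
by have := w0 t tt; rewrite mulr0.
Qed.

End Plaques.

Section LocalPlaque.
Variables (R : realType) (M : manifold R) (D : forall m : M, set (tangent m)).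

(** The second clause, against all plaques of all dimensions, makes overlaps open in the parameters
    of the given plaque; the final topology of the leaves rests on it. *)
Definition good_plaque r (W : set 'rV[R]_r) (tau : 'rV[R]_r -> M) (psi : 'I_r -> M -> R) : Prop :=
  plaque D W tau psi /\
  forall r1 (W1 : set 'rV[R]_r1) tau1 psi1 v0 v1, plaque D W1 tau1 psi1 -> W v0 -> W1 v1 -> tau v0 = tau1 v1 ->
    \forall v \near v0, W1 (\row_j psi1 j (tau v)) /\ tau v = tau1 (\row_j psi1 j (tau v)).

(** [frobenius_local] in a chart gives the plaque. It is good by capture: segments in its parameters
    are curves whose velocities are combinations of the [Y], with coefficients bounded by a constant
    times the length of the segment. *)
Theorem local_plaque (p : M) N (Y : 'I_N -> forall q : M, tangent q) (C : 'I_N -> 'I_N -> 'I_N -> M -> R) :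
  (forall a, smooth_field (Y a)) -> (forall a b c, smooth_fun (C a b c)) ->
  (\forall q \near p, forall a b f, smooth_fun f ->
     Y a q (fun q' => Y b q' f) - Y b q (fun q' => Y a q' f) = \sum_c C a b c q * Y c q f) ->
  (\forall q \near p, forall w : tangent q, @D q w <-> exists lam : 'I_N -> R, w = \sum_a lam a *: Y a q) ->
  exists r (eps : R) (tau : 'rV[R]_r -> M) psi,
    [/\ 0 < eps, good_plaque (ball 0 eps) tau psi & tau 0 = p].
Proof.
move=> sY sC nbr nsp.
have [c [x [ac dp sx nx]]] := chart_coordinates p.
pose N0 := [set q | [/\ chart_dom c q, \row_j x j q = chart_map c q &
     forall (w : tangent q) f, smooth_fun f -> w f = dird (f \o chart_inv c) (chart_map c q) (\row_j w (x j))] /\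
   ((forall a b f, smooth_fun f ->
     Y a q (fun q' => Y b q' f) - Y b q (fun q' => Y a q' f) = \sum_c C a b c q * Y c q f) /\
   \forall q' \near q, forall w : tangent q', @D q' w <-> exists lam : 'I_N -> R, w = \sum_a lam a *: Y a q')].
have nN0 : nbhs p N0 by apply: filterI => //; apply: filterI => //; exact: near_join.
have [e e0 He] := chart_ball ac dp nN0.
set x0 := chart_map c p in He *.
pose U := ball x0 e; have oU : open U by exact: ball_open.
have Uim : U `<=` chart_im c by move=> y /He[].
have Ux0 : U x0 by exact: ballxx.
pose Ym (y : 'rV[R]_(mdim M)) := \matrix_(a, j) Y a (chart_inv c y) (x j).
have CY k : CkM U k Ym.
  move=> a j; apply: (@Ck_eq _ _ k U ((fun q => Y a q (x j)) \o chart_inv c)) => //.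
    by move=> y _; rewrite mxE.
  exact: (Ck_subset Uim (sY a _ (sx j) c ac k)).
pose Cm a b d (y : 'rV[R]_(mdim M)) := C a b d (chart_inv c y).
have CC a b d : Ck 0 U (Cm a b d) by exact: (Ck_subset Uim (sC a b d c ac 0%N)).
have br a b y : U y -> vbrk (fun y => row a (Ym y)) (fun y => row b (Ym y)) y = \sum_d Cm a b d y *: row d (Ym y).
  move=> Uy; have [imy [[dy xy ex] [bry _]]] := He y Uy.
  apply/rowP => j; rewrite mxE summxE.
  have E a' b' : dird (fun y' => row b' (Ym y') 0 j) y (row a' (Ym y)) = Y a' (chart_inv c y) (fun q => Y b' q (x j)).
    rewrite ex; last exact: sY.
    rewrite chart_invK//; congr (dird _ _ _); first by apply/funext => y'; rewrite !mxE.
    by apply/rowP => k; rewrite !mxE.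
  rewrite !E bry//; apply: eq_bigr => d _; by rewrite !mxE.
have [r [E [eps [K [sigma [b [eps0 s0 Cs Hs]]]]]]] := frobenius_local oU Ux0 CY CC br.
pose tau := chart_inv c \o sigma.
have UB v : ball 0 eps v -> U (sigma v) by move=> /Hs[].
pose psi j q := \sum_k (x k q - x0 0 k) * E k j.
have spsi j : smooth_fun (psi j).
  apply: smooth_fun_sum => k; apply: smooth_fun_mul; last exact: smooth_fun_cst.
  by apply: smooth_fun_add => //; exact: smooth_fun_cst.
have oB : open (ball (0 : 'rV[R]_r) eps) by exact: ball_open.
have Ct f : smooth_fun f -> Cinf (ball 0 eps) (f \o tau).
  move=> sf k; change (Ck k (ball 0 eps) ((f \o chart_inv c) \o sigma)).
  by apply: (@Ck_comp _ _ _ k _ U) => //; apply: Ck_subset (sf c ac k).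
have ttan f v i : ball 0 eps v -> smooth_fun f ->
    partial i (f \o tau) v = \sum_j Jac sigma v i j * partial j (f \o chart_inv c) (sigma v).
  move=> bv sf.
  have := @Ck1_chain R r _ (ball 0 eps) U sigma (f \o chart_inv c) v (delta_mx 0 i) oB oU UB (Cs 1%N) (Ck_subset Uim (sf c ac 1%N)) bv.
  move=> [_]; rewrite /partial -/tau (_ : _ \o sigma = f \o tau)// => ->.
  by apply: eq_bigr => j _; rewrite mxE.
have tanY f v a : ball 0 eps v -> smooth_fun f ->
    Y a (tau v) f = \sum_j Ym (sigma v) a j * partial j (f \o chart_inv c) (sigma v).
  move=> bv sf; have Uv := UB v bv; have [imy [[dy xy ex] _]] := He _ Uv.
  rewrite ex// /tau /= chart_invK// /dird /dotp; apply: eq_bigr => j _.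
  by rewrite !mxE.
have pb f v i : ball 0 eps v -> smooth_fun f -> partial i (f \o tau) v = \sum_a b v i a * Y a (tau v) f.
  move=> bv sf; rewrite ttan//; have [_ _ -> _ _] := Hs v bv.
  under [RHS]eq_bigr => a _ do rewrite (tanY f v a bv sf) mulr_sumr.
  rewrite exchange_big /=; apply: eq_bigr => j _.
  by rewrite mxE mulr_suml; apply: eq_bigr => a _; rewrite mulrA.
have Yp f v a : ball 0 eps v -> smooth_fun f ->
    Y a (tau v) f = dird (f \o tau) v (row a (Ym (sigma v) *m E)).
  move=> bv sf; rewrite tanY// /dird /dotp; have [_ _ _ _ Yv] := Hs v bv.
  under [RHS]eq_bigr => i _ do rewrite (ttan f v i bv sf) mulr_sumr.
  rewrite exchange_big /=; apply: eq_bigr => j _.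
  by rewrite {1}Yv mxE mulr_suml; apply: eq_bigr => i _; rewrite mulrA !mxE.
have plq : plaque D (ball 0 eps) tau psi.
  split => //.
  - move=> v bv; have Uv := UB v bv; have [imy [[dy xy ex] _]] := He _ Uv.
    have [_ Ev _ _ _] := Hs v bv; apply/rowP => j; rewrite mxE /psi.
    have := congr1 (fun A : 'rV_r => A 0 j) Ev; rewrite /= mxE => <-.
    apply: eq_bigr => k _; congr (_ * _); rewrite rowBE.
    have := congr1 (fun A : 'rV_(mdim M) => A 0 k) xy; rewrite /= mxE chart_invK// => <-.
    by [].
  - move=> v bv w; have Uv := UB v bv; have [imy [_ [_ nspv]]] := He _ Uv.
    have := nbhs_singleton nspv w; rewrite -/(tau v) => -> ; split => [[lam ->]|[a Ha]].
      exists (\sum_a lam a *: row a (Ym (sigma v) *m E)) => f sf.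
      rewrite tangent_sumE dird_sumr; apply: eq_bigr => a _.
      by rewrite tangent_scaleE dirdZ Yp.
    exists (fun a' => \sum_i a 0 i * b v i a'); apply: tangent_ext => f sf.
    rewrite Ha// tangent_sumE /dird /dotp.
    under eq_bigr => i _ do rewrite (pb f v i bv sf) mulr_sumr.
    rewrite exchange_big /=; apply: eq_bigr => a' _.
    transitivity ((\sum_i a 0 i * b v i a') * Y a' (tau v) f); last by [].
    by rewrite mulr_suml; apply: eq_bigr => i _; rewrite mulrA.
exists r, eps, tau, psi; split => //; last by rewrite /tau /= s0 chart_mapK.
split => // r1 W1 tau1 psi1 v0 v1 plq1 bv0 Wv1 E01.
have nD : \forall q \near tau1 v1, forall a, D (Y a q).
  rewrite -E01; have [imy [_ [_ nspv]]] := He _ (UB _ bv0).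
  apply: filterS nspv => q Hq a; apply/Hq; exists (fun a' => (a' == a)%:R).
  by rewrite (bigD1 a)//= eqxx scale1r big1 ?addr0// => a' /negbTE ->; rewrite scale0r.
have [Oq [dl [nO dl0 cap]]] := plaque_capture plq1 Wv1 sY nD.
have nO' : \forall v \near v0, Oq (tau v).
  by apply: (plaque_continuous plq bv0); rewrite E01.
have nB : \forall v \near v0, ball 0 eps v by exact: open_nbhs_nbhs.
have nOB : nbhs v0 ([set v | Oq (tau v)] `&` ball 0 eps) by exact: filterI.
have /nbhs_ballP[s /= s_gt0 Hball] := nOB.
(* Short enough for the coefficients of the velocity, at most [r%:R * (|K| + 1)] times the length,
   to stay below the capture threshold [dl]. *)
pose rad := Num.min s (dl / (r%:R * (`|K| + 1) + 1)).
have den0 : 0 < r%:R * (`|K| + 1) + 1 by rewrite ltr_wpDl// mulr_ge0// addr_ge0.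
apply/nbhs_ballP; exists rad => /=; first by rewrite lt_min s_gt0 divr_gt0.
move=> v; rewrite -ball_normE /= lt_min => /andP[vs vd].
have seg (t : R) : 0 <= t <= 1 -> ball v0 s (v0 + t *: (v - v0)).
  move=> /andP[t0 t1]; rewrite -ball_normE /= opprD addrA subrr add0r normrN normrZ ger0_norm//.
  by apply: le_lt_trans vs; rewrite distrC ler_piMl.
pose gam (t : R) := tau (v0 + t *: (v - v0)).
have [|||] := cap gam (fun a t => \sum_i (v - v0) 0 i * b (v0 + t *: (v - v0)) i a) _ _ 1.
- move=> t t01; have [Ot bt] := Hball _ (seg t t01); split => //.
    move=> a; apply: le_trans (ler_norm_sum _ _ _) _.
    have Kb i : `|(v - v0) 0 i * b (v0 + t *: (v - v0)) i a| <= `|v0 - v| * (`|K| + 1).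
      rewrite normrM distrC; apply: ler_pM => //; first exact: ler_coord_norm.
      have [_ _ _ HK _] := Hs _ bt; apply: le_trans (HK i a) _.
      by apply: le_trans (ler_norm _) _; rewrite lerDl.
    apply: le_trans (sum_ord_le Kb) _.
    have : `|v0 - v| * (r%:R * (`|K| + 1) + 1) <= dl by rewrite -ler_pdivlMr// ltW.
    by apply: le_trans; rewrite mulrCA ler_wpM2l// lerDl.
  move=> f sf; have Cf := Ct f sf 1%N.
  have Du : is_derive t (1 : R) (fun t => v0 + t *: (v - v0)) (v - v0).
    apply/is_derive_rowP => j.
    have := @is_derive_affine R id ((v - v0) 0 j) (v0 0 j) t 1 (is_derive_id _ _).
    rewrite mulr1 => /is_derive_eq D1; rewrite (_ : (fun s => _) = (fun s => id ((v - v0) 0 j * s + v0 0 j))).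
      exact: D1.
    by apply/funext => t'; rewrite addrC mxE; congr (_ + _); rewrite mxE mulrC.
  have := dird_curve oB Cf bt Du.
  move=> /is_derive_eq; apply; rewrite /dird /dotp.
  under eq_bigr => i _ do rewrite (pb f _ i bt sf) mulr_sumr.
  rewrite exchange_big /=; apply: eq_bigr => a _.
  by rewrite mulr_suml; apply: eq_bigr => i _; rewrite mulrA.
- by exists v1 => //; rewrite /gam scale0r addr0.
- by rewrite ler01 lexx.
by rewrite /gam scale1r addrC subrK.
Qed.

End LocalPlaque.

(** * Leaves *)

Section PlaqueDimension.
Variables (R : realType) (M : manifold R) (D : forall m : M, set (tangent m)).

Lemma plaque_restrict r (W W' : set 'rV[R]_r) tau psi : open W' -> W' `<=` W -> plaque D W tau psi -> plaque D W' tau psi.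
Proof.
move=> oW' sub [oW Ct sp inv Dt]; split => //.
- by move=> f sf k; apply: Ck_subset (Ct f sf k).
- by move=> v /sub; exact: inv.
- by move=> v /sub; exact: Dt.
Qed.

Lemma good_restrict r (W W' : set 'rV[R]_r) tau psi : open W' -> W' `<=` W -> good_plaque D W tau psi ->
  good_plaque D W' tau psi.
Proof.
move=> oW' sub [pl cap]; split; first exact: plaque_restrict pl.
by move=> r1 W1 tau1 psi1 v0 v1 pl1 /sub Wv Wv1 E; exact: (cap _ _ _ _ _ _ pl1 Wv Wv1 E).
Qed.

Lemma plaque_coord r (W : set 'rV[R]_r) tau psi v a j : plaque D W tau psi -> W v ->
  dird (psi j \o tau) v a = a 0 j.
Proof.
move=> [oW Ct sp inv Dt] Wv; rewrite -[RHS](dotp_coord j a) -(dird_dotp (fun i => (i == j)%:R) v a).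
apply: (dird_eq oW _ _ Wv) => y Wy; rewrite dotp_coord -[RHS](congr1 (fun A : 'rV_r => A 0 j) (inv y Wy)).
by rewrite /= mxE.
Qed.

Lemma plaque_tangent r (W : set 'rV[R]_r) tau psi v a : plaque D W tau psi -> W v ->
  exists w : tangent (tau v), forall f, smooth_fun f -> w f = dird (f \o tau) v a.
Proof.
move=> [oW Ct sp inv Dt] Wv; exists (mktangent (tau v) (fun f => dird (f \o tau) v a)) => f sf.
apply: (mktangentE (v := fun f => dird (f \o tau) v a)) => //.
  move=> k g h sg sh; have C1 := Ct g sg 1%N; have C2 := Ct h sh 1%N.
  have Ck1 : Ck 1 W (fun y => k * (g \o tau) y) by apply: (Ck_mul oW) => //; exact: Ck_cst.
  rewrite (_ : _ \o tau = fun y => k * (g \o tau) y + (h \o tau) y)//.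
  rewrite (dird_add oW a Ck1 C2 Wv) (dird_mul oW a (Ck_cst W 1 k) C1 Wv) dird_cst mul0r addr0.
  by [].
move=> g h sg sh; have C1 := Ct g sg 1%N; have C2 := Ct h sh 1%N.
rewrite (_ : _ \o tau = fun y => (g \o tau) y * (h \o tau) y)// (dird_mul oW a C1 C2 Wv) addrC.
by [].
Qed.

Lemma plaque_D r (W : set 'rV[R]_r) tau psi v (m : M) (w : tangent m) : plaque D W tau psi -> W v -> tau v = m ->
  @D m w <-> exists a : 'rV[R]_r, forall f, smooth_fun f -> w f = dird (f \o tau) v a.
Proof. by move=> [_ _ _ _ Dt] Wv E; case: _ / E w => w; exact: Dt. Qed.

(** At a common point both parametrizations have the same tangent space, and the matrices comparing
    their coordinates compose to the identity. *)
Lemma plaque_dim_le r r' (W : set 'rV[R]_r) (W' : set 'rV[R]_r') tau tau' psi psi' v v' :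
  plaque D W tau psi -> plaque D W' tau' psi' -> W v -> W' v' -> tau v = tau' v' -> (r <= r')%N.
Proof.
move=> pl pl' Wv Wv' E; have [_ _ sp _ _] := pl; have [_ _ sp' _ _] := pl'.
pose T := \matrix_(i, j) partial i (psi' j \o tau) v.
pose T' := \matrix_(i, j) partial i (psi j \o tau') v'.
suff TT : T *m T' = 1%:M by exact: mulmx1_min TT.
apply/row_matrixP => i; rewrite row_mul row1 rowE -mulmxA; set a := delta_mx 0 i.
have [w Hw] := plaque_tangent a pl Wv.
have Dw : D w by apply/(plaque_D w pl Wv erefl); exists a.
have [a' Ha'] := (plaque_D w pl' Wv' (esym E)).1 Dw.
have Ea' : a' = a *m T.
  apply/rowP => j; rewrite -(plaque_coord a' j pl' Wv') -Ha'// Hw// mxE /dird /dotp.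
  by apply: eq_bigr => k _; rewrite [T _ _]mxE.
have Ea : a = a' *m T'.
  apply/rowP => j; rewrite -(plaque_coord a j pl Wv) -Hw// Ha'// mxE /dird /dotp.
  by apply: eq_bigr => k _; rewrite [T' _ _]mxE.
by rewrite mulmxA -Ea' -Ea.
Qed.

Lemma plaque_dim r r' (W : set 'rV[R]_r) (W' : set 'rV[R]_r') tau tau' psi psi' v v' :
  plaque D W tau psi -> plaque D W' tau' psi' -> W v -> W' v' -> tau v = tau' v' -> r = r'.
Proof.
move=> pl pl' Wv Wv' E; apply/eqP; rewrite eqn_leq (plaque_dim_le pl pl' Wv Wv' E).
exact: (plaque_dim_le pl' pl Wv' Wv (esym E)).
Qed.

Definition ball_link (m m' : M) := exists r (eps : R) (tau : 'rV[R]_r -> M) psi v v',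
  [/\ good_plaque D (ball 0 eps) tau psi, ball 0 eps v, ball 0 eps v', tau v = m & tau v' = m'].

(** The reflexive and transitive closure of [ball_link], as membership in every closed set; taking a
    suitable set [A] is induction along a chain. *)
Definition linked (m m' : M) := forall A : set M, A m -> (forall x y, ball_link x y -> A x -> A y) -> A m'.

Lemma ball_link_sym m m' : ball_link m m' -> ball_link m' m.
Proof. by move=> [r [eps [tau [psi [v [v' [? ? ? ? ?]]]]]]]; exists r, eps, tau, psi, v', v. Qed.

Lemma linked_refl m : linked m m. Proof. by []. Qed.

Lemma linked_trans m1 m2 m3 : linked m1 m2 -> linked m2 m3 -> linked m1 m3.
Proof. by move=> h1 h2 A A1 HA; apply: (h2 A) => //; exact: h1. Qed.

Lemma ball_linked m m' : ball_link m m' -> linked m m'.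
Proof. by move=> h A Am HA; exact: HA h Am. Qed.

Lemma linked_sym m m' : linked m m' -> linked m' m.
Proof.
move=> h; apply: (h (fun y => linked y m)); first exact: linked_refl.
by move=> x y xy; apply: linked_trans; apply: ball_linked; exact: ball_link_sym.
Qed.

End PlaqueDimension.

(** * The leaf topology and its charts *)

Section Leaves.
Variables (R : realType) (M : manifold R) (D : forall m : M, set (tangent m)).

(** The dimension is part of the data because it occurs in the type of charts; [leaf_partition]
    shows that the set determines it. *)
Record leaf_data := LeafData {
  ld_set : set M;
  ld_dim : nat;
  ld_class : exists2 m, ld_set m & ld_set = [set m' | linked D m m'];
  ld_plaque : forall m, ld_set m -> exists (eps : R) (tau : 'rV[R]_ld_dim -> M) psi,
    [/\ 0 < eps, good_plaque D (ball 0 eps) tau psi & tau 0 = m] }.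

Lemma ld_linked k m m' : ld_set k m -> linked D m m' -> ld_set k m'.
Proof. by have [m0 _ ->] := ld_class k; exact: linked_trans. Qed.

Lemma ld_connected k m m' : ld_set k m -> ld_set k m' -> linked D m m'.
Proof.
have [m0 _ ->] := ld_class k => /= h1 h2; apply: linked_trans h2; exact: linked_sym.
Qed.

Lemma ld_ball k r (eps : R) (tau : 'rV[R]_r -> M) psi v v' : good_plaque D (ball 0 eps) tau psi ->
  ball 0 eps v -> ball 0 eps v' -> ld_set k (tau v) -> ld_set k (tau v').
Proof.
move=> gp bv bv' kv; apply: ld_linked kv _; apply: ball_linked.
by exists r, eps, tau, psi, v, v'.
Qed.

(** The parameter set [W] need not be connected, so a plaque may leave the class; near [v] it stays
    in a ball plaque of the class, by the second clause of [good_plaque]. *)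
Lemma ld_near k r (W : set 'rV[R]_r) tau psi v : good_plaque D W tau psi -> W v -> ld_set k (tau v) ->
  \forall v' \near v, ld_set k (tau v').
Proof.
move=> [pl cap] Wv kv; have [eps [tau0 [psi0 [e0 gp0 E]]]] := ld_plaque kv.
have b0 : ball (0 : 'rV[R]_(ld_dim k)) eps 0 by exact: ballxx.
have := cap _ _ _ _ _ _ gp0.1 Wv b0 (esym E); apply: filterS => v' [bv' ->].
by apply: (ld_ball gp0 b0 bv'); rewrite E.
Qed.

Record leaf_point k := LeafPoint { leaf_val : M; leaf_valP : ld_set k leaf_val }.

Lemma leaf_val_inj k : injective (@leaf_val k).
Proof. by move=> [x hx] [y hy] /= E; subst y; congr LeafPoint; exact: Prop_irrelevance. Qed.

Variable k : leaf_data.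

HB.instance Definition _ := gen_eqMixin (leaf_point k).
HB.instance Definition _ := gen_choiceMixin (leaf_point k).

Definition leaf_trace r (W : set 'rV[R]_r) (tau : 'rV[R]_r -> M) (U : set (leaf_point k)) :=
  [set v | W v /\ exists2 y, U y & leaf_val y = tau v].

(* The final topology of the plaques. *)
Definition leaf_open (U : set (leaf_point k)) : Prop :=
  forall r (W : set 'rV[R]_r) tau psi, good_plaque D W tau psi -> open (leaf_trace W tau U).

Fact leaf_openT : leaf_open setT.
Proof.
move=> r W tau psi gp; rewrite openE => v [Wv [y _ Ey]].
have kv : ld_set k (tau v) by rewrite -Ey; exact: leaf_valP.
have nW : \forall v' \near v, W v' by apply: open_nbhs_nbhs; split => //; have [[]] := gp.
apply: filterS (filterI nW (ld_near gp Wv kv)) => v' [Wv' kv']; split => //.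
by exists (LeafPoint kv').
Qed.

Fact leaf_openI : setI_closed leaf_open.
Proof.
move=> A B oA oB r W tau psi gp.
have -> : leaf_trace W tau (A `&` B) = leaf_trace W tau A `&` leaf_trace W tau B.
  apply/seteqP; split => [v [Wv [y [Ay By] Ey]]|v [[Wv [y Ay Ey]] [_ [y' By' Ey']]]].
    by split; split => //; exists y.
  split => //; exists y => //; split => //.
  by rewrite (leaf_val_inj (etrans Ey (esym Ey'))).
by apply: openI; [exact: oA gp|exact: oB gp].
Qed.

Fact leaf_open_bigU (I : Type) (f : I -> set (leaf_point k)) :
  (forall i, leaf_open (f i)) -> leaf_open (\bigcup_i f i).
Proof.
move=> of_ r W tau psi gp.
have -> : leaf_trace W tau (\bigcup_i f i) = \bigcup_i leaf_trace W tau (f i).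
  apply/seteqP; split => [v [Wv [y [i _ fy] Ey]]|v [i _ [Wv [y fy Ey]]]].
    by exists i => //; split => //; exists y.
  by split => //; exists y => //; exists i.
by apply: bigcup_open => i _; exact: of_ gp.
Qed.

HB.instance Definition _ := isOpenTopological.Build (leaf_point k) leaf_openT leaf_openI leaf_open_bigU.

Lemma leaf_openP (U : set (leaf_point k)) : open U <-> leaf_open U.
Proof. by []. Qed.

Lemma leaf_val_continuous (x : leaf_point k) : {for x, continuous (@leaf_val k)}.
Proof.
move=> O; rewrite nbhsE; case=> O' [oO' O'x] sub.
suff : nbhs x (@leaf_val k @^-1` O') by apply: filterS => y; exact: sub.
apply: open_nbhs_nbhs; split => //; apply/leaf_openP => r W tau psi gp.
rewrite openE => v [Wv [y Oy Ey]].
have kv : ld_set k (tau v) by rewrite -Ey; exact: leaf_valP.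
have nW : \forall v' \near v, W v' by apply: open_nbhs_nbhs; split => //; have [[]] := gp.
have nO : \forall v' \near v, O' (tau v').
  apply: (plaque_continuous gp.1 Wv); apply: open_nbhs_nbhs; split => //; by rewrite -Ey.
apply: filterS (filterI nW (filterI nO (ld_near gp Wv kv))) => v' [Wv' [Ov' kv']]; split => //.
by exists (LeafPoint kv').
Qed.

Lemma leaf_hausdorff : hausdorff_space (leaf_point k).
Proof.
rewrite open_hausdorff => x y xy.
have vxy : leaf_val x != leaf_val y by apply: contra xy => /eqP/leaf_val_inj ->.
have := @m_hausdorff R M; rewrite open_hausdorff => /(_ _ _ vxy)[[A B] [/= Ax By] [oA oB AB]].
have op O : open O -> open (@leaf_val k @^-1` O).
  by move=> oO; apply: open_comp => // z _; exact: leaf_val_continuous.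
exists (@leaf_val k @^-1` A, @leaf_val k @^-1` B) => /=.
  by split; apply/mem_set; exact: set_mem.
split; [exact: op|exact: op|].
by apply/eqP; rewrite -preimage_setI (eqP AB) preimage_set0.
Qed.

Let x0 : leaf_point k.
Proof.
have H : exists x : leaf_point k, True.
  by have [m km _] := ld_class k; exists (LeafPoint km).
exact: (sval (cid H)).
Qed.

Definition leaf_inv r (tau : 'rV[R]_r -> M) (v : 'rV[R]_r) : leaf_point k :=
  xget x0 [set y | leaf_val y = tau v].

Lemma leaf_invE r (tau : 'rV[R]_r -> M) v : ld_set k (tau v) -> leaf_val (leaf_inv tau v) = tau v.
Proof. by move=> kv; rewrite /leaf_inv; case: xgetP => [y _ //|/(_ (LeafPoint kv)) []]. Qed.

Lemma leaf_inv_val r (tau : 'rV[R]_r -> M) v y : leaf_val y = tau v -> leaf_inv tau v = y.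
Proof.
by move=> E; apply: leaf_val_inj; rewrite leaf_invE ?E// -E; exact: leaf_valP.
Qed.

Definition leaf_chart (W : set 'rV[R]_(ld_dim k)) tau (psi : 'I_(ld_dim k) -> M -> R) :
    chart R (ld_dim k) (leaf_point k) :=
  Chart [set x | exists2 v, W v & leaf_val x = tau v] (fun x => \row_j psi j (leaf_val x)) (leaf_inv tau).

Definition leaf_plaque (W : set 'rV[R]_(ld_dim k)) tau psi :=
  good_plaque D W tau psi /\ forall v, W v -> ld_set k (tau v).

Lemma leaf_inv_continuous r (W : set 'rV[R]_r) tau psi v : good_plaque D W tau psi -> (forall v, W v -> ld_set k (tau v)) ->
  W v -> {for v, continuous (leaf_inv tau)}.
Proof.
move=> gp kW Wv O; rewrite nbhsE; case=> O' [oO' O'v] sub.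
have /leaf_openP/(_ _ _ _ _ gp) oT := oO'.
have : nbhs v (leaf_trace W tau O').
  apply: open_nbhs_nbhs; split => //; split => //; exists (leaf_inv tau v) => //.
  by rewrite leaf_invE//; exact: kW.
suff H : leaf_trace W tau O' `<=` [set z | O (leaf_inv tau z)] by exact: filterS.
by move=> z [Wz [y Oy Ey]]; apply: sub; rewrite (leaf_inv_val Ey).
Qed.

Lemma leaf_chart_im W tau psi : leaf_plaque W tau psi -> chart_im (leaf_chart W tau psi) = W.
Proof.
move=> [[[_ _ _ inv _] _] kW]; apply/seteqP; split => [_ [x /= [v Wv Ex] <-]|v Wv].
  by rewrite /= Ex inv.
exists (leaf_inv tau v) => /=; last by rewrite leaf_invE ?inv//; exact: kW.
by exists v => //; rewrite leaf_invE//; exact: kW.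
Qed.

Lemma leaf_chartP W tau psi : leaf_plaque W tau psi -> is_chart (leaf_chart W tau psi).
Proof.
move=> lp; have [[pl cap] kW] := lp; have [oW Ct sp inv Dt] := pl; split.
- apply/leaf_openP => r' W' tau' psi' [pl' cap'].
  rewrite openE => v' [Wv' [y /= [v Wv Ey] Ey']].
  have nW : \forall z \near v', W' z by apply: open_nbhs_nbhs; split => //; have [] := pl'.
  have := cap' _ _ _ _ _ _ pl Wv' Wv (etrans (esym Ey') Ey).
  move=> H; apply: filterS (filterI nW H) => z [Wz [Wpz Ez]]; split => //.
  exists (leaf_inv tau (\row_j psi j (tau' z))) => /=.
    by exists (\row_j psi j (tau' z)) => //; rewrite leaf_invE//; exact: kW.
  by rewrite leaf_invE//; exact: kW.
- by rewrite leaf_chart_im.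
- move=> x [v Wv Ex] /=; rewrite Ex inv//; exact: leaf_inv_val.
- move=> x _ /=; apply: (@continuous_comp _ _ _ (@leaf_val k) (fun q => \row_j psi j q)).
    exact: leaf_val_continuous.
  exact: row_smooth_continuous.
- by move=> v; rewrite leaf_chart_im// => Wv; exact: (leaf_inv_continuous (conj pl cap) kW Wv).
Qed.

Definition leaf_atlas : set (chart R (ld_dim k) (leaf_point k)) :=
  [set c | exists W tau psi, leaf_plaque W tau psi /\ c = leaf_chart W tau psi].

Lemma leaf_ball_plaque (x : leaf_point k) : exists (eps : R) tau psi,
  [/\ 0 < eps, leaf_plaque (ball 0 eps) tau psi & tau 0 = leaf_val x].
Proof.
have [eps [tau [psi [e0 gp E]]]] := ld_plaque (leaf_valP x).
exists eps, tau, psi; split => //; split => // v bv.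
by apply: (ld_ball gp (ballxx _ e0) bv); rewrite E; exact: leaf_valP.
Qed.

Lemma leaf_cover x : exists2 c, leaf_atlas c & chart_dom c x.
Proof.
have [eps [tau [psi [e0 lp E]]]] := leaf_ball_plaque x.
exists (leaf_chart (ball 0 eps) tau psi); first by exists (ball 0 eps), tau, psi.
by exists 0 => //; exact: ballxx.
Qed.

(** The transition map is [psi'] composed with [tau], smooth on all of [W] because the inverse
    coordinates of a plaque are global functions on [M]. *)
Lemma leaf_compatible c c' : leaf_atlas c -> leaf_atlas c' -> forall i,
  Cinf (chart_map c @` (chart_dom c `&` chart_dom c')) (fun x => chart_map c' (chart_inv c x) 0 i).
Proof.
move=> [W [tau [psi [lp ->]]]] [W' [tau' [psi' [lp' ->]]]] i l.
have [[[oW Ct sp inv Dt] cap] kW] := lp; have [[[_ _ sp' _ _] _] _] := lp'.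
have sub : chart_map (leaf_chart W tau psi) @` (chart_dom (leaf_chart W tau psi) `&` chart_dom (leaf_chart W' tau' psi')) `<=` W.
  by move=> _ [x [[v Wv Ex] _] <-]; rewrite /= Ex inv.
apply: Ck_subset sub _; apply: (@Ck_eq _ _ l W (psi' i \o tau)) => //; last exact: Ct.
by move=> v Wv /=; rewrite mxE leaf_invE//; exact: kW.
Qed.

End Leaves.

(* Poincare-Volterra: starting from x0, the countable dense subsets of the components through already
   reached points reach a countable set meeting every component. *)
Lemma connected_second_countable (X : topologicalType) (I : countType) (A : I -> set X) (x0 : X) :
  connected [set: X] -> (forall i x, open (connected_component (A i) x)) ->
  (forall x U, nbhs x U -> exists i, [/\ A i x, connected_component (A i) x `<=` U
    & exists D : nat -> X, forall O, open O -> O `&` connected_component (A i) x !=set0 ->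
        exists j, (O `&` connected_component (A i) x) (D j)]) ->
  @second_countable X.
Proof.
move=> cX oC H; pose C i x := connected_component (A i) x.
pose dense i x (D : nat -> X) := forall O, open O -> O `&` C i x !=set0 -> exists j, (O `&` C i x) (D j).
have /choice[D HD] : forall ix : I * X, exists D : nat -> X, (exists D, dense ix.1 ix.2 D) -> dense ix.1 ix.2 D.
  move=> [i x] /=; have [[D HD]|no] := EM (exists D, dense i x D); first by exists D.
  by exists (fun=> x) => /no.
(* A finite sequence codes a chain: each entry picks a piece and a term of the dense sequence of its
   component through the point reached so far. *)
pose q := fix q (l : seq (I * nat)) : X := if l is p :: l' then D (p.1, q l') p.2 else x0.
pose nice i x := exists D, dense i x D.
pose U := [set x | exists i l, nice i (q l) /\ C i (q l) x].
have oU : open U.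
  rewrite openE => x [i [l [ni Cx]]]; have : nbhs x (C i (q l)) by apply: open_nbhs_nbhs; split => //; exact: oC.
  by apply: filterS => y Cy; exists i, l.
have key x i : A i x -> nice i x -> forall O, open O -> O `<=` C i x -> O `&` U !=set0 -> exists l, O (q l).
  move=> Ax ni O oO OC [y [Oy [i' [l [ni' Cy]]]]].
  have [j [Oj Cj]] := HD (i', q l) ni' O oO (ex_intro _ y (conj Oy Cy)).
  by exists ((i', j) :: l).
have UT : U = setT.
  apply: connected_clopen => //.
    have [i [Ax _ ni]] := H x0 setT filterT; exists x0, i, [::]; split => //=.
    exact: connected_component_refl.
  rewrite openE => x nUx; have [i [Ax _ ni]] := H x setT filterT.
  have : nbhs x (C i x) by apply: open_nbhs_nbhs; split; [exact: oC|exact: connected_component_refl].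
  apply: filterS => y Cy Uy; apply: nUx.
  have [l Cl] := key x i Ax ni (C i x) (oC i x) (fun _ h => h) (ex_intro _ y (conj Cy Uy)).
  have E := same_connected_component Cl; exists i, l; split; first by rewrite /nice /dense /C -E.
  by rewrite /C -E; exact: connected_component_refl.
exists (range (fun p : I * seq (I * nat) => C p.1 (q p.2))).
  exact: (card_le_trans (card_image_le _ _) (countableP _)).
split; first by move=> _ [p _ <-]; exact: oC.
move=> x V nV; have [i [Ax CV ni]] := H x V nV.
have [l Cl] := key x i Ax ni (C i x) (oC i x) (fun _ h => h)
  (ex_intro _ x (conj (connected_component_refl Ax) (ltac:(by rewrite UT) : U x))).
have E : C i x = C i (q l) := same_connected_component Cl.
exists (C i (q l)); last by rewrite -E.
by split; [exists (i, l)|rewrite -E; exact: connected_component_refl].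
Qed.

Lemma ball_connected (R : realType) d (x : 'rV[R]_d) (e : R) : connected (ball x e).
Proof.
have [e0|e0] := ltP 0 e; last first.
  suff -> : ball x e = set0 by exact: connected0.
  by apply/seteqP; split => // y [/lt_geF]; rewrite e0.
have -> : ball x e = \bigcup_(y in ball x e) ((fun t : R => x + t *: (y - x)) @` `[0, 1]).
  apply/seteqP; split => [y by_|_ [y by_ [t /= t01 <-]]].
    exists y => //; exists 1; rewrite /= ?in_itv /= ?ler01 ?lexx//.
    by rewrite scale1r addrC subrK.
  move: by_; rewrite -ball_normE /= opprD addrA subrr sub0r normrN normrZ -normrN opprB => h.
  apply: le_lt_trans h; move: t01; rewrite in_itv /= => /andP[t0 t1].
  by rewrite ger0_norm// ler_piMl.
apply: bigcup_connected.
  exists x => y _; exists 0; first by rewrite /= in_itv /= lexx ler01.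
  by rewrite scale0r addr0.
move=> y _; apply: connected_continuous_connected; first exact: segment_connected.
apply: continuous_subspaceT => t; apply: cvgD; first exact: cvg_cst.
by apply: cvgZr_tmp; exact: cvg_id.
Qed.

(* The index of a term of this sequence codes a vector with rational coordinates. *)
Definition rational_vector (R : realType) d (i : nat) : 'rV[R]_d :=
  map_mx ratr (odflt (0 : 'rV[rat]_d) (unpickle i)).

Lemma rational_vector_dense (R : realType) d (x : 'rV[R]_d) (A : set 'rV[R]_d) : nbhs x A ->
  exists i, A (rational_vector R d i).
Proof.
rewrite nbhs_ballP => -[e /= e0 sub].
have /choice[r Hr] : forall j : 'I_d, exists r : rat, `|x 0 j - ratr r| < e.
  move=> j; have [|r] := @rat_in_itvoo R (x 0 j - e) (x 0 j + e); first lra.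
  by rewrite in_itv /= => /andP[r1 r2]; exists r; rewrite ltr_norml; apply/andP; split; lra.
exists (pickle (\row_j r j)); apply: sub; rewrite /rational_vector pickleK /=.
by split => // i j; rewrite !mxE /= ord1; exact: Hr.
Qed.

(** * Connectedness and second countability of leaves *)

Section LeafManifold.
Variables (R : realType) (M : manifold R) (D : forall m : M, set (tangent m)) (k : leaf_data D).

Lemma leaf_pointE : exists x : leaf_point k, True.
Proof. by have [m km _] := ld_class k; exists (LeafPoint km). Qed.

Lemma leaf_ball_im r (eps : R) (tau : 'rV[R]_r -> M) psi (rho : R) : good_plaque D (ball 0 eps) tau psi ->
  (forall v, ball 0 eps v -> ld_set k (tau v)) -> rho <= eps -> connected (leaf_inv k tau @` ball 0 rho).
Proof.
move=> gp kW re; apply: connected_continuous_connected; first exact: ball_connected.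
apply: continuous_in_subspaceT => v /set_mem bv; apply: (leaf_inv_continuous gp kW).
exact: le_ball bv.
Qed.

Lemma leaf_connected : connected [set: leaf_point k].
Proof.
have [x0 _] := leaf_pointE.
suff -> : [set: leaf_point k] = connected_component setT x0 by exact: component_connected.
apply/esym/seteqP; split => // y _.
have xy := ld_connected (leaf_valP x0) (leaf_valP y).
have [_] : ld_set k (leaf_val y) /\ forall y' : leaf_point k, leaf_val y' = leaf_val y -> connected_component setT x0 y'.
  apply: (xy (fun m => ld_set k m /\ forall y' : leaf_point k, leaf_val y' = m -> connected_component setT x0 y')).
    split; first exact: leaf_valP.
    by move=> y' /leaf_val_inj ->; exact: connected_component_refl.
  move=> a b [r [eps [tau [psi [v [v' [gp bv bv' <- <-]]]]]]] [kv Hv].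
  have e0 : 0 < eps by case: bv.
  have kW w : ball 0 eps w -> ld_set k (tau w) by move=> bw; exact: ld_ball gp bv bw kv.
  split; first exact: kW.
  move=> y' Ey'; apply: (connected_component_trans (Hv _ (leaf_invE kv))).
  exists (leaf_inv k tau @` ball 0 eps); last by exists v' => //; exact: leaf_inv_val.
  split => //.
  exact: leaf_ball_im gp kW (lexx _).
by apply.
Qed.

(** The pieces are the preimages of a countable basis of [M]. Their components are open in the leaf,
    and those of small pieces lie in a single plaque, where rational parameters are dense. *)
Lemma leaf_second_countable : @second_countable (leaf_point k).
Proof.
have [x0 _] := leaf_pointE.
have [B cB [oB bB]] := @m_countable R M; have /countable_injP[f finj] := cB.
pose b n := xget setT [set U | B U /\ f U = n].
have bE U : B U -> b (f U) = U.
  move=> BU; rewrite /b; case: xgetP => [V _ [BV E]|/(_ U) []//].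
  by apply: finj => //; apply/mem_set.
have ob n : open (b n).
  rewrite /b; case: xgetP => [V _ [BV _]|_]; [exact: oB|exact: openT].
pose A n := @leaf_val _ _ _ k @^-1` b n.
have oA n : open (A n) by apply: open_comp => // z _; exact: leaf_val_continuous.
have oC n x : open (connected_component (A n) x).
  rewrite openE => y Cy.
  have [eps [tau [psi [e0 lp E]]]] := leaf_ball_plaque y; have [gp kW] := lp.
  have inv0 : leaf_inv k tau 0 = y by exact: leaf_inv_val.
  have nA : nbhs y (A n) by apply: open_nbhs_nbhs; split => //; exact: connected_component_sub Cy.
  have := leaf_inv_continuous gp kW (ballxx 0 e0); rewrite /prop_for /continuous_at inv0 => /(_ _ nA).
  rewrite nbhs_simpl /= nbhs_ballP => -[rho /= r0 sub].
  pose s := Num.min rho eps; have s0 : 0 < s by rewrite lt_min r0.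
  have lps : leaf_plaque (k := k) (ball 0 s) tau psi.
    split; last by move=> v bv; apply: kW; apply: le_ball bv; rewrite ge_min lexx orbT.
    apply: good_restrict gp; first exact: ball_open.
    by apply: le_ball; rewrite ge_min lexx orbT.
  have [oc _ _ _ _] := leaf_chartP lps.
  have : nbhs y (chart_dom (leaf_chart (k := k) (ball 0 s) tau psi)).
    by apply: open_nbhs_nbhs; split => //; exists 0 => //; exact: ballxx.
  apply: filterS => z [v bv Ez]; apply: (connected_component_trans Cy).
  exists (leaf_inv k tau @` ball 0 s); last by exists v => //; exact: leaf_inv_val.
  split; [by exists 0 => //; exact: ballxx| |].
    by move=> _ [w bw <-]; apply: sub; apply: le_ball bw; rewrite ge_min lexx.
  by apply: (leaf_ball_im gp kW); rewrite ge_min lexx orbT.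
apply: (connected_second_countable (I := nat) (A := A) x0 leaf_connected oC) => x U nU.
have [eps [tau [psi [e0 lp E]]]] := leaf_ball_plaque x; have [gp kW] := lp.
have [[_ _ sp inv _] _] := gp.
have inv0 : leaf_inv k tau 0 = x by exact: leaf_inv_val.
have := leaf_inv_continuous gp kW (ballxx 0 e0); rewrite /prop_for /continuous_at inv0 => /(_ _ nU).
rewrite nbhs_simpl /= nbhs_ballP => -[rho /= r0 sub].
pose s := Num.min rho eps; have s0 : 0 < s by rewrite lt_min r0.
have se : ball (0 : 'rV[R]_(ld_dim k)) s `<=` ball 0 eps by apply: le_ball; rewrite ge_min lexx orbT.
have sr : ball (0 : 'rV[R]_(ld_dim k)) s `<=` ball 0 rho by apply: le_ball; rewrite ge_min lexx.
pose psiv (q : M) := \row_j psi j q.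
have cpsi q : {for q, continuous psiv} by exact: row_smooth_continuous.
have nO : nbhs (leaf_val x) (psiv @^-1` ball 0 s).
  apply: cpsi; rewrite -E /psiv inv//; last exact: ballxx.
  by apply: nbhsx_ballx.
have [V [BV Vx] VO] := bB (leaf_val x) _ nO.
pose C := connected_component (A (f V)) x.
have AE : A (f V) = @leaf_val _ _ _ k @^-1` V by rewrite /A bE.
have Ax : A (f V) x by rewrite AE.
have CO y : C y -> ball 0 s (psiv (leaf_val y)).
  by move=> /connected_component_sub; rewrite AE => /VO.
have lps : leaf_plaque (k := k) (ball 0 s) tau psi.
  by split; [apply: good_restrict gp => //; exact: ball_open|move=> v /se; exact: kW].
pose S := chart_dom (leaf_chart (k := k) (ball 0 s) tau psi).
have [oS _ _ _ _] := leaf_chartP lps.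
(* Within the piece, the plaque is open in the leaf and also relatively closed, as it is cut out by
   the equation [y = tau (psi y)]; a connected component that meets it lies in it. *)
have CS : C `<=` S.
  suff -> : C = C `&` S by move=> y [].
  apply/esym; apply: (component_connected (A := A (f V)) (x := x)).
  - exists x; split; first exact: connected_component_refl.
    by exists 0 => //; exact: ballxx.
  - by exists S.
  exists (~` [set y | ball 0 s (psiv (leaf_val y)) /\ leaf_val y <> tau (psiv (leaf_val y))]).
    apply: open_closedC; rewrite openE => y [by_ ny].
    have cy : {for y, continuous (psiv \o @leaf_val _ _ _ k)}.
      by apply: continuous_comp; [exact: leaf_val_continuous|exact: cpsi].
    have ct : {for y, continuous (tau \o (psiv \o @leaf_val _ _ _ k))}.
      by apply: continuous_comp; [exact: cy|exact: (plaque_continuous gp.1 (se _ by_))].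
    have nyb : leaf_val y != tau (psiv (leaf_val y)) by apply/eqP.
    have := @m_hausdorff R M; rewrite open_hausdorff => /(_ _ _ nyb)[[P Q] [/= Px Qy] [oP oQ PQ]].
    have n1 : nbhs y (@leaf_val _ _ _ k @^-1` P).
      by apply: leaf_val_continuous; apply: open_nbhs_nbhs; split => //; exact: set_mem.
    have n2 : nbhs y ((tau \o (psiv \o @leaf_val _ _ _ k)) @^-1` Q).
      by apply: ct; apply: open_nbhs_nbhs; split => //; exact: set_mem.
    have n3 : nbhs y ((psiv \o @leaf_val _ _ _ k) @^-1` ball 0 s).
      by apply: cy; apply: open_nbhs_nbhs; split => //; exact: ball_open.
    apply: filterS (filterI n1 (filterI n2 n3)) => z [Pz [Qz bz]]; split => // Ez.
    have : (P `&` Q) (leaf_val z) by split => //; rewrite Ez.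
    by rewrite (eqP PQ).
  apply/seteqP; split => y [Cy h]; split => //.
    move: h => [v bv Ev] [_]; apply; rewrite Ev /psiv inv//; exact: se.
  exists (psiv (leaf_val y)); first exact: CO.
  by apply: contrapT => h'; apply: h; split => //; exact: CO.
exists (f V); split => //.
  by move=> y /CS [v bv Ev]; rewrite -(leaf_inv_val Ev); apply: sub; exact: sr.
exists (fun i => leaf_inv k tau (rational_vector R _ i)) => O oO [y [Oy Cy]].
have [v bv Ev] := CS y Cy.
have : nbhs (leaf_inv k tau v) (O `&` C).
  by rewrite (leaf_inv_val Ev); apply: open_nbhs_nbhs; split; first exact: openI oO (oC _ _).
move=> /(leaf_inv_continuous gp kW (se _ bv)); rewrite nbhs_simpl /=.
exact: rational_vector_dense.
Qed.

End LeafManifold.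

Section FoliationOfPlaques.
Variables (R : realType) (M : manifold R) (D : forall m : M, set (tangent m)).

Definition leaf_manifold (k : leaf_data D) : manifold R :=
  @Manifold R (leaf_point k) (ld_dim k) (@leaf_atlas _ _ _ k) (@leaf_hausdorff _ _ _ k)
    (@leaf_second_countable _ _ _ k)
    (fun c (ac : leaf_atlas c) => let: ex_intro W (ex_intro tau (ex_intro psi (conj lp E))) := ac in
       ecast c (is_chart c) (esym E) (leaf_chartP lp))
    (@leaf_cover _ _ _ k) (@leaf_compatible _ _ _ k).

Definition leaf_incl (k : leaf_data D) (x : leaf_manifold k) : M := leaf_val (x : leaf_point k).

Lemma leaf_incl_inj k : injective (@leaf_incl k).
Proof. exact: leaf_val_inj. Qed.

Lemma leaf_incl_smooth k : smooth_map (@leaf_incl k).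
Proof.
apply/smooth_mapP => f sf c [W [tau [psi [lp ->]]]] l; rewrite (leaf_chart_im lp).
have [[[oW Ct _ _ _] _] kW] := lp.
apply: (@Ck_eq _ _ l W (f \o tau)) => //; last exact: Ct.
by move=> v Wv; rewrite /= /leaf_incl leaf_invE//; exact: kW.
Qed.

Lemma leaf_tangent k (x : leaf_manifold k) : exists (r : nat) (tau : 'rV[R]_r -> M) (T : 'rV[R]_r -> tangent x),
  [/\ forall v, exists a, v = T a, forall a f, smooth_fun f -> T a (f \o @leaf_incl k) = dird (f \o tau) 0 a,
      forall w, D w <-> exists a : 'rV[R]_r, forall f : M -> R, smooth_fun f -> (w : tangent (leaf_incl x)) f = dird (f \o tau) 0 a
    & forall a b, (forall f, smooth_fun f -> dird (f \o tau) 0 a = dird (f \o tau) 0 b) -> a = b].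
Proof.
have [eps [tau [psi [e0 lp E]]]] := leaf_ball_plaque (x : leaf_point k); have [[pl cap] kW] := lp.
have [oW Ct sp inv Dt] := pl.
have b0 : ball (0 : 'rV[R]_(ld_dim k)) eps 0 by exact: ballxx.
pose c : chart R (mdim (leaf_manifold k)) (leaf_manifold k) := leaf_chart (ball 0 eps) tau psi.
have ac : atlas c by exists (ball 0 eps), tau, psi.
have dx : chart_dom c x by exists 0.
have cx : chart_map c x = 0 by rewrite /c /= -E inv.
exists (ld_dim k), tau, (fun a => tvec c x a); split.
- by move=> v; exists (tcoord c v); rewrite (tcoordK ac dx).
- move=> a f sf; rewrite tvecE//; last by apply/(smooth_mapP _).1 => //; exact: leaf_incl_smooth.
  rewrite /dchart cx -/(dird _ _ _); apply: (dird_eq oW _ _ b0) => v bv.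
  by rewrite /= /leaf_incl leaf_invE//; exact: kW.
- by move=> w; exact: (plaque_D w pl b0 E).
- move=> a b H; apply/rowP => j; rewrite -(plaque_coord a j pl b0) -(plaque_coord b j pl b0).
  exact: H.
Qed.

Lemma leaf_incl_immersion k : immersion (@leaf_incl k).
Proof.
split=> [|x]; first exact: leaf_incl_smooth.
have [r [tau [T [surj HT _ inj]]]] := leaf_tangent x.
move=> v w; have [a ->] := surj v; have [b ->] := surj w => Eab; congr T; apply: inj => f sf.
rewrite -!HT// -!(dmapE _ (@leaf_incl_smooth k))//; by rewrite Eab.
Qed.

Lemma leaf_incl_tangent k (x : leaf_manifold k) : range (@dmap _ _ _ (@leaf_incl k) x) = @D (leaf_incl x).
Proof.
have [r [tau [T [surj HT HD inj]]]] := leaf_tangent x.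
apply/seteqP; split => [_ [v _ <-]|w /HD[a Ha]].
  have [a ->] := surj v; apply/HD; exists a => f sf.
  by rewrite dmapE ?HT//; exact: leaf_incl_smooth.
exists (T a) => //; apply: tangent_ext => f sf; rewrite dmapE//; last exact: leaf_incl_smooth.
by rewrite HT// Ha.
Qed.

Hypothesis H : forall p, exists r (eps : R) (tau : 'rV[R]_r -> M) psi,
  [/\ 0 < eps, good_plaque D (ball 0 eps) tau psi & tau 0 = p].

(** Induction along a chain shows that plaques at all points of the class have the dimension found
    at [m], each link being compared with the plaques at its two ends. Two leaves through [m] have
    equal sets and dimensions, and the remaining fields are propositions. *)
Lemma leaf_partition m : exists! k : leaf_data D, range (@leaf_incl k) m.
Proof.
have [d [eps [tau [psi [e0 gp E]]]]] := H m.
have HP m' : linked D m m' -> exists (eps : R) (tau : 'rV[R]_d -> M) psi,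
    [/\ 0 < eps, good_plaque D (ball 0 eps) tau psi & tau 0 = m'].
  move/(_ (fun y => exists (eps : R) (tau : 'rV[R]_d -> M) psi,
    [/\ 0 < eps, good_plaque D (ball 0 eps) tau psi & tau 0 = y])); apply; first by exists eps, tau, psi.
  move=> x y [r [e1 [t1 [p1 [v [v' [gp1 bv bv' Ev Ev']]]]]]] [e2 [t2 [p2 [e20 gp2 E2]]]].
  have [r3 [e3 [t3 [p3 [e30 gp3 E3]]]]] := H y.
  have Ed : r = d := plaque_dim gp1.1 gp2.1 bv (ballxx _ e20) (etrans Ev (esym E2)).
  have Er : r3 = d.
    by rewrite -Ed; exact: plaque_dim gp3.1 gp1.1 (ballxx _ e30) bv' (etrans E3 (esym Ev')).
  by subst d; move: t3 p3 gp3 E3; rewrite Er => t3 p3 gp3 E3; exists e3, t3, p3.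
pose k := @LeafData R M D [set m' | linked D m m'] d
  (ex_intro2 _ _ m (@linked_refl _ _ D m) erefl) HP.
have km : ld_set k m by exact: linked_refl.
exists k; split=> [|k' [x _ Ex]]; first by exists (LeafPoint km : leaf_manifold k).
have k'm : ld_set k' m by rewrite -Ex; exact: leaf_valP.
have Es : ld_set k = ld_set k'.
  apply/seteqP; split => m' h'; first exact: (ld_linked k'm).
  exact: ld_connected k'm h'.
have Ed : ld_dim k = ld_dim k'.
  have [e2 [t2 [p2 [e20 gp2 E2]]]] := ld_plaque k'm.
  exact: (plaque_dim gp.1 gp2.1 (ballxx _ e0) (ballxx _ e20) (etrans E (esym E2))).
clearbody k; move: k k' km k'm x Ex Es Ed => [s1 d1 c1 p1] [s2 d2 c2 p2] /= _ _ _ _ Es Ed.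
subst s2 d2; congr LeafData; exact: Prop_irrelevance.
Qed.

Theorem foliation_of_plaques : exists Fol : foliation M, integrates Fol D.
Proof.
have ne (k : leaf_data D) : [set: leaf_manifold k] !=set0.
  by have [x _] := leaf_pointE k; exists x.
exists (@Foliation R M (leaf_data D) leaf_manifold leaf_incl ne (@leaf_connected _ _ _) leaf_incl_inj
  leaf_incl_immersion leaf_partition) => k x.
exact: leaf_incl_tangent.
Qed.

End FoliationOfPlaques.

(** * The distribution of a quasi-hamiltonian space *)

Section BivectorFacts.
Variables (R : realType) (M : manifold R).

Lemma bivector_smooth_field (P : bifield M) f : is_bivector P -> smooth_fun f ->
  smooth_field (fun q => sharp P (dfun q f)).
Proof.
move=> [bP _ sP] sf g sg; rewrite (_ : (fun q => _) = poisson_bracket P g f); first exact: sP.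
by apply/funext => q; rewrite -dfunE sharpE.
Qed.

Lemma sharp_linear (P : bifield M) m k (a b : cotangent m) : bilinear_form (P m) ->
  sharp P (k *: a + b) = k *: sharp P a + sharp P b.
Proof.
move=> bP; apply: cotangent_separates => c; rewrite dual_linear !sharpE//.
exact: bP.2.
Qed.

Lemma pullback_linear (V W : lmodType R) (f : V -> W) k (a b : dual W) :
  (forall k u v, f (k *: u + v) = k *: f u + f v) ->
  pullback f (k *: a + b) = k *: pullback f a + pullback f b.
Proof.
by move=> fl; apply: dual_ext => v; rewrite dual_addE dual_scaleE !pullbackE// dual_addE dual_scaleE.
Qed.

End BivectorFacts.

Section QuasiPoisson.
Variables (R : realType) (n : nat) (DG : groupPair R n).
Local Notation D := (gpD DG).
Local Notation G := (gpG DG).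
Local Notation B := (@gp_metric R n DG (lg_one D)).
Local Notation i := (@gp_alg_incl R n DG).
Variables (M : manifold R) (act : G -> M -> M) (h : set (lie D)) (P : bifield M).
Local Notation fd x m := (fundamental act x m).
Local Notation pb m := (pullback (fun x => fundamental act x m)).
Local Notation mp := (gp_manin DG).

Section Change.
Hypotheses (Hact : is_action act) (bP : is_bivector P).
Variable h' : set (lie D).
Hypotheses (Hh : isotropic_complement B i h) (Hh' : isotropic_complement B i h').
Local Notation P' := (change_complement act h h' P).
Local Notation tw := (twist_map B i h h').

Lemma pullback_fundE m (a : cotangent m) x : pb m a x = a (fd x m).
Proof. by rewrite pullbackE// => k u v; exact: fundamental_linear. Qed.

Lemma change_complementE m (a b : cotangent m) : P' a b = P a b - b (fd (tw (pb m a)) m).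
Proof. by rewrite /change_complement /push2 /twist pullback_fundE. Qed.

Lemma change_complement_bilinear m : bilinear_form (@change_complement R n DG M act h h' P m).
Proof.
have [b1 _ _] := bP; have [bl br] := b1 m.
have lin4 (k a b c e : R) : k * a + b - (k * c + e) = k * (a - c) + (b - e) by ring.
split=> k u v w; rewrite !change_complementE ?bl ?br.
  rewrite pullback_linear; last by move=> *; exact: fundamental_linear.
  rewrite (twist_map_linear mp Hh Hh').
  rewrite (fundamental_linear Hact).
  rewrite dual_linear.
  exact: lin4.
rewrite dual_addE dual_scaleE.
exact: lin4.
Qed.

Lemma change_complement_skew m (a b : cotangent m) : P' a b = - P' b a.
Proof.
have [_ sk _] := bP; rewrite !change_complementE sk opprB -!pullback_fundE (twist_skew mp Hh Hh').
by rewrite opprK addrC.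
Qed.

Lemma sharp_changeE m (a : cotangent m) : sharp P' a = sharp P a + fd (tw (pb m a)) m.
Proof.
have [b1 _ _] := bP.
apply: cotangent_separates => b; rewrite dualD !sharpE//; last exact: change_complement_bilinear.
by rewrite change_complementE -!pullback_fundE (twist_skew mp Hh Hh') opprK.
Qed.

End Change.

(** Defined from the global bivector of [h] and the fundamental fields alone, so that finitely many
    smooth generators exist near any point. *)
Definition sum_distribution (m : M) : set (tangent m) :=
  [set v | exists a x, v = sharp P a + fd x m].
Arguments sum_distribution : clear implicits.

(** A twist changes the image of a covector by a fundamental vector; once these vectors lie in the
    image of the changed bivector, the correction can be absorbed. *)
Lemma range_sharp_change (h' : set (lie D)) m : is_action act -> is_bivector P ->
  isotropic_complement B i h -> isotropic_complement B i h' ->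
  (forall x, range (@sharp _ _ (change_complement act h h' P) m) (fd x m)) ->
  range (@sharp _ _ (change_complement act h h' P) m) = sum_distribution m.
Proof.
move=> Hact bP Hh Hh' Hx; apply/seteqP; split => [_ [a _ <-]|_ [a [x ->]]].
  by rewrite sharp_changeE//; exists a, (twist_map B i h h' (pb m a)).
have [b _ Eb] := Hx (x - twist_map B i h h' (pb m a)).
exists (1 *: b + a) => //; rewrite sharp_linear; last exact: change_complement_bilinear.
rewrite Eb sharp_changeE// scale1r addrC -addrA; congr (_ + _).
have E u v : fd (u + v) m = fd u m + fd v m by have := fundamental_linear Hact m 1 u v; rewrite !scale1r.
by rewrite -E addrC subrK.
Qed.

Section Moment.
Variables (S : homogeneousSpace DG) (mu : M -> S).
Hypotheses (Hh : isotropic_complement B i h) (qh : quasi_hamiltonian act h P mu).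

(** The moment condition is imposed on open sets; [admissible_near] provides one around any
    admissible point, which yields a pointwise form. *)
Lemma moment_map_at (h' : set (lie D)) m x : isotropic_complement B i h' -> admissible_at h' (mu m) ->
  sharp (change_complement act h h' P) (pullback (@dmap _ _ _ mu m) (hat h' x (mu m))) = fd x m.
Proof.
move=> Hh' adm; have [_ [smu _ Hmu]] := qh.
pose Omega := interior [set q | admissible_at h' (mu q)].
have Om : Omega m.
  have := admissible_near Hh' adm; exact: (smooth_map_cont (p := m) smu).
exact: (Hmu Omega h' (open_interior _) Hh' (fun q hq => interior_subset hq) x m Om).
Qed.

Lemma range_sharp_sum (h' : set (lie D)) m : isotropic_complement B i h' -> admissible_at h' (mu m) ->
  range (@sharp _ _ (change_complement act h h' P) m) = sum_distribution m.
Proof.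
move=> Hh' adm; have [[Hact bP _ _] _] := qh.
by apply: range_sharp_change => // x; rewrite -(moment_map_at x Hh' adm); eexists.
Qed.

Lemma image_distributionE m : @image_distribution R n DG S M act h P mu m = sum_distribution m.
Proof.
have [h' [Hh' adm]] := admissible_exists (mu m) Hh.
apply/seteqP; split=> [v [h1 [Hh1 adm1 h1v]]|v].
  by rewrite -(range_sharp_sum Hh1 adm1).
by rewrite -(range_sharp_sum Hh' adm) => hv; exists h'.
Qed.

End Moment.

End QuasiPoisson.

Section SpanNear.
Variables (R : realType) (M : manifold R) (p : M) (I : finType) (Z : I -> forall q : M, tangent q).

(** Locally generated modules: coefficients are globally smooth but the identity holds near [p]
    only. The elements are operators on functions, because a bracket is not given as a field of
    tangent vectors. *)
Definition span_near (V : M -> (M -> R) -> R) : Prop :=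
  exists2 c : I -> M -> R, forall a, smooth_fun (c a) &
    \forall q \near p, forall k, smooth_fun k -> V q k = \sum_a c a q * Z a q k.

Lemma span_near_eq V W : (\forall q \near p, forall k, smooth_fun k -> W q k = V q k) -> span_near V -> span_near W.
Proof.
move=> E [c sc H]; exists c => //; apply: filterS (filterI E H) => q [e1 e2] k sk.
by rewrite e1 ?e2.
Qed.

Lemma span_near_base a : span_near (fun q k => Z a q k).
Proof.
exists (fun b => cst (b == a)%:R); first by move=> b; exact: smooth_fun_cst.
apply: nearW => q k sk; rewrite (bigD1 a)//= eqxx mul1r big1 ?addr0// => b /negbTE ->.
by rewrite mul0r.
Qed.

Lemma span_near_add V W : span_near V -> span_near W -> span_near (fun q k => V q k + W q k).
Proof.
move=> [c sc H1] [c' sc' H2]; exists (fun a q => c a q + c' a q).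
  by move=> a; exact: smooth_fun_add.
apply: filterS (filterI H1 H2) => q [e1 e2] k sk; rewrite e1// e2// -big_split /=.
by apply: eq_bigr => a _; rewrite mulrDl.
Qed.

Lemma span_near_mul V c : smooth_fun c -> span_near V -> span_near (fun q k => c q * V q k).
Proof.
move=> sc [b sb H]; exists (fun a q => c q * b a q); first by move=> a; exact: smooth_fun_mul.
apply: filterS H => q e k sk; rewrite e// mulr_sumr.
by apply: eq_bigr => a _; rewrite mulrA.
Qed.

Lemma span_near_sum (J : Type) (r : seq J) (V : J -> M -> (M -> R) -> R) :
  (forall j, span_near (V j)) -> span_near (fun q k => \sum_(j <- r) V j q k).
Proof.
move=> H; elim: r => [|j r IH].
  exists (fun _ => cst 0); first by move=> a; exact: smooth_fun_cst.
  by apply: nearW => q k sk; rewrite big_nil big1// => a _; rewrite mul0r.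
apply: span_near_eq (span_near_add (H j) IH); apply: nearW => q k sk.
by rewrite big_cons.
Qed.

Lemma local_plaque_span (D : forall m : M, set (tangent m)) : (forall a, smooth_field (Z a)) ->
  (forall a b, span_near (fun q f => Z a q (fun q' => Z b q' f) - Z b q (fun q' => Z a q' f))) ->
  (\forall q \near p, forall w, D q w <-> exists lam : I -> R, w = \sum_a lam a *: Z a q) ->
  exists r (eps : R) (tau : 'rV[R]_r -> M) psi, [/\ 0 < eps, good_plaque D (ball 0 eps) tau psi & tau 0 = p].
Proof.
move=> sZ brZ DZ; pose N := #|I|; pose Y (a : 'I_N) := Z (enum_val a).
have /choice[C HC] : forall ab : I * I, exists C : I -> M -> R, (forall c, smooth_fun (C c)) /\
    \forall q \near p, forall f, smooth_fun f ->
      Z ab.1 q (fun q' => Z ab.2 q' f) - Z ab.2 q (fun q' => Z ab.1 q' f) = \sum_c C c q * Z c q f.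
  by move=> [a b]; have [c sc Hc] := brZ a b; exists c.
have sumE (F : I -> R) : \sum_(c < N) F (enum_val c) = \sum_c F c.
  by rewrite (reindex (@enum_val I predT)) //=; apply: onW_bij; exact: enum_val_bij.
have sumE' (q : M) (F : I -> tangent q) : \sum_(c < N) F (enum_val c) = \sum_c F c.
  by rewrite (reindex (@enum_val I predT)) //=; apply: onW_bij; exact: enum_val_bij.
apply: (local_plaque (N := N) (Y := Y) (C := fun a b c => C (enum_val a, enum_val b) (enum_val c))).
- by move=> a; exact: sZ.
- by move=> a b c; exact: (HC _).1.
- have H : \forall q \near p, forall ab : I * I, forall f, smooth_fun f ->
      Z ab.1 q (fun q' => Z ab.2 q' f) - Z ab.2 q (fun q' => Z ab.1 q' f) = \sum_c C ab c q * Z c q f.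
    by apply: filter_forall => ab; exact: (HC ab).2.
  apply: filterS H => q H a b f sf; rewrite [LHS](H (enum_val a, enum_val b) f sf).
  exact/esym/(sumE (fun c => C (enum_val a, enum_val b) c q * Z c q f)).
- apply: filterS DZ => q H w; rewrite H; split=> [[lam ->]|[lam ->]].
    by exists (fun a => lam (enum_val a)); rewrite (sumE' q (fun a => lam a *: Z a q)).
  exists (fun a => lam (enum_rank a)); rewrite -sumE'; apply: eq_bigr => a _.
  by rewrite enum_valK.
Qed.

End SpanNear.

Section ManinBracket.
Variables (R : realType) (d g : lmodType R) (br : d -> d -> d) (B : d -> d -> R) (i : g -> d) (n : nat).
Hypothesis mp : manin_pair br B i n.

Lemma form_ext u v : (forall w, B u w = B v w) -> u = v.
Proof.
move=> E; apply/eqP; rewrite -subr_eq0; apply/eqP; apply: (mp_nondegenerate mp) => w.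
by rewrite (formB mp) E subrr.
Qed.

Lemma form_linearr k u v w : B w (k *: u + v) = k * B w u + B w v.
Proof. by have [_ ->] := mp_bilinear mp. Qed.

Lemma bracket_linearl k x x' y : br (k *: x + x') y = k *: br x y + br x' y.
Proof.
by apply: form_ext => z; rewrite (mp_invariant mp) !(formD mp) !(formZ mp) !(mp_invariant mp).
Qed.

Lemma bracket_linearr k x y y' : br x (k *: y + y') = k *: br x y + br x y'.
Proof.
apply: form_ext => z.
by rewrite (mp_invariant mp) bracket_linearl form_linearr (formD mp) (formZ mp) !(mp_invariant mp).
Qed.

Variable h : set d.
Hypothesis Hh : isotropic_complement B i h.
Local Notation j := (j_iso B i h).

Lemma cobracketE x (xi eta : dual g) : F_ br B i h x xi eta = B (br (j xi) (j eta)) (i x).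
Proof.
rewrite /F_ /j_inv mkdualE => [|k u v]; last by rewrite (mp_linear mp) form_linearr.
by rewrite /proj_h (formB mp) [X in _ - X](mp_isotropic mp) ?subr0.
Qed.

Variables (N : nat) (e : 'I_N -> g) (eps : 'I_N -> dual g).
Hypothesis basis : forall x, x = \sum_k eps k x *: e k.

Lemma dual_basis_sum (xi : dual g) : xi = \sum_k xi (e k) *: eps k.
Proof.
apply: dual_ext => x; rewrite dual_sumE {1}(basis x) dual_sum.
by apply: eq_bigr => k _; rewrite dualZ dual_scaleE mulrC.
Qed.

Lemma bilinear_expand (W : lmodType R) (T : dual g -> dual g -> W) (xi eta : dual g) :
  (forall k a b c, T (k *: a + b) c = k *: T a c + T b c) ->
  (forall k a b c, T c (k *: a + b) = k *: T c a + T c b) ->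
  T xi eta = \sum_k \sum_l (xi (e k) * eta (e l)) *: T (eps k) (eps l).
Proof.
move=> Tl Tr.
have sl (F : 'I_N -> dual g) (x : 'I_N -> R) c (r : seq 'I_N) : T (\sum_(k <- r) x k *: F k) c = \sum_(k <- r) x k *: T (F k) c.
  elim: r => [|k r IH]; last by rewrite !big_cons Tl IH.
  rewrite !big_nil; have := Tl (-1) 0 0 c; by rewrite scaleN1r oppr0 addr0 scaleN1r addNr.
have sr (F : 'I_N -> dual g) (x : 'I_N -> R) c (r : seq 'I_N) : T c (\sum_(k <- r) x k *: F k) = \sum_(k <- r) x k *: T c (F k).
  elim: r => [|k r IH]; last by rewrite !big_cons Tr IH.
  rewrite !big_nil; have := Tr (-1) 0 0 c; by rewrite scaleN1r oppr0 addr0 scaleN1r addNr.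
rewrite {1}(dual_basis_sum xi) sl; apply: eq_bigr => k _.
rewrite {1}(dual_basis_sum eta) sr scaler_sumr; apply: eq_bigr => l _.
by rewrite scalerA.
Qed.

Lemma cobracket_expand x (xi eta : dual g) :
  F_ br B i h x xi eta = \sum_k \sum_l (xi (e k) * eta (e l)) * F_ br B i h x (eps k) (eps l).
Proof.
have H := @bilinear_expand R^o (fun a b => F_ br B i h x a b) xi eta.
apply: H => k a b c; rewrite !cobracketE (j_iso_linear mp Hh).
  by rewrite bracket_linearl (formD mp) (formZ mp).
by rewrite bracket_linearr (formD mp) (formZ mp).
Qed.

Lemma proj_bracket_expand (xi eta : dual g) : proj_g i h (br (j xi) (j eta)) =
  \sum_k \sum_l (xi (e k) * eta (e l)) *: proj_g i h (br (j (eps k)) (j (eps l))).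
Proof.
apply: (bilinear_expand (T := fun a b => proj_g i h (br (j a) (j b)))) => k a b c; rewrite (j_iso_linear mp Hh).
  by rewrite bracket_linearl (proj_g_linear mp Hh).
by rewrite bracket_linearr (proj_g_linear mp Hh).
Qed.

End ManinBracket.

Section FundamentalSum.
Variables (R : realType) (G : lieGroup R) (M : manifold R) (act : G -> M -> M).
Hypothesis Hact : is_action act.
Local Notation fd x m := (fundamental act x m).

Lemma fundamental_sum_id m N (e : 'I_N -> lie G) : fd (\sum_k e k) m = \sum_k fd (e k) m.
Proof.
elim: (index_enum _) => [|k r IH].
  rewrite !big_nil; have := fundamental_linear Hact m (-1) 0 0.
  by rewrite scaleN1r oppr0 addr0 scaleN1r addNr.
by rewrite !big_cons -IH -[e k]scale1r fundamental_linear// !scale1r.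
Qed.

Lemma fundamental_sum m N (e : 'I_N -> lie G) (c : 'I_N -> R) :
  fd (\sum_k c k *: e k) m = \sum_k c k *: fd (e k) m.
Proof.
rewrite fundamental_sum_id; apply: eq_bigr => k _.
have := fundamental_linear Hact m (c k) (e k) 0; have := fundamental_linear Hact m (-1) 0 0.
by rewrite scaleN1r oppr0 addr0 scaleN1r addNr => -> ; rewrite !addr0.
Qed.

End FundamentalSum.

(** * Involutivity from the quasi-Poisson identities *)

Section Involutive.
Variables (R : realType) (n : nat) (DG : groupPair R n).
Local Notation D := (gpD DG).
Local Notation G := (gpG DG).
Local Notation B := (@gp_metric R n DG (lg_one D)).
Local Notation br := (@lie_bracket R D).
Local Notation i := (@gp_alg_incl R n DG).
Variables (M : manifold R) (act : G -> M -> M) (h : set (lie D)) (P : bifield M).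
Local Notation fd x m := (fundamental act x m).
Local Notation pb m := (pullback (fun x => fundamental act x m)).
Local Notation mp := (gp_manin DG).
Hypotheses (Hh : isotropic_complement B i h) (qp : quasi_poisson act h P).

Let Hact : is_action act. Proof. by have [] := qp. Qed.
Let bP : is_bivector P. Proof. by have [] := qp. Qed.
Let bil m : bilinear_form (@P m). Proof. by have [] := bP. Qed.

Lemma lie_basis : exists (e : 'I_(mdim G) -> lie G) (eps : 'I_(mdim G) -> dual (lie G)),
  forall x, x = \sum_k eps k x *: e k.
Proof.
have [c ac dp] := m_cover (lg_one G).
exists (fun k => tvec c (lg_one G) (delta_mx 0 k)), (fun k => dfun (lg_one G) (coord_ext c (lg_one G) k)) => x.
by rewrite {1}(tangent_basis ac dp x); apply: eq_bigr => k _; rewrite dfunE.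
Qed.

Lemma hamiltonianE q u f : smooth_fun f -> sharp P (dfun q u) f = poisson_bracket P f u q.
Proof. by move=> sf; rewrite -dfunE sharpE. Qed.

Lemma hamiltonianNE q u f : smooth_fun f -> sharp P (dfun q u) f = - poisson_bracket P u f q.
Proof. by move=> sf; rewrite hamiltonianE// /poisson_bracket; have [_ -> _] := bP. Qed.

(** The identity for [P, P]/2, with [u] as the free argument: the third slot of phi is linear in du,
    so its contribution is a fundamental field. The convention for [sharp] makes the Hamiltonian
    field of [g] send [u] to {u, g}, whence the signs. *)
Lemma hamiltonian_bracket q f g u : smooth_fun f -> smooth_fun g -> smooth_fun u ->
  sharp P (dfun q f) (fun q' => sharp P (dfun q' g) u) - sharp P (dfun q g) (fun q' => sharp P (dfun q' f) u)
  = fd (proj_g i h (br (j_iso B i h (pb q (dfun q f))) (j_iso B i h (pb q (dfun q g))))) q u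
    - sharp P (dfun q (poisson_bracket P f g)) u.
Proof.
move=> sf sg su; have [_ _ sP] := bP; have [_ _ Hs _] := qp.
have := Hs f g u q sf sg su.
rewrite /half_schouten /push3 /phi_ (pullback_fundE Hact) dfunE => E.
rewrite (_ : (fun q' => sharp P (dfun q' g) u) = fun q' => - poisson_bracket P g u q'); last first.
  by apply/funext => q'; rewrite hamiltonianNE.
rewrite (_ : (fun q' => sharp P (dfun q' f) u) = poisson_bracket P u f); last first.
  by apply/funext => q'; rewrite hamiltonianE.
rewrite tan_opp; last exact: sP.
rewrite (hamiltonianE q (poisson_bracket P f g) su) !hamiltonianNE; try exact: sP; try by [].
rewrite -E; ring.
Qed.

(** The invariance identity with one free argument; the cobracket of [x] gives again a combination
    of fundamental fields. *)
Lemma fundamental_hamiltonian_bracket q x g u : smooth_fun g -> smooth_fun u ->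
  fd x q (fun q' => sharp P (dfun q' g) u) - sharp P (dfun q g) (fun q' => fd x q' u)
  = sharp P (dfun q (fun q' => fd x q' g)) u - F_ br B i h x (pb q (dfun q u)) (pb q (dfun q g)).
Proof.
move=> sg su; have [_ _ sP] := bP; have [_ _ _ Hl] := qp.
have := Hl x u g q su sg; rewrite /lie_derivative /push2 => E.
rewrite (_ : (fun q' => sharp P (dfun q' g) u) = poisson_bracket P u g); last first.
  by apply/funext => q'; rewrite hamiltonianE.
rewrite !hamiltonianE//; last exact: fundamental_smooth.
rewrite -E; ring.
Qed.

(** The generators are the Hamiltonian fields of local coordinates and the fundamental fields of a
    basis of g. Their brackets involve phi and F through constants multiplied by derivatives of
    coordinates along fundamental fields, which are smooth, and Hamiltonian fields of other
    functions, which [Zham] expands. *)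
Lemma sum_distribution_plaque p : exists r (eps : R) (tau : 'rV[R]_r -> M) psi,
  [/\ 0 < eps, good_plaque (sum_distribution act P) (ball 0 eps) tau psi & tau 0 = p].
Proof.
have [_ _ sP] := bP.
have [c [x [ac dp sx nx]]] := chart_coordinates p.
have [e [eps basis]] := lie_basis.
pose Z (a : 'I_(mdim M) + 'I_(mdim G)) (q : M) : tangent q :=
  match a with inl j => sharp P (dfun q (x j)) | inr k => fd (e k) q end.
pose pd u j q := partial j (u \o chart_inv c) (chart_map c q).
have dE : \forall q \near p, forall u, smooth_fun u -> dfun q u = \sum_j pd u j q *: dfun q (x j).
  apply: filterS nx => q [_ _ H] u su; apply: dual_ext => w.
  rewrite dual_sumE dfunE H// /dird /dotp; apply: eq_bigr => j _.
  by rewrite dual_scaleE dfunE mxE mulrC.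
have hamE : \forall q \near p, forall u, smooth_fun u -> sharp P (dfun q u) = \sum_j pd u j q *: sharp P (dfun q (x j)).
  apply: filterS dE => q H u su; rewrite H//; elim: (index_enum _) => [|j r IH]; last first.
    by rewrite !big_cons sharp_linear// IH.
  by rewrite !big_nil; apply: cotangent_separates => b; rewrite sharpE// dual0 bilin0r.
have Zinl j : span_near p Z (fun q u => sharp P (dfun q (x j)) u) := span_near_base p Z (inl j).
have Zinr k : span_near p Z (fun q u => fd (e k) q u) := span_near_base p Z (inr k).
have Zfd y : span_near p Z (fun q u => fd y q u).
  apply: (@span_near_eq _ _ _ _ _ (fun q u => \sum_k eps k y * fd (e k) q u)).
    apply: nearW => q u su; rewrite {1}(basis y) (fundamental_sum Hact) tangent_sumE.
    by apply: eq_bigr => k _; rewrite tangent_scaleE.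
  by apply: span_near_sum => k; apply: (span_near_mul (c := cst (eps k y))) => //; exact: smooth_fun_cst.
have Zham u : smooth_fun u -> span_near p Z (fun q f => sharp P (dfun q u) f).
  (* Partials of [u] in the chart are smooth near [p] only and are replaced by global functions, as
     [span_near] demands. *)
  move=> su; have /choice[b Hb] : forall j, exists b, smooth_fun b /\ \forall q \near p, b q = pd u j q.
    move=> j; have [d0 d00 sub] := chart_ball ac dp (filterT : nbhs p setT).
    have Cu : Cinf (chart_im c) (partial j (u \o chart_inv c)).
      by move=> k; have [_ /(_ j)[]] := su c ac k.+1.
    have [b sb Eb] : exists2 b, smooth_fun b & \forall q \near p, b q = pd u j q.
      apply: smooth_global; apply: (smooth_at_chart ac dp d00) => k.
      by apply: Ck_subset (Cu k) => y /sub[].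
    by exists b.
  apply: (@span_near_eq _ _ _ _ _ (fun q f => \sum_j b j q * sharp P (dfun q (x j)) f)).
    have nb : \forall q \near p, forall j, b j q = pd u j q by apply: filter_forall => j; exact: (Hb j).2.
    apply: filterS (filterI nb hamE) => q [e1 e2] f sf; rewrite e2// tangent_sumE.
    by apply: eq_bigr => j _; rewrite tangent_scaleE e1.
  by apply: span_near_sum => j; apply: span_near_mul => //; exact: (Hb j).1.
have Zmix k j : span_near p Z (fun q u => fd (e k) q (fun q' => sharp P (dfun q' (x j)) u)
                                 - sharp P (dfun q (x j)) (fun q' => fd (e k) q' u)).
  apply: (@span_near_eq _ _ _ _ _ (fun q u => sharp P (dfun q (fun q' => fd (e k) q' (x j))) u +
     \sum_a \sum_b (fd (e b) q (x j) * - F_ br B i h (e k) (eps a) (eps b)) * fd (e a) q u)).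
    apply: nearW => q u su; rewrite fundamental_hamiltonian_bracket//; congr (_ + _).
    rewrite (cobracket_expand mp Hh basis) -sumrN; apply: eq_bigr => a _.
    rewrite -sumrN; apply: eq_bigr => b _; rewrite !(pullback_fundE Hact) !dfunE.
    by rewrite mulrN mulNr; congr (- _); rewrite [RHS]mulrC mulrA.
  apply: span_near_add; first by apply: Zham; exact: fundamental_smooth.
  apply: span_near_sum => a; apply: span_near_sum => b; apply: (span_near_mul (c := fun q => _)); last exact: Zinr.
  by apply: smooth_fun_mul; [exact: fundamental_smooth|exact: smooth_fun_cst].
apply: (local_plaque_span (Z := Z)).
- move=> [j|k] f sf; first exact: (bivector_smooth_field bP (sx j) sf).
  exact: fundamental_smooth.
- move=> [j|k] [j'|k'] /=.
  + apply: (@span_near_eq _ _ _ _ _ (fun q u => \sum_a \sum_b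
      (fd (e a) q (x j) * fd (e b) q (x j')) * fd (proj_g i h (br (j_iso B i h (eps a)) (j_iso B i h (eps b)))) q u
      + -1 * sharp P (dfun q (poisson_bracket P (x j) (x j'))) u)).
      apply: nearW => q u su; rewrite hamiltonian_bracket// mulN1r; congr (_ - _).
      rewrite (proj_bracket_expand mp Hh basis).
      rewrite (fundamental_sum_id Hact) tangent_sumE; apply: eq_bigr => a _.
      rewrite (fundamental_sum Hact) tangent_sumE; apply: eq_bigr => b _.
      by rewrite tangent_scaleE !(pullback_fundE Hact) !dfunE.
    apply: span_near_add; last first.
      by apply: (span_near_mul (c := cst (-1))); [exact: smooth_fun_cst|apply: Zham; exact: sP].
    apply: span_near_sum => a; apply: span_near_sum => b; apply: (span_near_mul (c := fun q => _)); last exact: Zfd.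
    by apply: smooth_fun_mul; exact: fundamental_smooth.
  + have H := span_near_mul (c := cst (-1)) (smooth_fun_cst (-1)) (Zmix k' j); apply: span_near_eq H.
    by apply: nearW => q u su; rewrite mulN1r opprB.
  + exact: Zmix.
  + apply: span_near_eq (Zfd (lie_bracket (e k) (e k'))).
    by apply: nearW => q u su; rewrite -(fundamental_bracket Hact).
- apply: filterS hamE => q H w; split=> [[a [y ->]]|[lam ->]].
    have [u su ->] := cotangent_dfun a.
    exists (fun a => match a with inl j => pd u j q | inr k => eps k y end).
    by rewrite big_sumType /= H// {1}(basis y) (fundamental_sum Hact).
  rewrite big_sumType /=; exists (\sum_j lam (inl j) *: dfun q (x j)), (\sum_k lam (inr k) *: e k).
  rewrite (fundamental_sum Hact); congr (_ + _).
  elim: (index_enum _) => [|j r IH]; last by rewrite !big_cons sharp_linear// IH.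
  by rewrite !big_nil; apply: cotangent_separates => b; rewrite sharpE// dual0 bilin0r.
Qed.

End Involutive.

(** * Restriction to a leaf *)

Lemma tangent_in_coordinates (R : realType) (L : manifold R) (phi : 'I_(mdim L) -> L -> R) (V : set L) W
    (g : 'rV[R]_(mdim L) -> L) q (v : tangent q) f :
  (forall j, smooth_fun (phi j)) -> open V -> open W -> V q ->
  (forall q, V q -> W (\row_j phi j q) /\ g (\row_j phi j q) = q) ->
  (forall f, smooth_fun f -> Cinf W (f \o g)) -> smooth_fun f ->
  v f = dird (f \o g) (\row_j phi j q) (\row_j v (phi j)).
Proof.
move=> sphi oV oW Vq VW Cg sf; have [c ac dq] := m_cover q.
pose Phi x := \row_j phi j (chart_inv c x); pose U := chart_im c `&` chart_inv c @^-1` V.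
have oU : open U by exact: chart_pre_open.
have x0U : U (chart_map c q) by split; [exact: chart_im_map|rewrite /= chart_mapK].
have PhiE j : (fun x => Phi x 0 j) = phi j \o chart_inv c by apply/funext => x; rewrite mxE.
have CPhi : CkV 1 U Phi.
  by move=> j; rewrite PhiE; apply: Ck_subset (sphi j c ac 1%N) => x [].
have UW x : U x -> W (Phi x) by move=> [_ /VW[]].
have Ph0 : Phi (chart_map c q) = \row_j phi j q by rewrite /Phi chart_mapK.
rewrite (tan_expand ac dq v sf) /dotp.
transitivity (\sum_i tcoord c v 0 i * \sum_j dchart c q (phi j) i * partial j (f \o g) (\row_j phi j q)).
  apply: eq_bigr => i _; congr (_ * _); rewrite /dchart -Ph0.
  have [_ E] := Ck1_chain (delta_mx 0 i) oU oW UW CPhi (Cg f sf 1%N) x0U.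
  rewrite /partial -[RHS](_ : 'D_(delta_mx 0 i) ((f \o g) \o Phi) (chart_map c q) = _); last first.
    by rewrite E; apply: eq_bigr => j _; rewrite PhiE.
  apply: near_eq_derive; apply: filterS (open_nbhs_nbhs (conj oU x0U)) => x [_ Vx] /=.
  by rewrite (VW _ Vx).2.
under eq_bigr do rewrite mulr_sumr.
rewrite exchange_big /=; apply: eq_bigr => j _; rewrite mxE (tan_expand ac dq v (sphi j)) /dotp mulr_suml.
by apply: eq_bigr => i _; rewrite mulrA.
Qed.

(** A leaf of an arbitrary foliation is only an immersed manifold tangent to D; near [l] a chart of
    it, with the retraction as inverse coordinates, is a [plaque], which is all that
    [plaque_capture] requires. *)
Lemma immersed_plaque (R : realType) (L M : manifold R) (F : L -> M) (D : forall m : M, set (tangent m)) (l : L) (U : set L) :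
  immersion F -> (forall l, range (@dmap _ _ _ F l) = @D (F l)) -> nbhs l U ->
  exists W (g : 'rV[R]_(mdim L) -> L) psi v0, [/\ plaque D W (F \o g) psi, W v0, g v0 = l, forall v, W v -> U (g v) &
    \forall q \near l, exists2 v, W v & g v = q].
Proof.
move=> iF TF; rewrite nbhsE => -[U' [oU' U'l] U'U]; have [sF _] := iF.
have [psi [V [W [g [spsi [oV oW Vl] VW WV Cg]]]]] := immersion_retraction l iF.
have sFf f : smooth_fun f -> smooth_fun (f \o F) by move: f; apply/smooth_mapP.
have cg v : W v -> {for v, continuous g}.
  by move=> Wv; apply: continuous_of_smooth => f sf; exact: Ck_cont (Cg f sf 0%N) Wv.
exists (W `&` g @^-1` U'), g, psi, (\row_j psi j (F l)); split.
- split=> //; first exact: open_preimage_within.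
  + by move=> f sf k; apply: Ck_subset (Cg _ (sFf f sf) k) => v [].
  + by move=> v [Wv _]; have [] := WV v Wv.
  move=> v [Wv _] w; have [Vg Eg] := WV v Wv; rewrite -[D _]TF; split=> [[u _ <-]|[a Ha]].
    exists (\row_j u (psi j \o F)) => f sf; rewrite dmapE//.
    rewrite (tangent_in_coordinates u (fun j => sFf _ (spsi j)) oV oW Vg VW Cg (sFf f sf)).
    by rewrite [X in dird _ X _]Eg.
  have ex : exists u : tangent (g v), forall f, smooth_fun f -> u f = dird (f \o g) v a.
    exists (mktangent (g v) (fun f => dird (f \o g) v a)) => f sf.
    apply: (mktangentE (v := fun f => dird (f \o g) v a)) => //.
      move=> k f1 f2 s1 s2; have C1 := Cg f1 s1 1%N; have C2 := Cg f2 s2 1%N.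
      have Ck1 : Ck 1 W (fun y => k * (f1 \o g) y) by apply: (Ck_mul oW) => //; exact: Ck_cst.
      rewrite (_ : _ \o g = fun y => k * (f1 \o g) y + (f2 \o g) y)//.
      by rewrite (dird_add oW a Ck1 C2 Wv) (dird_mul oW a (Ck_cst W 1 k) C1 Wv) dird_cst mul0r addr0.
    move=> f1 f2 s1 s2; have C1 := Cg f1 s1 1%N; have C2 := Cg f2 s2 1%N.
    by rewrite (_ : _ \o g = fun y => (f1 \o g) y * (f2 \o g) y)// (dird_mul oW a C1 C2 Wv) addrC.
  have [u Hu] := ex; exists u => //; apply: tangent_ext => f sf; rewrite dmapE// Hu ?Ha//.
  exact: sFf.
- by split; [exact: (VW l Vl).1|rewrite /= (VW l Vl).2].
- exact: (VW l Vl).2.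
- by move=> v [_ /U'U].
- have nV : nbhs l V by exact: open_nbhs_nbhs.
  have nU' : nbhs l U' by exact: open_nbhs_nbhs.
  apply: filterS (filterI nV nU') => q [Vq Uq]; have [Wq Eq] := VW q Vq.
  by exists (\row_j psi j (F q)) => //; split => //=; rewrite Eq.
Qed.

(** * Orbits stay in leaves *)

Section ActionCurves.
Variables (R : realType) (G : lieGroup R) (M : manifold R) (act : G -> M -> M).
Hypothesis Hact : is_action act.
Variables (N : nat) (e : 'I_N -> lie G) (eps : 'I_N -> dual (lie G)).
Hypothesis basis : forall x, x = \sum_k eps k x *: e k.
Local Notation fd x m := (fundamental act x m).
Local Notation "a ** b" := (lg_mul a b) (at level 40, left associativity).
Local Notation one := (lg_one G).

(* The velocity of a curve a(t).m is a combination of the fields (e_k)_M, with coefficients given by the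
   right translation of a'(t) to the unit. *)
Lemma action_chart_line : exists (c : chart R (mdim G) G) (K d : R),
  [/\ atlas c, chart_dom c one, 0 <= K, 0 < d & forall y, ball 0 d y ->
   exists cf : 'I_N -> R -> R, forall t : R, 0 <= t <= 1 ->
    [/\ chart_im c (chart_map c one + t *: y), forall k, `|cf k t| <= K * `|y| &
     forall m f, smooth_fun f ->
       is_derive t (1 : R) (fun t => f (act (chart_inv c (chart_map c one + t *: y)) m))
        (\sum_k cf k t * fd (e k) (act (chart_inv c (chart_map c one + t *: y)) m) f)]].
Proof.
have [c ac d1] := m_cover one; set x0 := chart_map c one.
have /choice[kap Hkap] : forall k, exists kap, smooth_fun kap /\ eps k = dfun one kap.
  by move=> k; have [f sf E] := cotangent_dfun (eps k); exists f.
(* The differential of [Q k] in [a] at [a = b] is the k-th coordinate of the right translate to the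
   unit; joint smoothness bounds it near the unit. *)
pose Q k (a b : G) := kap k (a ** lg_inv b).
have sQ k : smooth_fun2 (Q k).
  apply: (smooth_fun2_comp2 (smooth_mul2 (Hkap k).1)); first exact/smooth_map2_fst/smooth_map_id.
  by apply: smooth_map2_snd; exact: lg_inv_smooth.
have /choice[r Hr] : forall k, exists r : R * R, [/\ 0 < r.1, 0 <= r.2 & forall x, ball x0 r.1 x ->
    forall j, `|dchart c (chart_inv c x) ((Q k)^~ (chart_inv c x)) j| <= r.2].
  move=> k; have [r [K [r0 K0 H]]] := smooth_fun2_dchart_bounded (sQ k) ac ac d1 d1.
  by exists (r, K); split => // x bx; have [] := H x x bx bx.
have [d0 d00 Hd0] := chart_ball ac d1 (filterT : nbhs one setT).
pose d := \big[Order.min/d0]_k (r k).1.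
have dd k : d <= (r k).1 by exact: bigmin_le_cond.
have dd0 : d <= d0 by exact: bigmin_le_id.
have d_0 : 0 < d by rewrite /d; elim/big_ind: _ => // [u v u0 v0|k _]; [rewrite lt_min u0|have [] := Hr k].
pose K := \sum_k (r k).2.
have rK k : (r k).2 <= K.
  by rewrite /K (bigD1 k)//= lerDl; apply: sumr_ge0 => j _; have [] := Hr j.
have K0 : 0 <= K by apply: sumr_ge0 => j _; have [] := Hr j.
exists c, ((mdim G)%:R * K), d; split => //; first by rewrite mulr_ge0.
move=> y by_; pose a (t : R) := chart_inv c (x0 + t *: y).
pose w (t : R) : tangent (a t) := tvec c (a t) y.
(* The minus sign compensates that of the fundamental fields. *)
exists (fun k t => - w t ((Q k)^~ (a t))) => t /andP[t0 t1].
have bt : ball x0 d (x0 + t *: y).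
  rewrite -ball_normE /= opprD addNKr normrN normrZ ger0_norm//.
  move: by_; rewrite -ball_normE /= sub0r normrN; apply: le_lt_trans.
  by rewrite ler_piMl.
have im : chart_im c (x0 + t *: y) by have [] := Hd0 _ (le_ball dd0 bt).
have da : chart_dom c (a t) by exact: chart_inv_dom.
have ca : chart_map c (a t) = x0 + t *: y by exact: chart_invK.
have sw k : smooth_fun ((Q k)^~ (a t)) := smooth_fun2_l _ (sQ k).
split => //.
  move=> k; rewrite normrN tvecE//; apply: le_trans (dotp_bound _ (M := (r k).2) _) _.
    by move=> j; have [_ _] := Hr k; apply; exact: le_ball bt.
  by rewrite -mulrA; apply: ler_wpM2l => //; rewrite mulrC; exact: ler_wpM2r.
move=> m f sf; pose phi b := f (act b m).
have sphi : smooth_fun phi by exact: (action_orbit_smooth Hact m sf).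
have dline : is_derive t (1 : R) (fun t => x0 + t *: y) y.
  rewrite -[X in is_derive _ _ _ X]add0r; apply: is_deriveD.
  have df : differentiable (fun s : R => s *: y) t by exact: ex_diff.
  by apply: DeriveDef; [exact: diff_derivable|rewrite deriveE// diff_val scale1r].
have := dird_curve (chart_im_open ac) (sphi c ac 1%N) im dline.
set D1 := dird _ _ _; suff -> : \sum_k - w t ((Q k)^~ (a t)) * fd (e k) (act (a t) m) f = D1 by [].
have -> : D1 = w t phi by rewrite /w tvecE// /D1 /dird /dchart ca.
have srm : smooth_map (fun b : G => b ** lg_inv (a t)) by exact: smooth_rmul.
pose X : lie G := dmap_to (fun b : G => b ** lg_inv (a t)) one (w t).
have XE g : smooth_fun g -> X g = w t (fun b => g (b ** lg_inv (a t))).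
  by move=> sg; rewrite /X dmap_toE// lgmV.
have [_ _ actM] := Hact.
have -> : w t phi = - fd X (act (a t) m) f.
  rewrite action_fundE// opprK XE; last exact: (action_orbit_smooth Hact).
  by congr (w t _); apply/funext => b; rewrite /phi -actM lgmVK.
rewrite {1}(basis X) (fundamental_sum Hact) tangent_sumE -sumrN; apply: eq_bigr => k _.
by rewrite tangent_scaleE (Hkap k).2 dfunE XE ?mulNr//; exact: (Hkap k).1.
Qed.

(** A group element near the unit is joined to it by a short segment in a chart, so the curve from
    [F q] has small coefficients along the fields (e_k)_M and is captured by the plaque of the leaf.
    Uniformity in [q] gives continuity for the topology of [L]. *)
Lemma action_near_plaque (L : manifold R) (F : L -> M) (D : forall m : M, set (tangent m)) (l : L) (U : set L) :
  immersion F -> (forall l, range (@dmap _ _ _ F l) = @D (F l)) -> (forall m x, @D m (fd x m)) -> nbhs l U ->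
  exists A V, [/\ nbhs one A, nbhs l V & forall a q, A a -> V q -> exists2 q', U q' & act a (F q) = F q'].
Proof.
move=> iF TF DF nU; have [sF _] := iF.
have [W [g [psi [v0 [pl Wv0 gv0 gU nV2]]]]] := immersed_plaque iF TF nU.
have [||O [eta [nO eta0 cap]]] := plaque_capture (Y := fun k q => fd (e k) q) pl Wv0.
- by move=> k f sf; exact: fundamental_smooth.
- by apply: nearW => q k; exact: DF.
have [c [K [d [ac d1 K0 d0 H]]]] := action_chart_line.
have [sact act1 actM] := Hact.
have nO1 : nbhs (act one (F l)) O by rewrite act1 -gv0.
have [A1 [V1 [nA1 nV1 HO]]] := smooth_map2_nbhs sact nO1.
set x0 := chart_map c one in H *.
have [s s0 Hs] := chart_ball ac d1 nA1.
have K1 : 0 < K + 1 by lra.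
(* [s] keeps the curve in the capture region, [d] is the range of [action_chart_line], and the last
   term makes the coefficients at most [eta]. *)
pose rho := Num.min s (Num.min d (eta / (K + 1))).
have rho0 : 0 < rho by rewrite !lt_min s0 d0 /= divr_gt0.
have nA : nbhs one (chart_dom c `&` [set a | ball x0 rho (chart_map c a)]).
  apply: filterI; first by apply: open_nbhs_nbhs; split => //; exact: chart_dom_open.
  by apply: (chart_map_cont ac d1); exact: nbhsx_ballx.
have nV3 : nbhs l (F @^-1` V1) by exact: (smooth_map_cont (p := l) sF).
exists (chart_dom c `&` [set a | ball x0 rho (chart_map c a)]), ([set q | exists2 v, W v & g v = q] `&` F @^-1` V1).
split => //; first exact: filterI.
move=> a q [da ba] [[v1 Wv1 gv1] Vq].
pose y := chart_map c a - x0.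
have yb : `|y| < rho by move: ba; rewrite -ball_normE /= -normrN opprB.
have bd : ball 0 d y.
  by rewrite -ball_normE /= sub0r normrN; apply: lt_le_trans yb _; rewrite !ge_min lexx !orbT.
have [cf Hcf] := H y bd.
pose gam (t : R) := act (chart_inv c (x0 + t *: y)) (F q).
have [|||Wg Eg] := cap gam cf _ _ 1.
- move=> t t01; have [im bcf Hd] := Hcf t t01; split; last by move=> f sf; exact: Hd.
    apply: HO => //; apply: (Hs _ _).2; rewrite -ball_normE /= opprD addNKr normrN normrZ.
    move: t01 => /andP[t0 t1]; rewrite ger0_norm//; apply: le_lt_trans (ler_piMl _ t1) _ => //.
    by apply: lt_le_trans yb _; rewrite ge_min lexx.
  move=> k; apply: le_trans (bcf k) _.
  apply: (@le_trans _ _ ((K + 1) * (eta / (K + 1)))); last by rewrite mulrC divfK// gt_eqF.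
  apply: ler_pM => //; first lra.
  by apply/ltW/(lt_le_trans yb); rewrite !ge_min lexx !orbT.
- by exists v1 => //; rewrite /gam scale0r addr0 chart_mapK// act1 /= gv1.
- by rewrite ler01 lexx.
exists (g (\row_j psi j (gam 1))); first exact: gU.
by move: Eg; rewrite {1}/gam scale1r /y addrC subrK chart_mapK.
Qed.

End ActionCurves.

Lemma smooth_fun2_local (R : realType) (L M : manifold R) (H : L -> M -> R) :
  (forall (l : L) (m : M), exists A B H', [/\ nbhs l A, nbhs m B, smooth_fun2 H' & forall a b, A a -> B b -> H' a b = H a b]) ->
  smooth_fun2 H.
Proof.
move=> loc c c' ac ac' k; apply/Ck_pointwise => x Dx; have [d1 d2] := Dx.
have [A [B [H' [nA nB sH' E]]]] := loc (chart_inv c (lsubmx x)) (chart_inv c' (rsubmx x)).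
have C' := sH' c c' ac ac' k; apply: (Ck_near _ ((Ck_pointwise _ _ _).1 C' x Dx)).
have cl : {for x, continuous (lsubmx : 'rV[R]_(mdim L + mdim M) -> 'rV[R]_(mdim L))}.
  exact: (@CkV_cont _ _ _ 0 setT _ _ (@CkV_lsubmx _ _ _ 0 setT)).
have cr : {for x, continuous (rsubmx : 'rV[R]_(mdim L + mdim M) -> 'rV[R]_(mdim M))}.
  exact: (@CkV_cont _ _ _ 0 setT _ _ (@CkV_rsubmx _ _ _ 0 setT)).
have n1 : \forall y \near x, A (chart_inv c (lsubmx y)).
  by apply: (continuous_comp (g := chart_inv c) cl (chart_inv_cont ac d1)).
have n2 : \forall y \near x, B (chart_inv c' (rsubmx y)).
  by apply: (continuous_comp (g := chart_inv c') cr (chart_inv_cont ac' d2)).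
by apply: filterS (filterI n1 n2) => y [Ay By]; exact: E.
Qed.

Section LeafAction.
Variables (R : realType) (G : lieGroup R) (M : manifold R) (act : G -> M -> M).
Hypotheses (Hact : is_action act) (cG : connected [set: G]).
Variables (N : nat) (e : 'I_N -> lie G) (eps : 'I_N -> dual (lie G)).
Hypothesis basis : forall x, x = \sum_k eps k x *: e k.
Variables (D : forall m : M, set (tangent m)) (Fol : foliation M).
Hypotheses (DF : forall m x, @D m (fundamental act x m)) (HI : integrates Fol D).
Local Notation "a ** b" := (lg_mul a b) (at level 40, left associativity).
Local Notation one := (lg_one G).
Local Notation inv := (@lg_inv R G).

Let act1 m : act one m = m. Proof. by have [] := Hact. Qed.
Let actM a b m : act (a ** b) m = act a (act b m). Proof. by have [] := Hact. Qed.

Lemma rmul_nbhs (a b : G) (A : set G) : nbhs (a ** b) A -> \forall c \near a, A (c ** b).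
Proof. by apply: (smooth_map_cont (p := a) (smooth_rmul b)). Qed.

Lemma lie_nbhs_one (a : G) (A : set G) : nbhs one A -> \forall c \near a, A (c ** inv a).
Proof. by move=> nA; apply: rmul_nbhs; rewrite lgmV. Qed.

Lemma lie_nbhs_inv (a : G) (A : set G) : nbhs one A -> \forall c \near a, A (a ** inv c).
Proof.
move=> nA; have sm : smooth_map (fun c : G => a ** inv c).
  by apply: smooth_map_mul; [exact: smooth_map_cst|exact: lg_inv_smooth].
by apply: (smooth_map_cont (p := a) sm); rewrite lgmV.
Qed.

Lemma leaf_near k (l : fol_leaf k) (U : set (fol_leaf k)) : nbhs l U -> exists A V, [/\ nbhs one A, nbhs l V &
  forall a q, A a -> V q -> exists2 q', U q' & act a (fol_incl q) = fol_incl (f := Fol) q'].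
Proof.
exact: (action_near_plaque Hact basis (@fol_immersion _ _ Fol k) (HI (k := k)) DF).
Qed.

Lemma orbit_in_leaf k (l : fol_leaf k) a : range (@fol_incl _ _ Fol k) (act a (fol_incl l)).
Proof.
pose E k' := [set a | range (@fol_incl _ _ Fol k') (act a (fol_incl l))].
have oE k' : open (E k').
  rewrite openE => a0 [l1 _ El1]; have [A [V [nA nV H]]] := leaf_near (filterT : nbhs l1 setT).
  have nb := lie_nbhs_one a0 nA.
  have : \forall c \near a0, E k' c.
    apply: filterS nb => c Ac; have [q' _ Eq] := H _ _ Ac (nbhs_singleton nV).
    by exists q' => //; rewrite -Eq El1 -actM lgmVK.
  by [].
suff : E k = setT by move=> ET; have : E k a by rewrite ET.
apply: connected_clopen => //; first by exists one, l => //; rewrite act1.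
rewrite openE => a0 na; have [k' [k'm _]] := fol_partition Fol (act a0 (fol_incl l)).
have nb : nbhs a0 (E k') by apply: open_nbhs_nbhs.
have nk : k' <> k by move=> Ek; apply: na; rewrite -Ek.
apply: filterS nb => c Ec Ekc; apply: nk.
have [k2 [_ U]] := fol_partition Fol (act c (fol_incl l)).
by rewrite -(U k Ekc) -(U k' Ec).
Qed.

Variable k : fol_index Fol.
Local Notation L := (fol_leaf k).
Local Notation F := (@fol_incl _ _ Fol k).

Let iF : immersion F := @fol_immersion _ _ Fol k.
Let Finj : injective F := @fol_injective _ _ Fol k.
Let Fcont (q : L) : {for q, continuous F}. Proof. exact: (smooth_map_cont (p := q) iF.1). Qed.

Variable actL : G -> L -> L.
Hypothesis actLE : forall a l, F (actL a l) = act a (F l).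

(** Continuity of [actL] at the pair, for the leaf topology; this topology may be finer than that
    induced by [M], so continuity is not inherited. *)
Let cont a l := forall U, nbhs (actL a l) U -> exists A V, [/\ nbhs a A, nbhs l V & forall b q, A b -> V q -> U (actL b q)].

Lemma leaf_act_near1 l : cont one l.
Proof.
move=> U; have -> : actL one l = l by apply: Finj; rewrite actLE act1.
move=> nU; have [A [V [nA nV H]]] := leaf_near nU; exists A, V; split => // b q Ab Vq.
by have [q' Uq' E] := H b q Ab Vq; rewrite (_ : actL b q = q')//; apply: Finj; rewrite actLE.
Qed.

(** Near the unit the action stays in a chart of the leaf, where a point is recovered continuously
    from its image in [M] by the retraction; there continuity does follow from that of [act]. *)
Lemma leaf_act_continuous_near (l : L) : exists (A : set G) (V : set L), [/\ nbhs one A, nbhs l V & forall b q, A b -> V q -> cont b q].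
Proof.
have [psi [V1 [W [g [spsi [oV oW Vl] VW WV Cg]]]]] := immersion_retraction l iF.
have [A [V [nA nV H]]] := leaf_near (open_nbhs_nbhs (conj oV Vl)).
have VH b q : A b -> V q -> V1 (actL b q).
  by move=> Ab Vq; have [q' Vq' E] := H b q Ab Vq; rewrite (_ : actL b q = q')//; apply: Finj; rewrite actLE.
exists (interior A), (interior V); split; [exact: nbhs_interior|exact: nbhs_interior|].
move=> c q Ac Vq U nU; have Vcq := VH _ _ (interior_subset Ac) (interior_subset Vq).
have [Wcq gcq] := VW _ Vcq.
have cg : {for (\row_j psi j (F (actL c q))), continuous g}.
  by apply: continuous_of_smooth => f sf; exact: Ck_cont (Cg f sf 0%N) Wcq.
have nO : nbhs (F (actL c q)) [set m | U (g (\row_j psi j m))].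
  have cr := @row_smooth_continuous _ _ _ psi (F (actL c q)) spsi.
  have nU' : nbhs (g (\row_j psi j (F (actL c q)))) U by rewrite gcq.
  exact: (continuous_comp (g := g) cr cg nU').
have [sact _ _] := Hact; rewrite actLE in nO.
have [A2 [V2 [nA2 nV2 H2]]] := smooth_map2_nbhs sact nO.
exists (A `&` A2), (V `&` F @^-1` V2); split.
- by apply: filterI.
- by apply: filterI => //; exact: Fcont.
move=> b q' [Ab A2b] [Vq' V2q']; rewrite -(VW _ (VH _ _ Ab Vq')).2 actLE.
exact: H2.
Qed.

Lemma leaf_actM a b l : actL (a ** b) l = actL a (actL b l).
Proof. by apply: Finj; rewrite !actLE actM. Qed.

Lemma leaf_act1 l : actL one l = l.
Proof. by apply: Finj; rewrite actLE act1. Qed.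

Lemma leaf_act_comp c a l : cont a l -> cont c (actL a l) -> cont (c ** a) l.
Proof.
move=> h1 h2 U; rewrite leaf_actM => /h2[A1 [V1 [nA1 nV1 H1]]].
have [A2 [V2 [nA2 nV2 H2]]] := h1 _ nV1.
exists [set b | A1 (b ** inv a)], V2; split => //; first by apply: rmul_nbhs; rewrite lgmK.
move=> b q Ab Vq; rewrite -[b](lgmVK a) leaf_actM; apply: H1 => //; apply: H2 => //.
exact: nbhs_singleton.
Qed.

(** Factoring a group element through a nearby one shows that both continuity and its failure
    persist near [a0], so connectedness of G concludes. *)
Lemma leaf_act_continuous a l : cont a l.
Proof.
suff : [set a | cont a l] = setT by move=> ET; have : [set a | cont a l] a by rewrite ET.
apply: connected_clopen => //; first by exists one; exact: leaf_act_near1.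
  rewrite openE => a0 ca0; have [A [V [nA nV H]]] := leaf_act_continuous_near (actL a0 l).
  have nb := lie_nbhs_one a0 nA; suff : \forall c \near a0, cont c l by [].
  apply: filterS nb => b Ab; rewrite -[b](lgmVK a0); apply: leaf_act_comp => //.
  by apply: H => //; exact: nbhs_singleton.
rewrite openE => a0 nca0; have [A [V [nA nV H]]] := leaf_act_continuous_near (actL a0 l).
have nV' : nbhs (actL one (actL a0 l)) V by rewrite leaf_act1.
have [A2 [V2 [nA2 nV2 H2]]] := leaf_act_near1 nV'.
have n1 := lie_nbhs_one a0 nA2; have n2 := lie_nbhs_inv a0 nA.
suff : \forall c \near a0, ~ cont c l by [].
apply: filterS (filterI n1 n2) => b [Ab Ab'] cb; apply: nca0; rewrite /= -[a0](lgmVK b).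
apply: leaf_act_comp => //; apply: H => //.
by rewrite -[b](lgmVK a0) leaf_actM; apply: H2 => //; exact: nbhs_singleton.
Qed.

(** Continuity keeps [actL a l] in the neighbourhood where a function on the leaf coincides with the
    restriction of one on [M]; smoothness is then that of [act]. *)
Lemma leaf_action : is_action actL.
Proof.
have [sact _ _] := Hact.
split; [|exact: leaf_act1|exact: leaf_actM].
apply/smooth_map2P => f sf; change (smooth_fun2 (fun a l => f (actL a l))).
apply: smooth_fun2_local => a l.
have [f' sf' Ef'] := immersion_extension (actL a l) iF sf.
have [A [V [nA nV H]]] := leaf_act_continuous Ef'.
exists A, V, (fun a l => f' (act a (F l))); split => //; last first.
  by move=> b q Ab Vq; rewrite -actLE; exact: H.
have s1 : smooth_map2 (fun (a : G) (_ : L) => a) := smooth_map2_fst (@smooth_map_id _ _).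
have s2 : smooth_map2 (fun (_ : G) (l : L) => F l) := smooth_map2_snd iF.1.
exact: (smooth_fun2_comp2 (smooth_map2_fun2 sact sf') s1 s2).
Qed.

End LeafAction.

(** * The restricted bivector *)

Section RestrictedBivector.
Variables (R : realType) (n : nat) (DG : groupPair R n).
Local Notation D := (gpD DG).
Local Notation G := (gpG DG).
Local Notation B := (@gp_metric R n DG (lg_one D)).
Local Notation br := (@lie_bracket R D).
Local Notation i := (@gp_alg_incl R n DG).
Local Notation mp := (gp_manin DG).
Variables (M : manifold R) (act : G -> M -> M) (h : set (lie D)) (P : bifield M).
Variables (L : manifold R) (F : L -> M) (actL : G -> L -> L).
Hypotheses (Hact : is_action act) (HactL : is_action actL) (bP : is_bivector P).
Hypothesis Hh : isotropic_complement B i h.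
Hypotheses (iF : immersion F) (actLE : forall a l, F (actL a l) = act a (F l)).
Hypothesis TF : forall l, range (@dmap _ _ _ F l) = @sum_distribution _ _ _ _ act P (F l).
Local Notation dF l := (@dmap R L M F l).
Local Notation pF l := (pullback (@dmap R L M F l)).
Local Notation fd x m := (fundamental act x m).
Local Notation fdL x l := (fundamental actL x l).
Local Notation pb m := (pullback (fun x => fundamental act x m)).
Local Notation pbL l := (pullback (fun x => fundamental actL x l)).

Let bil m : bilinear_form (@P m). Proof. by have [] := bP. Qed.

Let pFE l (a : cotangent (F l)) v : pF l a v = a (dF l v).
Proof. by rewrite pullbackE// => k u w; apply: dmap_linear; exact: iF.1. Qed.

Lemma smooth_restrict f : smooth_fun f -> smooth_fun (f \o F).
Proof. by move: f; apply/smooth_mapP; exact: iF.1. Qed.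

Lemma pullback_dF_surj l (a : cotangent l) : exists b : cotangent (F l), pF l b = a.
Proof.
have [f sf ->] := cotangent_dfun a; have [f' sf' E] := immersion_extension l iF sf.
exists (dfun (F l) f'); rewrite (pullback_dfun l iF.1 sf').
exact: dfun_near (smooth_restrict sf') sf E.
Qed.

Definition lift l (a : cotangent l) : cotangent (F l) := xget 0 [set b | pF l b = a].

Lemma liftK l (a : cotangent l) : pF l (lift a) = a.
Proof. by have [b Hb] := pullback_dF_surj a; rewrite /lift; case: xgetP => [c _ //|/(_ b)]. Qed.

Definition restricted : bifield L := fun l a b => P (lift a) (lift b).

Let Pskew m (a b : cotangent m) : P a b = - P b a. Proof. by have [_ H _] := bP. Qed.

Let PDl m (a b c : cotangent m) : P (a + b) c = P a c + P b c.
Proof. by rewrite -[a]scale1r (bil m).1 mul1r scale1r. Qed.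

(* A covector that vanishes on the leaf pairs to zero with every covector, as the image of P is tangent to the leaf. *)
Lemma bivector_annihilator l (a b : cotangent (F l)) : pF l a = 0 -> P a b = 0.
Proof.
move=> a0; rewrite -(sharpE (bil (F l)) b a).
have [v _ <-] : range (dF l) (sharp P b).
  rewrite TF; exists b, 0; have := fundamental_linear Hact (F l) (-1) 0 0.
  by rewrite scaleN1r oppr0 addr0 scaleN1r addNr => ->; rewrite addr0.
by rewrite -pFE a0.
Qed.

(** By [bivector_annihilator] the value of [P] depends only on the pullbacks of its arguments, so
    the choice in [lift] is immaterial. *)
Lemma restrictedE l (a b : cotangent (F l)) : restricted (pF l a) (pF l b) = P a b.
Proof.
have key (a1 a2 c : cotangent (F l)) : pF l a1 = pF l a2 -> P a1 c = P a2 c.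
  move=> E; rewrite -[a1](subrK a2) PDl bivector_annihilator ?add0r//.
  apply: dual_ext => v; rewrite pFE -scaleN1r addrC dual_addE dual_scaleE -!pFE E.
  by rewrite mulN1r addNr -(scale0r (0 : cotangent l)) dual_scaleE mul0r.
rewrite /restricted (key _ a _ (liftK _)) Pskew (key _ b _ (liftK _)) -Pskew.
by [].
Qed.

Lemma dmap_fundamental l x : dF l (fdL x l) = fd x (F l).
Proof.
apply: tangent_ext => f sf; rewrite dmapE//; last exact: iF.1.
rewrite !action_fundE//; last exact: smooth_restrict.
by congr (- x _); apply/funext => a; rewrite /= actLE.
Qed.

Lemma pullback_fund_restrict l (a : cotangent (F l)) : pbL l (pF l a) = pb (F l) a.
Proof.
by apply: dual_ext => x; rewrite !pullback_fundE// pFE dmap_fundamental.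
Qed.

Lemma dfun_restrict (l : L) f f' : smooth_fun f -> smooth_fun f' -> (\forall q \near l, f' (F q) = f q) ->
  dfun l f = pF l (dfun (F l) f').
Proof.
move=> sf sf' E; rewrite (pullback_dfun l iF.1 sf'); apply/esym.
exact: dfun_near (smooth_restrict sf') sf E.
Qed.

(** Extensions exist near a point only, but differentials see germs; the conclusion again holds near
    [l], so the argument can be iterated for nested brackets. *)
Lemma bracket_restrict (l : L) f g f' g' : smooth_fun f -> smooth_fun f' -> (\forall q \near l, f' (F q) = f q) ->
  smooth_fun g -> smooth_fun g' -> (\forall q \near l, g' (F q) = g q) ->
  \forall q \near l, poisson_bracket P f' g' (F q) = poisson_bracket restricted f g q.
Proof.
move=> sf sf' Ef sg sg' Eg; apply: filterS (filterI (near_join Ef) (near_join Eg)) => q [ef eg].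
by rewrite /poisson_bracket (dfun_restrict sf sf' ef) (dfun_restrict sg sg' eg) restrictedE.
Qed.

Lemma restricted_bivector : is_bivector restricted.
Proof.
have [_ _ sP] := bP.
have lin l k (a b : cotangent l) : k *: a + b = pF l (k *: lift a + lift b).
  by rewrite pullback_linear ?liftK// => c u w; apply: dmap_linear; exact: iF.1.
split.
- move=> l; split=> k u v w.
    by rewrite lin -{1}[w]liftK restrictedE (bil _).1.
  by rewrite lin -{1}[w]liftK restrictedE (bil _).2.
- by move=> l a b; exact: Pskew.
move=> f g sf sg; apply/smooth_funP => l.
have [f' sf' Ef] := immersion_extension l iF sf.
have [g' sg' Eg] := immersion_extension l iF sg.
apply: smooth_at_near (bracket_restrict sf sf' Ef sg sg' Eg) _.
by apply: (smooth_fun_at l (smooth_restrict (sP _ _ sf' sg'))).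
Qed.

Lemma change_restrictedE h' l (a b : cotangent (F l)) :
  @change_complement _ _ _ _ actL h h' restricted l (pF l a) (pF l b) = @change_complement _ _ _ _ act h h' P (F l) a b.
Proof. by rewrite !change_complementE// restrictedE !pFE pullback_fund_restrict dmap_fundamental. Qed.

Lemma restricted_quasi_poisson : quasi_poisson act h P -> quasi_poisson actL h restricted.
Proof.
move=> [_ _ Hs Hl]; have bL := restricted_bivector; have [_ _ sL] := bL; have [_ _ sP] := bP.
split => //.
- move=> f g u l sf sg su.
  have [f' sf' Ef] := immersion_extension l iF sf.
  have [g' sg' Eg] := immersion_extension l iF sg.
  have [u' su' Eu] := immersion_extension l iF su.
  have br3 a b c a' b' c' : smooth_fun a -> smooth_fun a' -> (\forall q \near l, a' (F q) = a q) ->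
      smooth_fun b -> smooth_fun b' -> (\forall q \near l, b' (F q) = b q) ->
      smooth_fun c -> smooth_fun c' -> (\forall q \near l, c' (F q) = c q) ->
      poisson_bracket restricted a (poisson_bracket restricted b c) l = poisson_bracket P a' (poisson_bracket P b' c') (F l).
    move=> sa sa' Ea sb sb' Eb sc sc' Ec.
    have H := bracket_restrict sa sa' Ea (sL _ _ sb sc) (sP _ _ sb' sc') (bracket_restrict sb sb' Eb sc sc' Ec).
    exact: esym (nbhs_singleton H).
  rewrite /half_schouten (br3 _ _ _ f' g' u')// (br3 _ _ _ g' u' f')// (br3 _ _ _ u' f' g')//.
  apply: (etrans (Hs f' g' u' (F l) sf' sg' su')); rewrite /push3.
  by rewrite (dfun_restrict sf sf' Ef) (dfun_restrict sg sg' Eg) (dfun_restrict su su' Eu) !pullback_fund_restrict.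
move=> x f g l sf sg.
have [f' sf' Ef] := immersion_extension l iF sf.
have [g' sg' Eg] := immersion_extension l iF sg.
have fdE u u' : smooth_fun u -> smooth_fun u' -> (\forall q \near l, u' (F q) = u q) ->
    \forall q \near l, fd x (F q) u' = fdL x q u.
  move=> su su' Eu; apply: filterS (near_join Eu) => q eu.
  by rewrite -dmap_fundamental dmapE//; [apply: tan_local => //; exact: smooth_restrict|exact: iF.1].
have := Hl x f' g' (F l) sf' sg'; rewrite /lie_derivative /push2.
rewrite (dfun_restrict sf sf' Ef) (dfun_restrict sg sg' Eg) !pullback_fund_restrict => <-.
have E0 := bracket_restrict sf sf' Ef sg sg' Eg.
have sxf := fundamental_smooth HactL x sf; have sxg := fundamental_smooth HactL x sg.
have sxf' := fundamental_smooth Hact x sf'; have sxg' := fundamental_smooth Hact x sg'.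
congr (_ - _ - _); apply/esym.
- exact: (nbhs_singleton (fdE _ _ (sL _ _ sf sg) (sP _ _ sf' sg') E0)).
- exact: (nbhs_singleton (bracket_restrict sxf sxf' (fdE _ _ sf sf' Ef) sg sg' Eg)).
- exact: (nbhs_singleton (bracket_restrict sf sf' Ef sxg sxg' (fdE _ _ sg sg' Eg))).
Qed.

(** Covectors of [M] separate vectors, and on their pullbacks the two bivectors agree. Images on the
    leaf can thus be computed in [M], after applying the injective differential of [F]. *)
Lemma sharp_restricted h' l (a : cotangent (F l)) : isotropic_complement B i h' ->
  dF l (sharp (change_complement actL h h' restricted) (pF l a)) = sharp (change_complement act h h' P) a.
Proof.
move=> Hh'; apply: cotangent_separates => b; rewrite -pFE !sharpE ?change_restrictedE//.
  by apply: change_complement_bilinear => //; exact: restricted_bivector.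
exact: change_complement_bilinear.
Qed.

End RestrictedBivector.

Section LeafSpace.
Variables (R : realType) (n : nat) (DG : groupPair R n) (S : homogeneousSpace DG).
Local Notation D := (gpD DG).
Local Notation G := (gpG DG).
Local Notation B := (@gp_metric R n DG (lg_one D)).
Local Notation i := (@gp_alg_incl R n DG).
Variables (M : manifold R) (act : G -> M -> M) (h : set (lie D)) (P : bifield M) (mu : M -> S).
Hypotheses (Hh : isotropic_complement B i h) (qh : quasi_hamiltonian act h P mu).
Variables (L : manifold R) (F : L -> M) (actL : G -> L -> L).
Hypotheses (HactL : is_action actL).
Hypotheses (iF : immersion F) (actLE : forall a l, F (actL a l) = act a (F l)).
Hypothesis TF : forall l, range (@dmap _ _ _ F l) = @sum_distribution _ _ _ _ act P (F l).
Local Notation PL := (restricted P F).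

Let Hact : is_action act. Proof. by have [[]] := qh. Qed.
Let bP : is_bivector P. Proof. by have [[]] := qh. Qed.

(** An open subset of the leaf need not come from an open subset of [M], so the moment identity of
    [M] is used in its pointwise form and pulled back through the injective differential of [F]. *)
Lemma leaf_quasi_hamiltonian : quasi_hamiltonian actL h PL (mu \o F).
Proof.
have [qp [smu equi _]] := qh; split; first exact: (restricted_quasi_poisson Hact).
split.
- exact: smooth_map_comp iF.1 smu.
- by move=> a l /=; rewrite actLE equi.
move=> Omega h' _ Hh' adm x l Ol; apply: (iF.2 l).
rewrite (dmap_fundamental Hact HactL iF actLE) -(moment_map_at qh x Hh' (adm l Ol)).
rewrite -(sharp_restricted Hact HactL bP Hh iF actLE TF)//; congr (dmap F (sharp _ _)).
apply: dual_ext => v; have smuF : smooth_map (mu \o F) := smooth_map_comp iF.1 smu.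
have l1 k u w := dmap_linear (p := l) k u w smuF.
have l2 k u w := dmap_linear (p := l) k u w iF.1.
have l3 k u w := dmap_linear (p := F l) k u w smu.
rewrite !pullbackE//.
congr (dual_fun _ _); apply: tangent_ext => f sf; rewrite dmapE//.
by rewrite (@dmapE _ _ _ mu)// dmapE//; [exact: iF.1|move: f sf; apply/smooth_mapP].
Qed.

(** Every vector tangent to the leaf is in the image of the bivector of [M] for an admissible
    complement, hence in that of the restriction; a skew map that is onto is injective. *)
Lemma leaf_nondegenerate : nondegenerate_space actL h PL (mu \o F).
Proof.
move=> l h' Hh' adm.
have bL : is_bivector PL by exact: (restricted_bivector Hact).
have bil := change_complement_bilinear HactL bL Hh Hh' l.
pose s := @sharp _ _ (change_complement actL h h' PL) l.
have surj v : exists a, s a = v.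
  have : range (@dmap _ _ _ F l) (dmap F v) by exists v.
  rewrite TF -(range_sharp_sum Hh qh Hh' adm) => -[a _ Ea].
  by exists (pullback (@dmap _ _ _ F l) a); apply: (iF.2 l); rewrite -Ea (sharp_restricted Hact HactL bP Hh iF actLE TF).
have inj : injective s.
  move=> a b E; apply: dual_ext => v; have [c <-] := surj v; rewrite /s !sharpE//.
  rewrite (change_complement_skew HactL bL Hh Hh') [RHS](change_complement_skew HactL bL Hh Hh').
  by congr (- _); rewrite -!sharpE//; congr (dual_fun c _).
have [t Ht] := choice surj; exists t => // a; exact: inj.
Qed.

End LeafSpace.

Theorem mainTheorem7 (R : realType) (n : nat) (DG : groupPair R n)
    (S : homogeneousSpace DG) (M : manifold R)
    (act : gpG DG -> M -> M) (h : set (lie (gpD DG)))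
    (P : bifield M) (mu : M -> S)
    (h_compl : lagrangian_complement h)
    (qham : quasi_hamiltonian act h P mu) :
  (forall (m : M) (h1 h2 : set (lie (gpD DG))),
     lagrangian_complement h1 -> admissible_at h1 (mu m) ->
     lagrangian_complement h2 -> admissible_at h2 (mu m) ->
     range (@sharp _ _ (change_complement act h h1 P) m) =
     range (@sharp _ _ (change_complement act h h2 P) m)) /\
  (exists Fol : foliation M, integrates Fol (image_distribution act h P mu)) /\
  (forall Fol : foliation M, integrates Fol (image_distribution act h P mu) ->
   forall k : fol_index Fol,
     (forall (a : gpG DG) (l : fol_leaf k),
        range (@fol_incl _ _ Fol k) (act a (fol_incl l))) /\
     exists (actL : gpG DG -> fol_leaf k -> fol_leaf k)
            (PL : bifield (fol_leaf k)),
       [/\ forall (a : gpG DG) (l : fol_leaf k),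
             fol_incl (actL a l) = act a (fol_incl l),
           forall (h' : set (lie (gpD DG))), lagrangian_complement h' ->
             bivector_restricts (@fol_incl _ _ Fol k)
               (change_complement actL h h' PL) (change_complement act h h' P),
           quasi_hamiltonian actL h PL (mu \o @fol_incl _ _ Fol k)
         & nondegenerate_space actL h PL (mu \o @fol_incl _ _ Fol k)]).
Proof.
have [[Hact bP Hs Hl] _] := qham; have qp : quasi_poisson act h P by [].
split.
  by move=> m h1 h2 H1 A1 H2 A2; rewrite (range_sharp_sum h_compl qham H1 A1) (range_sharp_sum h_compl qham H2 A2).
split.
  have [Fol HI] := foliation_of_plaques (sum_distribution_plaque h_compl qp).
  by exists Fol => k l; rewrite image_distributionE// HI.
move=> Fol HI0 k.
(* From here on the complements no longer intervene in the distribution, and the foliation is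
   arbitrary. *)
have HI : integrates Fol (sum_distribution act P) by move=> k' l; rewrite HI0 image_distributionE.
have DF m x : sum_distribution act P (fundamental act x m).
  exists 0, x; suff -> : sharp P (0 : cotangent m) = 0 by rewrite add0r.
  have [bil _ _] := bP.
  by apply: cotangent_separates => b; rewrite sharpE// dual0 bilin0r.
have [e [eps basis]] := lie_basis DG.
have cG := @gp_G_connected _ _ DG.
have orb := orbit_in_leaf Hact cG basis DF HI.
split; first by move=> a l; exact: orb.
have /choice[actL2 HactL2] : forall al : gpG DG * fol_leaf k, exists l' : fol_leaf k, fol_incl l' = act al.1 (fol_incl al.2).
  by move=> [a l]; have [l' _ E] := orb k l a; exists l'.
pose actL a l := actL2 (a, l).
have actLE a l : fol_incl (actL a l) = act a (fol_incl l) by exact: (HactL2 (a, l)).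
have HactL : is_action actL by exact: (leaf_action Hact cG basis DF HI actLE).
have iF := @fol_immersion _ _ Fol k.
have TF := HI k.
exists actL, (restricted P (@fol_incl _ _ Fol k)); split => //.
- move=> h' Hh' l a b; rewrite /push2.
  exact: (change_restrictedE h Hact HactL bP iF actLE TF).
- exact: (leaf_quasi_hamiltonian h_compl qham HactL iF actLE TF).
- exact: (leaf_nondegenerate h_compl qham HactL iF actLE TF).
Qed.
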